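(* Let $k\in\mathbb{C}\setminus\{0\}$. The tensor supercategories $KL_k$ and $\mathcal{O}_k^{fin}$ of $V_k(\mathfrak{gl}(1|1))$-modules are rigid; moreover, they are braided ribbon tensor supercategories with even natural twist isomorphism $\theta=e^{2\pi iL_0}$.
   Context: **Algebra.** $\mathfrak{gl}(1|1)$ has even basis $N,E$ and odd basis $\psi^+,\psi^-$; nonzero brackets $[N,\psi^\pm]=\pm\psi^\pm$, $\{\psi^+,\psi^-\}=E$; invariant form $\kappa(N,E)=\kappa(E,N)=1$, $\kappa(\psi^+,\psi^-)=-\kappa(\psi^-,\psi^+)=1$, zero on other pairs of basis elements. $\widehat{\mathfrak{gl}(1|1)}=\mathfrak{gl}(1|1)\otimes\mathbb{C}[t,t^{-1}]\oplus\mathbb{C}\mathbf{k}$ with $\mathbf k$ central, $[a_r,b_s]=[a,b]_{r+s}+r\kappa(a,b)\delta_{r+s,0}\mathbf{k}$, $a_r=a\otimes t^r$. $V_k(\mathfrak{gl}(1|1))$ is the level-$k$ module induced from the trivial $\mathfrak{gl}(1|1)$-module, a vertex operator superalgebra with conformal vector $\omega=\frac{1}{2k}(N_{-1}E_{-1}+E_{-1}N_{-1}-\psi^+_{-1}\psi^-_{-1}+\psi^-_{-1}\psi^+_{-1})\mathbf 1+\frac{1}{2k^2}E_{-1}^2\mathbf 1$; $L_n$ are the Virasoro modes. **Categories.** $KL_k$ is the supercategory of finite-length grading-restricted generalized $V_k(\mathfrak{gl}(1|1))$-modules (direct sums of finite-dimensional generalized $L_0$-eigenspaces, lower-bounded in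 each coset of $\mathbb Z$); $\mathcal{O}_k^{fin}$ is the full subcategory of modules on which $N_0,E_0$ act semisimply. Modules are $\mathbb{Z}_2$-graded; morphisms may be even or odd. **Braided tensor structure** (Huang–Lepowsky–Zhang; both supercategories have it, the second by restriction). $W_1\boxtimes W_2$ is the $P(1)$-tensor product, equipped with an even logarithmic intertwining operator $\mathcal Y_\boxtimes$ of type $\binom{W_1\boxtimes W_2}{W_1\,W_2}$ through which every intertwining operator of type $\binom{W_3}{W_1\,W_2}$ factors uniquely; more generally for $z\in\mathbb{C}^\times$ one has $P(z)$-tensor products, with $w_1\boxtimes_{P(z)}w_2$ the corresponding universal intertwining operator evaluated at $x=z$. The unit is $V_k(\mathfrak{gl}(1|1))$, with $l_W(\mathcal Y_\boxtimes(v,x)w)=Y_W(v,x)w$, $r_W(\mathcal Y_\boxtimes(w,x)v)=(-1)^{|v||w|}e^{xL_{-1}}Y_W(v,-x)w$. Associativity is characterized, for real $z_1>z_2>z_1-z_2>0$ (up to parallel transport, i.e. analytic continuation in $z$ along the positive reals, identifying the various $P(z)$-tensor products with $\boxtimes$), by $w_1\boxtimes_{P(z_1)}(w_2\boxtimes_{P(z_2)}w_3)\mapsto(w_1\boxtimes_{P(z_1-z_2)}w_2)\boxtimes_{P(z_2)}w_3$. The braiding is $\mathcal Y_\boxtimes(w_1,x)w_2\mapsto(-1)^{|w_1||w_2|}e^{xL_{-1}}\mathcal Y_\boxtimes(w_2,e^{\pi i}x)w_1$. **Rigidity.** A left dual of $W$ is an object $W'$ with even morphisms $e_W:W'\boxtimes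 W\to\mathbf 1$, $i_W:\mathbf 1\to W\boxtimes W'$ such that $r_W(\mathrm{id}_W\boxtimes e_W)\mathcal A^{-1}(i_W\boxtimes\mathrm{id}_W)l_W^{-1}=\mathrm{id}_W$ and $l_{W'}(e_W\boxtimes\mathrm{id}_{W'})\mathcal A(\mathrm{id}_{W'}\boxtimes i_W)r_{W'}^{-1}=\mathrm{id}_{W'}$. Right duals are defined analogously. The category is rigid if every object has left and right duals. It is ribbon with twist $\theta$ if additionally $\theta_{\mathbf 1}=\mathrm{id}$, $\theta_{W_1\boxtimes W_2}=\mathcal R_{W_2,W_1}\mathcal R_{W_1,W_2}(\theta_{W_1}\boxtimes\theta_{W_2})$ and $\theta_{W'}=(\theta_W)'$. *)

(* Defs.v *)
(* MathComp / MathComp-Analysis; the ground field is R[i] for R : realType. *)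
From mathcomp Require Import all_boot all_order all_algebra finmap.
From mathcomp Require Import complex.
From mathcomp Require Import all_classical all_reals all_analysis.

Set Implicit Arguments.
Unset Strict Implicit.
Unset Printing Implicit Defensive.

Import Order.TTheory GRing.Theory Num.Theory.
Local Open Scope classical_set_scope.
Local Open Scope ring_scope.
Local Open Scope complex_scope.

(* All sums over [set: nat] or [set: R[i]] below are finite-support sums: fsbig
   returns 0 on a family with infinite support, but every family summed in this
   way has finite support, by the truncation axioms that accompany it. *)

Section Complex.
Variable R : realType.
Local Notation C := R[i].

Definition expC (z : C) : C :=
  (expR (complex.Re z))%:C * (cos (complex.Im z) +i* sin (complex.Im z)).

Definition piI : C := 0 +i* pi.

Definition binz (m : int) (i : nat) : C :=
  (\prod_(t < i) (m%:~R - t%:R)) / (i`!)%:R.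

(* For z > 0 and the real branch of the logarithm, z^h. *)
Definition cpow (z : R) (h : C) : C := expC (h * (ln z)%:C).

(* Unconditional (equivalently, absolute) convergence of a complex series. *)
Definition abs_sum (F : C -> C) (s : C) : Prop :=
  forall e : C, 0 < e -> exists A0 : {fset C}, forall A : {fset C},
    (A0 `<=` A)%fset -> `|\sum_(n <- A) F n - s| < e.

End Complex.

Section Superspaces.
Variable R : realType.
Local Notation C := R[i].

(* A Z/2-graded complex vector space; the grading is encoded by its parity
   involution, whose +1- and -1-eigenspaces are the even and odd parts. *)
Record sspace := Sspace {
  scar :> lmodType C;
  par : scar -> scar;
  par_linear : linear par;
  par_invol : involutive par }.

Definition hmg (W : sspace) (a : bool) (w : W) : Prop :=
  par w = (-1) ^+ a *: w.

Definition spanned_by (W : sspace) (P : C -> W -> Prop) : Prop :=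
  forall w, exists (s : seq C) (u : C -> W),
    (forall h, P h (u h)) /\ w = \sum_(h <- s) u h.

Definition diagonalizable (W : sspace) (op : W -> W) : Prop :=
  spanned_by (fun h u => op u = h *: u).

Definition fin_dim (W : sspace) (P : W -> Prop) : Prop :=
  exists n (b : 'I_n -> W), forall w, P w ->
    exists c : 'I_n -> C, w = \sum_(t < n) c t *: b t.

End Superspaces.

Section GL11.
Variable R : realType.
Local Notation C := R[i].

Inductive gl11 := gN | gE | gPsiP | gPsiM.

Definition odd11 (a : gl11) : bool :=
  match a with gPsiP | gPsiM => true | _ => false end.

(* The value on [a,b] of the linear extension of x from the basis to gl(1|1). *)
Definition bracket11 (M : lmodType C) (x : gl11 -> M) (a b : gl11) : M :=
  match a, b with
  | gN, gPsiP => x gPsiP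
  | gN, gPsiM => - x gPsiM
  | gPsiP, gN => - x gPsiP
  | gPsiM, gN => x gPsiM
  | gPsiP, gPsiM | gPsiM, gPsiP => x gE
  | _, _ => 0
  end.

Definition kappa11 (a b : gl11) : C :=
  match a, b with
  | gN, gE | gE, gN | gPsiP, gPsiM => 1
  | gPsiM, gPsiP => -1
  | _, _ => 0
  end.

(* x a r is the action of a_r on a level-k module M for affine gl(1|1). *)
Definition affine_action (k : C) (M : sspace R) (x : gl11 -> int -> M -> M) :
    Prop :=
  [/\ forall a r, linear (x a r),
      forall a r w, x a r (par w) = (-1) ^+ odd11 a *: par (x a r w)
    & forall a b r s w,
        x a r (x b s w) - (-1) ^+ (odd11 a && odd11 b) *: x b s (x a r w) =
        bracket11 (fun c => x c (r + s) w) a b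
        + (if r + s == 0 then r%:~R * kappa11 a b * k else 0) *: w].

End GL11.

Section VertexSuperalgebras.
Variable R : realType.
Local Notation C := R[i].

(* vY v n u is the mode v_n u in Y(v,x)u = sum_n v_n u x^(-n-1). *)
Record vdata := Vdata {
  vsp :> sspace R;
  vY : vsp -> int -> vsp -> vsp;
  vac : vsp }.

(* The Jacobi identity in components (Borcherds form), for a series of parity q
   with modes c and for V acting through y1, y2, y3 on W1, W2, W3. *)
Definition borcherds (V : vdata) (W1 W2 W3 : sspace R)
    (y1 : V -> int -> W1 -> W1) (y2 : V -> int -> W2 -> W2)
    (y3 : V -> int -> W3 -> W3) (q : bool) (c : W1 -> int -> W2 -> W3) : Prop :=
  forall (a b : bool) (v : V) (w1 : W1) (w2 : W2) (m n l : int),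
    hmg a v -> hmg b w1 ->
    \sum_(i \in [set: nat])
       binz R m i *: c (y1 v (n + i%:Z) w1) (m + l - i%:Z) w2 =
    \sum_(i \in [set: nat])
       ((-1) ^+ i * binz R n i) *:
         ((-1) ^+ (q && a) *: y3 v (m + n - i%:Z) (c w1 (l + i%:Z) w2)
          - ((-1) ^ n * (-1) ^+ (a && b)) *:
              c w1 (n + l - i%:Z) (y2 v (m + i%:Z) w2)).

Record is_module (V : vdata) (W : sspace R) (y : V -> int -> W -> W) : Prop := {
  mod_linl : forall n w, linear (fun v => y v n w);
  mod_linr : forall v n, linear (y v n);
  mod_par : forall v n w, par (y v n w) = y (par v) n (par w);
  mod_trunc : forall v w, exists N : nat, forall n : nat,
    (N <= n)%N -> y v n%:Z w = 0;
  mod_vac : forall n w, y (vac V) n w = if n == -1 then w else 0;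
  mod_borcherds : borcherds (@vY V) y y false (fun v n w => y v n w) }.


Definition is_vsa (V : vdata) : Prop :=
  [/\ is_module (@vY V), hmg false (vac V),
      forall v, vY v (-1) (vac V) = v
    & forall v (n : nat), vY v n%:Z (vac V) = 0].

(* V_k(gl(1|1)), given by what determines it up to unique isomorphism: for each
   a in gl(1|1) the modes of gen a = a_(-1) vac define a level-k action of the
   affine algebra, for which V is the module induced from the trivial
   gl(1|1)-module (with gl(1|1) (x) t C[t] acting by zero), i.e. V is universal
   among level-k modules with a vector annihilated by gl(1|1) (x) C[t]. *)
Record affine_vsa (k : C) := AffineVsa {
  avs :> vdata;
  avs_vsa : is_vsa avs;
  gen : gl11 -> avs;
  gen_par : forall a, hmg (odd11 a) (gen a);
  gen_action : affine_action k (fun a r => vY (gen a) r);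
  gen_induced : forall (M : sspace R) (x : gl11 -> int -> M -> M) (m : M),
    affine_action k x -> hmg false m -> (forall a (r : nat), x a r%:Z m = 0) ->
    let extends (f : avs -> M) :=
      [/\ linear f, forall v, f (par v) = par (f v), f (vac avs) = m
        & forall a r v, f (vY (gen a) r v) = x a r (f v)] in
    exists2 f, extends f & forall g, extends g -> g = f }.

Definition conformal_vector (k : C) (V : affine_vsa k) : V :=
  (2%:R * k)^-1 *: (vY (gen V gN) (-1) (gen V gE)
                    + vY (gen V gE) (-1) (gen V gN)
                    - vY (gen V gPsiP) (-1) (gen V gPsiM)
                    + vY (gen V gPsiM) (-1) (gen V gPsiP))
  + (2%:R * k ^+ 2)^-1 *: vY (gen V gE) (-1) (gen V gE).

(* Weak V-modules. The L_(-1)-derivative property is not listed, since for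
   L_(-1) v = v_(-2) vac it is a consequence of the Borcherds identity. *)
Record vmod (V : vdata) := Vmod {
  msp :> sspace R;
  act : V -> int -> msp -> msp;
  act_module : is_module act }.

Lemma vsa_module (V : vdata) : is_vsa V -> is_module (@vY V).
Proof. by case. Qed.

Definition adjoint (k : C) (V : affine_vsa k) : vmod V :=
  Vmod (vsa_module (avs_vsa V)).

End VertexSuperalgebras.

Section Modules.
Variables (R : realType) (k : R[i]) (V : affine_vsa k).
Local Notation C := R[i].
Local Notation vmod := (vmod V).

Definition L (W : vmod) (n : int) : W -> W :=
  act (conformal_vector V) (n + 1).

Definition geneig (W : vmod) (h : C) (w : W) : Prop :=
  exists M : nat, iter M (fun u => L 0 u - h *: u) w = 0.

Definition submodule (W : vmod) (U : set W) : Prop :=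
  [/\ U 0, forall a u u', U u -> U u' -> U (a *: u + u'),
      forall u, U u -> U (par u) & forall v n u, U u -> U (act v n u)].

Definition finite_length (W : vmod) : Prop :=
  exists (n : nat) (F : nat -> set W),
    [/\ F 0%N = [set 0], F n = setT, forall i, (i <= n)%N -> submodule (F i)
      & forall i, (i < n)%N ->
          [/\ F i `<=` F i.+1, F i <> F i.+1
            & forall U, submodule U -> F i `<=` U -> U `<=` F i.+1 ->
                U = F i \/ U = F i.+1]].

Definition KL (W : vmod) : Prop :=
  [/\ finite_length W, spanned_by (@geneig W),
      forall h, fin_dim (@geneig W h)
    & forall h, exists N : nat, forall n : nat, (N <= n)%N ->
        forall w, geneig (h - n%:R) w -> w = 0 :> W].

Definition Ofin (W : vmod) : Prop :=
  [/\ KL W, diagonalizable (@act _ _ W (gen V gN) 0)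
    & diagonalizable (@act _ _ W (gen V gE) 0)].

(* Morphisms of parity p; those of the supercategory are the sums of an even
   and an odd one. *)
Definition is_hom (W1 W2 : vmod) (p : bool) (f : W1 -> W2) : Prop :=
  [/\ linear f, forall w, f (par w) = (-1) ^+ p *: par (f w)
    & forall (a : bool) (v : V) n w, hmg a v ->
        f (act v n w) = (-1) ^+ (p && a) *: act v n (f w)].

(* Y w1 h j w2 is the coefficient of x^(-h-1) (log x)^j in Y(w1,x)w2. *)
Definition log_modes (W1 W2 W3 : vmod) := W1 -> C -> nat -> W2 -> W3.

Record intertwining (W1 W2 W3 : vmod) (p : bool) (Y : log_modes W1 W2 W3) :
    Prop := {
  int_linl : forall h j w2, linear (fun w1 => Y w1 h j w2);
  int_linr : forall w1 h j, linear (Y w1 h j);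
  int_par : forall w1 h j w2,
    par (Y w1 h j w2) = (-1) ^+ p *: Y (par w1) h j (par w2);
  int_trunc : forall w1 w2 h, exists N : nat, forall n j : nat,
    (N <= n)%N -> Y w1 (h + n%:R) j w2 = 0;
  int_log : forall w1 w2 h, exists J : nat, forall j : nat,
    (J <= j)%N -> Y w1 h j w2 = 0;
  int_borcherds : forall h j,
    borcherds (@act _ _ W1) (@act _ _ W2) (@act _ _ W3) p
      (fun w1 n w2 => Y w1 (h + n%:~R) j w2);
  int_deriv : forall w1 h j w2,
    Y (L (-1) w1) (h + 1) j w2 =
    (- h - 1) *: Y w1 h j w2 + j.+1%:R *: Y w1 h j.+1 w2 }.

Definition Ymod (W : vmod) : log_modes (adjoint V) W W :=
  fun v h j w =>
    let n := Num.floor (complex.Re h) in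
    if (h == n%:~R) && (j == 0%N) then act (v : V) n w else 0.

(* The modes of w1, w2 |-> e^(x L_(-1)) Y(w2, e^(pi i) x) w1, where
   x^h and log x become e^(pi i h) x^h and log x + pi i. *)
Definition skew_modes (W1 W2 W3 : vmod) (Y : log_modes W2 W1 W3) :
    log_modes W1 W2 W3 :=
  fun w1 h j w2 =>
    \sum_(i \in [set: nat])
      (i`!%:R)^-1 *: iter i (L (-1))
        (expC (piI R * (- (h + i%:R) - 1)) *:
           \sum_(t \in [set: nat])
             ('C(j + t, j)%:R * piI R ^+ t) *: Y w2 (h + i%:R) (j + t)%N w1).

(* The x^(-n-1)-term of Y(w1,x)w2 at x = z > 0, with real log z. *)
Definition term_at (W1 W2 W3 : vmod) (Y : log_modes W1 W2 W3) (z : R)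
    (w1 : W1) (n : C) (w2 : W2) : W3 :=
  cpow z (- n - 1) *:
    \sum_(j \in [set: nat]) ((ln z)%:C ^+ j) *: Y w1 n j w2.

Definition graded_dual (W : vmod) (f : W -> C) : Prop :=
  scalar f /\
  exists s : seq C, forall h, h \notin s -> forall w, geneig h w -> f w = 0.

(* <f, Y(w1,z)w2> for f in the graded dual: a sum with finite support. *)
Definition pair_at (W1 W2 W3 : vmod) (f : W3 -> C) (Y : log_modes W1 W2 W3)
    (z : R) (w1 : W1) (w2 : W2) : C :=
  \sum_(m \in [set: C]) f (term_at Y z w1 m w2).

Definition is_exp2piL0 (W : vmod) (th : W -> W) : Prop :=
  linear th /\
  forall h M w, iter M (fun u => L 0 u - h *: u) w = 0 ->
    th w = expC (2%:R * piI R * h) *: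
      \sum_(m < M) ((2%:R * piI R) ^+ m / (m`!)%:R) *:
        iter m (fun u => L 0 u - h *: u) w.

(* tenm f g is the tensor product of morphisms; luni, runi, asci, brdi are the
   inverses of the unit, associativity and braiding isomorphisms. *)
Record tensor_data := TensorData {
  ten : vmod -> vmod -> vmod;
  tY : forall W1 W2 : vmod, log_modes W1 W2 (ten W1 W2);
  tenm : forall W1 W2 W3 W4 : vmod,
    (W1 -> W3) -> (W2 -> W4) -> ten W1 W2 -> ten W3 W4;
  lun : forall W : vmod, ten (adjoint V) W -> W;
  luni : forall W : vmod, W -> ten (adjoint V) W;
  run : forall W : vmod, ten W (adjoint V) -> W;
  runi : forall W : vmod, W -> ten W (adjoint V);
  asc : forall W1 W2 W3 : vmod, ten W1 (ten W2 W3) -> ten (ten W1 W2) W3;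
  asci : forall W1 W2 W3 : vmod, ten (ten W1 W2) W3 -> ten W1 (ten W2 W3);
  brd : forall W1 W2 : vmod, ten W1 W2 -> ten W2 W1;
  brdi : forall W1 W2 : vmod, ten W2 W1 -> ten W1 W2 }.

Section Tensor.
Variables (D : vmod -> Prop) (T : tensor_data).
Local Notation "A ** B" := (ten T A B) (at level 40, left associativity).
Local Notation "f *** g" := (@tenm T _ _ _ _ f g)
  (at level 40, left associativity).
Local Notation unit := (adjoint V).

Definition even_iso (W1 W2 : vmod) (f : W1 -> W2) (g : W2 -> W1) : Prop :=
  [/\ is_hom false f, cancel f g & cancel g f].

(* A braided monoidal structure on the full subcategory D. *)
Record braided_tensor : Prop := {
  bt_unit : D unit;
  bt_ten : forall W1 W2 : vmod, D W1 -> D W2 -> D (W1 ** W2);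
  bt_hom : forall (W1 W2 W3 W4 : vmod) p q (f : W1 -> W3) (g : W2 -> W4),
    D W1 -> D W2 -> D W3 -> D W4 -> is_hom p f -> is_hom q g ->
    is_hom (p (+) q) (f *** g);
  bt_linl : forall (W1 W2 W3 W4 : vmod) p q (a : C)
    (f f' : W1 -> W3) (g : W2 -> W4),
    D W1 -> D W2 -> D W3 -> D W4 ->
    is_hom p f -> is_hom p f' -> is_hom q g ->
    forall u, ((fun w => a *: f w + f' w) *** g) u =
              a *: (f *** g) u + (f' *** g) u;
  bt_linr : forall (W1 W2 W3 W4 : vmod) p q (a : C)
    (f : W1 -> W3) (g g' : W2 -> W4),
    D W1 -> D W2 -> D W3 -> D W4 ->
    is_hom p f -> is_hom q g -> is_hom q g' ->
    forall u, (f *** (fun w => a *: g w + g' w)) u =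
              a *: (f *** g) u + (f *** g') u;
  bt_id : forall W1 W2 : vmod, D W1 -> D W2 ->
    forall u : W1 ** W2, (@id W1 *** @id W2) u = u;
  bt_comp : forall (W1 W2 W3 W4 W5 W6 : vmod) p q p' q'
    (f : W3 -> W5) (g : W4 -> W6) (f' : W1 -> W3) (g' : W2 -> W4),
    D W1 -> D W2 -> D W3 -> D W4 -> D W5 -> D W6 ->
    is_hom p f -> is_hom q g -> is_hom p' f' -> is_hom q' g' ->
    forall u, (f *** g) ((f' *** g') u) =
              (-1) ^+ (q && p') *: ((f \o f') *** (g \o g')) u;
  bt_lun : forall W : vmod, D W -> even_iso (@lun T W) (@luni T W);
  bt_run : forall W : vmod, D W -> even_iso (@run T W) (@runi T W);
  bt_asc : forall W1 W2 W3 : vmod, D W1 -> D W2 -> D W3 ->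
    even_iso (@asc T W1 W2 W3) (@asci T W1 W2 W3);
  bt_brd : forall W1 W2 : vmod, D W1 -> D W2 ->
    even_iso (@brd T W1 W2) (@brdi T W1 W2);
  bt_lun_nat : forall (W W' : vmod) p (f : W -> W'), D W -> D W' -> is_hom p f ->
    forall u, lun ((@id unit *** f) u) = f (lun u);
  bt_run_nat : forall (W W' : vmod) p (f : W -> W'), D W -> D W' -> is_hom p f ->
    forall u, run ((f *** @id unit) u) = f (run u);
  bt_asc_nat : forall (W1 W2 W3 W1' W2' W3' : vmod) p q r
    (f : W1 -> W1') (g : W2 -> W2') (h : W3 -> W3'),
    D W1 -> D W2 -> D W3 -> D W1' -> D W2' -> D W3' ->
    is_hom p f -> is_hom q g -> is_hom r h ->
    forall u, asc ((f *** (g *** h)) u) = ((f *** g) *** h) (asc u);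
  bt_brd_nat : forall (W1 W2 W1' W2' : vmod) p q (f : W1 -> W1') (g : W2 -> W2'),
    D W1 -> D W2 -> D W1' -> D W2' -> is_hom p f -> is_hom q g ->
    forall u, brd ((f *** g) u) = (-1) ^+ (p && q) *: (g *** f) (brd u);
  bt_triangle : forall W1 W2 : vmod, D W1 -> D W2 ->
    forall u : W1 ** (unit ** W2),
      (@run T W1 *** @id W2) (asc u) = (@id W1 *** @lun T W2) u;
  bt_pentagon : forall W1 W2 W3 W4 : vmod, D W1 -> D W2 -> D W3 -> D W4 ->
    forall u : W1 ** (W2 ** (W3 ** W4)),
      asc (asc u) =
      (@asc T W1 W2 W3 *** @id W4)
        (asc ((@id W1 *** @asc T W2 W3 W4) u));
  bt_hexagon : forall W1 W2 W3 : vmod, D W1 -> D W2 -> D W3 ->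
    forall u : W1 ** (W2 ** W3),
      asc (brd (asc u)) =
      (@brd T W1 W3 *** @id W2) (asc ((@id W1 *** @brd T W2 W3) u));
  bt_hexagon' : forall W1 W2 W3 : vmod, D W1 -> D W2 -> D W3 ->
    forall u : (W1 ** W2) ** W3,
      asci (brd (asci u)) =
      (@id W2 *** @brd T W1 W3) (asci ((@brd T W1 W2 *** @id W3) u)) }.

(* The vertex-algebraic (Huang-Lepowsky-Zhang) braided tensor structure on D.
   For z > 0 parallel transport along the positive reals identifies
   w1 (x)_P(z) w2 with tY(w1,z)w2 at the real branch of log z. The two sides of
   the associativity characterization are elements of an algebraic completion;
   they are compared, and their absolute convergence is meant, after pairing
   with each element of the graded dual. The intermediate sum is indexed by the
   powers of the formal variable, i.e. by weights for homogeneous vectors. *)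
Record hlz_structure : Prop := {
  hlz_braided : braided_tensor;
  hlz_intertwining : forall W1 W2 : vmod, D W1 -> D W2 ->
    intertwining false (@tY T W1 W2);
  hlz_universal : forall (W1 W2 W3 : vmod) p (Y : log_modes W1 W2 W3),
    D W1 -> D W2 -> D W3 -> intertwining p Y ->
    let factors (f : W1 ** W2 -> W3) :=
      is_hom p f /\ forall w1 h j w2, f (tY T w1 h j w2) = Y w1 h j w2 in
    exists2 f, factors f & forall g, factors g -> g = f;
  hlz_tenm : forall (W1 W2 W3 W4 : vmod) p q (f : W1 -> W3) (g : W2 -> W4),
    D W1 -> D W2 -> D W3 -> D W4 -> is_hom p f -> is_hom q g ->
    forall (a : bool) w1 h j w2, hmg a w1 ->
      (f *** g) (tY T w1 h j w2) = (-1) ^+ (q && a) *: tY T (f w1) h j (g w2);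
  hlz_lun : forall W : vmod, D W -> forall v h j (w : W),
    lun (tY T v h j w) = Ymod v h j w;
  hlz_run : forall W : vmod, D W -> forall (a b : bool) (w : W) h j (v : unit),
    hmg a w -> hmg b v ->
    run (tY T w h j v) = (-1) ^+ (a && b) *: skew_modes (@Ymod W) w h j v;
  hlz_brd : forall W1 W2 : vmod, D W1 -> D W2 ->
    forall (a b : bool) (w1 : W1) h j (w2 : W2), hmg a w1 -> hmg b w2 ->
    brd (tY T w1 h j w2) = (-1) ^+ (a && b) *: skew_modes (@tY T W2 W1) w1 h j w2;
  hlz_asc : forall W1 W2 W3 : vmod, D W1 -> D W2 -> D W3 ->
    forall (w1 : W1) (w2 : W2) (w3 : W3) (z1 z2 : R)
      (f : (W1 ** W2) ** W3 -> C),
    z1 > z2 -> z2 > z1 - z2 -> z1 - z2 > 0 -> graded_dual f ->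
    exists s : C,
      abs_sum (fun n =>
        pair_at (f \o @asc T W1 W2 W3) (@tY T W1 (W2 ** W3)) z1 w1
          (term_at (@tY T W2 W3) z2 w2 n w3)) s /\
      abs_sum (fun n =>
        pair_at f (@tY T (W1 ** W2) W3) z2
          (term_at (@tY T W1 W2) (z1 - z2) w1 n w2) w3) s }.

Definition dual_pair (W W' : vmod) (e : W' ** W -> unit)
    (i : unit -> W ** W') : Prop :=
  [/\ is_hom false e, is_hom false i,
      forall w, run ((@id W *** e) (asci ((i *** @id W) (luni T w)))) = w
    & forall w, lun ((e *** @id W') (asc ((@id W' *** i) (runi T w)))) = w].

(* X is a right dual of W when W is a left dual of X. *)
Definition rigid : Prop :=
  forall W : vmod, D W ->
    (exists W' e i, D W' /\ @dual_pair W W' e i) /\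
    (exists X e i, D X /\ @dual_pair X W e i).

Definition dual_map (W W' : vmod) (e : W' ** W -> unit)
    (i : unit -> W ** W') (f : W -> W) : W' -> W' :=
  fun w => lun ((e *** @id W')
    (((@id W' *** f) *** @id W') (asc ((@id W' *** i) (runi T w))))).

Record twist (th : forall W : vmod, W -> W) : Prop := {
  tw_iso : forall W : vmod, D W -> is_hom false (th W) /\ bijective (th W);
  tw_nat : forall (W1 W2 : vmod) p (f : W1 -> W2), D W1 -> D W2 -> is_hom p f ->
    forall w, th W2 (f w) = f (th W1 w);
  tw_unit : forall v, th unit v = v;
  tw_balanced : forall W1 W2 : vmod, D W1 -> D W2 -> forall u : W1 ** W2,
    th (W1 ** W2) u =
    @brd T W2 W1 (@brd T W1 W2 ((th W1 *** th W2) u));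
  tw_dual : forall W W' e i, D W -> D W' -> @dual_pair W W' e i ->
    forall w, th W' w = dual_map e i (th W) w }.

Definition braided_ribbon (th : forall W : vmod, W -> W) : Prop :=
  [/\ braided_tensor, rigid & twist th].

End Tensor.
End Modules.

(* Main.v *)
(* Let S be simple, of highest weight (n, e), and S' its twist by the automorphism N -> -N, E -> -E. The invariant
 form on V and the pairing of S' with S give an intertwining operator, hence ev : S' (x) S -> 1, and by Schur S' is
 dual to S as soon as some i : 1 -> S (x) S' has a nonzero zigzag with ev. If e is in Zk, S has a highest weight
 vector s for a spectral flow of the triangular decomposition, s (x) s generates S (x) S', and i is onto. Otherwise
 the log x terms give an i through which theta - 1 factors on S (x) S'; were the zigzag zero, balancing and the
 hexagons would make the tail of ev vanish on the image of theta - c^4 on S (x) S, where c is the twist of S, and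
 this map is onto. Duals extend along composition series by pushouts and pullbacks. The twist is balanced because
 braiding twice is monodromy, and theta_S' is dual to theta_S because e^(x L1) x^(L0) turns the invariance of the
 evaluation into the self-adjointness of L0. *)
From HB Require Import structures.
Require Import Defs.
From mathcomp Require Import all_boot all_order all_algebra.
From mathcomp Require Import complex.
From mathcomp Require Import all_classical all_reals all_analysis.
From mathcomp Require Import ring lra zify.
Local Open Scope ring_scope.

Set Implicit Arguments.
Unset Strict Implicit.
Unset Printing Implicit Defensive.

Import Order.TTheory GRing.Theory Num.Theory.
Local Open Scope classical_set_scope.
Local Open Scope ring_scope.
Local Open Scope complex_scope.

(** Maps out of a tensor product come from intertwining operators; the obstacle is the coevaluation,
    a map into one. On S (x) S' the operator E_0 vanishes. This forces all conformal weights to be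
    natural numbers and L_0 = k^-1 psi^-_0 psi^+_0 on weight 0, so that a map 1 -> S (x) S' is a
    weight 0 vector killed by the nonnegative modes and can be written down explicitly. The
    evaluation is an explicit operator too, and its Jacobi identity can only be checked for the four
    currents; hence the long reduction of the Borcherds identity to generators. The exponent in c^4:
    let the tail of ev be ev after reassociation on (S (x) S') (x) S. If the zigzag vanished, the
    tail would not change under theta on S (x) S', which is c^2 times the double braiding of S and
    S'. The double braiding of S with S' (x) S is invisible to ev, so by the hexagons the double
    braiding of S with itself acts as c^2, and theta on S (x) S as c^2 times c^2. The twist on
    cokernel vectors of weights 4 h0 + e/k and 4 h0 - e/k differs from c^4 precisely because e/k is
    not an integer. *)

Implicit Type R : realType.
Notation ehom := (is_hom false).
Notation onto f := (forall y, exists x, f x = y).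
Notation diagble := Defs.diagonalizable.
Notation LL W := (@L _ _ _ W).

(** * Linear identities in modules, finite sums, binomial coefficients with integer upper
    argument *)

Section SquareZeroExtension.
Variables (K : comNzRingType) (W : lmodType K).
Definition szext : Type := (K * W)%type.
HB.instance Definition _ := GRing.Zmodule.on szext.
Definition szmul (x y : szext) : szext := (x.1 * y.1, x.1 *: y.2 + y.1 *: x.2).
Definition szone : szext := (1, 0).
Fact szmulC : commutative szmul.
by move=> x y; rewrite /szmul mulrC addrC. Qed.

Fact szmulA : associative szmul.
move=> x y z; rewrite /szmul /= mulrA; congr pair.
by rewrite !scalerDr !scalerA addrA (mulrC z.1 x.1) (mulrC z.1 y.1).
Qed.

Fact szmul1 : left_id szone szmul.
by move=> [a w]; rewrite /szmul /= mul1r scale1r scaler0 addr0. Qed.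

Fact szmulD : left_distributive szmul +%R.
move=> x y z; rewrite /szmul /= mulrDl; congr pair.
by rewrite scalerDl scalerDr addrACA.
Qed.

Fact szone_neq0 : szone != 0.
by apply/eqP => -[/eqP]; rewrite oner_eq0. Qed.
HB.instance Definition _ := GRing.Zmodule_isComNzRing.Build szext szmulA szmulC szmul1 szmulD szone_neq0.
Definition szscal (a : K) : szext := (a, 0).
Definition szvec (w : W) : szext := (0, w).
Fact szscal_additive : zmod_morphism szscal.
by move=> a b; rewrite /szscal; congr pair; rewrite subr0. Qed.
Fact szscal_multiplicative : monoid_morphism szscal.
by split=> // a b; congr pair; rewrite /= !scaler0 addr0. Qed.
HB.instance Definition _ := GRing.isZmodMorphism.Build _ _ szscal szscal_additive.
HB.instance Definition _ := GRing.isMonoidMorphism.Build _ _ szscal szscal_multiplicative.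
Lemma szvecD u v : szvec (u + v) = szvec u + szvec v.
by congr pair; rewrite addr0. Qed.
Lemma szvecN u : szvec (- u) = - szvec u.
by congr pair; rewrite oppr0. Qed.
Lemma szvec0 : szvec 0 = 0. by []. Qed.
Lemma szvecZ a u : szvec (a *: u) = szscal a * szvec u.
by congr pair; rewrite /= ?mulr0 // scale0r addr0. Qed.
Lemma szvecMn u n : szvec (u *+ n) = szvec u *+ n.
by elim: n => // n IH; rewrite !mulrS szvecD IH. Qed.
Lemma szvec_inj : injective szvec. by move=> u v [->]. Qed.
End SquareZeroExtension.

(* Decides linear identities in a module over a commutative ring, by ring
 normalization in the square-zero extension. *)
Ltac lmod_ring := apply: szvec_inj; rewrite ?(szvecD, szvecN, szvecZ, szvecMn, szvec0); ring.

Section FiniteSums.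
Variables (T : choiceType) (W : nmodType).

Lemma fsum_nat (f : nat -> W) N : (forall i, (N <= i)%N -> f i = 0) -> \sum_(i \in [set: nat]) f i = \sum_(i < N) f i.
move=> f0; rewrite fsbig_ord; symmetry; apply: fsbig_widen => // i [_ /=].
by rewrite /= => /negP; rewrite -leqNgt => /f0.
Qed.

Lemma fsum_seq (f : T -> W) (s : seq T) : uniq s -> (forall x, x \notin s -> f x = 0) ->
 \sum_(x \in [set: T]) f x = \sum_(x <- s) f x.
move=> us f0; rewrite [RHS]fsbig_seq //; symmetry; apply: fsbig_widen => // x /= [_ xs].
by apply: f0; apply/negP.
Qed.

Lemma sum_ord_widen (f : nat -> W) N M : (forall i, (N <= i)%N -> f i = 0) ->
 (N <= M)%N -> \sum_(i < M) f i = \sum_(i < N) f i.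
move=> f0 NM; rewrite -(fsum_nat f0); apply: esym; apply: fsum_nat => i Mi.
exact/f0/(leq_trans NM).
Qed.

Lemma sum_antidiagonal (F : nat -> nat -> W) N : (forall i j, (N <= i + j)%N -> F i j = 0) ->
 \sum_(i < N) \sum_(j < N) F i j = \sum_(l < N) \sum_(i < l.+1) F i (l - i)%N.
move=> F0; transitivity (\sum_(i < N) \sum_(l < N | (i <= l)%N) F i (l - i)%N).
 apply: eq_bigr => i _.
 rewrite -!(big_mkord xpredT) -(big_mkord (fun l => i <= l)%N (fun l => F i (l - i)%N)).
 rewrite [RHS]big_mkcond [RHS](big_cat_nat (n := i)) //=; last exact/ltnW.
 rewrite [X in _ = X + _]big_nat [X in _ = X + _]big1 ?add0r => [|j /andP[_ ji]]; last by rewrite leqNgt ji.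
 rewrite -{2}(add0n (i : nat)) big_addn [LHS](big_cat_nat (n := N - i)) ?leq_subr //= addrC
  big_nat_cond big1 ?add0r => [|j /andP[/andP[ij _] _]]; last by apply: F0; rewrite -leq_subLR.
 by apply: eq_bigr => j _; rewrite leq_addl addnK.
rewrite (exchange_big_dep xpredT) //=; apply: eq_bigr => l _.
rewrite -(big_mkord (fun i => i <= l)%N (fun i => F i (l - i)%N)).
rewrite -(big_mkord xpredT (fun i => F i (l - i)%N)).
rewrite [RHS](big_nat_widen 0 l.+1 N) //=.
Qed.

End FiniteSums.

Lemma linear_fsum_nat (K : pzRingType) (W1 W2 : lmodType K) (g : W1 -> W2)
  (f : nat -> W1) N : linear g -> (forall i, (N <= i)%N -> f i = 0) ->
 g (\sum_(i \in [set: nat]) f i) = \sum_(i \in [set: nat]) g (f i).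
move=> lg f0; pose G := GRing.isLinear.Build _ _ _ _ g lg.
pose g' : {linear W1 -> W2} := HB.pack g G.
rewrite (fsum_nat f0) (@fsum_nat _ (g \o f) N) => [|i Ni /=].
 by rewrite -[g]/(g' : W1 -> W2) raddf_sum.
by rewrite f0 // -[g]/(g' : W1 -> W2) raddf0.
Qed.

Section LinearPred.
Variables (K : pzRingType) (W1 W2 : lmodType K) (g : W1 -> W2) (lg : linear g).
Let g' : {linear W1 -> W2} := HB.pack g (GRing.isLinear.Build _ _ _ _ g lg).
Lemma lin0 : g 0 = 0. exact: (raddf0 g'). Qed.
Lemma linD : {morph g : x y / x + y}. exact: (raddfD g'). Qed.
Lemma linN : {morph g : x / - x}. exact: (raddfN g'). Qed.
Lemma linB : {morph g : x y / x - y}. exact: (raddfB g'). Qed.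
Lemma linZ a : {morph g : x / a *: x}. exact: (linearZ_LR g'). Qed.
Lemma lin_sum I r (P : pred I) F : g (\sum_(i <- r | P i) F i) = \sum_(i <- r | P i) g (F i).
exact: (raddf_sum g'). Qed.
End LinearPred.

Section Binz.
Variable R : realType.
Local Notation binz := (@binz R).
Lemma binz0 m : binz m 0 = 1.
by rewrite /binz big_ord0 fact0 divr1. Qed.
Lemma succ_neq0 i : i.+1%:R != 0 :> R[i]. by rewrite pnatr_eq0. Qed.
Hint Resolve succ_neq0 : core.

Lemma binzS m i : binz m i.+1 = binz m i * (m%:~R - i%:R) / i.+1%:R.
rewrite /binz big_ord_recr /= factS natrM invfM !mulrA mulrAC.
by congr (_ / _); rewrite mulrAC.
Qed.

Lemma binz_pascal m i : binz (m + 1) i.+1 = binz m i.+1 + binz m i.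
elim: i => [|i IH]; first by rewrite !binzS !binz0 intrD; field.
rewrite binzS IH (binzS m i.+1) binzS.
have -> : (m + 1)%:~R = m%:~R + 1 :> R[i] by rewrite intrD.
have := succ_neq0 i; have := succ_neq0 i.+1.
rewrite -(natr1 i.+1) -(natr1 i) => t0 s0.
by field; rewrite ?s0 -?addrA ?t0 //; apply/andP.
Qed.

Lemma binz_0 i : binz 0 i = (i == 0%N)%:R.
case: i => [|i]; first by rewrite binz0.
by rewrite /binz big_ord_recl /= subrr mul0r mul0r.
Qed.

Lemma binz_nat (n i : nat) : binz n i = 'C(n, i)%:R.
elim: n i => [|n IH] [|i]; rewrite ?binz0 ?bin0 ?binz_0 ?bin0n //.
have -> : n.+1%:Z = n%:Z + 1 by rewrite -addn1 PoszD.
by rewrite binz_pascal !IH binS natrD.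
Qed.

(** Both sides obey the Pascal recursion in [m]. Upwards it is explicit; downwards it has to be
    inverted, by an induction on [l]. *)
Lemma vandermonde m n l : binz (m + n) l = \sum_(i < l.+1) binz m i * binz n (l - i)%N.
pose S m l := \sum_(i < l.+1) binz m i * binz n (l - i)%N.
have Srec j q : S (j + 1) q.+1 = S j q.+1 + S j q.
 rewrite /S big_ord_recl binz0 mul1r.
 under eq_bigr => i _ do rewrite /= /bump add1n binz_pascal mulrDl subSS.
 rewrite big_split /= addrA; congr (_ + _).
 by rewrite [RHS]big_ord_recl binz0 mul1r.
have Sz j : S j 0%N = 1 by rewrite /S big_ord1 !binz0 mulr1.
rewrite -/(S m l); elim/int_ind: m l => [|m IH|m IH] l.
- rewrite /S add0r big_ord_recl binz0 mul1r subn0 big1 ?addr0 // => i _.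
 by rewrite binz_0 mul0r.
- case: l => [|l]; first by rewrite Sz binz0.
 rewrite -addn1 PoszD Srec -!IH addrAC binz_pascal //.
- elim: l => [|l IHl]; first by rewrite Sz binz0.
 have := Srec (- m.+1%:Z) l; have := binz_pascal (- m.+1%:Z + n) l.
 have -> : - m.+1%:Z + n + 1 = - m%:Z + n by lia.
 have -> : - m.+1%:Z + 1 = - m%:Z by lia.
 by rewrite IHl -IH => -> /addIr.
Qed.

Lemma binz_trinomial m i j : binz m i * binz (m - i%:Z) j = binz m (i + j)%N * 'C(i + j, i)%:R.
elim: j => [|j IH]; first by rewrite addn0 binn !binz0.
rewrite addnS [in LHS]binzS mulrA mulrA IH binzS.
have E : 'C((i + j).+1, i)%:R * j.+1%:R = (i + j).+1%:R * 'C(i + j, i)%:R :> R[i].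
 rewrite -!natrM; congr (_%:R); have := mul_bin_down (i + j).+1 i.
 have -> : ((i + j).+1 - i = j.+1)%N by lia.
 by rewrite mulnC [in RHS]mulnC => <-; rewrite mulnC.
have -> : 'C((i + j).+1, i)%:R = (i + j).+1%:R * 'C(i + j, i)%:R / j.+1%:R :> R[i] by rewrite -E mulfK.
rewrite [in RHS]mulrA; congr (_ / _).
rewrite [in RHS]mulrA mulfVK // intrB natrD opprD addrA.
by rewrite mulrAC.
Qed.

End Binz.

(** * Subspaces and generalized eigenspaces of a linear operator *)

Section Subspaces.
Variables (K : fieldType) (W : lmodType K).
Definition subspace (U : set W) : Prop := U 0 /\ forall a u v, U u -> U v -> U (a *: u + v).

Section Closure.
Variables (U : set W) (sU : subspace U).
Lemma sub0 : U 0. by case: sU. Qed.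
Lemma subZ a u : U u -> U (a *: u).
by case: sU => U0 UD Uu; rewrite -[_ *: _]addr0; apply: UD. Qed.
Lemma subD u v : U u -> U v -> U (u + v).
by case: sU => U0 UD Uu Uv; rewrite -[u]scale1r; apply: UD. Qed.
Lemma subN u : U u -> U (- u).
by move=> Uu; rewrite -scaleN1r; apply: subZ. Qed.
Lemma subB u v : U u -> U v -> U (u - v).
by move=> Uu Uv; apply/subD/subN. Qed.
Lemma sub_sum I (r : seq I) (P : pred I) F : (forall i, P i -> U (F i)) -> U (\sum_(i <- r | P i) F i).
by move=> UF; apply: big_ind => //; [exact: sub0 | exact: subD]. Qed.
Lemma subZ_iff a u : a != 0 -> U (a *: u) -> U u.
by move=> a0 Uu; rewrite -[u](scalerK a0); apply: subZ. Qed.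
Lemma sub_fsum (T : choiceType) (F : T -> W) : (forall i, U (F i)) -> U (\sum_(i \in [set: T]) F i).
by move=> UF; exact: sub_sum (fun i _ => UF i). Qed.
End Closure.
Lemma subspace0 : subspace [set 0].
by split=> // a u v -> ->; rewrite scaler0 addr0. Qed.
End Subspaces.

Section GeneralizedEigenspaces.
Variables (K : fieldType) (W : lmodType K) (A : W -> W) (lA : linear A).
Definition eshift h u := A u - h *: u.
Local Notation shift := eshift.
Definition geigen (h : K) : set W := [set w | exists M, iter M (shift h) w = 0].

Lemma shift_linear h : linear (shift h).
move=> a u v; rewrite /eshift (linD lA) (linZ lA) scalerDr opprD scalerBr !scalerA.
by rewrite addrACA (mulrC h).
Qed.

Lemma shiftC h h' w : shift h (shift h' w) = shift h' (shift h w).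
rewrite /eshift !(linB lA) !(linZ lA) !scalerBr !scalerA (mulrC h') !opprD !opprK.
by rewrite !addrA; congr (_ + _); rewrite addrAC.
Qed.

Lemma iter_shiftC h h' m n w : iter m (shift h) (iter n (shift h') w) = iter n (shift h') (iter m (shift h) w).
have E k v : iter k (shift h) (shift h' v) = shift h' (iter k (shift h) v)
 by elim: k v => // k IH v; rewrite [LHS]iterS IH shiftC.
by elim: n w => // n IH w; rewrite iterS E IH.
Qed.

Lemma iter_linear (B : W -> W) n : linear B -> linear (iter n B).
by move=> lB; elim: n => [|n IH] a u v //=; rewrite IH lB. Qed.
Lemma eshift_lin h n : linear (iter n (shift h)).
exact/iter_linear/shift_linear. Qed.

Lemma iter_shift_stable (U : set W) h n u : subspace U -> (forall u, U u -> U (A u)) -> U u -> U (iter n (shift h) u).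
move=> sU AU Uu; elim: n => [|n IH] //=.
by apply: subB => //; [exact: AU | exact: subZ].
Qed.

Lemma geigen_subspace h : subspace (geigen h).
split=> [|a u v [M Mu] [N Nv]]; first by exists 0%N.
have l0 n : iter n (shift h) 0 = 0 by apply/lin0/eshift_lin.
exists (M + N)%N; rewrite (eshift_lin h (M + N)).
by rewrite {1}addnC !iterD Mu Nv !l0 scaler0 addr0.
Qed.

(** Modulo [U] the vector is an eigenvector for h' and a generalized eigenvector for h, hence zero:
    (h' - h) u is the difference of its two shifts. *)
Lemma geigen_mod (U : set W) h h' u : subspace U -> (forall u, U u -> U (A u)) ->
 h != h' -> geigen h u -> U (shift h' u) -> U u.
move=> sU AU hh' [M Mu] Uu.
have {Mu} : U (iter M (shift h) u) by rewrite Mu; exact: sub0.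
elim: M u Uu => [|M IH] u Uu; first by [].
rewrite iterSr => /IH Uv; have {}Uv : U (shift h u).
 apply: Uv; rewrite shiftC.
 by apply: subB => //; [exact: AU | exact: subZ].
have /(subZ_iff sU) : h' - h != 0 by rewrite subr_eq0 eq_sym.
apply; have -> : (h' - h) *: u = shift h u - shift h' u.
 by rewrite scalerBl /eshift opprB [RHS]addrC addrA subrK.
exact: subB.
Qed.

Lemma geigen_shift h h' u : geigen h u -> geigen h (shift h' u).
move=> [M Mu]; exists M.
by rewrite -[shift h' u]/(iter 1 (shift h') u) iter_shiftC Mu; apply/lin0/shift_linear.
Qed.

Lemma geigen_iter_mod (U : set W) h h' n u : subspace U -> (forall u, U u -> U (A u)) -> h != h' -> geigen h u ->
 U (iter n (shift h') u) -> U u.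
move=> sU AU hh'; elim: n u => [|n IH] u gu; first by [].
rewrite iterSr => Un; apply: (geigen_mod sU AU hh' gu).
by apply: IH Un; exact: geigen_shift.
Qed.

(** Induction on the list: a power of A - h0 kills the first component and, by [geigen_iter_mod], is
    injective modulo [U] on the others. *)
Lemma geigen_components (U : set W) (s : seq K) (u : K -> W) : subspace U ->
 (forall u, U u -> U (A u)) -> uniq s -> (forall h, geigen h (u h)) ->
 U (\sum_(h <- s) u h) -> forall h, h \in s -> U (u h).
move=> sU AU; elim: s u => // h0 s IH u /= /andP[h0s us] gu.
rewrite big_cons => Us.
have Uh h : h \in s -> U (u h).
 have [M Mu] := gu h0; have lS := eshift_lin h0 M.
 move=> hs; apply: (@geigen_iter_mod U h h0 M) => //; first by apply: contraNneq h0s => <-.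
 apply: (IH (fun h => iter M (shift h0) (u h))) => // [h'|].
  by have [N Nu] := gu h'; exists N; rewrite iter_shiftC Nu (lin0 lS).
 have := iter_shift_stable h0 M sU AU Us.
 by rewrite (linD lS) Mu add0r (lin_sum lS).
move=> h; rewrite inE => /predU1P[->|/Uh //].
rewrite -(addrK (\sum_(h <- s) u h) (u h0)); apply: subB => //.
by rewrite big_seq; apply: sub_sum.
Qed.

Definition gspanned : Prop := forall w, exists (s : seq K) (u : K -> W),
 (forall h, geigen h (u h)) /\ w = \sum_(h <- s) u h.

(** [gspanned] tolerates repeated eigenvalues and arbitrary values off the list; this normal form
    makes the family unique. *)
Definition gdecomp (w : W) (u : K -> W) : Prop := (forall h, geigen h (u h)) /\
 exists s : seq K, [/\ uniq s, forall h, h \notin s -> u h = 0 & w = \sum_(h <- s) u h].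

Lemma gdecomp_sum w u s : (forall h, geigen h (u h)) -> uniq s ->
 w = \sum_(h <- s) u h -> gdecomp w (fun h => if h \in s then u h else 0).
move=> gu us ->; split=> [h|]; first by case: ifP => // _; exact: sub0 (geigen_subspace h).
exists s; split=> // [h /negbTE -> //|].
by rewrite !big_seq; apply: eq_bigr => h ->.
Qed.

Lemma gdecomp_widen (w : W) (u : K -> W) (s s' : seq K) : uniq s -> uniq s' -> {subset s <= s'} ->
 (forall h, h \notin s -> u h = 0) -> w = \sum_(h <- s) u h -> w = \sum_(h <- s') u h.
move=> us us' ss' u0 ->; rewrite [RHS](bigID [in s]) /= [X in _ = _ + X]big1 => [|h]; last exact: u0.
rewrite addr0 -[RHS]big_filter; apply: perm_big; apply: uniq_perm => //; first exact: filter_uniq.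
by move=> h; rewrite mem_filter; case: (boolP (h \in s)) => // /ss' ->.
Qed.

Lemma gdecomp_linear a w u w' u' : gdecomp w u -> gdecomp w' u' -> gdecomp (a *: w + w') (fun h => a *: u h + u' h).
move=> [gu [s [us u0 wE]]] [gu' [s' [us' u'0 w'E]]].
split=> [h|]; first by have [_] := geigen_subspace h; apply.
have s1 : {subset s <= undup (s ++ s')} by move=> h hs; rewrite mem_undup mem_cat hs.
have s2 : {subset s' <= undup (s ++ s')} by move=> h hs; rewrite mem_undup mem_cat hs orbT.
exists (undup (s ++ s')); split=> [|h|]; first exact: undup_uniq.
 by rewrite mem_undup mem_cat negb_or => /andP[/u0 -> /u'0 ->]; rewrite scaler0 addr0.
rewrite big_split -scaler_sumr /=; congr (_ *: _ + _).
 exact: gdecomp_widen (undup_uniq _) _ _ wE.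
exact: gdecomp_widen (undup_uniq _) _ _ w'E.
Qed.

Lemma gdecomp_uniq w u u' : gdecomp w u -> gdecomp w u' -> u = u'.
move=> gu gu'; apply/funext => h; apply/eqP; rewrite -subr_eq0; apply/eqP.
have [g [s [us s0 sE]]] := gdecomp_linear (- 1) gu' gu.
have [hs|/s0] := boolP (h \in s); last by rewrite scaleN1r addrC.
have := geigen_components (subspace0 W) _ us g _ hs.
rewrite scaleN1r addrC; apply; first by move=> v ->; rewrite (lin0 lA).
by rewrite -sE scaleN1r addNr.
Qed.

Definition gcomp (w : W) : K -> W := xget (fun=> 0) [set u | gdecomp w u].
Hypothesis sA : gspanned.

Lemma gcompP w : gdecomp w (gcomp w).
rewrite /gcomp; case: xgetP => // /(_ _) noex; exfalso.
have [s [u [gu wE]]] := sA w; apply: (noex _).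
(* An eigenvalue listed several times contributes [u h] each time. *)
apply: (@gdecomp_sum w (fun h => u h *+ count_mem h s) (undup s)) => [h||].
- by rewrite -scaler_nat; apply: subZ => //; exact: geigen_subspace.
- exact: undup_uniq.
- by rewrite wE -big_undup_iterop_count; apply: eq_bigr => h _; rewrite Monoid.iteropE iter_addr_0.
Qed.

Lemma gcomp_gen w h : geigen h (gcomp w h).
by have [] := gcompP w. Qed.

Lemma gcomp_linear h : linear (gcomp^~ h).
move=> a u v.
by rewrite (gdecomp_uniq (gcompP _) (gdecomp_linear a (gcompP u) (gcompP v))).
Qed.

Lemma gcomp_geigen h h' u : geigen h u -> gcomp u h' = if h' == h then u else 0.
move=> gu; have := @gdecomp_sum u (fun h' => if h' == h then u else 0) [:: h].
move=> /(_ _ isT) D; rewrite (gdecomp_uniq (gcompP u) (D _ _)) /=.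
- by rewrite inE; case: ifP => // /eqP ->; rewrite eqxx.
- by move=> k; case: eqP => [-> //|_]; exact: sub0 (geigen_subspace k).
- by rewrite big_seq1 eqxx.
Qed.

Lemma gcomp_sub (U : set W) w h : subspace U -> (forall u, U u -> U (A u)) -> U w -> U (gcomp w h).
move=> sU AU Uw; have [g [s [us s0 sE]]] := gcompP w.
have [hs|/s0 ->] := boolP (h \in s); last exact: sub0.
by apply: (geigen_components sU AU us g _ hs); rewrite -sE.
Qed.

Lemma gspan_ind (U : set W) : subspace U -> (forall h u, geigen h u -> U u) -> forall w, U w.
move=> sU gU w; have [s [u [gu ->]]] := sA w.
by apply: sub_sum => // h _; exact: gU (gu h).
Qed.

(** Glues maps that are given only on generalized eigenspaces; this turns e^(2 pi i L_0), a formula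
    that mentions the eigenvalue, into an operator. *)
Lemma gspan_extend (W2 : lmodType K) (f : K -> W -> W2) : (forall h a u v, geigen h u -> geigen h v ->
  f h (a *: u + v) = a *: f h u + f h v) -> exists2 F : W -> W2, linear F & forall h u, geigen h u -> F u = f h u.
move=> lf; have g0 h : geigen h 0 := sub0 (geigen_subspace h).
have f0 h : f h 0 = 0 by have := lf h (-1) 0 0 (g0 h) (g0 h); rewrite scaler0 addr0 scaleN1r addNr.
pose F w := \sum_(h \in [set: K]) f h (gcomp w h).
have FE w s : uniq s -> (forall h, h \notin s -> gcomp w h = 0) ->
  F w = \sum_(h <- s) f h (gcomp w h) by move=> us s0; apply: fsum_seq => // h /s0 ->.
exists F => [a u v|h u gu].
 have [_ [s [us u0 _]]] := gcompP u; have [_ [s' [us' v0 _]]] := gcompP v.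
 pose t := undup (s ++ s').
 have tu h : h \notin t -> gcomp u h = 0 by rewrite mem_undup mem_cat negb_or => /andP[/u0].
 have tv h : h \notin t -> gcomp v h = 0 by rewrite mem_undup mem_cat negb_or => /andP[_ /v0].
 rewrite (FE _ t) ?(FE u t) ?(FE v t) ?undup_uniq // => [|h ht]; last by rewrite gcomp_linear tu // tv // scaler0 addr0.
 rewrite scaler_sumr -big_split /=; apply: eq_bigr => h _.
 by rewrite gcomp_linear lf //; exact: gcomp_gen.
rewrite (FE u [:: h]) // => [|h']; last by rewrite inE (gcomp_geigen _ gu) => /negbTE ->.
by rewrite big_seq1 (gcomp_geigen _ gu) eqxx.
Qed.

End GeneralizedEigenspaces.

Section SubLmodule.
Variables (K : fieldType) (W : lmodType K) (U : set W).
Definition subspace_pred (sU : subspace U) : {pred W} := fun w => `[< U w >].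

Fact subspace_pred_closed sU : submod_closed (subspace_pred sU).
split=> [|a u v /asboolW Uu /asboolW Uv]; apply: asboolT; first exact: sub0.
by apply: subD => //; exact: subZ.
Qed.

HB.instance Definition _ sU := GRing.isSubmodClosed.Build K W (subspace_pred sU) (subspace_pred_closed sU).

Record subspace_type (sU : subspace U) := SubspaceType {
 subspace_val :> W; subspace_valP : subspace_val \in subspace_pred sU }.

HB.instance Definition _ sU := [isSub of subspace_type sU for @subspace_val sU].
HB.instance Definition _ sU := [Choice of subspace_type sU by <:].
HB.instance Definition _ sU := [SubChoice_isSubLmodule of subspace_type sU by <:].
Variable sU : subspace U.
Lemma subspace_valU (u : subspace_type sU) : U (val u).
by case: u => u uP; exact: asboolW uP. Qed.
Definition subspace_in u (Uu : U u) : subspace_type sU := SubspaceType (asboolT Uu : u \in subspace_pred sU).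
Lemma val_linear : linear (val : subspace_type sU -> W).
by move=> a u v; rewrite linearP. Qed.
End SubLmodule.
Lemma scalerCA (K : comPzRingType) (W : lmodType K) a b (w : W) : a *: (b *: w) = b *: (a *: w).
by rewrite !scalerA mulrC. Qed.

(** * Level k actions of affine gl(1|1), parity, and induction over V *)

Section LieModules.
Context R (k : R[i]).
Lemma signZ (b : bool) (W : lmodType R[i]) (w : W) : (-1) ^+ b *: ((-1) ^+ b *: w) = w.
by rewrite scalerA -expr2 sqrr_sign scale1r. Qed.
Lemma par0 (W : sspace R) : par 0 = 0 :> W.
exact/lin0/par_linear. Qed.

Section SubSpace.
Variables (W : sspace R) (U : set W) (sU : subspace U).
Hypothesis pU : forall u, U u -> U (par u).
Definition sub_par (u : subspace_type sU) : subspace_type sU := subspace_in sU (pU (subspace_valU u)).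
Fact sub_par_linear : linear sub_par.
by move=> a u v; apply: val_inj; rewrite /= par_linear. Qed.
Fact sub_par_invol : involutive sub_par.
by move=> u; apply: val_inj; rewrite /= par_invol. Qed.
Definition sub_sspace : sspace R := Sspace sub_par_linear sub_par_invol.
End SubSpace.

Section Spans.
Variables (M : sspace R) (x : gl11 -> int -> M -> M).
Hypothesis xM : affine_action k x.
Variables (X : set M) (raise : gl11 -> int -> Prop).

(** If all modes are allowed this is a generated submodule; if only the lowering modes of a
    triangular decomposition are, it says that words in these modes span. *)
Inductive mspan : set M :=
| mspan_base u of X u : mspan u
| mspan_zero : mspan 0
| mspan_lin a u v of mspan u & mspan v : mspan (a *: u + v)
| mspan_act a r u of raise a r & mspan u : mspan (x a r u).

Lemma mspan_sub : subspace mspan.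
by split; [exact: mspan_zero | exact: mspan_lin]. Qed.
Lemma act_linear a r : linear (x a r).
by case: xM. Qed.
Lemma act_par a r w : par (x a r w) = (-1) ^+ odd11 a *: x a r (par w).
by case: xM => _ xp _; rewrite -{1}[w]par_invol xp (linZ (@par_linear _ M)) par_invol. Qed.

Lemma act_swap a b r s w : x a r (x b s w) = (-1) ^+ (odd11 a && odd11 b) *: x b s (x a r w) +
  bracket11 (fun c => x c (r + s) w) a b + (if r + s == 0 then r%:~R * kappa11 R a b * k else 0) *: w.
by case: xM => _ _ H; rewrite -addrA -H addrC subrK. Qed.

(* Commuting a non-raising mode past a raising one only leaves modes acting on
 shorter words. *)
Lemma mspan_stable : (forall a r u, X u -> mspan (x a r u)) -> forall a r u, mspan u -> mspan (x a r u).
have S := mspan_sub.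
move=> XM a r u Mu; elim: Mu a r => {u} [u Xu a r|a r|c u v Mu IHu Mv IHv a r|b s u bs Mu IH a r].
- exact: XM.
- by rewrite (lin0 (act_linear a r)); exact: mspan_zero.
- by rewrite act_linear; apply: mspan_lin.
- rewrite act_swap; apply: (subD S); last exact: subZ.
 apply: (subD S); first by apply: subZ => //; apply: mspan_act => //; exact: IH.
 by case: (a) (b) => [] [] /=; first [exact: (sub0 S) | exact: IH | apply: (subN S); exact: IH].
Qed.

Lemma mspan_par : (forall u, X u -> mspan (par u)) -> forall u, mspan u -> mspan (par u).
have S := mspan_sub.
move=> Xp u; elim => {u} [u /Xp //||c u v _ IHu _ IHv|b s u bs _ IH].
- by rewrite par0; exact: mspan_zero.
- by rewrite par_linear; apply: mspan_lin.
- by rewrite act_par; apply: subZ => //; exact: mspan_act.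
Qed.

End Spans.

Lemma bracket11_linear (M1 M2 : lmodType R[i]) (g : M1 -> M2) (x : gl11 -> M1) a b :
 linear g -> g (bracket11 x a b) = bracket11 (g \o x) a b.
by move=> lg; case: a b => [] [] /=; rewrite ?(lin0 lg) ?(linN lg). Qed.

Lemma bracket11_ext (M : lmodType R[i]) (x y : gl11 -> M) a b :
 (forall c, x c = y c) -> bracket11 x a b = bracket11 y a b.
by move=> xy; case: a b => [] [] /=; rewrite ?xy. Qed.
End LieModules.

Section Homogeneous.
Context R (W : sspace R).
Definition hproj (a : bool) (w : W) : W := 2%:R^-1 *: (w + (-1) ^+ a *: par w).

Lemma hproj_linear a : linear (hproj a).
by move=> c u v; rewrite /hproj par_linear; lmod_ring.
Qed.

Lemma hproj_hmg a w : hmg a (hproj a w).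
rewrite /hmg /hproj (linZ (@par_linear _ W)) (linD (@par_linear _ W))
 (linZ (@par_linear _ W)) par_invol scalerCA; congr (_ *: _).
by rewrite scalerDr signZ addrC.
Qed.

Lemma hproj_id a w : hmg a w -> hproj a w = w.
rewrite /hproj => ->; rewrite signZ -[X in X + _]scale1r -[X in _ + X]scale1r.
by rewrite -scalerDl scalerA mulVf ?scale1r // pnatr_eq0.
Qed.

Lemma hproj_other a w : hmg (~~ a) w -> hproj a w = 0.
rewrite /hproj => ->; rewrite scalerA -signr_addb addbN addbb expr1.
by rewrite scaleN1r subrr scaler0.
Qed.

Lemma hproj_sum w : w = hproj false w + hproj true w.
rewrite /hproj -scalerDr !scale1r expr1 scaleN1r addrACA subrr addr0 -[X in X + _]scale1r -[X in _ + X]scale1r.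
by rewrite -scalerDl scalerA mulVf ?scale1r // pnatr_eq0.
Qed.

Lemma hmg0 a : hmg a (0 : W).
by rewrite /hmg par0 scaler0. Qed.

Lemma hmg_subspace a : subspace (@hmg R W a).
split=> [|c u v]; first exact: hmg0.
by rewrite /hmg par_linear => -> ->; rewrite scalerDr !scalerA mulrC.
Qed.

Lemma hmg_split (U : set W) : subspace U -> (forall a w, hmg a w -> U w) -> forall w, U w.
by move=> sU hU w; rewrite (hproj_sum w); apply: subD => //; apply: hU; exact: hproj_hmg.
Qed.

End Homogeneous.

Section Borcherds.
Context R (V : vdata R) (W1 W2 W3 : sspace R).
Variables (y1 : V -> int -> W1 -> W1) (y2 : V -> int -> W2 -> W2)
 (y3 : V -> int -> W3 -> W3) (q : bool) (c : W1 -> int -> W2 -> W3).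
Hypothesis B : borcherds y1 y2 y3 q c.

(** The case m = 0, the iterate formula; [borcherds_comm] is the case n = 0, the supercommutator
    formula. *)
Lemma borcherds_iter a b v w1 w2 n l : hmg a v -> hmg b w1 ->
 c (y1 v n w1) l w2 = \sum_(i \in [set: nat]) ((-1) ^+ i * binz R n i) *:
  ((-1) ^+ (q && a) *: y3 v (n - i%:Z) (c w1 (l + i%:Z) w2)
  - ((-1) ^ n * (-1) ^+ (a && b)) *: c w1 (n + l - i%:Z) (y2 v i%:Z w2)).
move=> ha hb; have := B w2 0 n l ha hb.
rewrite (fsum_nat (N := 1)) => [|[//|i] _]; last by rewrite binz_0 scale0r.
rewrite big_ord1 binz0 scale1r add0r subr0 addr0 => ->.
by apply: eq_fsbigr => i _; rewrite !add0r.
Qed.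

Lemma borcherds_comm a b v w1 w2 m l : hmg a v -> hmg b w1 ->
 \sum_(i \in [set: nat]) binz R m i *: c (y1 v i%:Z w1) (m + l - i%:Z) w2 =
 (-1) ^+ (q && a) *: y3 v m (c w1 l w2) - (-1) ^+ (a && b) *: c w1 l (y2 v m w2).
move=> ha hb; have := B w2 m 0 l ha hb.
rewrite [X in _ = X](fsum_nat (N := 1)) => [|[//|i] _]; last by rewrite binz_0 mulr0 scale0r.
rewrite big_ord1 binz0 mulr1 scale1r !addr0 add0r expr0z mul1r => <-.
by apply: eq_fsbigr => i _; rewrite add0r.
Qed.

End Borcherds.

Section Modes.
Context R (k : R[i]) (V : affine_vsa k).
Definition mode (W : vmod V) (a : gl11) (r : int) : W -> W := act (gen V a) r.
Arguments mode : clear implicits.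
Lemma gen_vac b : vY (gen V b) (-1) (vac V) = gen V b.
by case: (avs_vsa V). Qed.
Lemma mode_vac (v : V) (n : nat) : vY v n%:Z (vac V) = 0.
by case: (avs_vsa V). Qed.

Lemma gen_swap a b r s (w : V) : vY (gen V a) r (vY (gen V b) s w) =
 (-1) ^+ (odd11 a && odd11 b) *: vY (gen V b) s (vY (gen V a) r w) +
  bracket11 (fun c => vY (gen V c) (r + s) w) a b + (if r + s == 0 then r%:~R * kappa11 R a b * k else 0) *: w.
exact: (act_swap (gen_action V)). Qed.

Lemma gen_gen a b (i : nat) : vY (gen V a) i%:Z (gen V b) =
 if i is j.+1 then (if j is 0%N then (kappa11 R a b * k) *: vac V else 0) else bracket11 (gen V) a b.
rewrite -(gen_vac b) gen_swap mode_vac (lin0 (act_linear (gen_action V) _ _)) scaler0 add0r; case: i => [|[|i]].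
- by rewrite scale0r addr0 add0r; apply: bracket11_ext => c; rewrite gen_vac.
- rewrite (_ : 1 + -1 = 0) // eqxx mul1r -{2}[_ *: _]add0r; congr (_ + _).
 rewrite (@bracket11_ext _ _ _ (fun=> 0)) => [|c]; last exact: (mode_vac _ 0).
 by case: a b => [] [] /=; rewrite ?oppr0.
- rewrite (_ : i.+2%:Z + -1 = i.+1%:Z); last by lia.
 rewrite scale0r addr0 (@bracket11_ext _ _ _ (fun=> 0)) => [|c]; last exact: mode_vac.
 by case: a b => [] [] /=; rewrite ?oppr0.
Qed.

Section OneModule.
Variable W : vmod V.
Lemma act_linl n (w : W) : linear (fun v => act v n w).
exact: mod_linl (act_module W) n w. Qed.
Lemma act_linr v n : linear (@act _ _ W v n).
exact: mod_linr (act_module W) v n. Qed.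
Lemma act0l n (w : W) : act (0 : V) n w = 0. exact: (lin0 (act_linl _ _)). Qed.
Lemma act0r (v : V) n : act v n (0 : W) = 0. exact: (lin0 (act_linr _ _)). Qed.
Lemma act_vac n (w : W) : act (vac V) n w = if n == -1 then w else 0.
exact: mod_vac (act_module W) n w. Qed.

(** The commutator formula for two generators, whose operator product stops at the double pole
    ([gen_gen]). *)
Lemma mode_action : affine_action k (mode W).
split=> [a r|a r w|a b r s w]; first exact: act_linr.
 by rewrite /mode (mod_par (act_module W)) (gen_par V) (linZ (act_linl _ _)) signZ.
have := borcherds_comm (mod_borcherds (act_module W)) w r s (gen_par V a) (gen_par V b).
rewrite scale1r => <-; rewrite (fsum_nat (N := 2)) => [|[|[|i]] // _]; last by rewrite gen_gen act0l scaler0.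
rewrite !big_ord_recl big_ord0 addr0 /= !gen_gen binz0 scale1r ?subr0 ?addr0; congr (_ + _).
 exact: (bracket11_linear _ _ _ (act_linl _ _)).
rewrite (linZ (act_linl _ _)) act_vac binzS binz0 /bump /= subr0 divr1 mul1r.
have -> : (r + s - (1 + 0)%N%:Z == -1) = (r + s == 0) by lia.
by case: ifP; rewrite ?scaler0 ?scale0r // scalerA mulrA.
Qed.

End OneModule.
Definition vgen : V -> Prop := mspan (fun a r => vY (gen V a) r) [set vac V] (fun _ _ => True).
Fact vgen_act a r u : vgen u -> vgen (vY (gen V a) r u).
exact: mspan_act. Qed.
Fact vac_even : hmg false (vac V). by case: (avs_vsa V). Qed.

Fact vgen_par u : vgen u -> vgen (par u).
apply: (mspan_par (gen_action V)) => w ->; apply: mspan_base.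
by rewrite [par _]vac_even scale1r.
Qed.

Let S : subspace vgen. exact: mspan_sub. Qed.
Let G := sub_sspace S vgen_par.
Let xG a r (u : G) : G := subspace_in S (vgen_act a r (subspace_valU u)).

Fact vgen_action : affine_action k xG.
have [xl xp xc] := gen_action V; split=> [a r c u v|a r u|a b r s u]; apply: val_inj.
- by rewrite /= xl.
- by rewrite /= xp.
- have vl : linear (val : G -> V) := @val_linear _ _ _ S.
 rewrite (linB vl) (linZ vl) (linD vl) (linZ vl).
 by rewrite (bracket11_linear _ _ _ vl) /= xc.
Qed.

(* The subspace generated by the vacuum satisfies the universal property. *)
Lemma vgenT (v : V) : vgen v.
have vac0 : vgen (vac V) by exact: mspan_base.
have [||f [lf pf fv fx] _] := @gen_induced R k V G xG (subspace_in S vac0) vgen_action.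
- by apply: val_inj; rewrite /= scale1r vac_even scale1r.
- by move=> a r; apply: val_inj; rewrite /= mode_vac.
have [||g _ gu] := @gen_induced R k V V _ (vac V) (gen_action V).
- exact: vac_even.
- by move=> a r; rewrite mode_vac.
have fE : (fun v => val (f v)) = g.
 apply: gu; split=> [a u w|u||a r u].
 - by rewrite lf linearP.
 - by rewrite pf.
 - by rewrite fv.
 - by rewrite fx.
have gE : id = g by apply: gu; split.
have := subspace_valU (f v); suff -> : val (f v) = v by [].
by rewrite -[LHS]/((fun v => val (f v)) v) fE -gE.
Qed.

Lemma V_ind (U : set V) : subspace U -> U (vac V) -> (forall a r u, U u -> U (vY (gen V a) r u)) -> forall v, U v.
move=> sU U0 UM v; elim: (vgenT v) => {v} [v ->//||a u v _ Uu _ Uv|a r u _ _ Uu].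
- exact: sub0.
- by apply: subD => //; exact: subZ.
- exact: UM.
Qed.

(** A vector built from modes is not homogeneous in general, so the induction runs over both
    homogeneous projections at once. *)
Lemma V_hmg_ind (P : bool -> V -> Prop) : (forall b, subspace (P b)) -> P false (vac V) ->
 (forall a r b u, hmg b u -> P b u -> P (odd11 a (+) b) (vY (gen V a) r u)) -> forall b v, hmg b v -> P b v.
move=> sP P0 PM; suff H v : forall b, P b (hproj b v).
 by move=> b v hv; rewrite -(hproj_id hv).
apply: (V_ind (U := fun v => forall b, P b (hproj b v))) v => [||a r u Pu b].
- split=> [b|a u v Pu Pv b]; first by rewrite (lin0 (hproj_linear _)); exact: sub0.
 by rewrite hproj_linear; apply: subD => //; exact: subZ.
- case; last by rewrite (hproj_id vac_even).
 by rewrite (hproj_other (a := true) vac_even); exact: (sub0 (sP true)).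
have -> : hproj b (vY (gen V a) r u) = vY (gen V a) r (hproj (odd11 a (+) b) u).
 have lx := act_linear (gen_action V) a r.
 rewrite /hproj (act_par (gen_action V)) (linZ lx) (linD lx) (linZ lx) scalerA -signr_addb.
 by rewrite addbC.
by have := PM a r _ _ (hproj_hmg (odd11 a (+) b) u) (Pu _); rewrite addbA addbb.
Qed.

End Modes.

(** Transfers the bound of a finitely supported family to one built from it; what remains is that
    zero is sent to zero. *)
Ltac fin_of H := let N := fresh "N" in let hN := fresh "hN" in have [N hN] := H; exists N => ? /hN ->.

(** * Rearrangement of finitely supported double and triple sums *)

Section FiniteSupport.
Variables (K : pzRingType) (W : lmodType K).
Implicit Types (f g : nat -> W) (F : nat -> nat -> W).

Definition fsum f : W := \sum_(i \in [set: nat]) f i.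
Definition fin1 f := exists N, forall i, (N <= i)%N -> f i = 0.
(** The bound is on i + j, so that rows, columns and antidiagonals may be summed in any order. *)
Definition fin2 F := exists N, forall i j, (N <= i + j)%N -> F i j = 0.

Lemma fin2_intro F : (exists N, forall i j, (N <= i)%N -> F i j = 0) -> (forall i, fin1 (F i)) -> fin2 F.
move=> [N FN] Fi; suff [M FM] : exists M, forall i j, (i < N)%N -> (M <= j)%N -> F i j = 0.
 exists (N + M)%N => i j ij; have [/FN //|iN] := leqP N i.
 by apply: FM => //; lia.
elim: N {FN} => [|N [M FM]]; first by exists 0%N.
have [M' FM'] := Fi N; exists (maxn M M') => i j.
by rewrite ltnS leq_eqVlt geq_max => /predU1P[->|iN] /andP[]; [move=> _ /FM'|move=> /(FM _ _ iN)].
Qed.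

Lemma fin2_introC F : (exists N, forall i j, (N <= j)%N -> F i j = 0) -> (forall j, fin1 (F^~ j)) -> fin2 F.
move=> [N0 FN] Fj; have [|//|N H] := @fin2_intro (fun j i => F i j); first by exists N0 => i j /FN.
by exists N => i j; rewrite addnC => /H.
Qed.

Lemma fin2_row F i : fin2 F -> fin1 (F i).
by move=> [N FN]; exists N => j Nj; apply: FN; rewrite (leq_trans Nj) ?leq_addl. Qed.

Lemma fin2_fsum F : fin2 F -> fin1 (fun i => fsum (F i)).
move=> [N FN]; exists N => i Ni; rewrite /fsum (fsum_nat (N := 0)) ?big_ord0 // => j _.
by apply: FN; rewrite (leq_trans Ni) ?leq_addr.
Qed.

Lemma fsumE N f : (forall i, (N <= i)%N -> f i = 0) -> fsum f = \sum_(i < N) f i.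
exact: fsum_nat. Qed.
Lemma eq_fsum f g : (forall i, f i = g i) -> fsum f = fsum g.
by move=> fg; apply: eq_fsbigr => i _. Qed.
Lemma fsum_eq0 f : (forall i, f i = 0) -> fsum f = 0.
by move=> f0; rewrite (fsumE (N := 0)) ?big_ord0. Qed.

Lemma fsumD f g : fin1 f -> fin1 g -> fsum (fun i => f i + g i) = fsum f + fsum g.
move=> [N fN] [M gM]; pose L := maxn N M.
have fL i : (L <= i)%N -> f i = 0 by rewrite geq_max => /andP[/fN].
have gL i : (L <= i)%N -> g i = 0 by rewrite geq_max => /andP[_ /gM].
rewrite !(fsumE (N := L)) // => [|i Li]; last by rewrite fL ?gL ?addr0.
exact: big_split.
Qed.

Lemma fsumZ a f : fin1 f -> fsum (fun i => a *: f i) = a *: fsum f.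
by move=> [N fN]; rewrite !(fsumE (N := N)) ?scaler_sumr // => i /fN ->; rewrite scaler0.
Qed.

Lemma fsum_lin (W' : lmodType K) (g : W -> W') f : linear g -> fin1 f -> g (fsum f) = \sum_(i \in [set: nat]) g (f i).
by move=> lg [N fN]; exact: linear_fsum_nat lg fN. Qed.

Lemma fsumC F : fin2 F -> fsum (fun i => fsum (F i)) = fsum (fun j => fsum (F^~ j)).
move=> FF; have [N FN] := FF.
have FN1 i j : (N <= i)%N -> F i j = 0 by move=> h; apply: FN; lia.
have FN2 i j : (N <= j)%N -> F i j = 0 by move=> h; apply: FN; lia.
rewrite (fsumE (N := N)) => [|i Ni]; last by apply: fsum_eq0 => j; exact: FN1.
rewrite [RHS](fsumE (N := N)) => [|j Nj]; last by apply: fsum_eq0 => i; exact: FN2.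
transitivity (\sum_(i < N) \sum_(j < N) F i j).
 by apply: eq_bigr => i _; apply: fsumE => j; exact: FN2.
rewrite exchange_big; apply: eq_bigr => j _.
by rewrite (fsumE (N := N)) // => i /FN1.
Qed.

Lemma fsum_diag F : fin2 F -> fsum (fun i => fsum (F i)) = fsum (fun l => \sum_(i < l.+1) F i (l - i)%N).
move=> [N FN].
have FN1 i j : (N <= i)%N -> F i j = 0 by move=> h; apply: FN; lia.
have FN2 i j : (N <= j)%N -> F i j = 0 by move=> h; apply: FN; lia.
rewrite (fsumE (N := N)) => [|i Ni]; last by apply: fsum_eq0 => j; exact: FN1.
rewrite [RHS](fsumE (N := N)) => [|l Nl]; last by rewrite big1 // => i _; apply: FN; rewrite subnKC // -ltnS.
rewrite -sum_antidiagonal //; apply: eq_bigr => i _.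
by rewrite (fsumE (N := N)) // => j /FN2.
Qed.

Lemma fsum_big n (F : nat -> 'I_n -> W) : (forall t, fin1 (F^~ t)) ->
 fsum (fun i => \sum_(t < n) F i t) = \sum_(t < n) fsum (F^~ t).
elim: n F => [|n IH] F Ft.
 by rewrite big_ord0; apply: fsum_eq0 => i; rewrite big_ord0.
rewrite big_ord_recl -IH => [|t]; last exact: Ft.
rewrite -fsumD; [|exact: Ft|].
 by apply: eq_fsum => i; rewrite big_ord_recl.
have [N HN] : exists N, forall i, (N <= i)%N -> forall t, F i (lift ord0 t) = 0.
 have /fin_all_exists[M HM] t : exists N, forall i, (N <= i)%N -> F i (lift ord0 t) = 0.
  exact: Ft.
 exists (\max_t M t) => i Ni t; apply: HM; apply: leq_trans Ni; exact: leq_bigmax.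
by exists N => i Ni; rewrite big1 // => t _; exact: HN.
Qed.

Lemma fsum_shift k f : (forall i, (i < k)%N -> f i = 0) -> fin1 f -> fsum f = fsum (fun p => f (k + p)%N).
move=> f0 [N fN].
rewrite (fsumE (N := k + N)) => [|i h]; last by apply: fN; lia.
rewrite (fsumE (N := N)) => [|i h]; last by apply: fN; lia.
rewrite big_split_ord /= big1 ?add0r // => i _; exact: f0.
Qed.

Lemma fsum2Z a F : fin2 F -> a *: fsum (fun i => fsum (F i)) = fsum (fun i => fsum (fun j => a *: F i j)).
move=> FF; rewrite -fsumZ; last exact: fin2_fsum.
by apply: eq_fsum => i; rewrite -fsumZ //; exact: fin2_row.
Qed.

Lemma fsum2D F G : fin2 F -> fin2 G -> fsum (fun i => fsum (F i)) + fsum (fun i => fsum (G i)) =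
 fsum (fun i => fsum (fun j => F i j + G i j)).
move=> FF GG; rewrite -fsumD; [|exact: fin2_fsum|exact: fin2_fsum].
by apply: eq_fsum => i; rewrite -fsumD //; exact: fin2_row.
Qed.

Lemma fin1Z (a : nat -> K) f : fin1 f -> fin1 (fun i => a i *: f i).
by move=> [N fN]; exists N => i /fN ->; rewrite scaler0. Qed.
Lemma fin2Z (a : nat -> nat -> K) F : fin2 F -> fin2 (fun i j => a i j *: F i j).
by move=> [N FN]; exists N => i j /FN ->; rewrite scaler0. Qed.
Lemma fin2_add (f : nat -> W) : fin1 f -> fin2 (fun i j => f (i + j)%N).
by move=> [N fN]; exists N => i j /fN. Qed.
End FiniteSupport.

Notation "\fs_ i F" := (fsum (fun i => F)) (at level 41, i name, F at level 41).

Section BinomialRearrangements.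
Context R (W : lmodType R[i]) (r : int).
Implicit Types (Z : nat -> nat -> W).
Local Notation binz := (@binz R).

Lemma fsum_scaler_suml (a : nat -> nat -> R[i]) (w : nat -> W) : fin1 w ->
 fsum (fun l => \sum_(i < l.+1) a i (l - i)%N *: w l) = \fs_i \fs_j a i j *: w (i + j)%N.
move=> fw; rewrite fsum_diag; last exact/fin2Z/fin2_add.
by apply: eq_fsum => l; apply: eq_bigr => i _; rewrite subnKC // -ltnS.
Qed.

Lemma fsum_vandermonde m n (w : nat -> W) : fin1 w -> (\fs_i binz (m + n) i *: w i) =
 \fs_i \fs_j (binz m i * binz n j) *: w (i + j)%N.
move=> fw; rewrite -(fsum_scaler_suml (fun i j => binz m i * binz n j) fw).
by apply: eq_fsum => i; rewrite vandermonde scaler_suml.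
Qed.

Lemma binz_trinomialC m i j : binz m i * binz (m - i%:Z) j = binz m j * binz (m - j%:Z) i.
rewrite !binz_trinomial addnC; congr (_ * _%:R).
by rewrite -bin_sub ?leq_addl // addnK.
Qed.

(** Vandermonde splits C(r-p+m, i) into products C(r-p, k) C(m, j), and C(r,p) C(r-p,k) = C(r,k)
    C(r-k,p). This and the next two lemmas are the coefficient form of re-expanding (t1 - t2)^r in
    another domain. *)
Lemma fsum_trinomial m Z : fin2 Z -> (\fs_p \fs_i (binz r p * binz (r - p%:Z + m) i) *: Z p i) =
 \fs_k \fs_j \fs_p (binz r k * binz m j * binz (r - k%:Z) p) *: Z p (k + j)%N.
move=> fZ.
transitivity (\fs_p \fs_k fsum (fun j =>
  (binz r k * binz m j * binz (r - k%:Z) p) *: Z p (k + j)%N)).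
 apply: eq_fsum => p; have fp := fin2_row p fZ.
 transitivity (binz r p *: (\fs_i binz (r - p%:Z + m) i *: Z p i)).
  by rewrite -fsumZ; [apply: eq_fsum => i; rewrite scalerA|exact: fin1Z].
 rewrite (fsum_vandermonde _ _ fp).
 have f2 : fin2 (fun i j => (binz (r - p%:Z) i * binz m j) *: Z p (i + j)%N).
  exact/fin2Z/fin2_add.
 rewrite -fsumZ; last exact: fin2_fsum.
 apply: eq_fsum => i; rewrite -fsumZ; last exact: fin2_row f2.
 by apply: eq_fsum => j; rewrite scalerA mulrA binz_trinomialC mulrAC.
have [N ZN] := fZ.
rewrite fsumC; last first.
 exists N => p k pk; apply: fsum_eq0 => j; rewrite ZN ?scaler0 //; lia.
apply: eq_fsum => k; rewrite fsumC //.
by exists N => p j pj; rewrite ZN ?scaler0 //; lia.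
Qed.

(** Here C(r,s) C(s,k) = C(r,k) C(r-k,s-k), and the terms with s < k vanish, whence s = k + p. *)
Lemma fsum_trinomial_shift m Z : (exists N, forall s i, (N <= i)%N -> Z s i = 0) -> (forall i, fin1 (Z^~ i)) ->
 (\fs_s \fs_i (binz r s * binz (s%:Z + m) i) *: Z s i) =
 \fs_k \fs_j \fs_p (binz r k * binz m j * binz (r - k%:Z) p) *: Z (k + p)%N (k + j)%N.
move=> [N ZN] Z1; have fZ : fin2 Z by apply: fin2_introC => //; exists N.
rewrite fsumC; last exact: fin2Z.
pose a s k j := binz r s * 'C(s, k)%:R * binz m j.
transitivity (fsum (fun i => \sum_(k < i.+1) (\fs_s a s k (i - k)%N *: Z s i))).
 apply: eq_fsum => i; rewrite -fsum_big => [|t]; last exact: fin1Z.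
 apply: eq_fsum => s; rewrite vandermonde mulr_sumr scaler_suml.
 by apply: eq_bigr => t _; rewrite /a -mulrA binz_nat.
transitivity (\fs_k \fs_j \fs_s a s k j *: Z s (k + j)%N).
 rewrite fsum_diag; last by exists N => k j kj; apply: fsum_eq0 => s; rewrite ZN ?scaler0.
 by apply: eq_fsum => i; apply: eq_bigr => k _; rewrite subnKC // -ltnS.
apply: eq_fsum => k; apply: eq_fsum => j.
rewrite (@fsum_shift _ _ k) => [|s sk|]; [|by rewrite /a bin_small // mulr0 mul0r scale0r|exact: fin1Z].
by apply: eq_fsum => p; rewrite /a -binz_trinomial mulrAC.
Qed.

Lemma fsum_trinomial_add n (Z : nat -> nat -> W) :
 (exists N, forall s p, (N <= p)%N -> Z s p = 0) -> (forall p, fin1 (Z^~ p)) ->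
 (\fs_s \fs_i \fs_p (binz n i * binz r s * binz s%:Z p) *: Z (s + i)%N p) =
 \fs_p \fs_j (binz r p * binz (r - p%:Z + n) j) *: Z (p + j)%N p.
move=> [N ZN] Z1; have fZ : fin2 Z by apply: fin2_introC => //; exists N.
have [M ZM] := fZ.
transitivity (\fs_s \fs_p \fs_i (binz n i * binz r s * binz s%:Z p) *: Z (s + i)%N p).
 apply: eq_fsum => s; rewrite fsumC //.
 by exists M => i p ip; rewrite ZM ?scaler0 //; lia.
rewrite fsumC; last by exists M => s p sp; apply: fsum_eq0 => i; rewrite ZM ?scaler0 //; lia.
apply: eq_fsum => p.
rewrite (@fsum_shift _ _ p) => [|s sp|]; first last.
- by exists M => s Ms; apply: fsum_eq0 => i; rewrite ZM ?scaler0 //; lia.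
- by apply: fsum_eq0 => i; rewrite binz_nat bin_small // mulr0 scale0r.
have f1 : fin1 (fun j => Z (p + j)%N p) by exists M => j Mj; apply: ZM; lia.
transitivity (binz r p *: (\fs_j binz (r - p%:Z + n) j *: Z (p + j)%N p)); last by rewrite -fsumZ; [apply: eq_fsum => i; rewrite scalerA|exact: fin1Z].
rewrite (fsum_vandermonde _ _ f1).
have f2 : fin2 (fun i j => (binz (r - p%:Z) i * binz n j) *: Z (p + (i + j))%N p).
 exact/fin2Z/(fin2_add f1).
rewrite -fsumZ; last exact: fin2_fsum.
apply: eq_fsum => q; rewrite -fsumZ; last exact: fin2_row f2.
apply: eq_fsum => i; rewrite [RHS]scalerA [in RHS]mulrA binz_trinomial binz_nat addnA.
by congr (_ *: _); ring.
Qed.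

End BinomialRearrangements.

Opaque fsum Defs.binz.

(** * Reduction of the Jacobi identity to the generating currents *)

Section GeneratorReduction.
Context R (W1 W2 W3 : lmodType R[i]).
Local Notation C := R[i].
Local Notation binz := (@binz R).
Variables (c : W1 -> int -> W2 -> W3).
Variables (U1 V1 X1 : int -> W1 -> W1) (U2 V2 X2 : int -> W2 -> W2) (U3 V3 X3 : int -> W3 -> W3).
Hypotheses (c_linl : forall n w2, linear (fun w1 => c w1 n w2)) (c_linr : forall n w1, linear (c w1 n))
 (U1_lin : forall n, linear (U1 n)) (V1_lin : forall n, linear (V1 n))
 (U2_lin : forall n, linear (U2 n)) (V2_lin : forall n, linear (V2 n))
 (U3_lin : forall n, linear (U3 n)) (V3_lin : forall n, linear (V3 n)).
Hypotheses (c_fin : forall w1 w2 l, fin1 (fun i => c w1 (l + i%:Z) w2))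
 (U1_fin : forall w n, fin1 (fun i => U1 (n + i%:Z) w)) (V1_fin : forall w n, fin1 (fun i => V1 (n + i%:Z) w))
 (U2_fin : forall w n, fin1 (fun i => U2 (n + i%:Z) w)) (V2_fin : forall w n, fin1 (fun i => V2 (n + i%:Z) w))
 (U3_fin : forall w n, fin1 (fun i => U3 (n + i%:Z) w)) (V3_fin : forall w n, fin1 (fun i => V3 (n + i%:Z) w)).
Variables (r : int) (eps su sv tu tv : C).
Hypothesis eps2 : eps * eps = 1.
Let c0l n w : c 0 n w = 0. exact: (lin0 (c_linl _ _)). Qed.
Let c0r n w : c w n 0 = 0. exact: (lin0 (c_linr _ _)). Qed.
Let U30 n : U3 n 0 = 0. exact: (lin0 (U3_lin _)). Qed.
Let V30 n : V3 n 0 = 0. exact: (lin0 (V3_lin _)). Qed.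
(** The modes of the product u_r v, where U and V are the modes of u and v; [eps] is the sign of
    exchanging u and v. *)
Definition iterated (W : lmodType C) (U V X : int -> W -> W) := forall n w,
 X n w = \fs_s ((-1) ^+ s * binz r s) *:
  (U (r - s%:Z) (V (n + s%:Z) w) - ((-1) ^ r * eps) *: V (r + n - s%:Z) (U s%:Z w)).

Hypotheses (X1E : iterated U1 V1 X1) (X2E : iterated U2 V2 X2) (X3E : iterated U3 V3 X3).
(** The Borcherds identity for one field A and one fixed [w1]; s is the sign of moving A past the
    operator c, and t that of moving A past [w1]. *)
Definition jacobi (A1 : int -> W1 -> W1) (A2 : int -> W2 -> W2) (A3 : int -> W3 -> W3)
  (s t : C) (w1 : W1) := forall m n l w2, (\fs_i binz m i *: c (A1 (n + i%:Z) w1) (m + l - i%:Z) w2) =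
 \fs_i ((-1) ^+ i * binz n i) *: (s *: A3 (m + n - i%:Z) (c w1 (l + i%:Z) w2)
  - ((-1) ^ n * t) *: c w1 (n + l - i%:Z) (A2 (m + i%:Z) w2)).

Section JacobiSplit.
Variables (A1 : int -> W1 -> W1) (A2 : int -> W2 -> W2) (A3 : int -> W3 -> W3) (s t : C) (w1 : W1).
Hypotheses (A2_fin : forall w n, fin1 (fun i => A2 (n + i%:Z) w)) (A3_lin : forall n, linear (A3 n)).
Hypothesis J : jacobi A1 A2 A3 s t w1.

Lemma jacobi_split m n l w2 : s *: (\fs_i ((-1) ^+ i * binz n i) *: A3 (m + n - i%:Z) (c w1 (l + i%:Z) w2)) =
 \fs_i binz m i *: c (A1 (n + i%:Z) w1) (m + l - i%:Z) w2 +
 ((-1) ^ n * t) *: (\fs_i ((-1) ^+ i * binz n i) *: c w1 (n + l - i%:Z) (A2 (m + i%:Z) w2)).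
have f1 : fin1 (fun i => ((-1) ^+ i * binz n i) *: A3 (m + n - i%:Z) (c w1 (l + i%:Z) w2))
 by apply: fin1Z; fin_of (c_fin w1 w2 l); rewrite (lin0 (A3_lin _)).
have f2 : fin1 (fun i => ((-1) ^+ i * binz n i) *: c w1 (n + l - i%:Z) (A2 (m + i%:Z) w2))
 by apply: fin1Z; fin_of (A2_fin w2 m); rewrite c0r.
rewrite J -(fsumZ _ f1) -(fsumZ _ f2) -fsumD; [|idtac|exact: fin1Z].
 by apply: eq_fsum => i; lmod_ring.
have [N fN] := f1; have [N' fN'] := f2; exists (maxn N N') => i.
rewrite geq_max => /andP[/fN e1 /fN' e2].
by rewrite scalerBr !(scalerCA _ s) !(scalerCA _ (_ * t)) e1 e2 !scaler0 subr0.
Qed.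

Lemma jacobi_comm m l w2 : s *: A3 m (c w1 l w2) =
 \fs_i binz m i *: c (A1 i%:Z w1) (m + l - i%:Z) w2 + t *: c w1 l (A2 m w2).
have := jacobi_split m 0 l w2.
rewrite !(fsumE (N := 1) (f := fun i => (_ * binz 0 i) *: _)); try by move=> [//|i] _; rewrite binz_0 mulr0 scale0r.
rewrite !big_ord1 binz0 mulr1 !scale1r expr0z mul1r !addr0 !add0r => ->.
by congr (_ + _); apply: eq_fsum => i; rewrite add0r.
Qed.

Lemma jacobi_iter n l w2 : s *: (\fs_i ((-1) ^+ i * binz n i) *: A3 (n - i%:Z) (c w1 (l + i%:Z) w2)) =
 c (A1 n w1) l w2 + ((-1) ^ n * t) *: (\fs_i ((-1) ^+ i * binz n i) *: c w1 (n + l - i%:Z) (A2 i%:Z w2)).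
have := jacobi_split 0 n l w2.
rewrite (fsumE (N := 1) (f := fun i => (binz 0 i) *: _)); last by move=> [//|i] _; rewrite binz_0 scale0r.
rewrite big_ord1 binz0 !scale1r add0r addr0 => ->.
by congr (c _ _ _ + _ *: _); rewrite /= add0r addr0.
Qed.

End JacobiSplit.

Lemma signzB (n : int) (p : nat) : (-1) ^+ p * (-1) ^ (n - p%:Z) = (-1) ^ n :> C.
have -> : (-1) ^+ p = (-1) ^ p%:Z :> C by [].
by rewrite -expfzDr ?oppr_eq0 ?oner_eq0 //; congr (_ ^ _); lia. Qed.
Variable w1 : W1.
Hypotheses (JU : jacobi U1 U2 U3 su tu w1) (JV : jacobi V1 V2 V3 sv tv w1)
 (JUV : forall n, jacobi U1 U2 U3 su (tu * eps) (V1 n w1)) (JVU : forall n, jacobi V1 V2 V3 sv (tv * eps) (U1 n w1)).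

Section FixedIndices.
Variables (m n l : int) (w2 : W2).
(** The iterate formula splits each sum of the Jacobi identity into a part with U applied after V
    (index 1) and one with V after U (index 2): MM on the vector [w1], LL outside c, RR on [w2]. In
    X and Y one of the fields acts on [w1] and the other on [w2]; they must cancel. *)
Let MM1 := (\fs_i \fs_s (binz m i * ((-1) ^+ s * binz r s)) *:
 c (U1 (r - s%:Z) (V1 (n + i%:Z + s%:Z) w1)) (m + l - i%:Z) w2).
Let MM2 := (\fs_i \fs_s (binz m i * ((-1) ^+ s * binz r s)) *:
 c (V1 (r + (n + i%:Z) - s%:Z) (U1 s%:Z w1)) (m + l - i%:Z) w2).
Let LL1 := (\fs_i \fs_s ((-1) ^+ i * binz n i * ((-1) ^+ s * binz r s)) *:
 U3 (r - s%:Z) (V3 (m + n - i%:Z + s%:Z) (c w1 (l + i%:Z) w2))).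
Let LL2 := (\fs_i \fs_s ((-1) ^+ i * binz n i * ((-1) ^+ s * binz r s)) *:
 V3 (r + (m + n - i%:Z) - s%:Z) (U3 s%:Z (c w1 (l + i%:Z) w2))).
Let RR1 := (\fs_i \fs_s ((-1) ^+ i * binz n i * ((-1) ^+ s * binz r s)) *:
 c w1 (n + l - i%:Z) (U2 (r - s%:Z) (V2 (m + i%:Z + s%:Z) w2))).
Let RR2 := (\fs_i \fs_s ((-1) ^+ i * binz n i * ((-1) ^+ s * binz r s)) *:
 c w1 (n + l - i%:Z) (V2 (r + (m + i%:Z) - s%:Z) (U2 s%:Z w2))).

Let X := (\fs_p \fs_i (binz r p * binz (r - p%:Z + m) i) *:
 ((-1) ^+ p *: c (V1 (n + i%:Z) w1) (r + m + l - p%:Z - i%:Z) (U2 p%:Z w2))).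
Let Y := (\fs_p \fs_i (binz r p * binz (r - p%:Z + n) i) *:
 ((-1) ^+ i *: c (U1 p%:Z w1) (r + n + l - p%:Z - i%:Z) (V2 (m + i%:Z) w2))).

Lemma fin_X : fin2 (fun p i => (-1) ^+ p *: c (V1 (n + i%:Z) w1) (r + m + l - p%:Z - i%:Z) (U2 p%:Z w2)).
apply: fin2_intro => [|p].
 have [N UN] := U2_fin w2 0; exists N => p i Np.
 by have := UN p Np; rewrite add0r => ->; rewrite c0r scaler0.
by fin_of (V1_fin w1 n); rewrite c0l scaler0.
Qed.

Lemma fin_Y : fin2 (fun p i => (-1) ^+ i *: c (U1 p%:Z w1) (r + n + l - p%:Z - i%:Z) (V2 (m + i%:Z) w2)).
apply: fin2_intro => [|p].
 have [N UN] := U1_fin w1 0; exists N => p i Np.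
 by have := UN p Np; rewrite add0r => ->; rewrite c0l scaler0.
by fin_of (V2_fin w2 m); rewrite c0r scaler0.
Qed.

Let T s i := (-1) ^+ s *: U3 (r - s%:Z) (c (V1 (n + i%:Z) w1) (m + l + s%:Z - i%:Z) w2).

(* The function (t1 - t2)^r t2^m, re-expanded from |t1| > |t2| > |y| to
 |t1 - y| > |t2 - y|. *)
Lemma far_near : su *: (\fs_s \fs_i (binz r s * binz (s%:Z + m) i) *: T s i) =
 MM1 + ((-1) ^ r * tu * eps) *: X.
have TN : exists N, forall s i, (N <= i)%N -> T s i = 0.
 have [N VN] := V1_fin w1 n; exists N => s i /VN e.
 by rewrite /T e c0l U30 scaler0.
have T1 i : fin1 (T^~ i).
 have [N cN] := c_fin (V1 (n + i%:Z) w1) w2 (m + l - i%:Z); exists N => s /cN e.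
 by rewrite /T addrAC e U30 scaler0.
have [N VN] := V1_fin w1 n.
pose a k j := binz r k * binz m j.
pose A k j := c (U1 (r - k%:Z) (V1 (n + j%:Z + k%:Z) w1)) (m + l - j%:Z) w2.
pose B k j := (\fs_p (binz r k * binz m j * binz (r - k%:Z) p) *:
 ((-1) ^+ p *: c (V1 (n + (k + j)%N%:Z) w1) (r + m + l - p%:Z - (k + j)%N%:Z) (U2 p%:Z w2))).
pose G k j := (\fs_p (binz r k * binz m j * binz (r - k%:Z) p) *: T (k + p)%N (k + j)%N).
have fA : fin2 A.
 exists N => k j kj; rewrite /A -addrA -PoszD VN; last by rewrite addnC.
 by rewrite (lin0 (U1_lin _)) c0l.
have fB : fin2 B.
 exists N => k j kj; apply: fsum_eq0 => p.
 by rewrite VN // c0l !scaler0.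
have fG : fin2 G.
 exists N => k j kj; apply: fsum_eq0 => p.
 by rewrite /T VN // c0l U30 !scaler0.
have XE : X = (\fs_k fsum (B k)) by apply: fsum_trinomial; exact: fin_X.
have ME : MM1 = \fs_k \fs_j ((-1) ^+ k * a k j) *: A k j.
 rewrite fsumC; last exact: fin2Z.
 by apply: eq_fsum => j; apply: eq_fsum => k; congr (_ *: _); rewrite /a; ring.
transitivity (su *: (\fs_k fsum (G k))).
 by congr (su *: _); apply: fsum_trinomial_shift => //.
rewrite (fsum2Z _ fG) ME XE (fsum2Z _ fB) fsum2D; [|exact: fin2Z|]; last by have [N' BN] := fB; exists N' => k j /BN ->; rewrite scaler0.
apply: eq_fsum => k; apply: eq_fsum => j.
have I := jacobi_iter U2_fin U3_lin (JUV (n + j%:Z + k%:Z)) (r - k%:Z) (m + l - j%:Z) w2.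
have f1 : fin1 (fun i => ((-1) ^+ i * binz (r - k%:Z) i) *:
  U3 (r - k%:Z - i%:Z) (c (V1 (n + j%:Z + k%:Z) w1) (m + l - j%:Z + i%:Z) w2)).
 apply: fin1Z; have [N' cN] := c_fin (V1 (n + j%:Z + k%:Z) w1) w2 (m + l - j%:Z).
 by exists N' => i /cN ->; rewrite U30.
have f2 : fin1 (fun i => ((-1) ^+ i * binz (r - k%:Z) i) *:
  c (V1 (n + j%:Z + k%:Z) w1) (r - k%:Z + (m + l - j%:Z) - i%:Z) (U2 i%:Z w2)).
 apply: fin1Z; have [N' UN] := U2_fin w2 0.
 by exists N' => i /UN; rewrite add0r => ->; rewrite c0r.
have GE : G k j = ((-1) ^+ k * a k j) *: (\fs_i ((-1) ^+ i * binz (r - k%:Z) i) *: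
  U3 (r - k%:Z - i%:Z) (c (V1 (n + j%:Z + k%:Z) w1) (m + l - j%:Z + i%:Z) w2)).
 rewrite -(fsumZ _ f1); apply: eq_fsum => i; rewrite /T /a !scalerA exprD.
 congr (_ *: U3 _ (c (V1 _ _) _ _)); [by ring|by lia|by lia|by lia].
have BE : B k j = a k j *: (\fs_i ((-1) ^+ i * binz (r - k%:Z) i) *:
  c (V1 (n + j%:Z + k%:Z) w1) (r - k%:Z + (m + l - j%:Z) - i%:Z) (U2 i%:Z w2)).
 rewrite -(fsumZ _ f2); apply: eq_fsum => i; rewrite /a !scalerA.
 congr (_ *: c (V1 _ _) _ _); [by ring|by lia|by lia].
rewrite GE BE scalerCA I scalerDr; congr (_ + _).
rewrite !scalerA; congr (_ *: _); rewrite -(signzB r k); ring.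
Qed.

Let S := (\fs_s \fs_i ((-1) ^+ i * binz n i * ((-1) ^+ s * binz r s)) *:
 U3 (r - s%:Z) (c w1 (n + l - i%:Z) (V2 (m + i%:Z + s%:Z) w2))).

Lemma fin_V2 (g : nat -> nat -> W2 -> W3) : (forall s i, linear (g s i)) ->
 fin2 (fun s i => g s i (V2 (m + i%:Z + s%:Z) w2)).
move=> lg; have [N VN] := V2_fin w2 m; exists N => s i si.
by rewrite -addrA -PoszD VN ?(lin0 (lg _ _)) // addnC.
Qed.

(** U is moved inside by the commutator formula and lands on [w2], giving RR1, or on [w1], giving
    Y. *)
Lemma far_inside : su *: S = tu *: RR1 + Y.
have lc s i : linear (fun w => U3 (r - s%:Z) (c w1 (n + l - i%:Z) w)) by move=> b u v; rewrite c_linr U3_lin.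
have lc2 s i : linear (fun w => c w1 (n + l - i%:Z) (U2 (r - s%:Z) w)) by move=> b u v; rewrite U2_lin c_linr.
have f1 := fin_V2 lc; have f2 := fin_V2 lc2.
have fY := fin_Y.
pose B s i := (\fs_p (binz r s * binz n i * binz (r - s%:Z) p) *:
 ((-1) ^+ (s + i) *: c (U1 p%:Z w1) (r + n + l - p%:Z - (s + i)%N%:Z) (V2 (m + (s + i)%N%:Z) w2))).
have fB : fin2 B.
 have [N VN] := V2_fin w2 m; exists N => s i si; apply: fsum_eq0 => p.
 by rewrite VN // c0r !scaler0.
have -> : Y = (\fs_s fsum (B s)) by exact: fsum_trinomial.
have -> : RR1 = (\fs_s \fs_i ((-1) ^+ i * binz n i * ((-1) ^+ s * binz r s)) *:
   c w1 (n + l - i%:Z) (U2 (r - s%:Z) (V2 (m + i%:Z + s%:Z) w2))) by symmetry; apply: fsumC; exact: fin2Z.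
rewrite !fsum2Z; [|exact: fin2Z|exact: fin2Z].
rewrite fsum2D //; last exact/fin2Z/fin2Z.
apply: eq_fsum => s; apply: eq_fsum => i.
rewrite scalerCA (jacobi_comm U2_fin U3_lin JU) [X in _ *: X]addrC scalerDr (scalerCA _ tu).
congr (_ + _); rewrite -fsumZ; last first.
 apply: fin1Z; have [N UN] := U1_fin w1 0; exists N => p /UN; rewrite add0r => ->.
 by rewrite c0l.
apply: eq_fsum => p; rewrite !scalerA exprD.
congr (_ *: c _ _ (V2 _ _)); [by ring|by lia|by lia].
Qed.

(** V is moved inside under U; the terms with V on [w1] are [far_near], those with V on [w2] are
    [far_inside]. *)
Lemma far_first : (su * sv) *: LL1 = MM1 + ((-1) ^ r * tu * eps) *: X + ((-1) ^ n * tv) *: (tu *: RR1 + Y).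
have [N cN] := c_fin w1 w2 l.
have fLL : fin2 (fun i s => U3 (r - s%:Z) (V3 (m + n - i%:Z + s%:Z) (c w1 (l + i%:Z) w2))).
 apply: fin2_intro => [|i].
  by exists N => i s /cN ->; rewrite V30 U30.
 have [N' VN] := V3_fin (c w1 (l + i%:Z) w2) (m + n - i%:Z).
 by exists N' => s /VN ->; rewrite U30.
rewrite -far_near -far_inside /LL1 fsumC; last exact: fin2Z.
have lc s i : linear (fun w => U3 (r - s%:Z) (c w1 (n + l - i%:Z) w)) by move=> b u v; rewrite c_linr U3_lin.
have fT : fin2 (fun s i => (binz r s * binz (s%:Z + m) i) *: T s i).
 apply/fin2Z/fin2_introC => [|i].
  have [N' VN] := V1_fin w1 n; exists N' => s i /VN e.
  by rewrite /T e c0l U30 scaler0.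
 have [N' cN'] := c_fin (V1 (n + i%:Z) w1) w2 (m + l - i%:Z); exists N' => s /cN' e.
 by rewrite /T addrAC e U30 scaler0.
rewrite -scalerA [((-1) ^ n * tv) *: _]scalerCA -scalerDr; congr (su *: _).
rewrite /S (fsum2Z ((-1) ^ n * tv)); last exact/fin2Z/(fin_V2 lc).
rewrite fsum2D //; last exact/fin2Z/fin2Z/(fin_V2 lc).
rewrite fsum2Z; last by have [M FM] := fLL; exists M => s i; rewrite addnC => /FM ->; rewrite scaler0.
apply: eq_fsum => s.
have fV : fin1 (fun i => ((-1) ^+ i * binz n i) *: V3 (m + s%:Z + n - i%:Z) (c w1 (l + i%:Z) w2))
 by apply: fin1Z; exists N => i /cN ->; rewrite V30.
transitivity (((-1) ^+ s * binz r s) *: U3 (r - s%:Z) (sv *: fsum (fun i =>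
  ((-1) ^+ i * binz n i) *: V3 (m + s%:Z + n - i%:Z) (c w1 (l + i%:Z) w2)))).
 rewrite (linZ (U3_lin _)) (fsum_lin (U3_lin _) fV) -fsumZ; last by fin_of fV; rewrite U30.
 rewrite -fsumZ; last by fin_of fV; rewrite U30 scaler0.
 apply: eq_fsum => i; rewrite (linZ (U3_lin _)) !scalerA.
 by congr (_ *: U3 _ (V3 _ _)); [ring|lia].
rewrite (jacobi_split V2_fin V3_lin JV).
have f1 : fin1 (fun i => binz (m + s%:Z) i *: c (V1 (n + i%:Z) w1) (m + s%:Z + l - i%:Z) w2)
 by apply: fin1Z; fin_of (V1_fin w1 n); rewrite c0l.
have f2 : fin1 (fun i => ((-1) ^+ i * binz n i) *: c w1 (n + l - i%:Z) (V2 (m + s%:Z + i%:Z) w2)).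
 apply: fin1Z; fin_of (V2_fin w2 (m + s%:Z)).
 by rewrite c0r.
rewrite (linD (U3_lin _)) (linZ (U3_lin _)) (fsum_lin (U3_lin _) f1) (fsum_lin (U3_lin _) f2).
have g1 : fin1 (fun i => U3 (r - s%:Z) (binz (m + s%:Z) i *: c (V1 (n + i%:Z) w1) (m + s%:Z + l - i%:Z) w2))
 by fin_of f1; rewrite U30.
have g2 : fin1 (fun i => U3 (r - s%:Z) (((-1) ^+ i * binz n i) *: c w1 (n + l - i%:Z) (V2 (m + s%:Z + i%:Z) w2)))
 by fin_of f2; rewrite U30.
rewrite scalerDr scalerCA -!fsumZ //; [|exact: fin1Z].
rewrite -fsumD; [|exact: fin1Z|exact/fin1Z/fin1Z].
apply: eq_fsum => i; rewrite !(linZ (U3_lin _)) !scalerA; congr (_ + _).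
 congr (_ *: U3 _ (c _ _ _)); [by rewrite [s%:Z + m]addrC; ring|by lia].
congr (_ *: U3 _ (c _ _ (V2 _ _))); [by ring|by lia].
Qed.

Let Q := (\fs_s \fs_i ((-1) ^+ i * binz n i * ((-1) ^+ s * binz r s)) *:
 V3 (r + m + n - i%:Z - s%:Z) (c w1 (l + i%:Z) (U2 s%:Z w2))).

Lemma far_inside' : sv *: Q = X + ((-1) ^ n * tv) *: RR2.
have [N UN] := U2_fin w2 0.
have U0 s : (N <= s)%N -> U2 s%:Z w2 = 0 by move=> /UN; rewrite add0r.
have f1 : fin2 (fun s i => V3 (r + m + n - i%:Z - s%:Z) (c w1 (l + i%:Z) (U2 s%:Z w2))).
 apply: fin2_intro => [|s]; first by exists N => s i /U0 ->; rewrite c0r V30.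
 by fin_of (c_fin w1 (U2 s%:Z w2) l); rewrite V30.
have f2 : fin2 (fun s i => c w1 (n + l - i%:Z) (V2 (r + (m + i%:Z) - s%:Z) (U2 s%:Z w2))).
 apply: fin2_intro => [|s]; first by exists N => s i /U0 ->; rewrite (lin0 (V2_lin _)) c0r.
 have [M VM] := V2_fin (U2 s%:Z w2) (r + m - s%:Z); exists M => i /VM.
 have -> : r + m - s%:Z + i%:Z = r + (m + i%:Z) - s%:Z by lia.
 by move=> ->; rewrite c0r.
have -> : RR2 = (\fs_s \fs_i ((-1) ^+ i * binz n i * ((-1) ^+ s * binz r s)) *:
   c w1 (n + l - i%:Z) (V2 (r + (m + i%:Z) - s%:Z) (U2 s%:Z w2))) by symmetry; apply: fsumC; exact: fin2Z.
rewrite !fsum2Z; [|exact: fin2Z|exact: fin2Z].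
rewrite /X fsum2D //; [|exact/fin2Z/fin_X|exact/fin2Z/fin2Z].
apply: eq_fsum => s.
have fV : fin1 (fun i => ((-1) ^+ i * binz n i) *: V3 (r + m - s%:Z + n - i%:Z) (c w1 (l + i%:Z) (U2 s%:Z w2))).
 apply: fin1Z; have [M cM] := c_fin w1 (U2 s%:Z w2) l.
 by exists M => i /cM ->; rewrite V30.
transitivity (((-1) ^+ s * binz r s) *: (sv *: (\fs_i ((-1) ^+ i * binz n i) *:
  V3 (r + m - s%:Z + n - i%:Z) (c w1 (l + i%:Z) (U2 s%:Z w2))))).
 rewrite -!fsumZ //; last exact: fin1Z.
 apply: eq_fsum => i; rewrite !scalerA.
 by congr (_ *: V3 _ _); [ring|lia].
rewrite (jacobi_split V2_fin V3_lin JV).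
have g1 : fin1 (fun i => binz (r + m - s%:Z) i *: c (V1 (n + i%:Z) w1) (r + m - s%:Z + l - i%:Z) (U2 s%:Z w2))
 by apply: fin1Z; fin_of (V1_fin w1 n); rewrite c0l.
have g2 : fin1 (fun i => ((-1) ^+ i * binz n i) *: c w1 (n + l - i%:Z) (V2 (r + m - s%:Z + i%:Z) (U2 s%:Z w2))).
 apply: fin1Z; have [M VM] := V2_fin (U2 s%:Z w2) (r + m - s%:Z).
 by exists M => i /VM ->; rewrite c0r.
rewrite scalerDr (scalerCA _ (_ * tv)) -!fsumZ //; last exact: fin1Z.
rewrite -fsumD; [|exact: fin1Z|exact/fin1Z/fin1Z].
apply: eq_fsum => i; rewrite !scalerA; congr (_ + _).
 have -> : r - s%:Z + m = r + m - s%:Z by lia.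
 by congr (_ *: c _ _ _); [ring|lia].
by congr (_ *: c _ _ (V2 _ _)); [ring|lia].
Qed.

Let P := (\fs_s \fs_i \fs_p (binz n i * binz r s * binz s%:Z p) *: ((-1) ^+ (s + i)%N *:
  V3 (r + m + n - (s + i)%N%:Z) (c (U1 p%:Z w1) ((s + i)%N%:Z + l - p%:Z) w2))).

Lemma far_near' : sv *: P = MM2 + ((-1) ^ (r + n) * tv * eps) *: Y.
have [N UN] := U1_fin w1 0.
have U0 s : (N <= s)%N -> U1 s%:Z w1 = 0 by move=> /UN; rewrite add0r.
rewrite /P (fsum_trinomial_add r n (Z := fun S p => (-1) ^+ S *:
  V3 (r + m + n - S%:Z) (c (U1 p%:Z w1) (S%:Z + l - p%:Z) w2))); first last.
- move=> p; have [M cM] := c_fin (U1 p%:Z w1) w2 (l - p%:Z).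
 exists M => s /cM; have -> : l - p%:Z + s%:Z = s%:Z + l - p%:Z by lia.
 by move=> ->; rewrite V30 scaler0.
- by exists N => s p /U0 ->; rewrite c0l V30 scaler0.
have fA : fin2 (fun p i => c (V1 (r + (n + i%:Z) - p%:Z) (U1 p%:Z w1)) (m + l - i%:Z) w2).
 apply: fin2_intro => [|p].
  by exists N => p i /U0 ->; rewrite (lin0 (V1_lin _)) c0l.
 have [M VM] := V1_fin (U1 p%:Z w1) (r + n - p%:Z); exists M => i /VM.
 have -> : r + n - p%:Z + i%:Z = r + (n + i%:Z) - p%:Z by lia.
 by move=> ->; rewrite c0l.
have -> : MM2 = (\fs_p \fs_i (binz m i * ((-1) ^+ p * binz r p)) *:
  c (V1 (r + (n + i%:Z) - p%:Z) (U1 p%:Z w1)) (m + l - i%:Z) w2) by symmetry; apply: fsumC; exact: fin2Z.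
have fL : fin2 (fun p j => (-1) ^+ (p + j)%N *:
  V3 (r + m + n - (p + j)%N%:Z) (c (U1 p%:Z w1) ((p + j)%N%:Z + l - p%:Z) w2)).
 apply: fin2_intro => [|p].
  by exists N => p i /U0 ->; rewrite c0l V30 scaler0.
 have [M cM] := c_fin (U1 p%:Z w1) w2 l; exists M => j /cM.
 have -> : (p + j)%N%:Z + l - p%:Z = l + j%:Z by lia.
 by move=> ->; rewrite V30 scaler0.
rewrite (fsum2Z sv); last exact: fin2Z.
rewrite /Y (fsum2Z (_ * eps)); last exact/fin2Z/fin_Y.
rewrite fsum2D; [|exact: fin2Z|exact/fin2Z/fin2Z/fin_Y].
apply: eq_fsum => p.
have fV : fin1 (fun i => ((-1) ^+ i * binz (r - p%:Z + n) i) *: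
  V3 (m + (r - p%:Z + n) - i%:Z) (c (U1 p%:Z w1) (l + i%:Z) w2)).
 apply: fin1Z; have [M cM] := c_fin (U1 p%:Z w1) w2 l.
 by exists M => i /cM ->; rewrite V30.
transitivity (((-1) ^+ p * binz r p) *: (sv *: (\fs_i ((-1) ^+ i * binz (r - p%:Z + n) i) *:
  V3 (m + (r - p%:Z + n) - i%:Z) (c (U1 p%:Z w1) (l + i%:Z) w2)))).
 rewrite -!fsumZ //; last exact: fin1Z.
 apply: eq_fsum => i; rewrite !scalerA exprD.
 by congr (_ *: V3 _ (c _ _ _)); [ring|lia|lia].
rewrite (jacobi_split V2_fin V3_lin (JVU _)).
have g1 : fin1 (fun i => binz m i *: c (V1 (r - p%:Z + n + i%:Z) (U1 p%:Z w1)) (m + l - i%:Z) w2).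
 apply: fin1Z; have [M VM] := V1_fin (U1 p%:Z w1) (r - p%:Z + n).
 by exists M => i /VM ->; rewrite c0l.
have g2 : fin1 (fun i => ((-1) ^+ i * binz (r - p%:Z + n) i) *:
  c (U1 p%:Z w1) (r - p%:Z + n + l - i%:Z) (V2 (m + i%:Z) w2)).
 apply: fin1Z; have [M VM] := V2_fin w2 m.
 by exists M => i /VM ->; rewrite c0r.
rewrite scalerDr (scalerCA _ (_ * (tv * eps))) -!fsumZ //; last exact: fin1Z.
rewrite -fsumD; [|exact: fin1Z|exact/fin1Z/fin1Z].
apply: eq_fsum => i; rewrite !scalerA; congr (_ + _).
 by congr (_ *: c (V1 _ _) _ _); [ring|lia].
have -> : r + n + l - p%:Z - i%:Z = r - p%:Z + n + l - i%:Z by lia.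
congr (_ *: _); rewrite -(signzB (r + n) p).
have -> : r + n - p%:Z = r - p%:Z + n by lia.
ring.
Qed.

(** The opposite nesting: U is moved inside under V, which leaves [far_near'] and [far_inside']. *)
Lemma far_second : (su * sv) *: LL2 = MM2 + ((-1) ^ (r + n) * tv * eps) *: Y + tu *: (X + ((-1) ^ n * tv) *: RR2).
have [N cN] := c_fin w1 w2 l; have [N' UN] := U2_fin w2 0.
have U0 s : (N' <= s)%N -> U2 s%:Z w2 = 0 by move=> /UN; rewrite add0r.
have [N1 U1N] := U1_fin w1 0.
have U10 s : (N1 <= s)%N -> U1 s%:Z w1 = 0 by move=> /U1N; rewrite add0r.
have fLL : fin2 (fun i s => V3 (r + (m + n - i%:Z) - s%:Z) (U3 s%:Z (c w1 (l + i%:Z) w2))).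
 apply: fin2_intro => [|i].
  by exists N => i s /cN ->; rewrite U30 V30.
 have [M UM] := U3_fin (c w1 (l + i%:Z) w2) 0.
 by exists M => s /UM; rewrite add0r => ->; rewrite V30.
have fQ : fin2 (fun s i => V3 (r + m + n - i%:Z - s%:Z) (c w1 (l + i%:Z) (U2 s%:Z w2))).
 apply: fin2_intro => [|s]; first by exists N' => s i /U0 ->; rewrite c0r V30.
 by fin_of (c_fin w1 (U2 s%:Z w2) l); rewrite V30.
pose D s i := (\fs_p (binz n i * binz r s * binz s%:Z p) *: ((-1) ^+ (s + i)%N *:
  V3 (r + m + n - (s + i)%N%:Z) (c (U1 p%:Z w1) ((s + i)%N%:Z + l - p%:Z) w2))).
have fD : fin2 D.
 have [M HM] : exists M, forall j p, (M <= j)%N -> c (U1 p%:Z w1) (j%:Z + l - p%:Z) w2 = 0.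
  have f : fin2 (fun p j => c (U1 p%:Z w1) (j%:Z + l - p%:Z) w2).
   apply: fin2_intro => [|p]; first by exists N1 => p i /U10 ->; rewrite c0l.
   have [M cM] := c_fin (U1 p%:Z w1) w2 (l - p%:Z); exists M => j /cM.
   by have -> : l - p%:Z + j%:Z = j%:Z + l - p%:Z by lia.
  by have [M HM] := f; exists M => j p Mj; apply: HM; rewrite (leq_trans Mj) ?leq_addl.
 by exists M => s i si; apply: fsum_eq0 => p; rewrite HM // V30 !scaler0.
rewrite -far_near' -far_inside' -scalerA scalerCA (scalerCA tu) -scalerDr; congr (sv *: _).
rewrite /LL2 fsumC; last exact: fin2Z.
rewrite (fsum2Z tu); last exact: fin2Z.
rewrite /P -/(fsum _) (fsum2D fD); last exact/fin2Z/fin2Z.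
rewrite fsum2Z; last by have [M FM] := fLL; exists M => s i; rewrite addnC => /FM ->; rewrite scaler0.
apply: eq_fsum => s; apply: eq_fsum => i.
rewrite scalerCA -(linZ (V3_lin _)) (jacobi_comm U2_fin U3_lin JU).
have g : fin1 (fun p => binz s p *: c (U1 p%:Z w1) (s%:Z + (l + i%:Z) - p%:Z) w2)
 by apply: fin1Z; exists N1 => p /U10 ->; rewrite c0l.
have g' : fin1 (fun p => V3 (r + (m + n - i%:Z) - s%:Z) (binz s p *: c (U1 p%:Z w1) (s%:Z + (l + i%:Z) - p%:Z) w2))
 by fin_of g; rewrite V30.
rewrite (linD (V3_lin _)) (fsum_lin (V3_lin _) g) scalerDr -fsumZ //; congr (_ + _).
 apply: eq_fsum => p; rewrite (linZ (V3_lin _)) !scalerA exprD.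
 by congr (_ *: V3 _ (c _ _ _)); [ring|lia|lia].
rewrite (linZ (V3_lin _)) scalerCA.
by congr (_ *: (_ *: V3 _ _)); lia.
Qed.

End FixedIndices.

Lemma iterated_expand (W : lmodType C) (U V X : int -> W -> W)
  (U_lin : forall n, linear (U n)) (V_lin : forall n, linear (V n))
  (U_fin : forall w n, fin1 (fun i => U (n + i%:Z) w))
  (V_fin : forall w n, fin1 (fun i => V (n + i%:Z) w)) (XE : iterated U V X)
  (al : nat -> C) (g : nat -> W -> W3) (lg : forall i, linear (g i)) (N : nat -> int) (w : nat -> W) :
 let F i s := g i (U (r - s%:Z) (V (N i + s%:Z) (w i))) in let G i s := g i (V (r + N i - s%:Z) (U s%:Z (w i))) in
 fin2 F -> fin2 G -> (\fs_i al i *: g i (X (N i) (w i))) =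
 (\fs_i \fs_s (al i * ((-1) ^+ s * binz r s)) *: F i s) -
 ((-1) ^ r * eps) *: (\fs_i \fs_s (al i * ((-1) ^+ s * binz r s)) *: G i s).
move=> F G fF fG; rewrite -scaleNr fsum2Z; last exact: fin2Z.
rewrite fsum2D; [|exact: fin2Z|exact/fin2Z/fin2Z].
apply: eq_fsum => i; rewrite XE.
have f1 : fin1 (fun s => U (r - s%:Z) (V (N i + s%:Z) (w i)) - ((-1) ^ r * eps) *: V (r + N i - s%:Z) (U s%:Z (w i))).
 have [M VM] := V_fin (w i) (N i); have [M' UM] := U_fin (w i) 0.
 exists (maxn M M') => s; rewrite geq_max => /andP[/VM -> /UM].
 by rewrite add0r => ->; rewrite (lin0 (U_lin _)) (lin0 (V_lin _)) scaler0 subr0.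
rewrite (fsum_lin (lg i)); last exact: fin1Z.
rewrite -fsumZ; last by fin_of f1; rewrite scaler0 (lin0 (lg i)).
apply: eq_fsum => s; rewrite (linZ (lg i)) (linB (lg i)) (linZ (lg i)) /F /G.
by lmod_ring.
Qed.

Lemma fsumB_scale (a b : nat -> C) (x y : C) (f g : nat -> W3) : fin1 f -> fin1 g ->
 (\fs_i a i *: (x *: f i - y *: g i)) = x *: (\fs_i a i *: f i) - y *: (\fs_i a i *: g i).
move=> ff fg; rewrite -scaleNr -!fsumZ; try exact: fin1Z.
rewrite -fsumD; [|exact/fin1Z/fin1Z|exact/fin1Z/fin1Z].
by apply: eq_fsum => i; lmod_ring.
Qed.

Lemma fin2_UV (W : lmodType C) (U V : int -> W -> W) (U_lin : forall n, linear (U n))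
  (V_fin : forall w n, fin1 (fun i => V (n + i%:Z) w)) n w : fin2 (fun i s => U (r - s%:Z) (V (n + i%:Z + s%:Z) w)).
have [N VN] := V_fin w n; exists N => i s si.
by rewrite -addrA -PoszD VN ?(lin0 (U_lin _)).
Qed.

Lemma fin2_VU (W : lmodType C) (U V : int -> W -> W) (V_lin : forall n, linear (V n))
  (U_fin : forall w n, fin1 (fun i => U (n + i%:Z) w)) (V_fin : forall w n, fin1 (fun i => V (n + i%:Z) w)) n w :
 fin2 (fun i s => V (r + (n + i%:Z) - s%:Z) (U s%:Z w)).
apply: fin2_introC => [|s].
 by have [N UN] := U_fin w 0; exists N => i s /UN; rewrite add0r => ->; rewrite (lin0 (V_lin _)).
have [N VN] := V_fin (U s%:Z w) (r + n - s%:Z); exists N => i /VN.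
by have -> : r + n - s%:Z + i%:Z = r + (n + i%:Z) - s%:Z by lia.
Qed.

Lemma fin2_lin (W : lmodType C) (g : nat -> W -> W3) (F : nat -> nat -> W) :
 (forall i, linear (g i)) -> fin2 F -> fin2 (fun i s => g i (F i s)).
by move=> lg [N FN]; exists N => i s /FN ->; rewrite (lin0 (lg _)). Qed.

Lemma iterated_fin (W : lmodType C) (U V X : int -> W -> W) (U_lin : forall n, linear (U n))
  (V_lin : forall n, linear (V n)) (U_fin : forall w n, fin1 (fun i => U (n + i%:Z) w))
  (V_fin : forall w n, fin1 (fun i => V (n + i%:Z) w)) (XE : iterated U V X) n w : fin1 (fun i => X (n + i%:Z) w).
have [N UV] := fin2_UV U_lin V_fin n w; have [M VU] := fin2_VU V_lin U_fin V_fin n w.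
exists (maxn N M) => i; rewrite geq_max => /andP[Ni Mi]; rewrite XE; apply: fsum_eq0 => s.
rewrite UV ?VU ?scaler0 ?subr0 ?scaler0 //.
 exact: leq_trans Mi (leq_addr _ _).
exact: leq_trans Ni (leq_addr _ _).
Qed.

(** The counterpart of Dong's lemma, passing from u and v to u_r v. The Jacobi identities at
    [V1 n w1] and [U1 n w1] enter because the iterate formula applies one field to images of [w1]
    under the other. *)
Lemma jacobi_iterated : jacobi X1 X2 X3 (su * sv) (tu * tv) w1.
move=> m n l w2; have [N cN] := c_fin w1 w2 l.
have fX3 : fin1 (fun i => X3 (m + n - i%:Z) (c w1 (l + i%:Z) w2)).
 exists N => i /cN ->; rewrite X3E; apply: fsum_eq0 => s.
 by rewrite V30 !U30 V30 scaler0 subr0 scaler0.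
have fX2 : fin1 (fun i => c w1 (n + l - i%:Z) (X2 (m + i%:Z) w2)).
 have [M XM] := iterated_fin U2_lin V2_lin U2_fin V2_fin X2E m w2.
 by exists M => i /XM ->; rewrite c0r.
rewrite fsumB_scale // (iterated_expand U1_lin V1_lin U1_fin V1_fin X1E (binz m)
 (g := fun i w => c w (m + l - i%:Z) w2) _ (N := fun i => n + i%:Z) (w := fun _ => w1)) //; first last.
- by apply: (fin2_lin (g := fun i w => c w (m + l - i%:Z) w2) _ (fin2_VU V1_lin U1_fin V1_fin n w1)).
- by apply: (fin2_lin (g := fun i w => c w (m + l - i%:Z) w2) _ (fin2_UV U1_lin V1_fin n w1)).
rewrite (iterated_expand U2_lin V2_lin U2_fin V2_fin X2E (fun i => (-1) ^+ i * binz n i)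
 (g := fun i w => c w1 (n + l - i%:Z) w) _ (N := fun i => m + i%:Z) (w := fun _ => w2)) //; first last.
- by apply: (fin2_lin (g := fun i => c w1 (n + l - i%:Z)) _ (fin2_VU V2_lin U2_fin V2_fin m w2)).
- by apply: (fin2_lin (g := fun i => c w1 (n + l - i%:Z)) _ (fin2_UV U2_lin V2_fin m w2)).
rewrite (iterated_expand U3_lin V3_lin U3_fin V3_fin X3E (fun i => (-1) ^+ i * binz n i)
 (g := fun i w => w) _ (N := fun i => m + n - i%:Z) (w := fun i => c w1 (l + i%:Z) w2)) //; first last.
- apply: fin2_intro => [|i].
  by exists N => i s /cN ->; rewrite U30 V30.
 have [M UM] := U3_fin (c w1 (l + i%:Z) w2) 0.
 by exists M => s /UM; rewrite add0r => ->; rewrite V30.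
- apply: fin2_intro => [|i].
  by exists N => i s /cN ->; rewrite V30 U30.
 have [M VM] := V3_fin (c w1 (l + i%:Z) w2) (m + n - i%:Z).
 by exists M => s /VM ->; rewrite U30.
have r2 : (-1) ^ r * (-1) ^ r = 1 :> C by rewrite -expfzMl mulrNN mulr1 exp1rz.
have nD : (-1) ^ (r + n) = (-1) ^ r * (-1) ^ n :> C by rewrite expfzDr // oppr_eq0 oner_eq0.
have K : ((-1) ^ r * eps) * ((-1) ^ r * (-1) ^ n * tv * eps) = (-1) ^ n * tv.
 transitivity (((-1) ^ r * (-1) ^ r) * (eps * eps) * ((-1) ^ n * tv)); first by ring.
 by rewrite r2 eps2 !mul1r.
(* X cancels between the two nestings at once; Y cancels since eps^2 = 1 and (-1)^r (-1)^(r+n) =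
   (-1)^n. *)
have key (M1 M2 N1 N2 X Y L1 L2 : W3) :
  (su * sv) *: L1 = M1 + ((-1) ^ r * tu * eps) *: X + ((-1) ^ n * tv) *: (tu *: N1 + Y) ->
  (su * sv) *: L2 = M2 + ((-1) ^ (r + n) * tv * eps) *: Y + tu *: (X + ((-1) ^ n * tv) *: N2) ->
  M1 - ((-1) ^ r * eps) *: M2 = (su * sv) *: (L1 - ((-1) ^ r * eps) *: L2) -
   ((-1) ^ n * (tu * tv)) *: (N1 - ((-1) ^ r * eps) *: N2).
 move=> E1 E2; rewrite [(su * sv) *: (_ - _)]scalerBr E1 [(su * sv) *: (_ *: _)]scalerCA E2.
 rewrite nD !(scalerDr ((-1) ^ r * eps)) [((-1) ^ r * eps) *: (_ *: Y)]scalerA K.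
 by lmod_ring.
exact: key (far_first m n l w2) (far_second m n l w2).
Qed.

End GeneratorReduction.

Transparent fsum Defs.binz.

Section JacobiReduction.
Context R (W1 W2 W3 : lmodType R[i]).
Local Notation binz := (@Defs.binz R).
Variables (c : W1 -> int -> W2 -> W3).
Variables (A1 : int -> W1 -> W1) (A2 : int -> W2 -> W2) (A3 : int -> W3 -> W3).
Variables (s t : R[i]) (w1 : W1).

Lemma fsum_pascal (W : lmodType R[i]) m (f : nat -> W) : fin1 f -> (\fs_i binz (m + 1) i *: f i) =
 \fs_i binz m i *: f i + \fs_i binz m i *: f i.+1.
move=> [N fN]; pose g i := if i is j.+1 then binz m j *: f j.+1 else 0.
have fg : fin1 g by exists N.+1 => [[//|j]] Nj; rewrite /= fN ?scaler0 // ltnW.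
have -> : (\fs_i binz m i *: f i.+1) = fsum g by rewrite (fsum_shift (k := 1) (f := g)) => [//|[]//|//].
rewrite -fsumD //; last by apply: fin1Z; exists N.
by apply: eq_fsum => -[|i]; rewrite ?binz0 ?addr0 // binz_pascal scalerDl.
Qed.

Hypotheses (c_linl : forall n w2, linear (fun w1 => c w1 n w2))
 (c_linr : forall n w1, linear (c w1 n)) (A3_lin : forall n, linear (A3 n))
 (c_fin : forall w2 l, fin1 (fun i => c w1 (l + i%:Z) w2)) (A1_fin : forall n, fin1 (fun i => A1 (n + i%:Z) w1))
 (A2_fin : forall w n, fin1 (fun i => A2 (n + i%:Z) w)).

Let near m n l w2 := (\fs_i binz m i *: c (A1 (n + i%:Z) w1) (m + l - i%:Z) w2).
Let far m n l w2 := (\fs_i binz n i *: ((-1) ^+ i *: A3 (m + n - i%:Z) (c w1 (l + i%:Z) w2))).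
Let inside m n l w2 := (\fs_i binz n i *: ((-1) ^+ i *: c w1 (n + l - i%:Z) (A2 (m + i%:Z) w2))).
Let defect m n l w2 := near m n l w2 - s *: far m n l w2 + ((-1) ^ n * t) *: inside m n l w2.

Lemma fin_far m n l w2 : fin1 (fun i => (-1) ^+ i *: A3 (m + n - i%:Z) (c w1 (l + i%:Z) w2)).
by fin_of (c_fin w2 l); rewrite (lin0 (A3_lin _)) scaler0.
Qed.

Lemma fin_inside m n l w2 : fin1 (fun i => (-1) ^+ i *: c w1 (n + l - i%:Z) (A2 (m + i%:Z) w2)).
by fin_of (A2_fin w2 m); rewrite (lin0 (c_linr _ _)) scaler0.
Qed.

Lemma fin_near m n l w2 : fin1 (fun i => c (A1 (n + i%:Z) w1) (m + l - i%:Z) w2).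
by fin_of (A1_fin n); rewrite (lin0 (c_linl _ _)). Qed.

Lemma defectE m n l w2 : (defect m n l w2 = 0) <-> (near m n l w2 = \fs_i ((-1) ^+ i * binz n i) *:
  (s *: A3 (m + n - i%:Z) (c w1 (l + i%:Z) w2)
  - ((-1) ^ n * t) *: c w1 (n + l - i%:Z) (A2 (m + i%:Z) w2))).
have <- : s *: far m n l w2 - ((-1) ^ n * t) *: inside m n l w2 = \fs_i ((-1) ^+ i * binz n i) *:
  (s *: A3 (m + n - i%:Z) (c w1 (l + i%:Z) w2)
  - ((-1) ^ n * t) *: c w1 (n + l - i%:Z) (A2 (m + i%:Z) w2)).
 have f1 := fin_far m n l w2; have f2 := fin_inside m n l w2.
 rewrite -scaleNr /far /inside -!fsumZ; try exact: fin1Z.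
 rewrite -fsumD; [|exact/fin1Z/fin1Z|exact/fin1Z/fin1Z].
 by apply: eq_fsum => i; lmod_ring.
rewrite /defect; split=> [/eqP|->]; last by lmod_ring.
by rewrite -addrA addr_eq0 => /eqP ->; rewrite opprD opprK.
Qed.

Lemma defect_rec m n l w2 : defect (m + 1) n l w2 = defect m (n + 1) l w2 + defect m n (l + 1) w2.
rewrite /defect.
have -> : near (m + 1) n l w2 = near m (n + 1) l w2 + near m n (l + 1) w2.
 rewrite /near fsum_pascal; last exact: fin_near.
 rewrite addrC; congr (_ + _); apply: eq_fsum => i; congr (_ *: c (A1 _ _) _ _); lia.
have -> : far (m + 1) n l w2 = far m (n + 1) l w2 + far m n (l + 1) w2.
 rewrite /far [X in _ = X + _]fsum_pascal; last exact: fin_far.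
 have -> : (\fs_i binz n i *: ((-1) ^+ i.+1 *: A3 (m + (n + 1) - i.+1%:Z) (c w1 (l + i.+1%:Z) w2))) =
   - (\fs_i binz n i *: ((-1) ^+ i *: A3 (m + n - i%:Z) (c w1 (l + 1 + i%:Z) w2))).
  rewrite -scaleN1r -fsumZ; last exact/fin1Z/fin_far.
  apply: eq_fsum => i; rewrite exprS !scalerA.
  by congr (_ *: A3 _ (c _ _ _)); [ring|lia|lia].
 rewrite subrK; apply: eq_fsum => i; congr (_ *: (_ *: A3 _ _)); lia.
have -> : inside (m + 1) n l w2 = - inside m (n + 1) l w2 + inside m n (l + 1) w2.
 rewrite /inside [X in _ = - X + _]fsum_pascal; last exact: fin_inside.
 have -> : (\fs_i binz n i *: ((-1) ^+ i.+1 *: c w1 (n + 1 + l - i.+1%:Z) (A2 (m + i.+1%:Z) w2))) =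
   - (\fs_i binz n i *: ((-1) ^+ i *: c w1 (n + l - i%:Z) (A2 (m + 1 + i%:Z) w2))).
  rewrite -scaleN1r -fsumZ; last exact/fin1Z/fin_inside.
  apply: eq_fsum => i; rewrite exprS !scalerA.
  by congr (_ *: c _ _ (A2 _ _)); [ring|lia|lia].
 rewrite opprD opprK addrAC [X in _ = X + _]addrC.
 have -> : n + 1 + l = n + (l + 1) by lia.
 by rewrite subrr add0r.
rewrite expfzDr ?oppr_eq0 ?oner_eq0 // expr1z.
by lmod_ring.
Qed.

(* The functions t^m (t - y)^n are generated from the powers of t and the powers
 of t - y by t^(m+1) (t - y)^n = t^m (t - y)^(n+1) + y t^m (t - y)^n. *)
Lemma jacobi_of_comm_iter : (forall m l w2, (\fs_i binz m i *: c (A1 i%:Z w1) (m + l - i%:Z) w2) =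
  s *: A3 m (c w1 l w2) - t *: c w1 l (A2 m w2)) ->
 (forall n l w2, c (A1 n w1) l w2 = \fs_i ((-1) ^+ i * binz n i) *: (s *: A3 (n - i%:Z) (c w1 (l + i%:Z) w2)
  - ((-1) ^ n * t) *: c w1 (n + l - i%:Z) (A2 i%:Z w2))) -> jacobi c A1 A2 A3 s t w1.
move=> Dcomm Diter.
have D0 m l w2 : defect m 0 l w2 = 0.
 apply/defectE; rewrite (fsumE (N := 1)) => [|[//|i] _]; last by rewrite binz_0 mulr0 scale0r.
 rewrite big_ord1 binz0 mulr1 scale1r expr0z mul1r !addr0 add0r -Dcomm.
 by apply: eq_fsum => i; rewrite add0r.
have D0' n l w2 : defect 0 n l w2 = 0.
 apply/defectE; rewrite /near (fsumE (N := 1)) => [|[//|i] _]; last by rewrite binz_0 scale0r.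
 rewrite big_ord1 binz0 scale1r !addr0 add0r Diter.
 by apply: eq_fsum => i; rewrite !add0r.
suff D m n l w2 : defect m n l w2 = 0 by move=> m n l w2; apply/defectE.
(* Upwards the recursion yields n + 1 from n. Downwards it only shows that the defect depends on m +
   l, and m is then moved to 0, where [D0'] applies. *)
elim/int_ind: n m l w2 => [//|n IH|n IH] m l w2.
 have := defect_rec m n l w2; rewrite !IH addr0.
 have -> : n%:Z + 1 = n.+1%:Z by lia.
 by move=> <-.
have E j q v : defect (j + 1) (- n.+1%:Z) q v = defect j (- n.+1%:Z) (q + 1) v.
 rewrite defect_rec (_ : - n.+1%:Z + 1 = - n%:Z); last by lia.
 by rewrite IH add0r.
elim/int_ind: m l w2 => [//|m IHm|m IHm] l w2.
 by rewrite (_ : m.+1%:Z = m%:Z + 1) ?E ?IHm //; lia.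
have := E (- m.+1%:Z) (l - 1) w2; rewrite (_ : - m.+1%:Z + 1 = - m%:Z); last by lia.
by rewrite IHm subrK.
Qed.

End JacobiReduction.

Section Generators.
Context R (k : R[i]) (V : affine_vsa k).

Lemma jacobi_borcherds (W1 W2 W3 : sspace R) (y1 : V -> int -> W1 -> W1)
  (y2 : V -> int -> W2 -> W2) (y3 : V -> int -> W3 -> W3) q (c : W1 -> int -> W2 -> W3) :
 (forall a b v w1, hmg a v -> hmg b w1 -> jacobi c (y1 v) (y2 v) (y3 v) ((-1) ^+ (q && a)) ((-1) ^+ (a && b)) w1) <->
 borcherds y1 y2 y3 q c.
by split=> [H a b v w1 w2 m n l va wb|H a b v w1 va wb m n l w2];
 [exact: (H a b v w1 va wb m n l w2)|exact: (H a b v w1 w2 m n l va wb)].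
Qed.

Lemma act_fin (W : vmod V) v (w : W) n : fin1 (fun i => act v (n + i%:Z) w).
have [N WN] := mod_trunc (act_module W) v w.
exists (N + absz n)%N => i Ni; have -> : n + i%:Z = (absz (n + i%:Z))%:Z by lia.
by apply: WN; lia.
Qed.

Lemma act_hmg (W : vmod V) a b v n (w : W) : hmg a v -> hmg b w -> hmg (a (+) b) (act v n w).
move=> va wb; rewrite /hmg (mod_par (act_module W)) va wb.
rewrite (linZ (act_linr _ _)) (linZ (act_linl _ _)) scalerA mulrC.
by rewrite -signr_addb.
Qed.

Lemma act_iterated (W : vmod V) a r b u (n : int) (w : W) : hmg b u -> act (vY (gen V a) r u) n w =
 \fs_s ((-1) ^+ s * Defs.binz R r s) *: (act (gen V a) (r - s%:Z) (act u (n + s%:Z) w)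
  - ((-1) ^ r * (-1) ^+ (odd11 a && b)) *: act u (r + n - s%:Z) (act (gen V a) s%:Z w)).
move=> ub; rewrite (borcherds_iter (mod_borcherds (act_module W)) w r n (gen_par V a) ub).
by apply: eq_fsum => i; rewrite /= scale1r.
Qed.

Section Reduction.
Variables (W1 W2 W3 : vmod V) (q : bool) (c : W1 -> int -> W2 -> W3).
Hypotheses (c_linl : forall n w2, linear (fun w1 => c w1 n w2)) (c_linr : forall n w1, linear (c w1 n))
 (c_fin : forall w1 w2 l, fin1 (fun i => c w1 (l + i%:Z) w2)).
Hypothesis gens : forall a b w1, hmg b w1 ->
 jacobi c (@act _ _ W1 (gen V a)) (@act _ _ W2 (gen V a)) (@act _ _ W3 (gen V a))
  ((-1) ^+ (q && odd11 a)) ((-1) ^+ (odd11 a && b)) w1.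

(** Induction over V, with [jacobi_iterated] as the inductive step. A candidate for an intertwining
    operator can thus be tested on the four currents. *)
Lemma borcherds_generators : borcherds (@act _ _ W1) (@act _ _ W2) (@act _ _ W3) q c.
apply/jacobi_borcherds => a b v w1 va; move: b w1.
apply: (V_hmg_ind (P := fun a v => forall b w1, hmg b w1 ->
 jacobi c (act v) (act v) (act v) ((-1) ^+ (q && a)) ((-1) ^+ (a && b)) w1)) va => {a v}.
- move=> a; split=> [b w1 wb m n l w2|x u v Pu Pv b w1 wb m n l w2].
  rewrite !fsum_eq0 // => i; rewrite !act0l.
   by rewrite (lin0 (c_linr _ _)) !scaler0 subr0 scaler0.
  by rewrite (lin0 (c_linl _ _)) scaler0.
 have {}Pu := Pu b w1 wb m n l w2; have {}Pv := Pv b w1 wb m n l w2.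
 have fn v' : fin1 (fun i => Defs.binz R m i *: c (act v' (n + i%:Z) w1) (m + l - i%:Z) w2)
  by apply: fin1Z; fin_of (act_fin v' w1 n); rewrite (lin0 (c_linl _ _)).
 have fr v' : fin1 (fun i => ((-1) ^+ i * Defs.binz R n i) *:
   ((-1) ^+ (q && a) *: act v' (m + n - i%:Z) (c w1 (l + i%:Z) w2)
   - ((-1) ^ n * (-1) ^+ (a && b)) *: c w1 (n + l - i%:Z) (act v' (m + i%:Z) w2))).
  have [N cN] := c_fin w1 w2 l; have [N' AN] := act_fin v' w2 m.
  exists (maxn N N') => i; rewrite geq_max => /andP[/cN -> /AN ->].
  by rewrite act0r (lin0 (c_linr _ _)) !scaler0 subr0 scaler0.
 transitivity (x *: (\fs_i Defs.binz R m i *: c (act u (n + i%:Z) w1) (m + l - i%:Z) w2)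
  + \fs_i Defs.binz R m i *: c (act v (n + i%:Z) w1) (m + l - i%:Z) w2).
  rewrite -fsumZ // -fsumD //; last exact: fin1Z.
  by apply: eq_fsum => i; rewrite act_linl c_linl; lmod_ring.
 rewrite Pu Pv -fsumZ // -fsumD //; last exact: fin1Z.
 by apply: eq_fsum => i; rewrite !act_linl c_linr; lmod_ring.
- move=> b w1 wb; apply: jacobi_of_comm_iter => //.
 + by move=> n; exact: act_linr.
 + by move=> n; exact: act_fin.
 + by move=> w n; exact: act_fin.
 + move=> m l w2; rewrite andbF scale1r scale1r !act_vac.
  rewrite (fsumE (N := 0)) ?big_ord0 => [|i _]; last by rewrite act_vac (lin0 (c_linl _ _)) scaler0.
  by case: eqP => _; rewrite ?subrr // (lin0 (c_linr _ _)) subrr.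
 + move=> n l w2; rewrite andbF act_vac.
  have E i : act (vac V) i%:Z w2 = 0 :> W2 by rewrite act_vac.
  case: (leP 0 n) => n0; last first.
   rewrite (fsumE (N := 1)) => [|[//|i] _]; last first.
    rewrite E (lin0 (c_linr _ _)) scaler0 subr0 act_vac ifF ?scaler0 //.
    by apply/eqP; lia.
   rewrite big_ord1 binz0 mulr1 !scale1r E (lin0 (c_linr _ _)) scaler0 !(subr0, addr0) act_vac.
   by case: eqP => // _; rewrite (lin0 (c_linl _ _)).
  (* Now 0 <= n: outside c the vacuum survives only at i = n + 1, where the binomial coefficient
     C(n, i) is zero. *)
  rewrite ifF; last by apply/eqP; lia.
  rewrite (lin0 (c_linl _ _)) fsum_eq0 // => i.
  rewrite E (lin0 (c_linr _ _)) scaler0 subr0 act_vac; case: eqP => [e|_]; last by rewrite !scaler0.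
  have [j nj] : exists j : nat, n = j%:Z by exists (absz n); lia.
  by rewrite nj binz_nat bin_small ?mulr0 ?scale0r //; lia.
- move=> a r b u ub Pu b1 w1 wb1.
 have -> : (-1) ^+ (q && (odd11 a (+) b)) = (-1) ^+ (q && odd11 a) * (-1) ^+ (q && b) :> R[i]
  by rewrite -signr_addb; congr (_ ^+ _); case: q (odd11 a) b {ub Pu} => [] [] [].
 have -> : (-1) ^+ ((odd11 a (+) b) && b1) = (-1) ^+ (odd11 a && b1) * (-1) ^+ (b && b1) :> R[i]
  by rewrite -signr_addb; congr (_ ^+ _); case: b1 (odd11 a) b {ub Pu wb1} => [] [] [].
 have lin (W : vmod V) v n : linear (@act _ _ W v n) := act_linr v n.
 have fin (W : vmod V) v (w : W) n := act_fin v w n.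
 refine (@jacobi_iterated R W1 W2 W3 c (act (gen V a)) (act u) _ (act (gen V a)) (act u) _
  (act (gen V a)) (act u) _ c_linl c_linr (lin _ _) (lin _ _) (lin _ _) (lin _ _) (lin _ _)
  (lin _ _) c_fin (fin _ _) (fin _ _) (fin _ _) (fin _ _) (fin _ _) (fin _ _)
  r ((-1) ^+ (odd11 a && b)) _ _ _ _ _ _ _ _ w1 _ _ _ _).
 + by rewrite -expr2 sqrr_sign.
 + by move=> n w; exact: act_iterated.
 + by move=> n w; exact: act_iterated.
 + by move=> n w; exact: act_iterated.
 + exact: gens.
 + exact: Pu.
 + move=> n; have := @gens a _ _ (act_hmg n ub wb1).
  have -> // : (-1) ^+ (odd11 a && (b (+) b1)) = (-1) ^+ (odd11 a && b1) * (-1) ^+ (odd11 a && b) :> R[i].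
  by rewrite -signr_addb; congr (_ ^+ _); case: (odd11 a) b b1 {ub Pu wb1} => [] [] [].
 + move=> n; have := @Pu _ _ (act_hmg n (gen_par V a) wb1).
  have -> // : (-1) ^+ (b && (odd11 a (+) b1)) = (-1) ^+ (b && b1) * (-1) ^+ (odd11 a && b) :> R[i].
  by rewrite -signr_addb; congr (_ ^+ _); case: (odd11 a) b b1 {ub Pu wb1} => [] [] [].
Qed.

End Reduction.
End Generators.

Arguments mode {R k V} W a r _ : simpl never.

(** * Homomorphisms and submodules recognized on the currents *)

Section Homomorphisms.
Context R (k : R[i]) (V : affine_vsa k).
Lemma hom_lin (W1 W2 : vmod V) p (f : W1 -> W2) : is_hom p f -> linear f.
by case. Qed.

Lemma hom_mode (W1 W2 : vmod V) p (f : W1 -> W2) a r w : is_hom p f ->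
 f (mode W1 a r w) = (-1) ^+ (p && odd11 a) *: mode W2 a r (f w).
by move=> [_ _ fm]; exact/fm/gen_par. Qed.

Lemma mode_hom (W1 W2 : vmod V) (p : bool) (f : W1 -> W2) : linear f ->
 (forall w, f (par w) = (-1) ^+ p *: par (f w)) ->
 (forall a r w, f (mode W1 a r w) = (-1) ^+ (p && odd11 a) *: mode W2 a r (f w)) -> is_hom p f.
move=> lf pf fm; split=> // a v n w va; move: n w.
apply: (V_hmg_ind (P := fun a v => forall n w,
 f (act v n w) = (-1) ^+ (p && a) *: act v n (f w))) va => {a v} [b||a r b u ub IH n w].
- split=> [n w|a u v IHu IHv n w].
  by rewrite !act0l (lin0 lf) scaler0.
 by rewrite !act_linl lf IHu IHv; lmod_ring.
- by move=> n w; rewrite andbF scale1r !act_vac; case: ifP => // _; exact: lin0.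
have fin_s (W : vmod V) (g : W -> W2) (x : W) : linear g -> fin1 (fun s => ((-1) ^+ s * Defs.binz R r s) *:
  g (act (gen V a) (r - s%:Z) (act u (n + s%:Z) x)
  - ((-1) ^ r * (-1) ^+ (odd11 a && b)) *: act u (r + n - s%:Z) (act (gen V a) s%:Z x))).
 move=> lg; apply: fin1Z; have [N uN] := act_fin u x n; have [M aM] := act_fin (gen V a) x 0.
 exists (maxn N M) => s; rewrite geq_max => /andP[/uN -> /aM]; rewrite add0r => ->.
 by rewrite !act0r scaler0 subr0 (lin0 lg).
rewrite !(act_iterated _ _ _ _ ub).
have fE x : f x = f x by [].
rewrite (fsum_lin lf); last first.
 have [N uN] := act_fin u w n; have [M aM] := act_fin (gen V a) w 0.
 exists (maxn N M) => s; rewrite geq_max => /andP[/uN -> /aM]; rewrite add0r => ->.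
 by rewrite !act0r scaler0 subr0 scaler0.
rewrite -fsumZ; last by apply: (fin_s W2 (fun x => x)).
apply: eq_fsum => s; rewrite (linZ lf) (linB lf) (linZ lf).
have fm' t x : f (act (gen V a) t x) = (-1) ^+ (p && odd11 a) *: act (gen V a) t (f x) by exact: fm.
rewrite !(fm', IH) !(linZ (act_linr _ _)).
have -> : (-1) ^+ (p && (odd11 a (+) b)) = (-1) ^+ (p && odd11 a) * (-1) ^+ (p && b) :> R[i]
 by rewrite -signr_addb; congr (_ ^+ _); case: p (odd11 a) b {ub IH fin_s pf fm fm'} => [] [] [].
by lmod_ring.
Qed.

Lemma hom_comp (W1 W2 W3 : vmod V) p q (f : W2 -> W3) (g : W1 -> W2) :
 is_hom p f -> is_hom q g -> is_hom (p (+) q) (f \o g).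
move=> [lf pf fm] [lg pg gm]; split=> [a u v|w|a v n w va] /=.
- by rewrite lg lf.
- by rewrite pg (linZ lf) pf scalerA -signr_addb addbC.
- rewrite (gm a) // (linZ lf) (fm a) // scalerA -signr_addb.
 by congr (_ ^+ _ *: _); case: p q a {pf pg fm gm va} => [] [] [].
Qed.

Lemma hom_id (W : vmod V) : ehom (@id W).
by split=> // [w|a v n w _]; rewrite scale1r. Qed.
Lemma submod_sub (W : vmod V) (U : set W) : submodule U -> subspace U.
by case. Qed.

Lemma modes_submodule (W : vmod V) (U : set W) : subspace U ->
 (forall u, U u -> U (par u)) -> (forall a r u, U u -> U (mode W a r u)) -> submodule U.
move=> sU pU UM; split; [exact: sub0|by case: sU|by []|].
move=> v n u; move: (n) u; apply: (hmg_split (U := fun v => forall n u, U u -> U (act v n u))) v => {n}.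
 split=> [n u _|a v v' IH IH' n u Uu]; first by rewrite act0l; exact: sub0.
 by rewrite act_linl; apply: (subD sU); [apply: (subZ sU); exact: IH|exact: IH'].
move=> a v va; apply: (V_hmg_ind (P := fun a v => forall n u, U u -> U (act v n u))) va => {a v}.
- move=> _; split=> [n u _|a v v' IH IH' n u Uu]; first by rewrite act0l; exact: sub0.
 by rewrite act_linl; apply: (subD sU); [apply: (subZ sU); exact: IH|exact: IH'].
- by move=> n u Uu; rewrite act_vac; case: ifP => // _; exact: sub0.
move=> a r b v vb IH n u Uu; rewrite (act_iterated _ _ _ _ vb).
apply: sub_fsum => // s; apply: (subZ sU); apply: (subB sU); first exact/UM/IH.
by apply: (subZ sU); apply: IH; exact: UM.
Qed.

End Homomorphisms.

(** * The Sugawara vector and the commutators of L_n *)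

Section Sugawara.
Context R (k : R[i]) (hk : k != 0) (V : affine_vsa k).
Local Notation md := (mode (adjoint V)).

Lemma omegaE : conformal_vector V = (2%:R * k)^-1 *: (md gN (-1) (gen V gE) + md gE (-1) (gen V gN)
  - md gPsiP (-1) (gen V gPsiM) + md gPsiM (-1) (gen V gPsiP))
 + (2%:R * k ^+ 2)^-1 *: md gE (-1) (gen V gE).
by []. Qed.
Lemma md_linear a r : linear (md a r).
exact: act_linr. Qed.

Lemma md_gen a b (i : nat) : md a i (gen V b) =
 if i is j.+1 then (if j is 0%N then (kappa11 R a b * k) *: vac V else 0) else bracket11 (gen V) a b.
exact: gen_gen. Qed.

Lemma gen_pair a b c (i : nat) : md a i (md b (-1) (gen V c)) =
 (-1) ^+ (odd11 a && odd11 b) *: md b (-1) (md a i (gen V c)) + (bracket11 (fun d => md d (i%:Z - 1) (gen V c)) a b +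
 (if i == 1%N then (kappa11 R a b * k) *: gen V c else 0)).
rewrite (act_swap (mode_action (adjoint V))) addrA; congr (_ + _).
have -> : (i%:Z + -1 == 0) = (i == 1%N) by lia.
by case: eqP => [->|_]; rewrite ?scale0r // mul1r.
Qed.

(** All commutators of the currents with L_n follow from these products ([mode_L]). *)
Lemma gen_omega a (i : nat) : md a i (conformal_vector V) = if i == 1%N then gen V a else 0.
have vE b : md b (-1) (vac V) = gen V b := gen_vac V b.
have l := md_linear a i; have l1 x := md_linear x (-1).
have x2 : (2%:R * k ^+ 2)^-1 = 2%:R * ((2%:R * k)^-1 * (2%:R * k)^-1) by field; rewrite hk.
have kx : k * (2%:R * k)^-1 * 2%:R = 1 by field; rewrite hk.
rewrite omegaE x2 (linD l) !(linZ l) !(linD l) (linN l) !gen_pair.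
move: (_^-1) kx => x kx.
case: i {l} => [|[|[|i]]].
- have [y yE] : exists y : gl11 -> gl11 -> V, forall b c, md b (-1) (gen V c) = y b c
  by exists (fun b c => md b (-1) (gen V c)).
 have E1 b c : md b (0%N%:Z - 1) (gen V c) = y b c by rewrite -yE.
 rewrite !(bracket11_ext _ _ (fun d => E1 d _)) !md_gen.
 case: a; rewrite /= ?(lin0 (l1 _)) ?(linN (l1 _)) ?yE; lmod_ring.
- have E1 b c : md b (1%N%:Z - 1) (gen V c) = bracket11 (gen V) b c by exact: (md_gen b c 0).
 rewrite !(bracket11_ext _ _ (fun d => E1 d _)) !md_gen.
 (* For a = N the quadratic part leaves an extra multiple of E, since the Casimir element acts
    nontrivially on the adjoint representation; the summand with E_(-1)^2 in the conformal vector is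
    there to cancel it. *)
 transitivity ((k * x * 2%:R) *: gen V a +
  (2%:R * x * (k * x * 2%:R - 1)) *: (if a is gN then gen V gE else 0)); last by rewrite kx subrr mulr0 scale0r addr0 scale1r.
 case: a; rewrite /= ?(linZ (l1 _)) ?vE ?(lin0 (l1 _)); move: (gen V) => g; lmod_ring.
- have E1 b c : md b (2%N%:Z - 1) (gen V c) = (kappa11 R b c * k) *: vac V by exact: (md_gen b c 1).
 rewrite !(bracket11_ext _ _ (fun d => E1 d _)) !md_gen.
 case: a; rewrite /= ?(linZ (l1 _)) ?vE ?(lin0 (l1 _)); move: (gen V) (vac V) => g v; lmod_ring.
- have E1 b c : md b (i.+3%:Z - 1) (gen V c) = 0 by exact: (md_gen b c i.+2).
 rewrite !(bracket11_ext _ _ (fun d => E1 d _)) !md_gen.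
 case: a; rewrite /= ?(linZ (l1 _)) ?vE ?(lin0 (l1 _)); move: (gen V) (vac V) => g v; lmod_ring.
Qed.

Lemma omega_even : hmg false (conformal_vector V).
have S : subspace (@hmg R V false) by exact: hmg_subspace.
have H a b : ~~ (odd11 a (+) odd11 b) -> hmg false (md a (-1) (gen V b))
 by move=> ab; have := act_hmg (W := adjoint V) (-1) (gen_par V a) (gen_par V b); rewrite (negbTE ab).
rewrite omegaE; apply: (subD S); apply: (subZ S); last exact: H.
by apply: (subD S); [apply: (subB S); first apply: (subD S)|]; exact: H.
Qed.

Section Virasoro.
Variable W : vmod V.
Lemma L_linear n : linear (LL W n).
exact: act_linr. Qed.
Lemma L_par n w : par (L n w) = L n (par w) :> W.
by rewrite /L (mod_par (act_module W)) omega_even scale1r. Qed.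

Lemma mode_L a m n (w : W) : mode W a m (L n w) = L n (mode W a m w) + m%:~R *: mode W a (m + n) w.
have := borcherds_comm (mod_borcherds (act_module W)) w m (n + 1) (gen_par V a) omega_even.
have O i : vY (gen V a) i%:Z (conformal_vector V) = if i == 1%N then gen V a else 0 := gen_omega a i.
rewrite (fsum_nat (N := 2)) => [|[|[|i]] // _]; last by rewrite O act0l scaler0.
rewrite !big_ord_recl big_ord0 addr0 /= !O /= act0l scaler0 add0r
 andbF !scale1r => E; rewrite -[LHS](subrK (L n (mode W a m w))) addrC -E.
rewrite /bump /= binzS binz0 mul1r subr0 divr1 addr0.
by have -> : m + (n + 1) - (1 + 0)%N%:Z = m + n by lia.
Qed.

Lemma fsum_single (f : nat -> W) j : (forall i, i != j -> f i = 0) -> fsum f = f j.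
move=> f0; rewrite (fsumE (N := j.+1)) => [|i ji]; last by apply: f0; lia.
rewrite (bigD1 ord_max) //= big1 ?addr0 // => i; rewrite -val_eqE /=; exact: f0.
Qed.

Lemma binzN2 i : (-1) ^+ i * binz R (-2) i = i.+1%:R :> R[i].
elim: i => [|i IH]; first by rewrite binz0 mulr1.
have -> : (-1) ^+ i.+1 * binz R (-2) i.+1 = (-1) ^+ i * binz R (-2) i * ((i%:R + 2%:R) / i.+1%:R) :> R[i].
 rewrite binzS exprS (_ : (-2)%:~R = - 2%:R :> R[i]) //; ring.
rewrite IH.
by rewrite mulrC divfK ?pnatr_eq0 // -natrD addn2.
Qed.

(** The L_(-1)-derivative property, once [L_translate] identifies v_(-2) vac. In the iterate formula
    with exponent -2 the vacuum selects a single index, where the coefficient is given by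
    [binzN2]. *)
Lemma act_translate v n (w : W) : act (vY v (-2) (vac V)) n w = (- n%:~R) *: act v (n - 1) w.
have lV m u : linear (fun v : V => vY v m u) by exact: (act_linl (W := adjoint V)).
pose U v := act (vY v (-2) (vac V)) n w = (- n%:~R) *: act v (n - 1) w.
apply: (hmg_split (U := U)) v => [|a v va].
 split=> [|a u v Uu Uv]; rewrite /U.
  by rewrite (lin0 (lV _ _)) !act0l scaler0.
 by rewrite lV !act_linl Uu Uv; lmod_ring.
rewrite /U (borcherds_iter (mod_borcherds (act_module W)) w (-2) n va (vac_even V))
 -/(fsum _); have c2 : (-1) ^ (-2) = 1 :> R[i] by rewrite -exprnN expr2 mulrNN mulr1 invr1.
clear U; case: n => [[|n]|n].
- rewrite oppr0 scale0r; apply: fsum_eq0 => i; rewrite !act_vac.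
 have -> : (0%N%:Z + i%:Z == -1) = false by lia.
 have -> : (-2 + 0%N%:Z - i%:Z == -1) = false by lia.
 by rewrite !act0r !scaler0 subr0 scaler0.
- rewrite (fsum_single (j := n)) => [|i ni]; rewrite !act_vac.
  have -> : (n.+1%:Z + n%:Z == -1) = false by lia.
  have -> : (-2 + n.+1%:Z - n%:Z == -1) by lia.
  rewrite !act0r andbF c2 mulr1 !scale1r sub0r scalerN binzN2 scaleNr.
  by have -> : n.+1%:Z - 1 = n%:Z by lia.
 have -> : (n.+1%:Z + i%:Z == -1) = false by lia.
 have -> : (-2 + n.+1%:Z - i%:Z == -1) = false by lia.
 by rewrite !act0r !scaler0 subr0 scaler0.
- rewrite (fsum_single (j := n)) => [|i ni]; rewrite !act_vac.
  have -> : (Negz n + n%:Z == -1) by lia.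
  have -> : (-2 + Negz n - n%:Z == -1) = false by lia.
  rewrite !scaler0 subr0 scale1r binzN2; congr (_ *: act _ _ _); last lia.
  by rewrite NegzE mulrNz opprK.
 have -> : (Negz n + i%:Z == -1) = false by lia.
 have -> : (-2 + Negz n - i%:Z == -1) = false by lia.
 by rewrite !act0r !scaler0 subr0 scaler0.
Qed.

End Virasoro.
Local Notation AV := (adjoint V).
Lemma L_vac (n : nat) : L (n%:Z - 1) (vac V : AV) = 0.
by rewrite /L subrK; exact: mode_vac. Qed.

(** Induction over V: both operators kill the vacuum and have the same commutator with every a_r. *)
Lemma L_translate (v : V) : L (-1) (v : AV) = vY v (-2) (vac V).
have lV m u : linear (fun v : V => vY v m u) by exact: (act_linl (W := AV)).
have V0 x m : vY x m (0 : V) = 0 by exact: (lin0 (act_linr (W := AV) _ _)).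
pose U (v : V) := L (-1) (v : AV) = vY v (-2) (vac V).
have sU : subspace U.
 split=> [|a u u' Uu Uv]; rewrite /U.
  by rewrite (lin0 (lV _ _)) (lin0 (L_linear (W := AV) _)).
 by rewrite lV (L_linear (W := AV)) Uu Uv.
apply: (hmg_split (U := U)) v => // a v va.
apply: (V_hmg_ind (P := fun _ => U)) va => {a v} [_ //||a r b u ub Uu]; rewrite /U.
 by have := L_vac 0; rewrite sub0r => ->; rewrite [vY _ _ _](act_vac (W := AV)).
rewrite [RHS](act_iterated (W := AV) a r (-2) (vac V) ub).
have -> : L (-1) (vY (gen V a) r u : AV) = vY (gen V a) r (L (-1) (u : AV)) - r%:~R *: vY (gen V a) (r - 1) u
 by have /eqP := mode_L (W := AV) a r (-1) u; rewrite -subr_eq => /eqP.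
have E s : (2 <= s)%N -> vY u (-2 + s%:Z) (vac V) = 0
 by move=> s2; rewrite (_ : -2 + s%:Z = (s - 2)%N%:Z) ?mode_vac //; lia.
rewrite (fsumE (N := 2)) => [|s s2]; rewrite /= ?E //; last by rewrite mode_vac !V0 scaler0 subr0 scaler0.
rewrite !big_ord_recl big_ord0 /= /bump /= !mode_vac !V0 !scaler0 !subr0
 [vY (conformal_vector V) _ u]Uu addr0 binz0 !binzS binz0 mulr1 scale1r expr1 mul1r subr0 divr1 mulN1r scaleNr.
congr (_ - _ *: _).
by have [_ _ -> _] := avs_vsa V.
Qed.

Lemma L0_gen a : L 0 (gen V a : AV) = gen V a.
rewrite -{1}gen_vac; have := mode_L (W := AV) a (-1) 0 (vac V).
rewrite (_ : L 0 (vac V : AV) = 0) ?(lin0 (md_linear _ _)) ?addr0; last exact: (L_vac 1).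
move=> /esym/eqP.
by rewrite addr_eq0 scaleN1r opprK => /eqP ->; rewrite [mode _ _ _ _]gen_vac.
Qed.

Lemma L0_omega : L 0 (conformal_vector V : AV) = 2%:R *: conformal_vector V.
have lL := L_linear (W := AV) 0.
have H a b : L 0 (md a (-1) (gen V b)) = 2%:R *: md a (-1) (gen V b).
 have := mode_L (W := AV) a (-1) 0 (gen V b); rewrite L0_gen addr0 scaleN1r => /eqP.
 by rewrite eq_sym subr_eq => /eqP ->; rewrite -mulr2n -scaler_nat.
rewrite omegaE (linD lL) !(linZ lL) !(linD lL) (linN lL) !H; lmod_ring.
Qed.

Section OnModules.
Variable W : vmod V.

(** L_0 is the mode 1 of the conformal vector, so the commutator formula sees only its products 0
    and 1 with itself, namely L_(-1) omega and 2 omega. *)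
Lemma L0_L n (w : W) : L 0 (L n w) = L n (L 0 w) - n%:~R *: L n w.
have := borcherds_comm (mod_borcherds (act_module W)) w 1 (n + 1) omega_even omega_even.
have w0 : vY (conformal_vector V) 0 (conformal_vector V) = vY (conformal_vector V) (-2) (vac V)
 by rewrite -L_translate.
have w1 : vY (conformal_vector V) 1 (conformal_vector V) = 2%:R *: conformal_vector V := L0_omega.
have b2 i : binz R 1 i.+2 = 0 by rewrite (binz_nat _ 1) bin_small.
rewrite (fsum_nat (N := 2)) => [|[|[|i]] // _]; last by rewrite b2 scale0r.
rewrite !big_ord_recl big_ord0 addr0 /= /bump /= !w0 !w1 binzS binz0 /= !scale1r => /eqP.
rewrite eq_sym subr_eq => /eqP; rewrite /L add0r => ->.
rewrite act_translate (linZ (act_linl _ _)) subr0 divr1 mul1r [RHS]addrC addrA addrC; congr (_ + _); rewrite -scaleNr.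
have -> : 1 + (n + 1) - 1 = n + 1 by lia.
have -> : (1 + (n + 1))%:~R = n%:~R + 2%:R :> R[i] by rewrite -[2%:R]/(2%:~R) -intrD; congr (_%:~R); lia.
by rewrite add0r -[1%:~R]/(1 : R[i]); lmod_ring.
Qed.

(* The Casimir operator: L_0 on the vectors annihilated by positive modes. *)
Lemma L0_casimir (w : W) : (forall a (r : nat), mode W a r.+1 w = 0) ->
 L 0 w = (2%:R * k)^-1 *: (mode W gE 0 (mode W gN 0 w) + mode W gN 0 (mode W gE 0 w)
  + mode W gPsiM 0 (mode W gPsiP 0 w) - mode W gPsiP 0 (mode W gPsiM 0 w))
 + (2%:R * k ^+ 2)^-1 *: mode W gE 0 (mode W gE 0 w).
move=> w0.
have H b c : act (md b (-1) (gen V c)) 1 w = (-1) ^+ (odd11 b && odd11 c) *: mode W c 0 (mode W b 0 w).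
 rewrite [md _ _ _]/(vY (gen V b) (-1) (gen V c)) (act_iterated _ _ 1 w (gen_par V c)).
 have aw d (r : nat) : act (gen V d) r.+1%:Z w = 0 by exact: w0.
 rewrite (fsumE (N := 1)) => [|[//|s] _]; last first.
  have -> : 1 + s.+1%:Z = s.+2%:Z by lia.
  by rewrite !aw !act0r scaler0 subr0 scaler0.
 rewrite big_ord1 /= addr0 (aw _ 0%N) act0r sub0r binz0 mulr1 scale1r.
 by rewrite exprN1 invrN invr1 mulN1r scaleNr opprK.
have l := act_linl (W := W) 1 w.
rewrite /L omegaE (linD l) !(linZ l) !(linD l) (linN l) !H /=.
by rewrite expr0 expr1; lmod_ring.
Qed.

End OnModules.
Lemma hom_L (W1 W2 : vmod V) p (f : W1 -> W2) n w : is_hom p f -> f (L n w) = L n (f w).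
by move=> [_ _ fm]; rewrite /L (fm false _ _ _ omega_even) andbF scale1r. Qed.

Section Intertwining.
Variables (W1 W2 W3 : vmod V) (p : bool) (Y : log_modes W1 W2 W3).
Hypothesis HY : intertwining p Y.

Lemma int_L_comm (m : nat) w1 h j w2 : L (m%:Z - 1) (Y w1 h j w2) = Y w1 h j (L (m%:Z - 1) w2) +
 \sum_(i < m.+1) 'C(m, i)%:R *: Y (L (i%:Z - 1) w1) (h + (m%:Z - i%:Z)%:~R) j w2.
pose U w1 := L (m%:Z - 1) (Y w1 h j w2) = Y w1 h j (L (m%:Z - 1) w2) +
 \sum_(i < m.+1) 'C(m, i)%:R *: Y (L (i%:Z - 1) w1) (h + (m%:Z - i%:Z)%:~R) j w2.
have Yl w2 h := int_linl HY h j w2.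
apply: (hmg_split (U := U)) w1 => [|b w1 w1b].
 split=> [|a u v]; rewrite /U.
  rewrite !(lin0 (Yl _ _)) (lin0 (L_linear _)) add0r big1 // => i _.
  by rewrite (lin0 (L_linear _)) (lin0 (Yl _ _)) scaler0.
 move=> Uu Uv; rewrite !Yl L_linear Uu Uv scalerDr addrACA; congr (_ + _).
 rewrite scaler_sumr -big_split; apply: eq_bigr => i _.
 by rewrite L_linear Yl; lmod_ring.
have := borcherds_comm (int_borcherds HY h j) w2 m 0 omega_even w1b.
rewrite (fsum_nat (N := m.+1)) => [|i mi]; last by rewrite binz_nat bin_small // scale0r.
rewrite andbF !scale1r !addr0 => /eqP; rewrite eq_sym subr_eq => /eqP E.
rewrite /U /L !subrK E addrC; congr (_ + _); apply: eq_bigr => i _.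
by rewrite binz_nat subrK.
Qed.

Lemma int_L0_comm w1 h j w2 : L 0 (Y w1 h j w2) = Y w1 h j (L 0 w2) + Y (L 0 w1) h j w2
 + (- h - 1) *: Y w1 h j w2 + j.+1%:R *: Y w1 h j.+1 w2.
rewrite (int_L_comm 1) !big_ord_recl big_ord0 /= /bump /= !addr0 bin0 binn !scale1r
 (_ : 1%N%:Z - 1 = 0) // (_ : 0%N%:Z - 1 = -1) // (int_deriv HY).
by rewrite -!addrA; congr (_ + _); rewrite addrC -addrA addrC addrA.
Qed.

Lemma int_Lm_comm w1 h j w2 : L 1 (Y w1 h j w2) = Y w1 h j (L 1 w2) + Y (L 1 w1) h j w2
 + 2%:R *: Y (L 0 w1) (h + 1) j w2 + Y (L (-1) w1) (h + 2%:R) j w2.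
rewrite (int_L_comm 2) !big_ord_recl big_ord0 /= /bump /= !addr0 bin0 bin1 binn !scale1r
 (_ : 2%N%:Z - 1 = 1) // (_ : 0%N%:Z - 1 = -1) // (_ : 1%N%:Z - 1 = 0) // -!addrA; congr (_ + _).
rewrite -[2%N%:Z%:~R]/(2%:R : R[i]) -[1%N%:Z%:~R]/(1 : R[i]) addrC addrA [LHS]addrAC -addrA.
by lmod_ring.
Qed.

End Intertwining.
End Sugawara.

(** * Quotients, submodules and products of modules *)

Section QuotientLmodule.
Variables (K : fieldType) (W : lmodType K) (U : set W).
(** The choice depends only on the coset, so the quotient is realized as the subtype of chosen
    representatives. *)
Definition coset_repr (w : W) : W := xget 0 [set v | U (v - w)].

Record quot_type (sU : subspace U) := QuotientType {
 quotient_val : W; quotient_valP : coset_repr quotient_val == quotient_val }.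

HB.instance Definition _ sU := [isSub of quot_type sU for @quotient_val sU].
HB.instance Definition _ sU := [Choice of quot_type sU by <:].
Variable sU : subspace U.

Lemma coset_reprP w : U (coset_repr w - w).
rewrite /coset_repr; case: xgetP => [v _ //|/(_ w)]; case.
by rewrite /= subrr; exact: sub0.
Qed.

Lemma coset_repr_eq w w' : U (w - w') -> coset_repr w = coset_repr w'.
move=> Uw; rewrite /coset_repr; congr (xget _ _); apply/seteqP; split=> v /= Uv.
- by have := subD sU Uv Uw; rewrite addrA subrK.
- by have := subB sU Uv Uw; rewrite opprB addrA subrK.
Qed.

Fact coset_repr_idem w : coset_repr (coset_repr w) == coset_repr w.
exact/eqP/coset_repr_eq/coset_reprP. Qed.
Definition qpi w : quot_type sU := QuotientType sU (coset_repr_idem w).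
Lemma qpi_val (q : quot_type sU) : qpi (val q) = q.
by apply: val_inj; exact/eqP/quotient_valP. Qed.

Lemma qpi_eq w w' : qpi w = qpi w' <-> U (w - w').
split=> [[e]|/coset_repr_eq e]; last exact: val_inj.
have -> : w - w' = (coset_repr w' - w') - (coset_repr w - w) by rewrite e; lmod_ring.
by apply: subB => //; exact: coset_reprP.
Qed.

Lemma qpi_surj (q : quot_type sU) : exists w, q = qpi w.
by exists (val q); rewrite qpi_val. Qed.
Let qadd (p q : quot_type sU) := qpi (val p + val q).
Let qopp (p : quot_type sU) := qpi (- val p).
Let qscale a (p : quot_type sU) := qpi (a *: val p).
Let U_val w : U (val (qpi w) - w). exact: coset_reprP. Qed.
Let qaddE w w' : qadd (qpi w) (qpi w') = qpi (w + w').
by apply/qpi_eq; rewrite opprD addrACA; apply: subD => //; exact: U_val. Qed.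
Let qoppE w : qopp (qpi w) = qpi (- w).
by apply/qpi_eq; rewrite -[- _ - _]opprD; apply: subN => //; exact: U_val. Qed.
Let qscaleE a w : qscale a (qpi w) = qpi (a *: w).
by apply/qpi_eq; rewrite -scalerBr; apply: subZ => //; exact: U_val. Qed.

Fact qaddA : associative qadd.
move=> p q r; have [[u ->] [v ->]] := (qpi_surj p, qpi_surj q); have [w ->] := qpi_surj r.
by rewrite !qaddE addrA.
Qed.
Fact qaddC : commutative qadd.
by move=> p q; rewrite /qadd addrC. Qed.
Fact qadd0 : left_id (qpi 0) qadd.
by move=> p; have [u ->] := qpi_surj p; rewrite qaddE add0r. Qed.
Fact qaddN : left_inverse (qpi 0) qopp qadd.
by move=> p; have [u ->] := qpi_surj p; rewrite qoppE qaddE addNr. Qed.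
HB.instance Definition _ := GRing.isZmodule.Build (quot_type sU) qaddA qaddC qadd0 qaddN.
Lemma qpiD u v : qpi (u + v) = qpi u + qpi v. by rewrite -qaddE. Qed.
Fact qscaleA a b p : qscale a (qscale b p) = qscale (a * b) p.
by have [u ->] := qpi_surj p; rewrite !qscaleE scalerA. Qed.
Fact qscale1 : left_id 1 qscale.
by move=> p; have [u ->] := qpi_surj p; rewrite qscaleE scale1r. Qed.
Fact qscaleDr : right_distributive qscale +%R.
move=> a p q; have [[u ->] [v ->]] := (qpi_surj p, qpi_surj q).
by rewrite -qpiD !qscaleE -qpiD scalerDr.
Qed.
Fact qscaleDl p : {morph qscale^~ p : a b / a + b}.
by move=> a b; have [u ->] := qpi_surj p; rewrite !qscaleE -qpiD scalerDl. Qed.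
HB.instance Definition _ := GRing.Zmodule_isLmodule.Build K (quot_type sU) qscaleA qscale1 qscaleDr qscaleDl.
Lemma qpi_linear : linear qpi.
by move=> a u v; rewrite qpiD -qscaleE. Qed.
Lemma qpi0 u : qpi u = 0 <-> U u.
by rewrite -(lin0 qpi_linear) qpi_eq subr0. Qed.
End QuotientLmodule.

Section ModuleConstructions.
Context R (k : R[i]) (V : affine_vsa k).
Local Notation vmod := (vmod V).

Section JointlyInjective.
Variables (I : Type) (W : I -> vmod) (M : sspace R) (y : V -> int -> M -> M) (g : forall i, M -> W i).
Hypotheses (gl : forall i, linear (g i)) (gp : forall i m, g i (par m) = par (g i m))
 (gy : forall i v n m, g i (y v n m) = act v n (g i m)) (gi : forall m m', (forall i, g i m = g i m') -> m = m')
 (y_trunc : forall v m, exists N : nat, forall n : nat, (N <= n)%N -> y v n%:Z m = 0).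

(** Apart from truncation the axioms are identities and may be checked after the maps [g]: the
    inclusion of a submodule, or the two projections of a product. *)
Lemma module_of_injective : is_module y.
have yl n m : linear (fun v => y v n m) by move=> a u v; apply: gi => i; rewrite !(gl, gy) act_linl.
have yr v n : linear (y v n) by move=> a u w; apply: gi => i; rewrite !(gl, gy) act_linr.
have yf v m n : fin1 (fun i => y v (n + i%:Z) m).
 have [N yN] := y_trunc v m; exists (N + absz n)%N => i Ni.
 by rewrite (_ : n + i%:Z = (absz (n + i%:Z))%:Z) ?yN //; lia.
split=> // [v n w|n w|].
- by apply: gi => i; rewrite !(gp, gy) (mod_par (act_module _)).
- by apply: gi => i; rewrite gy act_vac; case: ifP => // _; rewrite (lin0 (gl i)).
move=> a b v u w m n l va ub; apply: gi => i; have glE := gl i.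
have f1 : fin1 (fun i => y (vY v (n + i%:Z) u) (m + l - i%:Z) w).
 have [N uN] := act_fin (W := adjoint V) v u n; exists N => j /uN e.
 by rewrite [vY _ _ _]e (lin0 (yl _ _)).
have f2 : fin1 (fun i => y v (m + n - i%:Z) (y u (l + i%:Z) w))
 by fin_of (yf u w l); rewrite (lin0 (yr _ _)).
have f3 : fin1 (fun i => y u (n + l - i%:Z) (y v (m + i%:Z) w))
 by fin_of (yf v w m); rewrite (lin0 (yr _ _)).
rewrite (fsum_lin glE) ?(fsum_lin glE); [| |exact: fin1Z].
 have := mod_borcherds (act_module (W i)) (g i w) m n l va ub.
 have E j : g i (binz R m j *: y (vY v (n + j%:Z) u) (m + l - j%:Z) w) =
  binz R m j *: act (vY v (n + j%:Z) u) (m + l - j%:Z) (g i w) by rewrite (linZ glE) gy.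
 move=> H; rewrite [LHS](eq_fsum E) [LHS]H; apply: eq_fsum => j.
 by rewrite (linZ glE) (linB glE) !(linZ glE) !gy.
have [N2 h2] := f2; have [N3 h3] := f3; exists (maxn N2 N3) => j; rewrite geq_max => /andP[j2 j3].
by rewrite h2 // h3 // !scaler0 subr0 scaler0.
Qed.

End JointlyInjective.

Section Surjective.
Variables (W : vmod) (M : sspace R) (y : V -> int -> M -> M) (q : W -> M).
Hypotheses (ql : linear q) (qp : forall m, q (par m) = par (q m))
 (qy : forall v n w, q (act v n w) = y v n (q w)) (qs : forall m, exists w, m = q w).

Lemma module_of_surjective : is_module y.
split=> [n m a u v|v n a m m'|v n m|v m|n m|a b v u m' m n l va ub].
- by have [w ->] := qs m; rewrite -!qy act_linl ql.
- by have [[w ->] [w' ->]] := (qs m, qs m'); rewrite -ql -!qy act_linr ql.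
- by have [w ->] := qs m; rewrite -qy -!qp -qy (mod_par (act_module _)).
- have [w ->] := qs m; have [N vN] := mod_trunc (act_module W) v w.
 by exists N => n /vN e; rewrite -qy e (lin0 ql).
- by have [w ->] := qs m; rewrite -qy act_vac; case: ifP => // _; rewrite (lin0 ql).
have [w ->] := qs m'.
have f1 : fin1 (fun i => act (vY v (n + i%:Z) u) (m + l - i%:Z) w).
 have [N uN] := act_fin (W := adjoint V) v u n; exists N => j /uN e.
 by rewrite [vY _ _ _]e act0l.
have f2 : fin1 (fun i => act v (m + n - i%:Z) (act u (l + i%:Z) w))
 by fin_of (act_fin u w l); rewrite act0r.
have f3 : fin1 (fun i => act u (n + l - i%:Z) (act v (m + i%:Z) w))
 by fin_of (act_fin v w m); rewrite act0r.
have := congr1 q (mod_borcherds (act_module W) w m n l va ub).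
rewrite (fsum_lin ql); last exact: fin1Z.
rewrite (fsum_lin ql).
 have E j : q (binz R m j *: act (vY v (n + j%:Z) u) (m + l - j%:Z) w) =
  binz R m j *: y (vY v (n + j%:Z) u) (m + l - j%:Z) (q w) by rewrite (linZ ql) qy.
 move=> H; rewrite -[LHS](eq_fsum E) [LHS]H; apply: eq_fsum => j.
 by rewrite (linZ ql) (linB ql) !(linZ ql) !qy.
have [N2 h2] := f2; have [N3 h3] := f3; exists (maxn N2 N3) => j; rewrite geq_max => /andP[j2 j3].
by rewrite h2 // h3 // !scaler0 subr0 scaler0.
Qed.

End Surjective.

Section Submodules.
Variables (W : vmod) (U : set W) (sU : submodule U).
Let S : subspace U := submod_sub sU.
Let pU : forall u, U u -> U (par u). by case: sU. Qed.
Let aU v n u : U u -> U (act v n u). by case: sU => _ _ _; apply. Qed.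
Definition sub_act (v : V) n (u : sub_sspace S pU) : sub_sspace S pU := subspace_in S (aU v n (subspace_valU u)).

Fact sub_act_module : is_module sub_act.
apply: (@module_of_injective unit (fun=> W) (sub_sspace S pU) _ (fun _ (u : sub_sspace S pU) => val u)) => //.
- by move=> u u' e; apply: val_inj; exact: e tt.
- move=> v u; have [N vN] := mod_trunc (act_module W) v (val u).
 by exists N => n /vN e; apply: val_inj.
Qed.

Definition sub_vmod : vmod := Vmod sub_act_module.
Definition sub_in u (Uu : U u) : sub_vmod := subspace_in S Uu.
Definition sub_incl (u : sub_vmod) : W := val u.
Lemma sub_inclK u (Uu : U u) : sub_incl (sub_in Uu) = u. by []. Qed.
Lemma sub_inclP u : U (sub_incl u). exact: subspace_valU. Qed.
Lemma sub_incl_inj : injective sub_incl. exact: val_inj. Qed.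
Lemma sub_incl_hom : ehom sub_incl.
by split=> [|w|a v n w _]; rewrite ?scale1r //; exact: val_linear. Qed.

Lemma sub_corestrict (W' : vmod) p (f : W' -> W) (fU : forall w, U (f w)) :
 is_hom p f -> is_hom p (fun w => sub_in (fU w)).
move=> [fl fp fa]; split=> [a u v|w|a v n w va]; apply: sub_incl_inj.
- by rewrite [RHS](hom_lin sub_incl_hom) !sub_inclK fl.
- by rewrite (linZ (hom_lin sub_incl_hom)) sub_inclK fp.
- by rewrite (linZ (hom_lin sub_incl_hom)) sub_inclK (fa a).
Qed.

Let qpar : quot_type S -> quot_type S := fun q => qpi S (par (val q)).
Let qparE w : qpar (qpi S w) = qpi S (par w).
apply/qpi_eq; rewrite -(linB (@par_linear _ W)).
exact/pU/(coset_reprP S).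
Qed.
Fact qpar_linear : linear qpar.
move=> a p q; have [[u ->] [v ->]] := (qpi_surj p, qpi_surj q).
by rewrite -(qpi_linear S a u v) !qparE par_linear (qpi_linear S).
Qed.
Fact qpar_invol : involutive qpar.
by move=> p; have [u ->] := qpi_surj p; rewrite !qparE par_invol. Qed.
Definition quot_sspace := Sspace qpar_linear qpar_invol.
Definition quot_act (v : V) n (q : quot_sspace) : quot_sspace := qpi S (act v n (val q)).
Let quot_actE v n w : qpi S (act v n w) = quot_act v n (qpi S w : quot_sspace).
apply/qpi_eq; rewrite -(linB (act_linr v n)).
by apply: aU; rewrite -opprB; apply: subN => //; exact: (coset_reprP S).
Qed.

Fact quot_act_module : is_module quot_act.
apply: (@module_of_surjective W _ _ (fun w => qpi S w : quot_sspace)) => //; first exact: qpi_linear.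
exact: qpi_surj.
Qed.

Definition quot_vmod : vmod := Vmod quot_act_module.
Definition quot_map (w : W) : quot_vmod := qpi S w.
Lemma quot_onto q : exists w, quot_map w = q.
by have [w ->] := qpi_surj (q : quot_type S); exists w. Qed.
Lemma quot_map0 w : quot_map w = 0 <-> U w.
exact: qpi0. Qed.
Lemma quot_map_hom : ehom quot_map.
split=> [|w|a v n w _]; rewrite ?scale1r; first exact: qpi_linear.
 by rewrite /quot_map -qparE.
exact: quot_actE.
Qed.

End Submodules.

Section Products.
Variables W1 W2 : vmod.
Let M := (W1 * W2)%type.
Let ppar (w : M) : M := (par w.1, par w.2).
Fact ppar_linear : linear ppar.
by move=> a u v; rewrite /ppar /= !par_linear. Qed.
Fact ppar_invol : involutive ppar.
by case=> u v; rewrite /ppar /= !par_invol. Qed.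
Definition prod_sspace : sspace R := Sspace ppar_linear ppar_invol.
Definition prod_act (v : V) n (w : prod_sspace) : prod_sspace := (act v n w.1, act v n w.2).

Fact prod_act_module : is_module prod_act.
apply: (@module_of_injective bool (fun b => if b then W1 else W2) prod_sspace _
 (fun b => if b return prod_sspace -> (if b then W1 else W2) then fst else snd)) => [[]|[]|[]|[u v] [u' v'] e|v [u u']].
all: try by [].
- by congr pair; [exact: e true|exact: e false].
- have [N vN] := mod_trunc (act_module W1) v u; have [N' vN'] := mod_trunc (act_module W2) v u'.
 exists (maxn N N') => n; rewrite geq_max => /andP[/vN e /vN' e'].
 by rewrite /prod_act /= e e'.
Qed.
Definition prod_vmod : vmod := Vmod prod_act_module.
Lemma fst_hom : ehom (fst : prod_vmod -> W1).
by split=> // *; rewrite scale1r. Qed.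
Lemma snd_hom : ehom (snd : prod_vmod -> W2).
by split=> // *; rewrite scale1r. Qed.
Lemma pair_hom (W : vmod) p (f : W -> W1) (g : W -> W2) : is_hom p f -> is_hom p g ->
 is_hom p (fun w => (f w, g w) : prod_vmod).
move=> [fl fp fa] [gl gp ga]; split=> [a u v|w|a v n w va].
- by rewrite fl gl.
- by rewrite fp gp.
- by rewrite (fa a) // (ga a).
Qed.

End Products.

Lemma hom_add (W1 W2 : vmod) p (f g : W1 -> W2) a : is_hom p f -> is_hom p g -> is_hom p (fun w => a *: f w + g w).
move=> [fl fp fa] [gl gp ga]; split=> [b u v|w|b v n w va].
- by rewrite fl gl; lmod_ring.
- by rewrite fp gp par_linear; lmod_ring.
- by rewrite (fa b) // (ga b) // act_linr; lmod_ring.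
Qed.

Lemma hom_zero (W1 W2 : vmod) p : is_hom p (fun _ : W1 => 0 : W2).
split=> [a u v|w|a v n w _]; first by rewrite scaler0 addr0.
 by rewrite par0 scaler0.
by rewrite act0r scaler0.
Qed.

Lemma submodule_ker (W1 W2 : vmod) p (f : W1 -> W2) : is_hom p f -> submodule [set w | f w = 0].
move=> [fl fp fa]; split=> [|a u v /= fu fv|u /= fu|v n u /= fu].
- exact: lin0.
- by rewrite fl fu fv scaler0 addr0.
- by rewrite fp fu par0 scaler0.
move: n; apply: (hmg_split (U := fun v => forall n, f (act v n u) = 0)) v => [|a v va n].
 split=> [n|a v v' fv fv' n]; first by rewrite act0l (lin0 fl).
 by rewrite act_linl fl fv fv' scaler0 addr0.
by rewrite (fa a) // fu act0r scaler0.
Qed.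

Lemma submod_image (W1 W2 : vmod) p (f : W1 -> W2) (U : set W1) : is_hom p f -> submodule U -> submodule (f @` U).
move=> [fl fp fa] sU; have [U0 Ul Up Ua] := sU.
have S : subspace (f @` U).
 split=> [|a _ _ [u Uu <-] [v Uv <-]]; first by exists 0 => //; exact: lin0.
 by exists (a *: u + v); [exact: Ul|exact: fl].
split; [by case: S|by case: S|move=> _ [u Uu <-]|move=> v n _ [u Uu <-]].
 exists ((-1) ^+ p *: par u); last by rewrite (linZ fl) fp signZ.
 by apply: (subZ (submod_sub sU)); exact: Up.
apply: (hmg_split (U := fun v => (f @` U) (act v n (f u)))) v => [|a v va].
 split=> [|a v v' fv fv']; first by rewrite act0l; exact: sub0.
 by rewrite act_linl; apply: (subD S) => //; exact: (subZ S).
exists ((-1) ^+ (p && a) *: act v n u); last by rewrite (linZ fl) (fa a) // signZ.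
by apply: (subZ (submod_sub sU)); exact: Ua.
Qed.

Lemma submodule_preim (W1 W2 : vmod) (f : W1 -> W2) (U : set W2) : ehom f ->
 submodule U -> submodule (f @^-1` U).
move=> [fl fp fa] sU; have [U0 Ul Up Ua] := sU.
have S : subspace (f @^-1` U) by split=> [|a u v Uu Uv]; rewrite /= ?(lin0 fl) // fl; exact: Ul.
split; [by case: S|by case: S|move=> u Uu|move=> v n u Uu].
 by rewrite /= fp scale1r; exact: Up.
apply: (hmg_split (U := fun v => (f @^-1` U) (act v n u))) v => [|a v va].
 split=> [|a v v' fv fv']; first by rewrite act0l; exact: sub0.
 by rewrite act_linl; apply: (subD S) => //; exact: (subZ S).
by rewrite /= (fa a) // scale1r; exact: Ua.
Qed.

Lemma submoduleI (W : vmod) (U U' : set W) : submodule U -> submodule U' -> submodule (U `&` U').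
move=> [a b c d] [a' b' c' d']; split=> // [x u v [? ?] [? ?]|u [? ?]|v n u [? ?]].
- by split; [exact: b|exact: b'].
- by split; [exact: c|exact: c'].
- by split; [exact: d|exact: d'].
Qed.

Lemma submoduleT (W : vmod) : submodule [set: W]. by []. Qed.
Lemma submodule0 (W : vmod) : submodule [set (0 : W)].
split=> // [a u v -> ->|u ->|v n u ->]; rewrite /= ?scaler0 ?addr0 //; first exact: par0.
exact: act0r.
Qed.

Lemma hom_factor (W1 W2 W3 : vmod) (f : W1 -> W3) (g : W1 -> W2) :
 ehom f -> ehom g -> onto g ->
 (forall u, g u = 0 -> f u = 0) -> exists2 h : W2 -> W3, ehom h & forall u, h (g u) = f u.
move=> [fl fp fa] [gl gp ga] gs fg; have [s sK] := choice gs.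
have sE u : f (s (g u)) = f u by apply/eqP; rewrite -subr_eq0 -(linB fl); apply/eqP/fg; rewrite (linB gl) sK subrr.
exists (fun w => f (s w)) => //; split=> [a u v|w|a v n w va].
- by rewrite -[in LHS](sK u) -[in LHS](sK v) -gl sE fl.
- by rewrite scale1r -[in LHS](sK w) -[par (g _)]scale1r -(gp (s w)) sE fp scale1r.
- by rewrite scale1r -[in LHS](sK w) -[act _ _ (g _)]scale1r -(ga a) // sE (fa a) // scale1r.
Qed.

End ModuleConstructions.

Section LinearAlgebra.
Variable K : fieldType.

Section Intertwined.
Variables (W1 W2 : lmodType K) (A : W1 -> W1) (B : W2 -> W2) (f : W1 -> W2).
Hypotheses (lf : linear f) (fA : forall w, f (A w) = B (f w)).
Lemma iter_eshift_map h n w : f (iter n (eshift A h) w) = iter n (eshift B h) (f w).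
by elim: n => // n IH; rewrite !iterS -IH /eshift (linB lf) (linZ lf) fA. Qed.
Lemma geigen_map h w : geigen A h w -> geigen B h (f w).
by move=> [n wn]; exists n; rewrite -iter_eshift_map wn (lin0 lf). Qed.
Lemma geigen_unmap h w : injective f -> geigen B h (f w) -> geigen A h w.
by move=> fi [n wn]; exists n; apply: fi; rewrite iter_eshift_map wn (lin0 lf). Qed.
End Intertwined.

(** Elimination: either the last coordinate can always be taken zero on P, or a vector [w0] of P
    with nonzero last coordinate reduces P to the span of the remaining vectors. *)
Lemma span_subspace (W : lmodType K) n (b : 'I_n -> W) (P : set W) : subspace P ->
 (forall w, P w -> exists c, w = \sum_(t < n) c t *: b t) -> exists m (b' : 'I_m -> W), (forall t, P (b' t)) /\
  forall w, P w -> exists c, w = \sum_(t < m) c t *: b' t.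
elim: n b P => [|n IH] b P sP Pb.
 exists 0%N, (fun _ => 0); split=> [[]//|w /Pb[c ->]]; exists (fun=> 0).
 by rewrite !big_ord0.
pose b0 (t : 'I_n) := b (widen_ord (leqnSn n) t).
pose P0 : set W := [set w | P w /\ exists c, w = \sum_(t < n) c t *: b0 t].
have sP0 : subspace P0.
 split=> [|a u v [Pu [c cu]] [Pv [d dv]]].
  split; first exact: sub0.
  by exists (fun=> 0); rewrite big1 // => t _; rewrite scale0r.
 split; first by case: sP => _; apply.
 exists (fun t => a * c t + d t); rewrite cu dv scaler_sumr -big_split.
 by apply: eq_bigr => t _ /=; rewrite scalerDl scalerA.
have [m [b' [P0b b'P]]] := IH b0 P0 sP0 (fun w => @proj2 _ _).
have [[w0 [c [Pw0 w0E c0]]]|no] := pselect (exists w0 c, [/\ P w0,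
  w0 = \sum_(t < n.+1) c t *: b t & c ord_max != 0]); last first.
 exists m, b'; split=> [t|w Pw]; first by case: (P0b t).
 apply: b'P; split=> //; have [c wE] := Pb w Pw.
 exists (fun t => c (widen_ord (leqnSn n) t)); rewrite wE big_ord_recr /=.
 have [->|c0] := eqVneq (c ord_max) 0; first by rewrite scale0r addr0.
 by case: no; exists w, c.
exists m.+1, (fun t => if unlift ord_max t is Some j then b' j else w0); split=> [t|w Pw].
 by case: unliftP => [j _|_] //; case: (P0b j).
have [d wE] := Pb w Pw; pose a := d ord_max / c ord_max.
have [|e eE] := b'P (w - a *: w0).
 split; first by apply: subB => //; exact: subZ.
 exists (fun t => d (widen_ord (leqnSn n) t) - a * c (widen_ord (leqnSn n) t)).
 rewrite wE w0E !big_ord_recr /= scalerDr scalerA divfK // opprD addrACA subrr addr0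
  scaler_sumr -sumrB; apply: eq_bigr => t _.
 by rewrite scalerBl scalerA.
exists (fun t => if unlift ord_max t is Some j then e j else a).
rewrite big_ord_recr /= unlift_none -[LHS](subrK (a *: w0)) eE; congr (_ + _).
apply: eq_bigr => t _; have -> : widen_ord (leqnSn m) t = lift ord_max t.
 by apply: val_inj; rewrite [RHS]lift_max.
by rewrite !liftK.
Qed.

End LinearAlgebra.

(** * Composition series, and closure of KL and O^fin under subobjects, quotients and products *)

Section Modules.
Context R (k : R[i]) (V : affine_vsa k).
Local Notation vmod := (vmod V).
Lemma L_lin (W : vmod) n : linear (LL W n).
exact: act_linr. Qed.

Section SpannedBy.
Variables (W : sspace R) (P : R[i] -> W -> Prop).
Hypothesis sP : forall h, subspace (P h).

Lemma spanned_subspace : subspace [set w : W | exists (s : seq R[i]) (u : R[i] -> W),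
 (forall h, P h (u h)) /\ w = \sum_(h <- s) u h].
have U w (s : seq R[i]) (u : R[i] -> W) : (forall h, P h (u h)) -> w = \sum_(h <- s) u h ->
  exists (s : seq R[i]) (u : R[i] -> W), [/\ (forall h, P h (u h)), uniq s,
   (forall h, h \notin s -> u h = 0) & w = \sum_(h <- s) u h].
 move=> Pu wE; exists (undup s), (fun h => u h *+ count_mem h s); split.
 - by move=> h; rewrite -scaler_nat; exact: subZ.
 - exact: undup_uniq.
 - by move=> h; rewrite mem_undup => /count_memPn ->.
 - by rewrite wE -big_undup_iterop_count; apply: eq_bigr => h _; rewrite Monoid.iteropE iter_addr_0.
split=> [|a w w' [s [u [Pu wE]]] [s' [u' [Pu' wE']]]].
 by exists [::], (fun=> 0); rewrite big_nil; split=> // h; exact: sub0.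
have {Pu wE} [s0 [v [Pv us v0 ->]]] := U _ _ _ Pu wE.
have {Pu' wE'} [s0' [v' [Pv' us' v0' ->]]] := U _ _ _ Pu' wE'.
have s1 : {subset s0 <= undup (s0 ++ s0')} by move=> h hs; rewrite mem_undup mem_cat hs.
have s2 : {subset s0' <= undup (s0 ++ s0')} by move=> h hs; rewrite mem_undup mem_cat hs orbT.
exists (undup (s0 ++ s0')), (fun h => a *: v h + v' h); split=> [h|].
 by case: (sP h) => _; apply.
rewrite big_split -scaler_sumr /=; congr (_ *: _ + _).
 exact: gdecomp_widen (undup_uniq _) s1 v0 (erefl _).
exact: gdecomp_widen (undup_uniq _) s2 v0' (erefl _).
Qed.

End SpannedBy.
Lemma geneig_sub (W : vmod) h : subspace (@geneig _ _ _ W h).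
exact: (geigen_subspace (L_lin (W := W) 0)). Qed.
Definition eigsub (W : sspace R) (op : W -> W) h : set W := [set u | op u = h *: u].

Lemma eigsub_subspace (W : sspace R) (op : W -> W) h : linear op -> subspace (eigsub op h).
move=> lo; split=> [|a u v]; rewrite /eigsub /= ?(lin0 lo) ?scaler0 //.
by rewrite lo => -> ->; rewrite scalerDr !scalerA mulrC.
Qed.

Lemma diag_span (W : sspace R) (op : W -> W) : diagble op -> gspanned op.
move=> D w; have [s [u [uh ->]]] := D w; exists s, u; split=> // h.
by exists 1%N; rewrite /= /eshift uh subrr.
Qed.

Lemma diag_gcomp (W : sspace R) (op : W -> W) w h : linear op -> diagble op -> eigsub op h (gcomp op w h).
move=> lo D; have [s [u [uh ->]]] := D w; have sp := diag_span D.
rewrite (lin_sum (gcomp_linear lo sp h)); apply: sub_sum; first exact: eigsub_subspace.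
move=> h' _; rewrite (gcomp_geigen lo sp (h := h')) /=; last by exists 1%N; rewrite /= /eshift uh subrr.
case: eqP => [->|_]; first exact: uh.
by apply: sub0; exact: eigsub_subspace.
Qed.

Section Chains.
Variable W : vmod.
(** Equality is allowed: images and preimages of a composition series may repeat terms, and
    [finite_lengthP] discards the repetitions. *)
Definition wcover (U U' : set W) := U `<=` U' /\ forall X, submodule X -> U `<=` X -> X `<=` U' -> X = U \/ X = U'.

Inductive chain (U : set W) : set W -> Prop :=
| chain_refl : chain U U
| chain_step X X' of chain U X & submodule X & submodule X' & wcover X X' : chain U X'.

Lemma chain_trans U X Z : chain U X -> chain X Z -> chain U Z.
by move=> UX; elim=> // Y Y' _ UY sY sY' YY'; exact: chain_step UY sY sY' YY'. Qed.

Lemma finite_lengthP : finite_length W <-> chain [set 0] setT.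
split=> [[n [F [F0 Fn sF Fc]]]|H].
 suff : forall i, (i <= n)%N -> chain [set 0] (F i) by rewrite -Fn; apply.
 elim=> [|i IH] ni; first by rewrite F0; exact: chain_refl.
 have [a _ c] := Fc i ni; apply: (chain_step (X := F i)); [exact/IH/ltnW|exact/sF/ltnW|exact: sF|].
 by split.
suff : forall X, chain [set 0] X -> submodule X -> exists n (F : nat -> set W),
 [/\ F 0%N = [set 0], F n = X, forall i, (i <= n)%N -> submodule (F i) & forall i, (i < n)%N ->
     [/\ F i `<=` F i.+1, F i <> F i.+1 & forall U, submodule U -> F i `<=` U -> U `<=` F i.+1 ->
        U = F i \/ U = F i.+1]].
 by move=> /(_ _ H (submoduleT W)).
move=> X; elim=> {X H} [s0|X X' _ IH sX sX' [XX' cX] _].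
 by exists 0%N, (fun=> [set 0]).
have [n [F [F0 Fn sF Fc]]] := IH sX.
have [<-|neq] := pselect (X = X'); first by exists n, F.
exists n.+1, (fun i => if (i <= n)%N then F i else X'); split=> //.
- by rewrite ltnn.
- by move=> i _; case: ifP => // /sF.
move=> i; rewrite ltnS => ni; rewrite ni; have [lt|] := ltnP i n; first exact: Fc.
move=> le; have -> : i = n by apply/eqP; rewrite eqn_leq ni.
by rewrite Fn; split.
Qed.

End Chains.

Section ChainMaps.
Variables (W1 W2 : vmod) (f : W1 -> W2).
Hypothesis hf : ehom f.
Let fl := hom_lin hf.

Lemma submoduleD (W : vmod) (X X' : set W) : submodule X -> submodule X' ->
 submodule [set w | exists x x', [/\ X x, X' x' & w = x + x']].
move=> [a b c d] [a' b' c' d']; split.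
- by exists 0, 0; rewrite addr0.
- move=> x _ _ [u [u' [Xu Xu' ->]]] [v [v' [Xv Xv' ->]]].
 exists (x *: u + v), (x *: u' + v'); split; [exact: b|exact: b'|lmod_ring].
- move=> _ [u [u' [Xu Xu' ->]]]; exists (par u), (par u').
 by split; [exact: c|exact: c'|exact: (linD (@par_linear _ W))].
- move=> v n _ [u [u' [Xu Xu' ->]]]; exists (act v n u), (act v n u').
 by split; [exact: d|exact: d'|exact: (linD (act_linr _ _))].
Qed.

(** For Z between the preimages, X + f(Z) lies between X and X', hence is one of them, and it
    determines Z. *)
Lemma wcover_preim X X' : submodule X -> submodule X' -> wcover X X' -> wcover (f @^-1` X) (f @^-1` X').
move=> sX sX' [XX' cX]; split=> [u /= /XX'//|Z sZ XZ ZX'].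
have [X0 _ _ _] := sX; have SX := submod_sub sX; have SZ := submod_sub sZ.
have := cX _ (submoduleD sX (submod_image hf sZ)) => -[||E|E].
- by move=> x Xx; exists x, 0; split; [|exists 0; [case: sZ|exact: lin0]|rewrite addr0].
- move=> _ [x [_ [Xx [z Zz <-] ->]]]; apply: (subD (submod_sub sX')); first exact: XX'.
 exact: ZX'.
- left; apply/seteqP; split=> // z Zz; rewrite /preimage /= -E; exists 0, (f z).
 by split; [|exists z|rewrite add0r].
right; apply/seteqP; split=> // u; rewrite /preimage /= -{1}E => -[x [_ [Xx [z Zz <-] fu]]].
have : (f @^-1` X) (u - z) by rewrite /preimage /= (linB fl) fu addrK.
by move=> /XZ h; rewrite -(subrK z u); exact: (subD SZ).
Qed.

Lemma wcover_image X X' : submodule X -> submodule X' -> wcover X X' -> wcover (f @` X) (f @` X').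
move=> sX sX' [XX' cX]; split=> [_ [u /XX' X'u <-]|Z sZ XZ ZX']; first by exists u.
have [||E|E] := cX _ (submoduleI (submodule_preim hf sZ) sX').
- by move=> x Xx; split; [apply: XZ; exists x|exact: XX'].
- by move=> x [].
- left; apply/seteqP; split=> // z Zz; have [x X'x fx] := ZX' z Zz; exists x => //.
 by rewrite -E; split=> //=; rewrite fx.
right; apply/seteqP; split=> [z /ZX'//|z [x]].
by rewrite -{1}E => -[fx _] <-; exact: fx.
Qed.

Lemma chain_preim U X : submodule U -> chain U X -> chain (f @^-1` U) (f @^-1` X).
move=> sU; elim=> [|Y Y' _ IH sY sY' YY']; first exact: chain_refl.
apply: (chain_step IH); [exact: submodule_preim|exact: submodule_preim|exact: wcover_preim].
Qed.

Lemma chain_image U X : submodule U -> chain U X -> chain (f @` U) (f @` X).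
move=> sU; elim=> [|Y Y' _ IH sY sY' YY']; first exact: chain_refl.
apply: (chain_step IH); [exact: submod_image hf sY|exact: submod_image hf sY'|exact: wcover_image].
Qed.

End ChainMaps.

Lemma finite_length_injective (W W' : vmod) (f : W' -> W) : ehom f -> injective f ->
 finite_length W -> finite_length W'.
move=> hf fi /finite_lengthP cW; apply/finite_lengthP.
have -> : [set (0 : W')] = f @^-1` [set 0].
 apply/seteqP; split=> x /=; first by move=> ->; exact: (lin0 (hom_lin hf)).
 by move=> fx; apply: fi; rewrite fx (lin0 (hom_lin hf)).
exact: (chain_preim hf (submodule0 W) cW).
Qed.

Lemma image0 (W W' : vmod) (f : W -> W') : ehom f -> f @` [set 0] = [set 0].
move=> hf; apply/seteqP; split=> x /=; first by move=> [_ -> <-]; exact: (lin0 (hom_lin hf)).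
by move=> ->; exists 0 => //; exact: (lin0 (hom_lin hf)).
Qed.

Lemma finite_length_surjective (W W' : vmod) (f : W -> W') : ehom f ->
 onto f -> finite_length W -> finite_length W'.
move=> hf fs /finite_lengthP cW; apply/finite_lengthP.
have -> : [set: W'] = f @` setT by apply/seteqP; split=> x // _; have [u <-] := fs x; exists u.
by rewrite -(image0 hf); exact: (chain_image hf (submodule0 W) cW).
Qed.

Lemma inl_hom (W1 W2 : vmod) : ehom (fun w : W1 => (w, 0) : prod_vmod W1 W2).
by apply: pair_hom; [exact: hom_id|exact: hom_zero]. Qed.
Lemma inr_hom (W1 W2 : vmod) : ehom (fun w : W2 => (0, w) : prod_vmod W1 W2).
by apply: pair_hom; [exact: hom_zero|exact: hom_id]. Qed.

Lemma finite_length_prod (W1 W2 : vmod) : finite_length W1 -> finite_length W2 -> finite_length (prod_vmod W1 W2).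
move=> /finite_lengthP c1 /finite_lengthP c2; apply/finite_lengthP.
have hi := inl_hom W1 W2; have hs := snd_hom W1 W2.
apply: chain_trans (chain_preim hs (submodule0 W2) c2).
rewrite -(image0 hi); have -> : (snd : prod_vmod W1 W2 -> W2) @^-1` [set 0] =
  (fun w : W1 => (w, 0) : prod_vmod W1 W2) @` setT.
 apply/seteqP; split=> [[u v]|_ [w _ <-]] //.
 by rewrite /preimage /= => ->; exists u.
exact: (chain_image hi (submodule0 W1) c1).
Qed.

Lemma KL_span (W : vmod) : KL W -> gspanned (LL W 0).
by case. Qed.

Section Closure.
Lemma hom_L0 (W W' : vmod) p (f : W -> W') w : is_hom p f -> f (L 0 w) = L 0 (f w).
exact: hom_L. Qed.

(** The image is L_0-stable, so it contains the weight components of its vectors, and these lift. *)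
Lemma KL_injective (W W' : vmod) (f : W' -> W) : ehom f -> injective f -> KL W -> KL W'.
move=> hf fi KW; have [fW sW dW bW] := KW; have fl := hom_lin hf.
have fL w : f (L 0 w) = L 0 (f w) := hom_L0 w hf.
have lL := L_lin (W := W) 0.
have sI : subspace (f @` setT) := submod_sub (submod_image hf (submoduleT W')).
have LI u : (f @` setT) u -> (f @` setT) (L 0 u) by move=> [v _ <-]; exists (L 0 v).
split; first exact: finite_length_injective hf fi fW.
- move=> w; have H h : exists u, f u = gcomp (LL W 0) (f w) h.
  by have [|u _ fu] := gcomp_sub lL sW h sI LI (w := f w); [exists w|exists u].
 have [u fu] := choice H; have [_ [s [_ _ wE]]] := gcompP lL sW (f w).
 exists s, u; split=> [h|]; last by apply: fi; rewrite wE (lin_sum fl); apply: eq_bigr => h _; rewrite fu.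
 apply: (geigen_unmap fl fL) fi _; rewrite fu; exact: gcomp_gen.
- move=> h; have [n [b bP]] := dW h; pose P := f @` (@geneig _ _ _ W' h).
 have [|w [u uh <-]|m [b' [Pb' b'P]]] := @span_subspace _ _ n b P.
 + split=> [|a _ _ [u uh <-] [v vh <-]]; first by exists 0; [exact: sub0 (geneig_sub _ _)|exact: lin0].
  by exists (a *: u + v); [case: (geneig_sub W' h) => _; apply|exact: fl].
 + exact/bP/(geigen_map fl fL uh).
 have [c cP] := choice (fun t => let: ex_intro2 u _ e := Pb' t in ex_intro (fun u => f u = b' t) u e).
 exists m, c => w wh; have [|d dE] := b'P (f w); first by exists w.
 exists d; apply: fi; rewrite dE (lin_sum fl); apply: eq_bigr => t _.
 by rewrite (linZ fl) cP.
move=> h; have [N NP] := bW h; exists N => n Nn w wh; apply: fi; rewrite (lin0 fl).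
exact: NP Nn _ (geigen_map fl fL wh).
Qed.

Lemma KL_surjective (W W' : vmod) (f : W -> W') : ehom f -> onto f -> KL W -> KL W'.
move=> hf fs KW; have [fW sW dW bW] := KW; have fl := hom_lin hf.
have fL w : f (L 0 w) = L 0 (f w) := hom_L0 w hf.
have lL := L_lin (W := W) 0; have lL' := L_lin (W := W') 0.
have sW' : spanned_by (@geneig _ _ _ W').
 move=> w; have [v <-] := fs w; have [s [u [uh ->]]] := sW v.
 by exists s, (fun h => f (u h)); rewrite (lin_sum fl); split=> // h; exact: (geigen_map fl fL (uh h)).
(* A preimage is projected to weight h; by uniqueness of decompositions f commutes with this
   projection. *)
have lift h w : geneig h w -> exists2 u, geneig h u & f u = w.
 move=> wh; have [v vw] := fs w; exists (gcomp (LL W 0) v h); first exact: gcomp_gen.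
 have [g [s [us s0 vE]]] := gcompP lL sW v.
 have D : gdecomp (LL W' 0) w (fun h => f (gcomp (LL W 0) v h)).
  split=> [h'|]; first exact: (geigen_map fl fL (g h')).
  exists s; split=> // [h' /s0 ->|]; first exact: lin0.
  by rewrite -vw {1}vE (lin_sum fl).
 rewrite -[LHS]/((fun h => f (gcomp (LL W 0) v h)) h).
 rewrite (gdecomp_uniq lL' D (gcompP lL' sW' w)).
 by rewrite (gcomp_geigen lL' sW' _ wh) eqxx.
split=> //; first exact: finite_length_surjective hf fs fW.
- move=> h; have [n [b bP]] := dW h; exists n, (fun t => f (b t)) => w /lift[u uh <-].
 have [c ->] := bP u uh; exists c; rewrite (lin_sum fl); apply: eq_bigr => t _.
 by rewrite (linZ fl).
- move=> h; have [N NP] := bW h; exists N => n Nn w /lift[u uh <-].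
 by rewrite (NP n Nn u uh) (lin0 fl).
Qed.

Lemma KL_prod (W1 W2 : vmod) : KL W1 -> KL W2 -> KL (prod_vmod W1 W2).
move=> [f1 s1 d1 b1] [f2 s2 d2 b2]; split; first exact: finite_length_prod.
- have hl := inl_hom W1 W2; have hr := inr_hom W1 W2.
 have S := spanned_subspace (fun h => @geneig_sub (prod_vmod W1 W2) h).
 case=> w1 w2; have -> : (w1, w2) = (w1, 0) + (0, w2) :> prod_vmod W1 W2.
  by congr pair; rewrite ?addr0 ?add0r.
 apply: (subD S).
 + have [s [u [uh ->]]] := s1 w1; exists s, (fun h => (u h, 0) : prod_vmod W1 W2); split.
   by move=> h; exact: (geigen_map (hom_lin hl) (fun w => hom_L0 w hl) (uh h)).
  exact: (lin_sum (hom_lin hl)).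
 + have [s [u [uh ->]]] := s2 w2; exists s, (fun h => (0, u h) : prod_vmod W1 W2); split.
   by move=> h; exact: (geigen_map (hom_lin hr) (fun w => hom_L0 w hr) (uh h)).
  exact: (lin_sum (hom_lin hr)).
- have hf := fst_hom W1 W2; have hs := snd_hom W1 W2.
 move=> h; have [n [c cP]] := d1 h; have [m [d dP]] := d2 h.
 pose b t : prod_vmod W1 W2 := match fintype.split t with inl i => (c i, 0) | inr i => (0, d i) end.
 exists (n + m)%N, b.
 move=> w wh; have [x xE] := cP w.1 (geigen_map (hom_lin hf) (fun w => hom_L0 w hf) wh).
 have [y yE] := dP w.2 (geigen_map (hom_lin hs) (fun w => hom_L0 w hs) wh).
 exists (fun t => match fintype.split t with inl i => x i | inr i => y i end).
 rewrite big_split_ord /=; have E1 : \sum_(i < n) x i *: ((c i, 0) : prod_vmod W1 W2) = (w.1, 0).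
  rewrite xE [RHS](lin_sum (hom_lin (inl_hom W1 W2))); apply: eq_bigr => i _.
  by rewrite (linZ (hom_lin (inl_hom W1 W2))).
 have E2 : \sum_(i < m) y i *: ((0, d i) : prod_vmod W1 W2) = (0, w.2).
  rewrite yE [RHS](lin_sum (hom_lin (inr_hom W1 W2))); apply: eq_bigr => i _.
  by rewrite (linZ (hom_lin (inr_hom W1 W2))).
 have -> : w = (w.1, 0) + (0, w.2) :> prod_vmod W1 W2
  by case: w {wh xE yE E1 E2} => u v; congr pair; rewrite ?addr0 ?add0r.
 rewrite -E1 -E2; congr (_ + _); apply: eq_bigr => i _.
  by rewrite /b (unsplitK (inl i)).
 by rewrite /b (unsplitK (inr i)).
- have hf := fst_hom W1 W2; have hs := snd_hom W1 W2.
 move=> h; have [N NP] := b1 h; have [M MP] := b2 h; exists (maxn N M) => n.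
 rewrite geq_max => /andP[Nn Mn] w wh.
 have e1 := NP n Nn w.1 (geigen_map (hom_lin hf) (fun w => hom_L0 w hf) wh).
 have e2 := MP n Mn w.2 (geigen_map (hom_lin hs) (fun w => hom_L0 w hs) wh).
 by rewrite [w]surjective_pairing e1 e2.
Qed.

Section DiagClosure.
Variable a : gl11.
Let op (W : vmod) : W -> W := @act _ _ W (gen V a) 0.
Let op_lin W : linear (@op W). exact: act_linr. Qed.
Let op_hom (W W' : vmod) (f : W -> W') w : ehom f -> f (op w) = op (f w).
by move=> hf; rewrite /op; have := hom_mode a 0 w hf; rewrite scale1r. Qed.

Lemma diag_injective (W W' : vmod) (f : W' -> W) : ehom f -> injective f ->
 diagble (@op W) -> diagble (@op W').
move=> hf fi D w; have fl := hom_lin hf.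
have sW := diag_span D; have lW := @op_lin W.
have sI : subspace (f @` setT) := submod_sub (submod_image hf (submoduleT W')).
have LI u : (f @` setT) u -> (f @` setT) (op u) by move=> [v _ <-]; exists (op v) => //; exact: op_hom.
have H h : exists u, f u = gcomp (@op W) (f w) h
 by have [|u _ fu] := gcomp_sub lW sW h sI LI (w := f w); [exists w|exists u].
have [u fu] := choice H; have [_ [s [_ _ wE]]] := gcompP lW sW (f w).
exists s, u; split=> [h|]; last by apply: fi; rewrite wE (lin_sum fl); apply: eq_bigr => h _; rewrite fu.
by apply: fi; rewrite (linZ fl) op_hom // fu; exact: diag_gcomp.
Qed.

Lemma diag_surjective (W W' : vmod) (f : W -> W') : ehom f ->
 onto f -> diagble (@op W) -> diagble (@op W').
move=> hf fs D w; have fl := hom_lin hf; have [v <-] := fs w; have [s [u [uh ->]]] := D v.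
exists s, (fun h => f (u h)); rewrite (lin_sum fl); split=> // h.
by rewrite -op_hom // uh (linZ fl).
Qed.

Lemma diag_prod (W1 W2 : vmod) : diagble (@op W1) -> diagble (@op W2) ->
 diagble (@op (prod_vmod W1 W2)).
have hl := inl_hom W1 W2; have hr := inr_hom W1 W2.
move=> s1 s2; have S := spanned_subspace (fun h => eigsub_subspace h (@op_lin (prod_vmod W1 W2))).
case=> w1 w2; have -> : (w1, w2) = (w1, 0) + (0, w2) :> prod_vmod W1 W2.
 by congr pair; rewrite ?addr0 ?add0r.
apply: (subD S).
+ have [s [u [uh ->]]] := s1 w1; exists s, (fun h => (u h, 0) : prod_vmod W1 W2); split.
  by move=> h; have := congr1 (fun w : W1 => (w, 0) : prod_vmod W1 W2) (uh h); rewrite (op_hom _ hl) (linZ (hom_lin hl)).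
 exact: (lin_sum (hom_lin hl)).
+ have [s [u [uh ->]]] := s2 w2; exists s, (fun h => (0, u h) : prod_vmod W1 W2); split.
  by move=> h; have := congr1 (fun w : W2 => (0, w) : prod_vmod W1 W2) (uh h); rewrite (op_hom _ hr) (linZ (hom_lin hr)).
 exact: (lin_sum (hom_lin hr)).
Qed.

End DiagClosure.

Lemma Ofin_injective (W W' : vmod) (f : W' -> W) : ehom f -> injective f -> Ofin W -> Ofin W'.
move=> hf fi [a b c]; split; [exact: KL_injective hf fi a|exact: (diag_injective (a := gN) hf fi b)|].
exact: (diag_injective (a := gE) hf fi c).
Qed.

Lemma Ofin_surjective (W W' : vmod) (f : W -> W') : ehom f ->
 onto f -> Ofin W -> Ofin W'.
move=> hf fi [a b c]; split; [exact: KL_surjective hf fi a|exact: (diag_surjective (a := gN) hf fi b)|].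
exact: (diag_surjective (a := gE) hf fi c).
Qed.

Lemma Ofin_prod (W1 W2 : vmod) : Ofin W1 -> Ofin W2 -> Ofin (prod_vmod W1 W2).
move=> [a b c] [a' b' c']; split; [exact: KL_prod|exact: (diag_prod (a := gN))|].
exact: (diag_prod (a := gE)).
Qed.

End Closure.
End Modules.

(** * Exponentials of locally nilpotent operators and the twist *)

Section ComplexExponential.
Variable R : realType.

Lemma expCD (a b : R[i]) : expC (a + b) = expC a * expC b.
case: a b => [a a'] [b b']; rewrite /expC /= expRD cosD sinD.
by apply/eqP; rewrite eq_complex /=; apply/andP; split; apply/eqP; ring.
Qed.

Lemma expC0 : expC (0 : R[i]) = 1.
by rewrite /expC /= expR0 cos0 sin0; apply/eqP; rewrite eq_complex /= !mulr0 mul0r mulr1 subr0 ?addr0 !eqxx.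
Qed.

Lemma expC_neq0 (a : R[i]) : expC a != 0.
apply/eqP => a0; have := expCD a (- a); rewrite subrr expC0 a0 mul0r => /eqP.
by rewrite oner_eq0.
Qed.

Lemma expC_piI : expC (piI R) = -1.
rewrite /expC /= expR0 cospi sinpi; apply/eqP; rewrite eq_complex /= !mulr0 mul0r mul1r subr0 addr0.
by rewrite oppr0 !eqxx.
Qed.

Lemma expC_piIn (n : nat) : expC (piI R * n%:R) = (-1) ^+ n.
elim: n => [|n IH]; first by rewrite mulr0 expC0.
by rewrite -addn1 natrD mulrDr mulr1 expCD IH expC_piI exprD expr1.
Qed.

Lemma expC_2piIz (n : int) : expC (2%:R * piI R * n%:~R) = 1.
have E (m : nat) : expC (2%:R * piI R * m%:R) = 1 :> R[i] by rewrite mulrAC mulrC -natrM expC_piIn exprM sqrrN !expr1n.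
case: n => n; first exact: E.
rewrite NegzE mulrNz mulrN; have := expCD (2%:R * piI R * n.+1%:R) (- (2%:R * piI R * n.+1%:R)).
by rewrite subrr expC0 E mul1r.
Qed.

End ComplexExponential.

Section CommutingExponentials.
Variables (K : numFieldType) (W : lmodType K).

Section Two.
Variable H : nat -> nat -> W.

Lemma binomial_step n : \sum_(i < n.+1) 'C(n, i)%:R *: (H i.+1 (n - i)%N + H i (n - i).+1) =
 \sum_(i < n.+2) 'C(n.+1, i)%:R *: H i (n.+1 - i)%N.
rewrite [RHS]big_ord_recl /= bin0 subn0.
under [X in _ = _ + X]eq_bigr => i _.
 rewrite /bump /= add1n subSS binS natrD scalerDl; over.
rewrite big_split /=; under [LHS]eq_bigr => i _ do rewrite scalerDr.
rewrite big_split /= addrC addrA; congr (_ + _).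
rewrite big_ord_recl /= bin0 subn0 [in RHS]big_ord_recr /= bin_small // scale0r addr0.
congr (_ + _); apply: eq_bigr => i _; rewrite /bump /= add1n; congr (_ *: H _ _).
by rewrite subnSK.
Qed.

Lemma iter_binomial (N : W -> W) : linear N -> (forall l r, N (H l r) = H l.+1 r + H l r.+1) ->
 forall n, iter n N (H 0%N 0%N) = \sum_(i < n.+1) 'C(n, i)%:R *: H i (n - i)%N.
move=> lN NH; elim=> [|n IH]; first by rewrite big_ord1 scale1r.
rewrite iterS IH (lin_sum lN) -binomial_step; apply: eq_bigr => i _.
by rewrite (linZ lN) NH.
Qed.

End Two.
Definition fexp (s : K) (N : W -> W) (u : W) : W := (\fs_m (s ^+ m / m`!%:R) *: iter m N u).
Lemma fact_neq0 n : n`!%:R != 0 :> K.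
by rewrite pnatr_eq0 -lt0n fact_gt0. Qed.

Lemma expr_binomial (s : K) i j : s ^+ (i + j) / (i + j)`!%:R * 'C(i + j, i)%:R = s ^+ i / i`!%:R * (s ^+ j / j`!%:R).
have := congr1 (fun n => n%:R : K) (bin_fact (leq_addr j i)); rewrite addKn /= !natrM => E.
rewrite exprD -E; field; rewrite !fact_neq0 /=.
by rewrite pnatr_eq0 -lt0n bin_gt0 leq_addr.
Qed.

Lemma fexp2 (s : K) (N : W -> W) (H : nat -> nat -> W) : linear N ->
 (forall l r, N (H l r) = H l.+1 r + H l r.+1) -> fin2 H -> fexp s N (H 0%N 0%N) =
 \fs_i (s ^+ i / i`!%:R) *: (\fs_j (s ^+ j / j`!%:R) *: H i j).
move=> lN NH fH.
transitivity (\fs_i \fs_j (s ^+ i / i`!%:R * (s ^+ j / j`!%:R)) *: H i j).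
 rewrite fsum_diag; last exact: fin2Z.
 apply: eq_fsum => m; rewrite (iter_binomial lN NH) scaler_sumr; apply: eq_bigr => i _.
 have im : (i <= m)%N by rewrite -ltnS.
 by rewrite scalerA -expr_binomial subnKC.
apply: eq_fsum => i; rewrite -fsumZ; last exact/fin1Z/fin2_row.
by apply: eq_fsum => j; rewrite scalerA.
Qed.

(** The exponential of a sum of three commuting index shifts factors. In [int_fexp] the shifts are
    the nilpotent parts of L_0 on the two arguments and differentiation by log x. *)
Lemma fexp3 (s : K) (N : W -> W) (F : nat -> nat -> nat -> W) : linear N ->
 (forall a b t, N (F a b t) = F a.+1 b t + F a b.+1 t + F a b t.+1) ->
 (exists M, forall a b t, [|| M <= a, M <= b | M <= t]%N -> F a b t = 0) -> fexp s N (F 0%N 0%N 0%N) =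
 \fs_i (s ^+ i / i`!%:R) *: (\fs_j (s ^+ j / j`!%:R) *:
  (\fs_t (s ^+ t / t`!%:R) *: F i j t)).
move=> lN NF [M FM].
pose G i n := \sum_(l < n.+1) 'C(n, l)%:R *: F i l (n - l)%N.
have NG i n : N (G i n) = G i.+1 n + G i n.+1.
 rewrite /G -[in RHS](binomial_step (F i)) (lin_sum lN) -big_split; apply: eq_bigr => l _ /=.
 by rewrite (linZ lN) NF; lmod_ring.
have fG : fin2 G.
 exists (M + M + M)%N => i n h; rewrite /G big1 // => l _; rewrite FM ?scaler0 //.
 by have := ltn_ord l; lia.
have -> : F 0%N 0%N 0%N = G 0%N 0%N by rewrite /G big_ord1 scale1r.
rewrite (fexp2 s lN NG fG); apply: eq_fsum => i; congr (_ *: _).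
have fF : fin2 (F i) by exists (M + M)%N => j t h; apply: FM; lia.
transitivity (\fs_j \fs_t (s ^+ j / j`!%:R * (s ^+ t / t`!%:R)) *: F i j t).
 rewrite fsum_diag; last exact: fin2Z.
 apply: eq_fsum => n; rewrite scaler_sumr; apply: eq_bigr => l _.
 have ln : (l <= n)%N by rewrite -ltnS.
 by rewrite scalerA -expr_binomial subnKC.
apply: eq_fsum => j; rewrite -fsumZ; last exact/fin1Z/fin2_row.
by apply: eq_fsum => t; rewrite scalerA.
Qed.

End CommutingExponentials.

Section Tensor.
Context R (k : R[i]) (hk : k != 0) (V : affine_vsa k).

Section Intertwiners.
Variables (W1 W2 W3 : vmod V) (q : bool) (Y : log_modes W1 W2 W3).
Hypothesis HY : intertwining q Y.
Lemma int_fin w1 w2 h j : fin1 (fun i => Y w1 (h + i%:R) j w2).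
by have [N YN] := int_trunc HY w1 w2 h; exists N => i Ni; exact: YN. Qed.

Lemma int_comp (W4 : vmod V) p (f : W3 -> W4) : is_hom p f -> intertwining (p (+) q) (fun w1 h j w2 => f (Y w1 h j w2)).
move=> [fl fp fa]; split.
- by move=> h j w2 a u v; rewrite (int_linl HY) fl.
- by move=> w1 h j a u v; rewrite (int_linr HY) fl.
- move=> w1 h j w2; have -> : par (f (Y w1 h j w2)) = (-1) ^+ p *: f (par (Y w1 h j w2)).
  by rewrite fp signZ.
 by rewrite (int_par HY) (linZ fl) scalerA signr_addb.
- move=> w1 w2 h; have [N YN] := int_trunc HY w1 w2 h.
 by exists N => n j /YN ->; rewrite (lin0 fl).
- move=> w1 w2 h; have [N YN] := int_log HY w1 w2 h.
 by exists N => j /YN ->; rewrite (lin0 fl).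
- move=> h j a b v w1 w2 m n l va w1b.
 have := congr1 f (int_borcherds HY h j w2 m n l va w1b).
 have [N YN] := int_fin w1 w2 (h + l%:~R) j.
 have YN' i : (N <= i)%N -> Y w1 (h + (l + i%:Z)%:~R) j w2 = 0 by move=> Ni; rewrite intrD addrA; exact: YN.
 rewrite (fsum_lin fl); last first.
  fin_of (act_fin v w1 n).
  by rewrite (lin0 (int_linl HY _ _ _)) scaler0.
 rewrite (fsum_lin fl); last first.
  have [M vM] := act_fin v w2 m; exists (maxn N M) => i; rewrite geq_max => /andP[/YN' -> /vM ->].
  by rewrite act0r (lin0 (int_linr HY _ _ _)) !scaler0 subr0 scaler0.
 have E i : f (binz R m i *: Y (act v (n + i%:Z) w1) (h + (m + l - i%:Z)%:~R) j w2) =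
  binz R m i *: f (Y (act v (n + i%:Z) w1) (h + (m + l - i%:Z)%:~R) j w2) by rewrite (linZ fl).
 move=> H; rewrite -[LHS](eq_fsum E) [LHS]H; apply: eq_fsum => i.
 rewrite (linZ fl) (linB fl) !(linZ fl) (fa a) // scalerA -signr_addb.
 by rewrite (_ : q && a (+) p && a = (p (+) q) && a) //; case: (p) (q) (a) => [] [] [].
- by move=> w1 h j w2; rewrite (int_deriv HY) fl !(linZ fl).
Qed.

Lemma int_descend (A : vmod V) (g : W1 -> A) (s : A -> W1) : ehom g -> (forall a, g (s a) = a) ->
 (forall w1 h j w2, g w1 = 0 -> Y w1 h j w2 = 0) -> intertwining q (fun a h j w2 => Y (s a) h j w2).
move=> [gl gp ga] sK Y0.
have YE w1 h j w2 : Y (s (g w1)) h j w2 = Y w1 h j w2.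
 apply/eqP; rewrite -subr_eq0 -(linB (int_linl HY _ _ _)); apply/eqP/Y0.
 by rewrite (linB gl) sK subrr.
split.
- move=> h j w2 a u v; rewrite -(sK u) -(sK v) -gl !YE; exact: (int_linl HY).
- move=> a h j; exact: (int_linr HY).
- move=> w1 h j w2; rewrite (int_par HY) -(YE (par _)) -(sK w1) gp scale1r.
 by rewrite !sK.
- move=> w1 w2 h; exact: (int_trunc HY).
- move=> w1 w2 h; exact: (int_log HY).
- move=> h j a b v w1 w2 m n l va w1b.
 pose y := hproj b (s w1); have gy : g y = w1.
  by rewrite /y /hproj (linZ gl) (linD gl) (linZ gl) gp sK scale1r; exact: hproj_id.
 have := int_borcherds HY h j w2 m n l va (hproj_hmg b (s w1)); rewrite -/y => H.
 rewrite -gy.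
 under eq_fsbigr => i _.
  rewrite -[act _ _ (g y)]scale1r -[1]/((-1) ^+ (false && a)) -ga // YE.
  over.
 rewrite [LHS]H; apply: eq_fsbigr => i _; by rewrite !YE.
- move=> w1 h j w2; have -> : L (-1) w1 = g (L (-1) (s w1)).
  by have := hom_L (-1) (s w1) (And3 gl gp ga); rewrite sK => ->.
 by rewrite YE (int_deriv HY).
Qed.

Section GeneralizedWeights.
Variables (h1 h2 : R[i]) (w1 : W1) (w2 : W2) (h : R[i]) (j : nat).
Let N1 := eshift (LL W1 0) h1.
Let N2 := eshift (LL W2 0) h2.
Let c := h1 + h2 - h - 1.
Let N := eshift (LL W3 0) c.
(** The quotient of factorials absorbs the factor j + 1 that L_0 produces with each further
    logarithm, so that L_0 minus its eigenvalue acts by three plain shifts. *)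
Let F a b t := ((j + t)`!%:R / j`!%:R) *: Y (iter a N1 w1) h (j + t)%N (iter b N2 w2).
Let NF a b t : N (F a b t) = F a.+1 b t + F a b.+1 t + F a b t.+1.
have Yl := int_linl HY; have Yr := int_linr HY.
have E1 u v jj : Y (N1 u) h jj v = Y (L 0 u) h jj v - h1 *: Y u h jj v
 by rewrite /N1 /eshift (linB (Yl _ _ _)) (linZ (Yl _ _ _)).
have E2 u v jj : Y u h jj (N2 v) = Y u h jj (L 0 v) - h2 *: Y u h jj v
 by rewrite /N2 /eshift (linB (Yr _ _ _)) (linZ (Yr _ _ _)).
have j0 := fact_neq0 R[i] j.
rewrite /N /eshift /F (linZ (L_lin _)) (int_L0_comm HY) !iterS E1 E2 addnS factS natrM /c.
have -> : ((j + t).+1%:R * (j + t)`!%:R / j`!%:R) = ((j + t)`!%:R / j`!%:R) * (j + t).+1%:R :> R[i]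
 by rewrite [_%:R * _]mulrC mulrAC.
by move: (_ / j`!%:R) => x; lmod_ring.
Qed.

Hypotheses (w1h : geneig h1 w1) (w2h : geneig h2 w2).
Let Fvan : exists M, forall a b t, [|| M <= a, M <= b | M <= t]%N -> F a b t = 0.
have [M1 w1M] := w1h; have [M2 w2M] := w2h.
have van (W : vmod V) hh (w : W) M m : iter M (eshift (LL W 0) hh) w = 0 -> (M <= m)%N ->
  iter m (eshift (LL W 0) hh) w = 0.
 move=> e /subnK <-; rewrite iterD e; apply: lin0; apply: eshift_lin; exact: L_lin.
have J a b : exists J, forall jj, (J <= jj)%N -> Y (iter a N1 w1) h jj (iter b N2 w2) = 0.
 exact: (int_log HY).
have [J0 JP] : exists J0, forall a b jj, (a < M1)%N -> (b < M2)%N -> (J0 <= jj)%N ->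
  Y (iter a N1 w1) h jj (iter b N2 w2) = 0.
 elim: M1 {w1M} => [|m [J1 J1P]]; first by exists 0%N.
 have [J2 J2P] : exists J2, forall b jj, (b < M2)%N -> (J2 <= jj)%N -> Y (iter m N1 w1) h jj (iter b N2 w2) = 0.
  elim: M2 {w2M J1P} => [|m' [J2 J2P]]; first by exists 0%N.
  have [J3 J3P] := J m m'; exists (maxn J2 J3) => b jj.
  rewrite ltnS leq_eqVlt geq_max => /orP[/eqP ->|bm] /andP[? ?]; [exact: J3P|exact: J2P].
 exists (maxn J1 J2) => a b jj.
 rewrite ltnS leq_eqVlt geq_max => /orP[/eqP ->|am] bM /andP[? ?]; [exact: J2P|exact: J1P].
exists (M1 + M2 + J0)%N => a b t h'.
have [aM|aM] := leqP M1 a.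
 by rewrite /F (van _ _ _ _ _ w1M aM) (lin0 (int_linl HY _ _ _)) scaler0.
have [bM|bM] := leqP M2 b.
 by rewrite /F (van _ _ _ _ _ w2M bM) (lin0 (int_linr HY _ _ _)) scaler0.
rewrite /F JP ?scaler0 //; lia.
Qed.

Lemma int_geneig : geneig c (Y w1 h j w2).
have lN : linear N by exact/shift_linear/L_lin.
have [M FM] := Fvan; exists (M + M + M)%N; rewrite -/N.
have -> : Y w1 h j w2 = F 0%N 0%N 0%N by rewrite /F addn0 divff ?scale1r //; exact: fact_neq0.
pose G i n := \sum_(l < n.+1) 'C(n, l)%:R *: F i l (n - l)%N.
have NG i n : N (G i n) = G i.+1 n + G i n.+1.
 rewrite /G -[in RHS](binomial_step (F i)) (lin_sum lN) -big_split; apply: eq_bigr => l _ /=.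
 by rewrite (linZ lN) NF; lmod_ring.
have -> : F 0%N 0%N 0%N = G 0%N 0%N by rewrite /G big_ord1 scale1r.
rewrite (iter_binomial lN NG) big1 // => i _; rewrite /G big1 ?scaler0 // => l _.
by rewrite FM ?scaler0 //; have := ltn_ord l; have := ltn_ord i; lia.
Qed.

(** The binomial sum is the coefficient of (log x)^j after the substitution log x -> log x + s. *)
Lemma int_fexp s : fexp s N (Y w1 h j w2) =
 \fs_t ('C(j + t, j)%:R * s ^+ t) *: Y (fexp s N1 w1) h (j + t)%N (fexp s N2 w2).
have lN : linear N by exact/shift_linear/L_lin.
have -> : Y w1 h j w2 = F 0%N 0%N 0%N by rewrite /F addn0 divff ?scale1r //; exact: fact_neq0.
rewrite (fexp3 s lN NF Fvan); have [M1 w1M] := w1h; have [M2 w2M] := w2h; have [M FM] := Fvan.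
have van (W : vmod V) hh (w : W) x m : iter x (eshift (LL W 0) hh) w = 0 -> (x <= m)%N ->
  iter m (eshift (LL W 0) hh) w = 0.
 move=> e /subnK <-; rewrite iterD e; apply: lin0; apply: eshift_lin; exact: L_lin.
have E1 : fexp s N1 w1 = \sum_(i < M1) (s ^+ i / i`!%:R) *: iter i N1 w1
 by rewrite /fexp (fsumE (N := M1)) // => i /(van _ _ _ _ _ w1M) ->; rewrite scaler0.
have E2 : fexp s N2 w2 = \sum_(i < M2) (s ^+ i / i`!%:R) *: iter i N2 w2
 by rewrite /fexp (fsumE (N := M2)) // => i /(van _ _ _ _ _ w2M) ->; rewrite scaler0.
rewrite E1 E2 (fsumE (N := M1)) => [|i iM]; last first.
 rewrite (fsum_eq0 (f := fun j0 => _)) ?scaler0 // => b; rewrite (fsum_eq0 (f := fun t => _)) ?scaler0 // => t.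
 by rewrite /F (van _ _ _ _ _ w1M iM) (lin0 (int_linl HY _ _ _)) !scaler0.
under eq_bigr => i _.
 rewrite (fsumE (N := M2)) => [|b bM]; last first.
  rewrite (fsum_eq0 (f := fun t => _)) ?scaler0 // => t.
  by rewrite /F (van _ _ _ _ _ w2M bM) (lin0 (int_linr HY _ _ _)) !scaler0.
 over.
symmetry.
have Yf i b : fin1 (fun t => Y (iter i N1 w1) h (j + t)%N (iter b N2 w2)).
 have [J YJ] := int_log HY (iter i N1 w1) (iter b N2 w2) h; exists J => t Jt.
 by apply: YJ; lia.
transitivity (fsum (fun t => \sum_(i < M1) \sum_(b < M2) (s ^+ i / i`!%:R * (s ^+ b / b`!%:R)
  * ('C(j + t, j)%:R * s ^+ t)) *: Y (iter i N1 w1) h (j + t)%N (iter b N2 w2))).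
 apply: eq_fsum => t; rewrite (lin_sum (int_linl HY _ _ _)) scaler_sumr; apply: eq_bigr => i _.
 rewrite (lin_sum (int_linr HY _ _ _)) scaler_sumr; apply: eq_bigr => b _.
 by rewrite (linZ (int_linl HY _ _ _)) (linZ (int_linr HY _ _ _)) !scalerA; congr (_ *: _); ring.
have fin_sum (T : finType) (G : nat -> T -> W3) : (forall b, fin1 (G^~ b)) -> fin1 (fun t => \sum_b G t b).
 move=> Gf; have [B BP] := choice Gf; exists (\max_b B b)%N => t tB; rewrite big1 // => b _.
 by apply: BP; apply: leq_trans tB; exact: leq_bigmax.
rewrite fsum_big => [|i]; last by apply: fin_sum => b; exact: fin1Z.
apply: eq_bigr => i _; rewrite fsum_big => [|b]; last exact: fin1Z.
rewrite scaler_sumr; apply: eq_bigr => b _; rewrite scalerA -fsumZ; last by apply/fin1Z/fin1Z.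
apply: eq_fsum => t; rewrite /F !scalerA; congr (_ *: _).
have := congr1 (fun n => n%:R : R[i]) (bin_fact (leq_addr t j)); rewrite addKn /= !natrM => <-.
by field; rewrite !fact_neq0.
Qed.

End GeneralizedWeights.
End Intertwiners.
End Tensor.

Section Twist.
Context R (k : R[i]) (hk : k != 0) (V : affine_vsa k).
Local Notation twopiI := (2%:R * piI R).
Definition texp (W : vmod V) (h : R[i]) (u : W) : W := expC (twopiI * h) *: fexp twopiI (eshift (LL W 0) h) u.
Definition is_theta (W : vmod V) (F : W -> W) : Prop := linear F /\ forall h u, geneig h u -> F u = texp h u.
(** [thetaP] proves existence for modules spanned by generalized L_0-eigenvectors; [id] is a default
    value. *)
Definition theta (W : vmod V) : W -> W := if pselect (exists F, @is_theta W F) is left e then sval (cid e) else @id W.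

Lemma fin_iter (W : vmod V) h (u : W) : geneig h u -> fin1 (fun m => iter m (eshift (LL W 0) h) u).
move=> [M uM]; exists M => m /subnK <-; rewrite iterD [iter M _ _]uM.
by apply: lin0; apply: eshift_lin; exact: L_lin.
Qed.

Lemma texpE (W : vmod V) h M (u : W) : iter M (eshift (LL W 0) h) u = 0 ->
 texp h u = expC (twopiI * h) *: \sum_(m < M) (twopiI ^+ m / m`!%:R) *: iter m (eshift (LL W 0) h) u.
move=> uM; rewrite /texp /fexp (fsumE (N := M)) // => m /subnK <-; rewrite iterD uM.
by rewrite (lin0 (eshift_lin (L_lin _) _ _)) scaler0.
Qed.

Section OnModule.
Variable W : vmod V.
Hypothesis sW : gspanned (LL W 0).

Lemma thetaP : linear (@theta W) /\ forall h (u : W), geneig h u -> theta u = texp h u.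
rewrite /theta; case: pselect => [e|no]; first exact: (svalP (cid e)).
exfalso; have [|F lF FE] := gspan_extend (L_lin 0) sW (f := @texp W); last by apply: no; exists F.
move=> h a u v uh vh; rewrite /texp /fexp.
have -> : (\fs_m (twopiI ^+ m / m`!%:R) *: iter m (eshift (LL W 0) h) (a *: u + v)) =
  a *: (\fs_m (twopiI ^+ m / m`!%:R) *: iter m (eshift (LL W 0) h) u) +
  \fs_m (twopiI ^+ m / m`!%:R) *: iter m (eshift (LL W 0) h) v.
 have fu := fin1Z (fun m => twopiI ^+ m / m`!%:R) (fin_iter uh).
 have fv := fin1Z (fun m => twopiI ^+ m / m`!%:R) (fin_iter vh).
 rewrite -(fsumZ a fu) -fsumD //; last exact: fin1Z.
 by apply: eq_fsum => m; rewrite (eshift_lin (L_lin _)) scalerDr scalerCA.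
by rewrite scalerDr scalerCA.
Qed.

Lemma theta_lin : linear (@theta W). by case: thetaP. Qed.
Lemma theta_gen h (u : W) : geneig h u -> theta u = texp h u. by case: thetaP => _; apply. Qed.

Lemma theta_exp : is_exp2piL0 (@theta W).
split=> [|h M w wM]; first exact: theta_lin.
by rewrite (theta_gen (h := h)) ?(texpE wM) //; exists M.
Qed.

Lemma theta_eigen h (u : W) : L 0 u = h *: u -> theta u = expC (twopiI * h) *: u.
move=> uh; have e : iter 1 (eshift (LL W 0) h) u = 0 by rewrite /= /eshift uh subrr.
rewrite (theta_gen (h := h)); last by exists 1%N.
by rewrite (texpE e) big_ord1 expr0 fact0 divr1 scale1r.
Qed.

(* u + (nilpotent terms) up to a nonzero scalar. *)
Lemma theta_unip (U : set W) h (u : W) : subspace U -> geneig h u ->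
 (forall m, (0 < m)%N -> U (iter m (eshift (LL W 0) h) u)) -> U (theta u - expC (twopiI * h) *: u).
move=> sU uh Uu; rewrite (theta_gen uh); have [M uM] := uh; rewrite (texpE uM).
case: M uM => [/= ->|M uM]; first by rewrite big_ord0 subrr; exact: sub0.
rewrite big_ord_recl /= expr0 fact0 divr1 scale1r -scalerBr addrC addKr.
apply: subZ => //; apply: sub_sum => // m _; apply: subZ => //; exact: (Uu m.+1).
Qed.

(** On a generalized eigenspace theta is a nonzero scalar plus nilpotent terms, so it can be
    inverted inside any L_0-stable subspace. The zero subspace and the image of theta yield
    injectivity and surjectivity. *)
Lemma theta_sub (U : set W) h u : subspace U -> (forall v, U v -> U (L 0 v)) -> geneig h u -> U (theta u) -> U u.
move=> sU LU [M uM]; elim: M u uM => [u /= -> _|M IH u uM Uu]; first exact: sub0.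
have lS := shift_linear (L_lin (W := W) 0) h.
have lN := eshift_lin (L_lin (W := W) 0) h.
pose N := eshift (LL W 0) h.
have gu : geneig h u by exists M.+1.
have NU v : U v -> U (N v) by move=> Uv; apply: subB => //; [exact: LU|exact: subZ].
have tN v : geneig h v -> theta (N v) = N (theta v).
 move=> gv; have gNv : geneig h (N v) by exact: (geigen_shift (L_lin 0) h gv).
 rewrite !(theta_gen (h := h)) // /texp [RHS](linZ lS); congr (_ *: _).
 rewrite /fexp [RHS](fsum_lin lS); last exact/fin1Z/fin_iter.
 by apply: eq_fsum => m; rewrite (linZ lS) -iterS iterSr.
have UN : U (N u) by apply: IH; [rewrite -uM iterSr|rewrite tN //; exact: NU].
have := theta_unip sU gu; rewrite -/N => /(_ _) H.
apply: (subZ_iff sU (expC_neq0 (twopiI * h))).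
rewrite -[X in U X](subKr (theta u)); apply: subB => //; apply: H => m; case: m => // m _.
by rewrite iterSr; elim: m => // m IHm; exact: NU.
Qed.

End OnModule.

Lemma theta_nat (W1 W2 : vmod V) p (f : W1 -> W2) : gspanned (LL W1 0) -> gspanned (LL W2 0) ->
 is_hom p f -> forall w, theta (f w) = f (theta w).
move=> s1 s2 hf; have fl := hom_lin hf; have l1 := theta_lin s1; have l2 := theta_lin s2.
have fL w : f (L 0 w) = L 0 (f w) := hom_L0 w hf.
apply: (gspan_ind s1) => [|h u uh]; first split=> [|a u v Uu Uv].
- by rewrite (lin0 fl) (lin0 l1) (lin0 l2) (lin0 fl).
- by rewrite fl l2 Uu Uv l1 fl.
rewrite (theta_gen s1 uh) (theta_gen s2 (geigen_map fl fL uh)) /texp (linZ fl); congr (_ *: _).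
rewrite /fexp (fsum_lin fl); last exact/fin1Z/fin_iter.
by apply: eq_fsum => m; rewrite (linZ fl) (iter_eshift_map fl fL).
Qed.

Lemma mode_L0 (W : vmod V) a r (w : W) : mode W a r (L 0 w) = L 0 (mode W a r w) + r%:~R *: mode W a r w.
by rewrite (mode_L hk) addr0. Qed.

Lemma iter_mode (W : vmod V) a r h m (w : W) :
 mode W a r (iter m (eshift (LL W 0) h) w) = iter m (eshift (LL W 0) (h - r%:~R)) (mode W a r w).
have la : linear (mode W a r) by exact: act_linr.
elim: m => // m IH; rewrite !iterS -IH /eshift (linB la) (linZ la) mode_L0; lmod_ring.
Qed.

Lemma mode_geneig (W : vmod V) a r h (w : W) : geneig h w -> geneig (h - r%:~R) (mode W a r w).
by move=> [m wm]; exists m; rewrite -iter_mode [iter m _ _]wm; apply/lin0/act_linr. Qed.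

Lemma geneig_par (W : vmod V) h (w : W) : geneig h w -> geneig h (par w).
by apply: (geigen_map (@par_linear _ W)) => u; rewrite L_par.
Qed.

(** Modes shift L_0 by integers, which e^(2 pi i L_0) does not see. *)
Lemma theta_hom (W : vmod V) : gspanned (LL W 0) -> ehom (@theta W).
move=> sW; have l := theta_lin sW; apply: mode_hom => [//|w|a r w]; rewrite scale1r.
 apply: (gspan_ind sW (U := fun w => theta (par w) = par (theta w))) w => [|h u uh].
  split=> [|a u v Uu Uv]; first by rewrite par0 (lin0 l) par0.
  by rewrite par_linear l Uu Uv l par_linear.
 rewrite (theta_gen sW uh) (theta_gen sW (geneig_par uh)) /texp (linZ (@par_linear _ W)).
 congr (_ *: _); rewrite /fexp [RHS](fsum_lin (@par_linear _ W)); last exact/fin1Z/fin_iter.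
 apply: eq_fsum => m; rewrite (linZ (@par_linear _ W)); congr (_ *: _).
 by rewrite (iter_eshift_map (B := LL W 0) (@par_linear _ W)) // => v; rewrite L_par.
apply: (gspan_ind sW (U := fun w => theta (mode W a r w) = mode W a r (theta w))) w => [|h u uh].
 have la' : linear (mode W a r) by exact: act_linr.
 split=> [|c u v Uu Uv]; first by rewrite (lin0 la') !(lin0 l) (lin0 la').
 by rewrite la' !l la' Uu Uv.
have la : linear (mode W a r) by exact: act_linr.
rewrite (theta_gen sW uh) (theta_gen sW (mode_geneig a r uh)) /texp (linZ la).
have -> : expC (twopiI * (h - r%:~R)) = expC (twopiI * h) by rewrite mulrBr expCD -mulrN -intrN expC_2piIz mulr1.
congr (_ *: _); rewrite /fexp [RHS](fsum_lin la); last exact/fin1Z/fin_iter.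
by apply: eq_fsum => m; rewrite (linZ la) iter_mode.
Qed.

Lemma theta_bijective (W : vmod V) : gspanned (LL W 0) -> bijective (@theta W).
move=> sW; have l := theta_lin sW; have hth := theta_hom sW.
have LK v : theta v = 0 -> theta (L 0 v) = 0 :> W by move=> tv; rewrite (hom_L 0 v hth) tv (lin0 (L_lin _)).
have ker w : theta w = 0 -> w = 0 :> W.
 move=> tw; have S : subspace [set v | theta v = 0 :> W] := submod_sub (submodule_ker hth).
 have [g [s [_ _ ->]]] := gcompP (L_lin 0) sW w; rewrite big1 // => h _.
 have := theta_sub sW (U := [set 0]) (subspace0 W) _ (g h); apply => [v -> /=|].
  exact: (lin0 (L_lin _)).
 exact: (gcomp_sub (L_lin 0) sW h S LK tw).
have surj w : exists v, theta v = w :> W.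
 have S : subspace (@theta W @` setT) := submod_sub (submod_image hth (submoduleT W)).
 have [] : (@theta W @` setT) w; last by move=> v _ <-; exists v.
 apply: (gspan_ind sW (U := @theta W @` setT)) w => // h u uh.
 apply: (theta_sub sW S _ uh); last by exists u.
 by move=> _ [v _ <-]; exists (L 0 v) => //; exact: (hom_L 0 v hth).
have [g gK] := choice surj; exists g => w; last exact: gK.
apply/eqP; rewrite -subr_eq0; apply/eqP/ker; by rewrite (linB l) gK subrr.
Qed.

Lemma theta_adjoint (v : adjoint V) : gspanned (LL (adjoint V) 0) -> theta v = v.
move=> sV; have l := theta_lin sV; have [_ _ tm] := theta_hom sV.
apply: (V_ind (U := fun v => theta (v : adjoint V) = v)) v => [||a r u Uu].
- by split=> [|a u v Uu Uv]; rewrite ?(lin0 l) // l Uu Uv.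
- by rewrite (theta_eigen sV (h := 0)) ?mulr0 ?expC0 ?scale1r // scale0r; exact: (L_vac V 1).
- by rewrite [theta _](tm _ _ _ _ (gen_par V a)) scale1r Uu.
Qed.

End Twist.

(** * Consequences of the universal property: spanning, right exactness, balance *)

Section Tensor.
Context R (k : R[i]) (hk : k != 0) (V : affine_vsa k).
Variables (T : tensor_data V) (hT : hlz_structure (@KL R k V) T).
Local Notation C := R[i].
Local Notation KLV := (@KL R k V).
Local Notation "A ** B" := (ten T A B) (at level 40, left associativity).
Local Notation "f *** g" := (@tenm _ _ _ T _ _ _ _ f g) (at level 40, left associativity).
Let hB := hlz_braided hT.

Section Pair.
Variables W1 W2 : vmod V.
Hypotheses (K1 : KLV W1) (K2 : KLV W2).
Let HY := hlz_intertwining hT K1 K2.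

Lemma tY_act b v (w1 : W1) h j (w2 : W2) n a : hmg a v -> hmg b w1 ->
 act v n (tY T w1 h j w2) = (-1) ^+ (a && b) *: tY T w1 h j (act v n w2) +
  \fs_i binz R n i *: tY T (act v i%:Z w1) (h + (n - i%:Z)%:~R) j w2.
move=> va w1b; have := borcherds_comm (int_borcherds HY h j) w2 n 0 va w1b.
rewrite -/(fsum _) !addr0 scale1r => ->; by rewrite addrC subrK.
Qed.

(** The span S of all coefficients, taken as the intersection of the subspaces that contain them, is
    a submodule by the commutator formula. Modulo S the universal operator is zero, so uniqueness of
    the factorization makes the quotient map zero. *)
Lemma ten_ind (U : set (W1 ** W2)) : subspace U -> (forall w1 h j w2, U (tY T w1 h j w2)) -> forall u, U u.
move=> sU UY; have KT := bt_ten hB K1 K2.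
pose S (u : W1 ** W2) := forall U' : set (W1 ** W2), subspace U' ->
 (forall (w1 : W1) h j (w2 : W2), U' (tY T w1 h j w2)) -> U' u.
have SY (w1 : W1) h j (w2 : W2) : S (tY T w1 h j w2) by move=> U' _; apply.
have sS : subspace S.
 split=> [U' sU' _|a u v Su Sv U' sU' U'Y]; first exact: sub0.
 by case: (sU') => _; apply; [exact: Su|exact: Sv].
have mS : submodule S.
 split; [by case: sS|by case: sS|move=> u Su U' sU' U'Y|move=> v n u Su].
  apply: (Su (fun u => U' (par u))); first split=> [|a x y Ux Uy].
  - by rewrite par0; exact: sub0.
  - by rewrite par_linear; case: sU' => _; apply.
  - by move=> w1 h j w2; rewrite (int_par HY) scale1r.
 apply: (Su (fun u => S (act v n u))); first split=> [|a x y Ux Uy].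
 - by rewrite act0r; exact: sub0.
 - by rewrite act_linr; case: sS => _; apply.
 move=> w1 h j w2.
 apply: (hmg_split (U := fun v => S (act v n (tY T w1 h j w2)))) v => [|a v va].
  split=> [|a x y Ux Uy]; first by rewrite act0l; exact: sub0.
  by rewrite act_linl; case: sS => _; apply.
 apply: (hmg_split (U := fun w1 => S (act v n (tY T w1 h j w2)))) w1 => [|b w1 w1b].
  split=> [|c x y Ux Uy]; first by rewrite (lin0 (int_linl HY _ _ _)) act0r; exact: sub0.
  by rewrite (int_linl HY) act_linr; case: sS => _; apply.
 rewrite (tY_act h j w2 n va w1b); apply: (subD sS); first by apply: (subZ sS); exact: SY.
 by apply: (sub_fsum sS) => i; apply: (subZ sS); exact: SY.
have KQ : KLV (quot_vmod mS) by exact: (KL_surjective (quot_map_hom mS) (@quot_onto _ _ _ _ _ mS) KT).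
have hI := int_comp HY (quot_map_hom mS).
have [f [_ _] fu] := hlz_universal hT K1 K2 KQ hI.
have qf : quot_map mS = f by apply: fu; split=> //; exact: quot_map_hom.
have zf : (fun=> 0) = f.
 apply: fu; split; first exact: hom_zero.
 by move=> w1 h j w2; apply/esym/quot_map0; exact: SY.
move=> u; have : quot_map mS u = 0 by rewrite qf -zf.
by move=> /quot_map0; apply.
Qed.

Lemma ten_ext (W : lmodType C) (f g : W1 ** W2 -> W) : linear f -> linear g ->
 (forall w1 h j w2, f (tY T w1 h j w2) = g (tY T w1 h j w2)) -> forall u, f u = g u.
move=> lf lg; apply: ten_ind; split=> [|a u v Uu Uv]; first by rewrite (lin0 lf) (lin0 lg).
by rewrite lf lg Uu Uv.
Qed.

Lemma ten_hext (W : lmodType C) (f g : W1 ** W2 -> W) : linear f -> linear g ->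
 (forall a b w1 h j w2, hmg a w1 -> hmg b w2 -> f (tY T w1 h j w2) = g (tY T w1 h j w2)) -> forall u, f u = g u.
move=> lf lg fg; apply: ten_ext => // w1 h j w2.
apply: (hmg_split (U := fun w1 => f (tY T w1 h j w2) = g (tY T w1 h j w2))) w1 => [|a w1 w1a].
 split=> [|a u v Uu Uv]; first by rewrite (lin0 (int_linl HY _ _ _)) (lin0 lf) (lin0 lg).
 by rewrite (int_linl HY) lf lg Uu Uv.
apply: (hmg_split (U := fun w2 => f (tY T w1 h j w2) = g (tY T w1 h j w2))) w2 => [|b w2 w2b].
 split=> [|c u v Uu Uv]; first by rewrite (lin0 (int_linr HY _ _ _)) (lin0 lf) (lin0 lg).
 by rewrite (int_linr HY) lf lg Uu Uv.
exact: fg w1a w2b.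
Qed.

End Pair.

Lemma tenmE (W1 W2 W3 W4 : vmod V) p (f : W1 -> W3) (g : W2 -> W4) w1 h j w2 :
 KLV W1 -> KLV W2 -> KLV W3 -> KLV W4 -> is_hom p f -> ehom g ->
 (f *** g) (tY T w1 h j w2) = tY T (f w1) h j (g w2).
move=> K1 K2 K3 K4 hf hg; have I := hlz_intertwining hT K1 K2; have J := hlz_intertwining hT K3 K4.
have hfg := hom_lin (bt_hom hB K1 K2 K3 K4 hf hg).
apply: (hmg_split (U := fun w1 => (f *** g) (tY T w1 h j w2) = tY T (f w1) h j (g w2))) w1 => [|a w1 w1a].
 split=> [|a u v Uu Uv].
  by rewrite (lin0 (int_linl I _ _ _)) (lin0 hfg) (lin0 (hom_lin hf)) (lin0 (int_linl J _ _ _)).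
 by rewrite (int_linl I) hfg Uu Uv (hom_lin hf) (int_linl J).
by rewrite (hlz_tenm hT K1 K2 K3 K4 hf hg _ _ _ w1a) scale1r.
Qed.

Lemma tenm_surj (W1 W2 W3 W4 : vmod V) (f : W1 -> W3) (g : W2 -> W4) :
 KLV W1 -> KLV W2 -> KLV W3 -> KLV W4 -> ehom f -> ehom g ->
 onto f -> onto g -> forall w, exists u, (f *** g) u = w.
move=> K1 K2 K3 K4 hf hg fs gs; have hfg := bt_hom hB K1 K2 K3 K4 hf hg.
apply: (ten_ind K3 K4) => [|w3 h j w4].
 have [S0 SD] := submod_sub (submod_image hfg (submoduleT _)).
 split=> [|a u v [x xu] [y yv]]; first by have [x _ e] := S0; exists x.
 by have [||z _ e] := SD a u v; [exists x|exists y|exists z].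
have [u <-] := fs w3; have [v <-] := gs w4; exists (tY T u h j v).
exact: (tenmE _ _ _ _ K1 K2 K3 K4 hf hg).
Qed.

(** Right exactness: modulo the image of j (x) E the universal operator of Y (x) E descends along q,
    so the quotient map factors through q (x) E. *)
Lemma tenm_kernel (B Y A E : vmod V) (j : B -> Y) (q : Y -> A) : KLV B -> KLV Y -> KLV A -> KLV E ->
 ehom j -> ehom q -> onto q -> (forall y, q y = 0 -> exists b, j b = y) ->
 forall u : Y ** E, (q *** @id E) u = 0 -> exists v, (j *** @id E) v = u.
move=> KB KY KA KE hj hq qs qj u qu; have hid := hom_id E.
have hjE := bt_hom hB KB KE KY KE hj hid; have hqE := bt_hom hB KY KE KA KE hq hid.
have mI := submod_image hjE (submoduleT _).
have KQ : KLV (quot_vmod mI).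
 exact: KL_surjective (quot_map_hom mI) (@quot_onto _ _ _ _ _ mI) (bt_ten hB KY KE).
have hI := int_comp (hlz_intertwining hT KY KE) (quot_map_hom mI).
have [s sK] := choice qs.
have Y0 y h i e : q y = 0 -> quot_map mI (tY T y h i e) = 0.
 move=> /qj[b <-]; apply/quot_map0; exists (tY T b h i e) => //.
 exact: (tenmE _ _ _ _ KB KE KY KE hj hid).
have J := int_descend hI hq sK Y0.
have [f [hf fE] _] := hlz_universal hT KA KE KQ J.
have E1 u' : f ((q *** @id E) u') = quot_map mI u'.
 move: u'; apply: (ten_ext KY KE).
 - by move=> a x y; rewrite (hom_lin hqE) (hom_lin hf).
 - exact: hom_lin (quot_map_hom mI).
 move=> y h i e; rewrite (tenmE _ _ _ _ KY KE KA KE hq hid) fE; apply/eqP.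
 rewrite -subr_eq0 -(linB (hom_lin (quot_map_hom mI))) -(linB (int_linl (hlz_intertwining hT KY KE) _ _ _)).
 by apply/eqP/Y0; rewrite (linB (hom_lin hq)) sK subrr.
have : quot_map mI u = 0 by rewrite -E1 qu (lin0 (hom_lin hf)).
by move=> /quot_map0 [v _ vu]; exists v.
Qed.

Lemma tenm_kernel' (B Y A E : vmod V) (j : B -> Y) (q : Y -> A) : KLV B -> KLV Y -> KLV A -> KLV E ->
 ehom j -> ehom q -> onto q -> (forall y, q y = 0 -> exists b, j b = y) ->
 forall u : E ** Y, (@id E *** q) u = 0 -> exists v, (@id E *** j) v = u.
move=> KB KY KA KE hj hq qs qj u qu; have hid := hom_id E.
have [v vu] : exists v, (j *** @id E) v = brd u.
 apply: (tenm_kernel KB KY KA KE hj hq qs qj).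
 have := bt_brd_nat hB KE KY KE KA hid hq u; rewrite scale1r qu => <-.
 by have [hb _ _] := bt_brd hB KE KA; rewrite (lin0 (hom_lin hb)).
have [_ _ bK] := bt_brd hB KE KB; have [_ cK _] := bt_brd hB KE KY.
exists (brdi v); apply: (can_inj cK); have := bt_brd_nat hB KE KB KE KY hid hj (brdi v).
by rewrite scale1r bK vu => ->.
Qed.

Section Balanced.
Variables W1 W2 : vmod V.
Hypotheses (K1 : KLV W1) (K2 : KLV W2).
Let K12 := bt_ten hB K1 K2.
Let I12 := hlz_intertwining hT K1 K2.
Let I21 := hlz_intertwining hT K2 K1.
Local Notation twopiI := (2%:R * piI R).

(* The monodromy: x^(-h-1) (log x)^j is replaced by its continuation along a loop around 0. *)
Definition loopY (w1 : W1) h j (w2 : W2) : W1 ** W2 := expC (twopiI * (- h - 1)) *: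
 (\fs_t ('C(j + t, j)%:R * twopiI ^+ t) *: tY T w1 h (j + t)%N w2).

Let fin_log (W3 W4 W5 : vmod V) q (Y : log_modes W3 W4 W5) w3 h j w4 :
 intertwining q Y -> fin1 (fun t => Y w3 h (j + t)%N w4).
by move=> HY; have [J YJ] := int_log HY w3 w4 h; exists J => t Jt; apply: YJ; lia.
Qed.

Lemma loopY_linl h j w2 : linear (fun w1 => loopY w1 h j w2).
move=> a u v; rewrite /loopY scalerCA -scalerDr; congr (_ *: _).
rewrite -fsumZ; last exact/fin1Z/(fin_log _ _ _ _ I12).
rewrite -fsumD; [|exact/fin1Z/fin1Z/(fin_log _ _ _ _ I12)|exact/fin1Z/(fin_log _ _ _ _ I12)].
by apply: eq_fsum => t; rewrite (int_linl I12); lmod_ring.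
Qed.

Lemma loopY_linr w1 h j : linear (loopY w1 h j).
move=> a u v; rewrite /loopY scalerCA -scalerDr; congr (_ *: _).
rewrite -fsumZ; last exact/fin1Z/(fin_log _ _ _ _ I12).
rewrite -fsumD; [|exact/fin1Z/fin1Z/(fin_log _ _ _ _ I12)|exact/fin1Z/(fin_log _ _ _ _ I12)].
by apply: eq_fsum => t; rewrite (int_linr I12); lmod_ring.
Qed.

(** On generalized eigenvectors this is [int_fexp] with s = 2 pi i; the eigenvalue h1 + h2 - h - 1
    accounts for the phase of the loop. *)
Lemma theta_tY w1 h j w2 : theta (tY T w1 h j w2) = loopY (theta w1) h j (theta w2).
have s1 := KL_span K1; have s2 := KL_span K2; have s12 := KL_span K12.
have l1 := theta_lin s1; have l2 := theta_lin s2; have l12 := theta_lin s12.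
apply: (gspan_ind s1 (U := fun w1 => theta (tY T w1 h j w2) = loopY (theta w1) h j (theta w2))) w1 => [|h1 w1 w1h].
 split=> [|a u v Uu Uv]; last by rewrite (int_linl I12) l12 Uu Uv l1 loopY_linl.
 by rewrite (lin0 (int_linl I12 _ _ _)) (lin0 l12) (lin0 l1) (lin0 (loopY_linl _ _ _)).
apply: (gspan_ind s2 (U := fun w2 => theta (tY T w1 h j w2) = loopY (theta w1) h j (theta w2))) w2 => [|h2 w2 w2h].
 split=> [|a u v Uu Uv]; last by rewrite (int_linr I12) l12 Uu Uv l2 loopY_linr.
 by rewrite (lin0 (int_linr I12 _ _ _)) (lin0 l12) (lin0 l2) (lin0 (loopY_linr _ _ _)).
rewrite (theta_gen s1 w1h) (theta_gen s2 w2h) (theta_gen s12 (int_geneig hk I12 h j w1h w2h))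
 /texp (int_fexp hk I12 h j w1h w2h) (linZ (loopY_linl _ _ _)) (linZ (loopY_linr _ _ _))
 /loopY !scalerA; congr (_ *: _); rewrite -!expCD; congr (expC _); ring.
Qed.

(** The coefficients of e^y e^(-y) = 1. *)
Lemma binomial_alternating n : \sum_(i < n.+1) i`!%:R^-1 * (n - i)`!%:R^-1 * (-1) ^+ (n - i) = (n == 0%N)%:R :> C.
have := exprDn (-1 : C) 1 n; rewrite addNr expr0n => E.
apply: (mulfI (fact_neq0 C n)); rewrite mulr_sumr; transitivity ((n == 0%N)%:R : C); last by case: (n) => [|m] /=; rewrite ?fact0 ?mulr1 ?mulr0.
rewrite E; apply: eq_bigr => i _; rewrite expr1n mulr1 -mulr_natr.
have le : (i <= n)%N by rewrite -ltnS.
rewrite -(bin_fact le) !natrM; move: (_ ^+ _) => x; field; rewrite !fact_neq0 //.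
Qed.

(** C(j+t, j) C(j+s, j+t) = C(j+s, j) C(s, t). The power of 2 merges two shifts of log x by pi i
    into one by 2 pi i. *)
Lemma binomial_row j s : \sum_(t < s.+1) 'C(j + t, j)%:R * 'C(j + s, j + t)%:R = 'C(j + s, j)%:R * 2%:R ^+ s :> C.
have -> : (2%:R : C) ^+ s = \sum_(t < s.+1) 'C(s, t)%:R.
 have := exprDn (1 : C) 1 s; rewrite -[1 + 1]/(2%:R) => ->.
 by apply: eq_bigr => t _; rewrite !expr1n mulr1.
rewrite mulr_sumr; apply: eq_bigr => t _; rewrite -!natrM; congr (_%:R).
have ts : (t <= s)%N by rewrite -ltnS.
have f0 : (0 < j`! * t`! * (s - t)`!)%N by rewrite !muln_gt0 !fact_gt0.
apply/eqP; rewrite -(eqn_pmul2r f0); apply/eqP.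
have e1 := bin_fact (leq_addr t j); have e2 := bin_fact (n := j + s) (m := j + t).
have e3 := bin_fact (leq_addr s j); have e4 := bin_fact ts.
rewrite leq_add2l ts in e2; have {}e2 := e2 isT; rewrite subnDl in e2.
rewrite addKn in e1; rewrite addKn in e3.
transitivity (j + s)`!; first by rewrite -e2 -e1; ring.
by rewrite -e3 -e4; ring.
Qed.

(** Two half turns: the phases and the shifts of log x add up, while the translations e^(x L_(-1))
    and e^(-x L_(-1)) cancel. *)
Lemma brd_brd a b w1 h j w2 : hmg a w1 -> hmg b w2 -> brd (brd (tY T w1 h j w2)) = loopY w1 h j w2.
move=> w1a w2b; have [hb _ _] := bt_brd hB K2 K1; have bl := hom_lin hb.
have lL (W : vmod V) i : linear (iter i (LL W (-1))) by apply: iter_linear; exact: L_lin.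
have bL i x : brd (iter i (L (-1)) x) = iter i (LL (W1 ** W2) (-1)) (brd x)
 by elim: i => // i IH; rewrite !iterS (hom_L _ _ hb) IH.
pose e (h : C) := expC (piI R * (- h - 1)).
have [N1 Y1] := int_trunc I21 w2 w1 h; have [N2 Y2] := int_trunc I12 w1 w2 h.
have f2 h' j' : fin1 (fun t => tY T w2 h' (j' + t)%N w1) by exact: fin_log I21.
have f1 h' j' : fin1 (fun t => tY T w1 h' (j' + t)%N w2) by exact: fin_log I12.
pose U i x := iter i (LL (W1 ** W2) (-1)) x; pose c j' t : C := 'C(j' + t, j')%:R * piI R ^+ t.
have U0 i : U i 0 = 0 by exact: lin0 (lL _ i).
have B1 : brd (tY T w1 h j w2) = (-1) ^+ (a && b) *: (\fs_i i`!%:R^-1 *: iter i (LL (W2 ** W1) (-1))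
  (e (h + i%:R) *: (\fs_t c j t *: tY T w2 (h + i%:R) (j + t)%N w1))).
 exact: (hlz_brd hT K1 K2 h j w1a w2b).
have B2 h' j' : brd (tY T w2 h' j' w1) = (-1) ^+ (a && b) *: (\fs_i i`!%:R^-1 *: U i
  (e (h' + i%:R) *: (\fs_t c j' t *: tY T w1 (h' + i%:R) (j' + t)%N w2)))
 by rewrite andbC; exact: (hlz_brd hT K2 K1 h' j' w2b w1a).
pose S (h' : C) := (\fs_s ('C(j + s, j)%:R * twopiI ^+ s) *: tY T w1 h' (j + s)%N w2).
pose G h' t := \fs_t' (c j t * c (j + t)%N t') *: tY T w1 h' (j + t + t')%N w2.
have G0 n t : (N2 <= n)%N -> G (h + n%:R) t = 0 by move=> /Y2 Yn; apply: fsum_eq0 => s; rewrite Yn scaler0.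
have inner h' : fsum (G h') = S h'.
 transitivity (fsum (fun s => \sum_(t < s.+1) ('C(j + t, j)%:R * 'C(j + s, j + t)%:R) *:
   (piI R ^+ s *: tY T w1 h' (j + s)%N w2))).
  rewrite fsum_diag; last first.
   have [J YJ] := int_log I12 w1 w2 h'; exists J => t t' tt'; rewrite YJ ?scaler0 //; lia.
  apply: eq_fsum => s; apply: eq_bigr => t _; have ts : (t <= s)%N by rewrite -ltnS.
  have e0 : piI R ^+ s = piI R ^+ t * piI R ^+ (s - t) by rewrite -exprD subnKC.
  rewrite /c -addnA subnKC // scalerA; congr (_ *: _); rewrite e0; ring.
 apply: eq_fsum => s; rewrite -scaler_suml binomial_row scalerA; congr (_ *: _).
 by rewrite exprMn mulrA.
have S0 n : (N2 <= n)%N -> S (h + n%:R) = 0 by move=> /Y2 Yn; apply: fsum_eq0 => s; rewrite Yn scaler0.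
(* The sign (-1)^i' comes from substituting e^(pi i) x into the inner translation, which becomes
   e^(-x L_(-1)). *)
have eE i i' : e (h + i%:R) * e (h + i%:R + i'%:R) = expC (twopiI * (- h - 1)) * (-1) ^+ i'.
 have -> : (-1) ^+ i' = (-1) ^ i'%:Z :> C by [].
 have s2 : ((-1) ^+ i') * (-1) ^+ i' = 1 :> C by rewrite -expr2 sqrr_sign.
 apply: (mulIf (x := (-1) ^+ i')); first by rewrite signr_eq0.
 rewrite -[RHS]mulrA s2 mulr1 -expC_piIn /e -!expCD.
 have -> : piI R * (- (h + i%:R) - 1) + piI R * (- (h + i%:R + i'%:R) - 1) + piI R * i'%:R =
   twopiI * (- h - 1) + twopiI * (- i%:Z)%:~R by rewrite mulrNz; ring.
 by rewrite [LHS]expCD expC_2piIz mulr1.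
have -> : brd (brd (tY T w1 h j w2)) = \fs_i \fs_i' (i`!%:R^-1 * i'`!%:R^-1 * (-1) ^+ i') *:
  (expC (twopiI * (- h - 1)) *: U (i + i')%N (S (h + (i + i')%:R))).
 have z1 i : (N1 <= i)%N -> \fs_t c j t *: tY T w2 (h + i%:R) (j + t)%N w1 = 0
  by move=> /Y1 Yi; apply: fsum_eq0 => t; rewrite Yi scaler0.
 rewrite B1 (linZ bl) (fsum_lin bl); last by exists N1 => i /z1 ->; rewrite scaler0 (lin0 (lL _ _)) scaler0.
 rewrite -/(fsum _) -fsumZ; last by exists N1 => i /z1 ->; rewrite scaler0 (lin0 (lL _ _)) scaler0 (lin0 bl).
 apply: eq_fsum => i; rewrite (linZ bl) bL (linZ bl) (fsum_lin bl) -/(fsum _); last exact: fin1Z.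
 pose H i' x := i'`!%:R^-1 *: U i' (e (h + i%:R + i'%:R) *: x); pose g i' := G (h + i%:R + i'%:R).
 have H0 i' : H i' 0 = 0 by rewrite /H scaler0 U0 scaler0.
 have g0 i' t : (N2 <= i')%N -> g i' t = 0 by move=> Ni; rewrite /g -addrA -natrD G0 //; lia.
 have E t : brd (c j t *: tY T w2 (h + i%:R) (j + t)%N w1) = (-1) ^+ (a && b) *: (\fs_i' H i' (g i' t)).
  rewrite (linZ bl) B2 scalerCA -fsumZ; last first.
   exists N2 => i' Ni'; rewrite (fsum_eq0 (f := fun t => _ *: tY T w1 _ _ _)) => [|t']; last by rewrite -addrA -natrD Y2 ?scaler0 //; lia.
   by rewrite scaler0 U0 scaler0.
  congr (_ *: _); apply: eq_fsum => i'; rewrite scalerCA; congr (_ *: _).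
  rewrite -(linZ (lL _ _)) scalerCA; congr (iter _ _ (_ *: _)); rewrite -fsumZ; last exact: fin1Z.
  by apply: eq_fsum => t'; rewrite scalerA.
 rewrite (eq_fsum E).
 have [J gJ] : exists J, forall i' t, (J <= t)%N -> g i' t = 0.
  have [J JP] := choice (fun i' => int_log I12 w1 w2 (h + i%:R + i'%:R)).
  exists (\max_(i' < N2) J i')%N => i' t Jt; have [Ni|iN] := leqP N2 i'; first exact: g0.
  have JJ : (J i' <= t)%N by apply: leq_trans Jt; exact: (leq_bigmax (Ordinal iN)).
  by apply: fsum_eq0 => t'; rewrite JP ?scaler0 //; lia.
 rewrite fsumZ; last by exists J => t tJ; apply: fsum_eq0 => i'; rewrite gJ.
 rewrite fsumC; last first.
  exists (J + N2)%N => t i' ti'; have [tJ|tJ] := leqP J t; first by rewrite gJ.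
  by rewrite g0 //; lia.
 rewrite (linZ (lL _ _)) (linZ (lL _ _)) [_ *: (_ *: _)]scalerCA [(-1) ^+ _ *: (_ *: _)]scalerCA signZ.
 have fi' : fin1 (fun i' => \fs_t H i' (g i' t)) by exists N2 => i' Ni'; apply: fsum_eq0 => t; rewrite g0.
 rewrite (fsum_lin (lL _ _)) // -/(fsum _).
 have fi'' : fin1 (fun i' => U i (\fs_t H i' (g i' t))) by fin_of fi'.
 rewrite -fsumZ // -fsumZ; last exact: fin1Z.
 apply: eq_fsum => i'.
 have fJ : fin1 (g i') by exists J => t tJ; rewrite gJ.
 have -> : \fs_t H i' (g i' t) = H i' (S (h + (i + i')%:R)).
  have lg : linear (H i') by move=> z x y; rewrite /H scalerDr scalerCA /U (lL _ i') scalerDr scalerCA.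
  by rewrite natrD addrA -inner [RHS](fsum_lin lg).
 rewrite /H /U (linZ (lL _ _)) -iterD (linZ (lL _ _)) !scalerA; congr (_ *: _).
 by rewrite -[RHS]mulrA [(-1) ^+ _ * _]mulrC -(eE i); ring.
rewrite fsum_diag; last by exists N2 => i i' /S0 ->; rewrite U0 !scaler0.
have fE n : \sum_(i < n.+1) (i`!%:R^-1 * (n - i)`!%:R^-1 * (-1) ^+ (n - i)) *:
  (expC (twopiI * (- h - 1)) *: U (i + (n - i))%N (S (h + (i + (n - i))%:R))) =
  (n == 0%N)%:R *: (expC (twopiI * (- h - 1)) *: U n (S (h + n%:R))).
 rewrite -binomial_alternating scaler_suml; apply: eq_bigr => i _.
 by rewrite subnKC // -ltnS.
rewrite (eq_fsum fE) (fsumE (N := 1)) => [|[//|n] _]; last by rewrite scale0r.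
by rewrite big_ord1 eqxx scale1r /= addr0.
Qed.

Lemma theta_balanced (u : W1 ** W2) :
 theta u = @brd _ _ _ T W2 W1 (@brd _ _ _ T W1 W2 ((@theta _ _ _ W1 *** @theta _ _ _ W2) u)).
have s1 := KL_span K1; have s2 := KL_span K2; have s12 := KL_span K12.
have h1 := theta_hom hk s1; have h2 := theta_hom hk s2.
have [hb _ _] := bt_brd hB K1 K2; have [hb' _ _] := bt_brd hB K2 K1.
have ht := bt_hom hB K1 K2 K1 K2 h1 h2.
move: u; apply: (ten_hext K1 K2).
- exact: theta_lin.
- by move=> a x y; rewrite (hom_lin ht) (hom_lin hb) (hom_lin hb').
move=> a b w1 h j w2 w1a w2b; rewrite (tenmE _ _ _ _ K1 K2 K1 K2 h1 h2) theta_tY.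
apply/esym/(brd_brd (a := a) (b := b)); first by rewrite /hmg -[LHS]scale1r -[1]/((-1)^+false); case: h1 => _ tp _; rewrite -tp w1a (linZ (theta_lin s1)).
by rewrite /hmg -[LHS]scale1r -[1]/((-1)^+false); case: h2 => _ tp _; rewrite -tp w2b (linZ (theta_lin s2)).
Qed.

End Balanced.
End Tensor.

(** * Coherence, zigzags and duals in a braided monoidal category *)

Section Category.
Context R (k : R[i]) (V : affine_vsa k) (D : vmod V -> Prop)
 (T : tensor_data V) (hB : braided_tensor D T).

Record obj := Obj { ob :> vmod V; obP : D ob }.
(** Structure maps, evaluations, coevaluations and twists are all even, and between even maps no
    Koszul signs occur. *)
Record mor (A B : obj) := Mor { mf :> A -> B; mP : ehom mf }.

Definition idm (A : obj) : mor A A := Mor (hom_id A).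
Definition cm (A B C : obj) (f : mor B C) (g : mor A B) : mor A C := Mor (hom_comp (mP f) (mP g)).
Lemma cmE (A B C : obj) (f : mor B C) (g : mor A B) x : cm f g x = f (g x). by []. Qed.
Lemma idmE (A : obj) (x : A) : idm A x = x. by []. Qed.
Definition un : obj := Obj (bt_unit hB).
Definition te (A B : obj) : obj := Obj (bt_ten hB (obP A) (obP B)).
Definition tm (A B C E : obj) (f : mor A C) (g : mor B E) : mor (te A B) (te C E) :=
 @Mor (te A B) (te C E) _ (bt_hom hB (obP A) (obP B) (obP C) (obP E) (mP f) (mP g)).

Lemma iso_hom (W1 W2 : vmod V) (f : W1 -> W2) g : even_iso f g -> ehom f.
by case. Qed.

Lemma iso_inv_hom (W1 W2 : vmod V) (f : W1 -> W2) g : even_iso f g -> ehom g.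
move=> [[fl fp fa] fK gK]; split=> [a u v|w|a v n w va]; apply: (can_inj fK); rewrite gK.
- by rewrite fl !gK.
- by rewrite scale1r fp gK scale1r.
- by rewrite scale1r (fa a) // gK scale1r.
Qed.

Definition lu (A : obj) : mor (te un A) A := @Mor (te un A) A _ (iso_hom (bt_lun hB (obP A))).
Definition lui (A : obj) : mor A (te un A) := @Mor A (te un A) _ (iso_inv_hom (bt_lun hB (obP A))).
Definition ru (A : obj) : mor (te A un) A := @Mor (te A un) A _ (iso_hom (bt_run hB (obP A))).
Definition rui (A : obj) : mor A (te A un) := @Mor A (te A un) _ (iso_inv_hom (bt_run hB (obP A))).
Definition as_ (A B C : obj) : mor (te A (te B C)) (te (te A B) C) :=
 @Mor (te A (te B C)) (te (te A B) C) _ (iso_hom (bt_asc hB (obP A) (obP B) (obP C))).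
Definition asi (A B C : obj) : mor (te (te A B) C) (te A (te B C)) :=
 @Mor (te (te A B) C) (te A (te B C)) _ (iso_inv_hom (bt_asc hB (obP A) (obP B) (obP C))).
Definition br (A B : obj) : mor (te A B) (te B A) := @Mor (te A B) (te B A) _ (iso_hom (bt_brd hB (obP A) (obP B))).
Definition bri (A B : obj) : mor (te B A) (te A B) := @Mor (te B A) (te A B) _ (iso_inv_hom (bt_brd hB (obP A) (obP B))).
Lemma luK A : cancel (lu A) (lui A). by case: (bt_lun hB (obP A)). Qed.
Lemma luiK A : cancel (lui A) (lu A). by case: (bt_lun hB (obP A)). Qed.
Lemma ruK A : cancel (ru A) (rui A). by case: (bt_run hB (obP A)). Qed.
Lemma ruiK A : cancel (rui A) (ru A). by case: (bt_run hB (obP A)). Qed.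
Lemma asK A B C : cancel (as_ A B C) (asi A B C). by case: (bt_asc hB (obP A) (obP B) (obP C)). Qed.
Lemma asiK A B C : cancel (asi A B C) (as_ A B C). by case: (bt_asc hB (obP A) (obP B) (obP C)). Qed.
Lemma brK A B : cancel (br A B) (bri A B). by case: (bt_brd hB (obP A) (obP B)). Qed.
Lemma briK A B : cancel (bri A B) (br A B). by case: (bt_brd hB (obP A) (obP B)). Qed.
Lemma mor_lin (A B : obj) (f : mor A B) : linear f. exact: hom_lin (mP f). Qed.

Lemma tm_comp (A B C E F G : obj) (f : mor C F) (g : mor E G) (f' : mor A C) (g' : mor B E) u :
 tm f g (tm f' g' u) = tm (cm f f') (cm g g') u.
rewrite [LHS](bt_comp hB (obP A) (obP B) (obP C) (obP E) (obP F) (obP G) (mP f) (mP g) (mP f') (mP g')).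
by rewrite scale1r.
Qed.

Lemma eq_tm (A B C E : obj) (f f' : mor A C) (g g' : mor B E) u :
 (forall x, f x = f' x) -> (forall x, g x = g' x) -> tm f g u = tm f' g' u.
move=> /funext ff /funext gg; rewrite -[LHS]/(@tenm _ _ _ T A B C E (mf f) (mf g) u).
by rewrite (ff : mf f = mf f') (gg : mf g = mf g').
Qed.

Lemma tm_id (A B : obj) (f : mor A A) (g : mor B B) u : (forall x, f x = x) -> (forall x, g x = x) -> tm f g u = u.
move=> f1 g1; rewrite (@eq_tm _ _ _ _ f (idm A) g (idm B)) //.
exact: (bt_id hB (obP A) (obP B)).
Qed.

Lemma as_nat (A B C A' B' C' : obj) (f : mor A A') (g : mor B B') (h : mor C C') u :
 as_ A' B' C' (tm f (tm g h) u) = tm (tm f g) h (as_ A B C u).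
exact: (bt_asc_nat hB (obP A) (obP B) (obP C) (obP A') (obP B') (obP C') (mP f) (mP g) (mP h)). Qed.

Lemma asi_nat (A B C A' B' C' : obj) (f : mor A A') (g : mor B B') (h : mor C C') u :
 asi A' B' C' (tm (tm f g) h u) = tm f (tm g h) (asi A B C u).
by apply: (can_inj (@asK A' B' C')); rewrite asiK as_nat asiK. Qed.

Lemma br_nat (A B A' B' : obj) (f : mor A A') (g : mor B B') u : br A' B' (tm f g u) = tm g f (br A B u).
rewrite [LHS](bt_brd_nat hB (obP A) (obP B) (obP A') (obP B') (mP f) (mP g)).
by rewrite scale1r.
Qed.

Lemma bri_nat (A B A' B' : obj) (f : mor A A') (g : mor B B') u : bri A' B' (tm g f u) = tm f g (bri A B u).
by apply: (can_inj (@brK A' B')); rewrite briK br_nat briK. Qed.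
Lemma lu_nat (A B : obj) (f : mor A B) u : lu B (tm (idm un) f u) = f (lu A u).
exact: (bt_lun_nat hB (obP A) (obP B) (mP f)). Qed.
Lemma lui_nat (A B : obj) (f : mor A B) u : lui B (f u) = tm (idm un) f (lui A u).
by apply: (can_inj (@luK B)); rewrite luiK lu_nat luiK. Qed.
Lemma ru_nat (A B : obj) (f : mor A B) u : ru B (tm f (idm un) u) = f (ru A u).
exact: (bt_run_nat hB (obP A) (obP B) (mP f)). Qed.
Lemma rui_nat (A B : obj) (f : mor A B) u : rui B (f u) = tm f (idm un) (rui A u).
by apply: (can_inj (@ruK B)); rewrite ruiK ru_nat ruiK. Qed.
Lemma triangle (A B : obj) u : tm (ru A) (idm B) (as_ A un B u) = tm (idm A) (lu B) u.
exact: (bt_triangle hB (obP A) (obP B)). Qed.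

Lemma pentagon (A B C E : obj) u : as_ (te A B) C E (as_ A B (te C E) u) =
 tm (as_ A B C) (idm E) (as_ A (te B C) E (tm (idm A) (as_ B C E) u)).
exact: (bt_pentagon hB (obP A) (obP B) (obP C) (obP E)). Qed.

Lemma hexagon (A B C : obj) u : as_ C A B (br (te A B) C (as_ A B C u)) =
 tm (br A C) (idm B) (as_ A C B (tm (idm A) (br B C) u)).
exact: (bt_hexagon hB (obP A) (obP B) (obP C)). Qed.

Lemma hexagon' (A B C : obj) u : asi B C A (br A (te B C) (asi A B C u)) =
 tm (idm B) (br A C) (asi B A C (tm (br A B) (idm C) u)).
exact: (bt_hexagon' hB (obP A) (obP B) (obP C)). Qed.
Lemma tmK1 (A B C : obj) (f : mor A B) (g : mor B A) u : cancel f g -> tm g (idm C) (tm f (idm C) u) = u.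
by move=> fK; rewrite tm_comp tm_id. Qed.
Lemma tmK2 (A B C : obj) (f : mor A B) (g : mor B A) u : cancel f g -> tm (idm C) g (tm (idm C) f u) = u.
by move=> fK; rewrite tm_comp tm_id. Qed.
Lemma tm_split1 (A B C E : obj) (f : mor A C) (g : mor B E) u : tm f g u = tm f (idm E) (tm (idm A) g u).
by rewrite tm_comp; apply: eq_tm. Qed.
Lemma tm_split2 (A B C E : obj) (f : mor A C) (g : mor B E) u : tm f g u = tm (idm C) g (tm f (idm B) u).
by rewrite tm_comp; apply: eq_tm. Qed.
Lemma tm_cm1 (A B C E : obj) (f : mor B C) (g : mor A B) u : tm (cm f g) (idm E) u = tm f (idm E) (tm g (idm E) u).
by rewrite tm_comp; apply: eq_tm. Qed.
Lemma tm_cm2 (A B C E : obj) (f : mor B C) (g : mor A B) u : tm (idm E) (cm f g) u = tm (idm E) f (tm (idm E) g u).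
by rewrite tm_comp; apply: eq_tm. Qed.

Lemma tm_faithful_l (A B : obj) (f g : mor A B) :
 (forall u, tm (idm un) f u = tm (idm un) g u) -> forall x, f x = g x.
by move=> fg x; rewrite -(luiK x) -!lu_nat fg. Qed.

Lemma tm_faithful_r (A B : obj) (f g : mor A B) :
 (forall u, tm f (idm un) u = tm g (idm un) u) -> forall x, f x = g x.
by move=> fg x; rewrite -(ruiK x) -!ru_nat fg. Qed.

(** Kelly's argument: it suffices to compare after tensoring with the unit, where the pentagon and
    the triangle apply. *)
Lemma lu_as (A B : obj) u : tm (lu A) (idm B) (as_ un A B u) = lu (te A B) u.
move: u; apply: (tm_faithful_l (f := cm (tm (lu A) (idm B)) (as_ un A B)) (g := lu (te A B))) => u.
apply: (can_inj (@asK un A B)); rewrite -triangle.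
have id2 t : tm (ru un) (idm (te A B)) t = tm (ru un) (tm (idm A) (idm B)) t by apply: eq_tm => // x; rewrite tm_id.
rewrite id2 as_nat pentagon tm_cm2 as_nat tm_comp; apply: eq_tm => // x.
by rewrite cmE triangle.
Qed.

Lemma lu_asi (A B : obj) u : lu (te A B) (asi un A B u) = tm (lu A) (idm B) u.
by rewrite -lu_as asiK. Qed.

Lemma lui_as (A B : obj) u : as_ un A B (lui (te A B) u) = tm (lui A) (idm B) u.
apply: (can_inj (g := tm (lui A) (idm B)) (f := tm (lu A) (idm B))).
 by move=> x; rewrite tmK1 //; exact: luK.
by rewrite lu_as luiK tmK1 //; exact: luiK.
Qed.

Lemma ru_as (A B : obj) u : ru (te A B) (as_ A B un u) = tm (idm A) (ru B) u.
move: u; apply: (tm_faithful_r (f := cm (ru (te A B)) (as_ A B un)) (g := tm (idm A) (ru B))) => u.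
have [w ->] : exists w, u = as_ A (te B un) un (tm (idm A) (as_ B un un) w).
 exists (tm (idm A) (asi B un un) (asi A (te B un) un u)).
 by rewrite tmK2 ?asiK //; exact: asiK.
rewrite tm_cm1 -pentagon triangle -as_nat.
have id2 t : tm (idm (te A B)) (lu un) t = tm (tm (idm A) (idm B)) (lu un) t by apply: eq_tm => // x; rewrite tm_id.
rewrite id2 -as_nat; congr (as_ _ _ _ _); rewrite tm_comp; apply: eq_tm => // x.
by rewrite cmE triangle.
Qed.

Lemma lu_ru (u : te un un) : lu un u = ru un u.
move: u; apply: (tm_faithful_r (f := lu un) (g := ru un)) => u.
rewrite -(asiK u) lu_as triangle; apply: (can_inj (@luK un)).
by rewrite lu_nat.
Qed.

Lemma rui_as (A B : obj) u : as_ A un B (tm (idm A) (lui B) u) = tm (rui A) (idm B) u.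
apply: (can_inj (g := tm (rui A) (idm B)) (f := tm (ru A) (idm B))).
 by move=> x; rewrite tmK1 //; exact: ruK.
by rewrite triangle tmK2 ?tmK1 //; [exact: ruiK|exact: luiK].
Qed.

Section Zigzags.
Variables (W X : obj) (e : mor (te X W) un) (i : mor un (te W X)).
Definition zig1 : mor W W := cm (ru W) (cm (tm (idm W) e) (cm (asi W X W) (cm (tm i (idm W)) (lui W)))).
Definition zig2 : mor X X := cm (lu X) (cm (tm e (idm X)) (cm (as_ X W X) (cm (tm (idm X) i) (rui X)))).
Lemma zig1E w : zig1 w = ru W (tm (idm W) e (asi W X W (tm i (idm W) (lui W w)))). by []. Qed.
Lemma zig2E x : zig2 x = lu X (tm e (idm X) (as_ X W X (tm (idm X) i (rui X x)))). by []. Qed.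

Lemma zig1_tm (Z : obj) (y : te W Z) : tm (idm W) (lu Z) (tm (idm W) (tm e (idm Z)) (tm (idm W) (as_ X W Z)
  (asi W X (te W Z) (tm i (idm (te W Z)) (lui (te W Z) y))))) = tm zig1 (idm Z) y.
set m := tm i _ _.
have E : tm (asi W X W) (idm Z) (as_ (te W X) W Z m) = as_ W (te X W) Z (tm (idm W) (as_ X W Z) (asi W X (te W Z) m)).
 apply: (can_inj (g := tm (asi W X W) (idm Z)) (f := tm (as_ W X W) (idm Z))).
  by move=> x; rewrite tmK1 //; exact: asK.
 rewrite -pentagon asiK tmK1 //; exact: asiK.
rewrite -triangle as_nat -E !tm_cm1 -lui_as; congr (tm _ _ (tm _ _ (tm _ _ _))).
rewrite /m -as_nat; congr (as_ _ _ _ _); apply: eq_tm => // x; by rewrite tm_id.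
Qed.

Lemma zig2_tm (Z : obj) (u : te X Z) : lu (te X Z) (tm e (idm (te X Z)) (as_ X W (te X Z) (tm (idm X) (asi W X Z)
  (tm (idm X) (tm i (idm Z)) (tm (idm X) (lui Z) u))))) = tm zig2 (idm Z) u.
set q := tm (idm X) (tm i _) _.
have E : as_ X W (te X Z) (tm (idm X) (asi W X Z) q) = asi (te X W) X Z (tm (as_ X W X) (idm Z) (as_ X (te W X) Z q)).
 apply: (can_inj (@asK (te X W) X Z)); rewrite asiK pentagon tmK2 //; exact: asiK.
rewrite E !tm_cm1 -lu_asi asi_nat; congr (lu _ _).
have id2 t : tm e (idm (te X Z)) t = tm e (tm (idm X) (idm Z)) t by apply: eq_tm => // x; rewrite tm_id.
by rewrite id2; congr (tm _ _ (asi _ _ _ (tm _ _ _))); rewrite /q as_nat rui_as.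
Qed.

(** Both sides create a pair W (x) X in the middle of X (x) W by i and evaluate both neighbours; the
    order of the two evaluations is immaterial. *)
Lemma e_zig (u : te X W) : e (tm zig2 (idm W) u) = e (tm (idm X) zig1 u).
rewrite -zig2_tm -lu_nat !tm_cm2 -ru_as -ru_nat lu_ru; congr (ru _ _).
rewrite as_nat.
have id2 t : tm (tm (idm X) (idm W)) e t = tm (idm (te X W)) e t by apply: eq_tm => // x; rewrite tm_id.
by rewrite id2 -tm_split2 -tm_split1.
Qed.

(** With [flat] the adjunction between X (x) - and W (x) -. Each composite being the identity uses
    one of the two zigzags: [flat_sharp] the first and [sharp_flat] the second. *)
Definition sharp (Y Z : obj) (g : mor (te X Y) Z) : mor Y (te W Z) :=
 cm (tm (idm W) g) (cm (asi W X Y) (cm (tm i (idm Y)) (lui Y))).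
Definition flat (Y Z : obj) (f : mor Y (te W Z)) : mor (te X Y) Z :=
 cm (lu Z) (cm (tm e (idm Z)) (cm (as_ X W Z) (tm (idm X) f))).

Lemma sharpE (Y Z : obj) (g : mor (te X Y) Z) y : sharp g y = tm (idm W) g (asi W X Y (tm i (idm Y) (lui Y y))).
by []. Qed.
Lemma flatE (Y Z : obj) (f : mor Y (te W Z)) u : flat f u = lu Z (tm e (idm Z) (as_ X W Z (tm (idm X) f u))).
by []. Qed.

Lemma flat_sharp (Y Z : obj) (f : mor Y (te W Z)) : (forall w, zig1 w = w) -> forall y, sharp (flat f) y = f y.
move=> z1 y; transitivity (tm zig1 (idm Z) (f y)); last by rewrite tm_id.
rewrite -zig1_tm lui_nat sharpE !tm_cm2; congr (tm _ _ (tm _ _ (tm _ _ _))).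
have -> : tm i (idm (te W Z)) (tm (idm un) f (lui Y y)) = tm (tm (idm W) (idm X)) f (tm i (idm Y) (lui Y y))
 by rewrite !tm_comp; apply: eq_tm => // t; rewrite !cmE ?idmE tm_id.
by rewrite asi_nat.
Qed.

Lemma sharp_flat (Y Z : obj) (g : mor (te X Y) Z) : (forall x, zig2 x = x) -> forall u, flat (sharp g) u = g u.
move=> z2 u; transitivity (g (tm zig2 (idm Y) u)); last by rewrite tm_id.
rewrite -zig2_tm -lu_nat flatE; congr (lu _ _).
rewrite !tm_cm2 as_nat.
have id2 t : tm (tm (idm X) (idm W)) g t = tm (idm (te X W)) g t by apply: eq_tm => // x; rewrite tm_id.
by rewrite id2 -tm_split1 -tm_split2.
Qed.

Lemma sharp_natl (Y Y' Z : obj) (g : mor (te X Y) Z) (h : mor Y' Y) y : sharp g (h y) = sharp (cm g (tm (idm X) h)) y.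
rewrite !sharpE lui_nat tm_cm2; congr (tm _ _ _).
have -> : tm i (idm Y) (tm (idm un) h (lui Y' y)) = tm (tm (idm W) (idm X)) h (tm i (idm Y') (lui Y' y))
 by rewrite !tm_comp; apply: eq_tm => // t; rewrite !cmE ?idmE tm_id.
by rewrite asi_nat.
Qed.

Lemma flat_natl (Y Y' Z : obj) (f : mor Y (te W Z)) (h : mor Y' Y) u : flat f (tm (idm X) h u) = flat (cm f h) u.
by rewrite !flatE tm_cm2. Qed.

Lemma flat_natr (Y Z Z' : obj) (f : mor Y (te W Z)) (h : mor Z Z') u : h (flat f u) = flat (cm (tm (idm W) h) f) u.
rewrite !flatE tm_cm2 as_nat -lu_nat; congr (lu _ _).
have id2 t : tm (tm (idm X) (idm W)) h t = tm (idm (te X W)) h t by apply: eq_tm => // x; rewrite tm_id.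
by rewrite id2 -tm_split1 -tm_split2.
Qed.

Lemma flat_eq (Y Z : obj) (f f' : mor Y (te W Z)) : (forall y, f y = f' y) -> forall u, flat f u = flat f' u.
by move=> ff u; rewrite !flatE; congr (lu _ (tm _ _ (as_ _ _ _ _))); apply: eq_tm. Qed.
Lemma sharp_eq (Y Z : obj) (g g' : mor (te X Y) Z) : (forall y, g y = g' y) -> forall u, sharp g u = sharp g' u.
by move=> gg u; rewrite !sharpE; apply: eq_tm. Qed.
End Zigzags.
Definition dual (W X : obj) (e : mor (te X W) un) (i : mor un (te W X)) :=
 (forall w, zig1 e i w = w) /\ (forall x, zig2 e i x = x).

Lemma dual_dual_pair (W X : obj) e i : @dual W X e i -> dual_pair e i.
by move=> [z1 z2]; split; [exact: (mP e)|exact: (mP i)|exact: z1|exact: z2]. Qed.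

Section RightDual.
Hypothesis lu_br : forall (A : obj) u, lu A (br A un u) = ru A u.
Hypothesis ru_br : forall (A : obj) u, ru A (br un A u) = lu A u.
Lemma br_rui (A : obj) w : br A un (rui A w) = lui A w.
by apply: (can_inj (@luK A)); rewrite lu_br ruiK luiK. Qed.
Lemma br_lui (A : obj) w : br un A (lui A w) = rui A w.
by apply: (can_inj (@ruK A)); rewrite ru_br ruiK luiK. Qed.
Lemma ru_bri (A : obj) u : ru A (bri A un u) = lu A u.
by rewrite -lu_br briK. Qed.
Lemma lu_bri (A : obj) u : lu A (bri un A u) = ru A u.
by rewrite -ru_br briK. Qed.

(** The hexagons carry the new zigzags to the old ones, conjugated by a braiding with the unit.
    Right duals thereby come from left duals. *)
Lemma dual_braided (W X : obj) (e : mor (te X W) un) (i : mor un (te W X)) : dual e i ->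
 dual (cm e (br W X)) (cm (bri X W) i).
move=> [z1 z2]; split=> [x|w].
- rewrite zig1E tm_cm2 tm_cm1; set y := tm i _ _.
 have -> : tm (idm X) (br W X) (asi X W X (tm (bri X W) (idm X) y)) =
   bri X (te X W) (as_ X W X (tm (idm X) i (rui X x))).
  set z := tm (idm X) i _; set u' := asi X W X _.
  pose u := tm (bri X X) (idm W) (as_ X X W (tm (idm X) (bri X W) z)).
  have E1 : tm (idm X) (br W X) u' = asi X X W u.
   apply: (can_inj (@asK X X W)); rewrite asiK.
   apply: (can_inj (g := tm (bri X X) (idm W)) (f := tm (br X X) (idm W))).
    by move=> t; rewrite tmK1 //; exact: brK.
   rewrite -hexagon asiK br_nat /y br_nat br_lui tmK1; last exact: briK.
   by rewrite /z.
  rewrite E1; apply: (can_inj (@brK X (te X W))); rewrite briK.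
  apply: (can_inj (@asiK X W X)); rewrite hexagon' tmK1; last exact: briK.
  by rewrite !asK tmK2 //; exact: briK.
 by rewrite -bri_nat ru_bri -zig2E z2.
rewrite zig2E tm_cm2 tm_cm1; set z := tm (idm W) i _.
have -> : tm (br W X) (idm W) (as_ W X W (tm (idm W) (bri X W) z)) =
  bri (te X W) W (asi W X W (tm i (idm W) (lui W w))).
 set y := tm i (idm W) _; set v := tm (idm W) (bri X W) z.
 pose u' := tm (idm X) (bri W W) (asi X W W (tm (bri X W) (idm W) y)).
 have E1 : tm (br W X) (idm W) (as_ W X W v) = as_ X W W u'.
  apply: (can_inj (@asiK X W W)); rewrite asK.
  apply: (can_inj (g := tm (idm X) (bri W W)) (f := tm (idm X) (br W W))).
   by move=> t; rewrite tmK2 //; exact: brK.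
  rewrite -hexagon' asK br_nat /z br_nat br_rui tmK2; last exact: briK.
  by rewrite /y.
 rewrite E1; apply: (can_inj (@brK (te X W) W)); rewrite briK.
 apply: (can_inj (@asK W X W)); rewrite hexagon tmK2; last exact: briK.
 by rewrite !asiK tmK1 //; exact: briK.
by rewrite -bri_nat lu_bri -zig1E z1.
Qed.

End RightDual.
End Category.

(** * Compatibility of the braiding with the unit isomorphisms *)

Section UnitBraiding.
Context R (k : R[i]) (hk : k != 0) (V : affine_vsa k).
Variables (T : tensor_data V) (hT : hlz_structure (@KL R k V) T).
Local Notation KLV := (@KL R k V).
Let hB := hlz_braided hT.

Lemma skew_hom (W1 W2 W3 W4 : vmod V) q (Y : log_modes W2 W1 W3) (f : W3 -> W4) w1 h j w2 :
 intertwining q Y -> ehom f ->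
 f (skew_modes Y w1 h j w2) = skew_modes (fun w2 h j w1 => f (Y w2 h j w1)) w1 h j w2.
move=> HY hf; have fl := hom_lin hf.
have lL (W : vmod V) i : linear (iter i (LL W (-1))) by apply: iter_linear; exact: L_lin.
have fL i x : f (iter i (L (-1)) x) = iter i (LL W4 (-1)) (f x)
 by elim: i => // i IH; rewrite !iterS (hom_L _ _ hf) IH.
have [N YN] := int_trunc HY w2 w1 h.
rewrite /skew_modes (fsum_lin fl); last first.
 exists N => i Ni; have -> : \sum_(t \in [set: nat]) ('C(j + t, j)%:R * piI R ^+ t) *: Y w2 (h + i%:R) (j + t)%N w1 = 0.
  by apply: fsum_eq0 => t; rewrite YN ?scaler0.
 by rewrite scaler0 (lin0 (lL _ _)) scaler0.
apply: eq_fsum => i; rewrite (linZ fl) fL (linZ fl) (fsum_lin fl); last first.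
 have [J YJ] := int_log HY w2 w1 (h + i%:R); exists J => t Jt; rewrite YJ ?scaler0 //; lia.
congr (_ *: iter _ _ (_ *: _)); apply: eq_fsum => t; by rewrite (linZ fl).
Qed.

Lemma lun_brd (A : vmod V) (KA : KLV A) (u : ten T A (adjoint V)) : lun (brd u) = run u.
have KV := bt_unit hB; have [hb _ _] := bt_brd hB KA KV; have [hl _ _] := bt_lun hB KA.
have [hr _ _] := bt_run hB KA; move: u; apply: (ten_hext hT KA KV).
- by move=> a x y; rewrite (hom_lin hb) (hom_lin hl).
- exact: hom_lin hr.
move=> a b w h j v wa vb; rewrite (hlz_brd hT KA KV h j wa vb) (hlz_run hT KA h j wa vb).
rewrite (linZ (hom_lin hl)) (skew_hom _ _ _ _ (hlz_intertwining hT KV KA) hl); congr (_ *: _).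
have E : (fun (v : adjoint V) h j (w : A) => lun (tY T v h j w)) = @Ymod _ _ _ A
 by apply/funext => v'; apply/funext => h'; apply/funext => j'; apply/funext => w'; exact: (hlz_lun hT KA).
by rewrite E.
Qed.

(** Follows from [lun_brd] through the twist: balance on 1 (x) A, pushed through the left unit, says
    that theta after [lun] equals theta after [run] and the braiding, and theta is injective. *)
Lemma run_brd (A : vmod V) (KA : KLV A) (u : ten T (adjoint V) A) : run (brd u) = lun u.
have KV := bt_unit hB; have [hb _ _] := bt_brd hB KV KA.
have sA := KL_span KA; have sV := KL_span KV.
have sVA := KL_span (bt_ten hB KV KA).
have [hl _ _] := bt_lun hB KA; have hth := theta_hom hk sA.
apply: (bij_inj (theta_bijective hk sA)).
have := theta_balanced hk hT KV KA u => /(congr1 (@lun _ _ _ T A)).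
rewrite (lun_brd KA) -(theta_nat sVA sA hl) => ->.
rewrite (_ : @theta _ _ _ (adjoint V) = id); last by apply/funext => v; exact: theta_adjoint.
have := bt_brd_nat hB KV KA KV KA (hom_id _) hth u; rewrite scale1r => ->.
by rewrite (bt_run_nat hB KA KA hth).
Qed.

End UnitBraiding.

(** * Duals of extensions, and reduction to simple modules *)

Section Extensions.
Context R (k : R[i]) (hk : k != 0) (V : affine_vsa k).
Variables (T : tensor_data V) (hT : hlz_structure (@KL R k V) T).
Variables (D : vmod V -> Prop) (hDK : forall W, D W -> KL W) (hB : braided_tensor D T).
Hypotheses (Dinj : forall (W W' : vmod V) (f : W' -> W), ehom f -> injective f -> D W -> D W')
 (Dsur : forall (W W' : vmod V) (f : W -> W'), ehom f -> onto f -> D W -> D W')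
 (Dprod : forall W1 W2 : vmod V, D W1 -> D W2 -> D (prod_vmod W1 W2)).
Local Notation obj := (@obj _ _ _ D).
Local Notation un := (un hB).
Local Notation te := (te hB).
Local Notation tm := (tm hB).
Local Notation as_ := (as_ hB).
Local Notation eqtm f f' g g' := (@eq_tm _ _ _ _ _ hB _ _ _ _ f f' g g').
Local Notation asi := (asi hB).
Local Notation lu := (lu hB).
Local Notation lui := (lui hB).
Local Notation ru := (ru hB).
Local Notation rui := (rui hB).
Local Notation idm := (@idm _ _ _ D).
Local Notation zig1 := (zig1 (hB := hB)).
Local Notation zig2 := (zig2 (hB := hB)).
Local Notation dual := (dual (hB := hB)).
Definition cb (A B : obj) a (f g : mor A B) : mor A B := Mor (hom_add a (mP f) (mP g)).
Definition zm (A B : obj) : mor A B := Mor (hom_zero A B false).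
Lemma cbE (A B : obj) a (f g : mor A B) x : cb a f g x = a *: f x + g x. by []. Qed.
Lemma zmE (A B : obj) (x : A) : zm A B x = 0. by []. Qed.
Lemma tm_cbl (A B A' B' : obj) a (f f' : mor A A') (g : mor B B') u : tm (cb a f f') g u = a *: tm f g u + tm f' g u.
exact: (bt_linl hB a (obP A) (obP B) (obP A') (obP B') (mP f) (mP f') (mP g)). Qed.
Lemma tm_cbr (A B A' B' : obj) a (f : mor A A') (g g' : mor B B') u : tm f (cb a g g') u = a *: tm f g u + tm f g' u.
exact: (bt_linr hB a (obP A) (obP B) (obP A') (obP B') (mP f) (mP g) (mP g')). Qed.
Lemma tm_zml (A B A' B' : obj) (g : mor B B') u : tm (zm A A') g u = 0.
rewrite (eqtm (zm A A') (cb (-1) (zm A A') (zm A A')) g g) //.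
 by rewrite tm_cbl scaleN1r addNr.
by move=> x; rewrite cbE !zmE scaler0 addr0.
Qed.
Lemma tm_zmr (A B A' B' : obj) (f : mor A A') u : tm f (zm B B') u = 0.
rewrite (eqtm f f (zm B B') (cb (-1) (zm B B') (zm B B'))) //.
 by rewrite tm_cbr scaleN1r addNr.
by move=> x; rewrite cbE !zmE scaler0 addr0.
Qed.

Definition surj (A B : obj) (f : mor A B) := forall y, exists x, f x = y.
Definition exact (A B E : obj) (f : mor A B) (g : mor B E) := forall y, g y = 0 -> exists x, f x = y.
Lemma tm_surj (A B A' B' : obj) (f : mor A A') (g : mor B B') : surj f -> surj g -> surj (tm f g).
exact: (tenm_surj hT (hDK (obP A)) (hDK (obP B)) (hDK (obP A')) (hDK (obP B')) (mP f) (mP g)). Qed.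

Lemma tm_exact_l (A B E X : obj) (f : mor A B) (g : mor B E) : surj g -> exact f g ->
 exact (tm f (idm X)) (tm g (idm X)).
move=> gs fg; apply: (tenm_kernel hT (hDK (obP A)) (hDK (obP B)) (hDK (obP E)) (hDK (obP X)) (mP f) (mP g)) => //.
Qed.

Lemma tm_exact_r (A B E X : obj) (f : mor A B) (g : mor B E) : surj g -> exact f g ->
 exact (tm (idm X) f) (tm (idm X) g).
move=> gs fg; apply: (tenm_kernel' hT (hDK (obP A)) (hDK (obP B)) (hDK (obP E)) (hDK (obP X)) (mP f) (mP g)) => //.
Qed.

Lemma lu_br (A : obj) u : lu A (br hB A un u) = ru A u.
by rewrite -[RHS](lun_brd hk hT (hDK (obP A))). Qed.
Lemma ru_br (A : obj) u : ru A (br hB un A u) = lu A u.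
by rewrite -[RHS](run_brd hk hT (hDK (obP A))). Qed.
Definition hasdual (W : obj) := exists (X : obj) e i, @dual W X e i.
Lemma dual_hasdual (W X : obj) e i : @dual W X e i -> hasdual X.
by move=> /(dual_braided lu_br ru_br) H; exists W; eexists; eexists; exact: H. Qed.

Lemma mor_factor (A B E : obj) (f : mor A E) (g : mor A B) : surj g ->
 (forall u, g u = 0 -> f u = 0) -> exists h : mor B E, forall u, h (g u) = f u.
move=> gs fg; have [h hh hE] := hom_factor (mP f) (mP g) gs fg.
by exists (Mor hh).
Qed.

Lemma mor_lift (A B E : obj) (f : mor A E) (j : mor B E) : injective j ->
 (forall u, exists v, j v = f u) -> exists h : mor A B, forall u, j (h u) = f u.
move=> ji jf; have [h hE] := choice jf; have [fl fp fa] := mP f; have [jl jp ja] := mP j.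
suff hh : ehom h by exists (Mor hh).
split=> [a u v|w|a v n w va]; apply: ji.
- by rewrite jl !hE fl.
- by rewrite scale1r jp !hE fp.
- by rewrite scale1r (ja a) // !hE (fa a).
Qed.

Definition subobj (W : obj) (U : set W) (sU : submodule U) : obj :=
 Obj (Dinj (sub_incl_hom sU) (@sub_incl_inj _ _ _ _ _ sU) (obP W)).
Definition submor (W : obj) (U : set W) (sU : submodule U) : mor (subobj sU) W :=
 @Mor _ _ _ _ (subobj sU) W _ (sub_incl_hom sU).
Definition quobj (W : obj) (U : set W) (sU : submodule U) : obj :=
 Obj (Dsur (quot_map_hom sU) (@quot_onto _ _ _ _ _ sU) (obP W)).
Definition qumor (W : obj) (U : set W) (sU : submodule U) : mor W (quobj sU) :=
 @Mor _ _ _ _ W (quobj sU) _ (quot_map_hom sU).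
Definition probj (A B : obj) : obj := Obj (Dprod (obP A) (obP B)).
Definition prfst (A B : obj) : mor (probj A B) A := @Mor _ _ _ _ (probj A B) A _ (fst_hom A B).
Definition prsnd (A B : obj) : mor (probj A B) B := @Mor _ _ _ _ (probj A B) B _ (snd_hom A B).
Definition prpair (E A B : obj) (f : mor E A) (g : mor E B) : mor E (probj A B) :=
 @Mor _ _ _ _ E (probj A B) _ (pair_hom (mP f) (mP g)).

Definition pullback_set (A B E : obj) (f : mor A E) (g : mor B E) : set (probj A B) :=
 [set z | cb (-1) (cm f (prfst A B)) (cm g (prsnd A B)) z = 0].
Lemma pullback_sub (A B E : obj) (f : mor A E) (g : mor B E) : submodule (pullback_set f g).
exact: submodule_ker (mP (cb (-1) (cm f (prfst A B)) (cm g (prsnd A B)))). Qed.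
Definition pullback (A B E : obj) (f : mor A E) (g : mor B E) : obj := subobj (pullback_sub f g).
Definition pb1 (A B E : obj) (f : mor A E) (g : mor B E) : mor (pullback f g) A :=
 cm (prfst A B) (submor (pullback_sub f g)).
Definition pb2 (A B E : obj) (f : mor A E) (g : mor B E) : mor (pullback f g) B :=
 cm (prsnd A B) (submor (pullback_sub f g)).

Section Pullback.
Variables (A B E : obj) (f : mor A E) (g : mor B E).

Lemma pb_eq z : f (pb1 f g z) = g (pb2 f g z).
have := sub_inclP (z : sub_vmod (pullback_sub f g)); rewrite /pullback_set /= scaleN1r addrC => /eqP.
by rewrite subr_eq0 => /eqP.
Qed.

Lemma pb_inj z z' : pb1 f g z = pb1 f g z' -> pb2 f g z = pb2 f g z' -> z = z'.
move=> e1 e2; apply: (@sub_incl_inj _ _ _ _ _ (pullback_sub f g)).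
by rewrite [LHS]surjective_pairing [RHS]surjective_pairing; congr pair.
Qed.

Lemma pb_ex x y : f x = g y -> exists z, pb1 f g z = x /\ pb2 f g z = y.
move=> e; have Uz : pullback_set f g ((x, y) : probj A B).
 by rewrite /pullback_set /= e scaleN1r addNr.
by exists (sub_in (pullback_sub f g) Uz).
Qed.

Lemma pb_mor (X : obj) (u : mor X A) (v : mor X B) : (forall x, f (u x) = g (v x)) ->
 exists h : mor X (pullback f g), forall x, pb1 f g (h x) = u x /\ pb2 f g (h x) = v x.
move=> e; have Uz x : pullback_set f g (prpair u v x).
 by rewrite /pullback_set /= e scaleN1r addNr.
by exists (@Mor _ _ _ _ X (pullback f g) _ (sub_corestrict (pullback_sub f g) Uz (mP (prpair u v)))).
Qed.

End Pullback.

(** The inclusion of the kernel into X (x) A transposes to a map into A that f kills; so the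
    transpose is zero, and the inclusion too. *)
Lemma tm_inj (X : obj) (A B : obj) (f : mor A B) : hasdual X -> injective f -> injective (tm (idm X) f).
move=> [X' [e [i [z1 z2]]]] fi.
have K0 u : tm (idm X) f u = 0 -> u = 0.
 pose sK := submodule_ker (mP (tm (idm X) f)); pose K := subobj sK; pose c : mor K (te X A) := submor sK.
 move=> fu; have c0 y : c y = 0.
  rewrite -(flat_sharp c z1 y).
  have -> : sharp i (flat e c) y = sharp i (zm (te X' K) A) y; last by rewrite sharpE tm_zmr.
  apply: sharp_eq => v; apply: fi; rewrite (lin0 (mor_lin f)) flat_natr.
  have -> : flat e (cm (tm (idm X) f) c) v = flat e (zm K (te X B)) v
   by apply: flat_eq => y'; exact: (sub_inclP (y' : sub_vmod sK)).
  by rewrite flatE tm_zmr (lin0 (mor_lin (as_ _ _ _))) (lin0 (mor_lin (tm _ _))) (lin0 (mor_lin (lu _))).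
 exact: (c0 (sub_in sK fu)).
move=> u v uv; apply/eqP; rewrite -subr_eq0; apply/eqP/K0.
by rewrite (linB (mor_lin (tm _ _))) uv subrr.
Qed.

Lemma tm_zig1 (Z B B' : obj) (e : mor (te B' B) un) (i : mor un (te B B')) (t : te Z B) :
 ru (te Z B) (tm (idm (te Z B)) e (asi (te Z B) B' B (tm (as_ Z B B') (idm B)
  (tm (tm (idm Z) i) (idm B) (tm (rui Z) (idm B) t))))) = tm (idm Z) (zig1 e i) t.
rewrite -rui_as -as_nat; set m := tm (idm Z) (tm i (idm B)) _.
have -> : tm (as_ Z B B') (idm B) (as_ Z (te B B') B m) =
  as_ (te Z B) B' B (as_ Z B (te B' B) (tm (idm Z) (asi B B' B) m)) by rewrite pentagon tmK2 //; exact: asiK.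
rewrite asK.
have id2 s : tm (idm (te Z B)) e s = tm (tm (idm Z) (idm B)) e s by apply: eq_tm => // x; rewrite tm_id.
by rewrite id2 -as_nat ru_as !tm_cm2.
Qed.

Lemma zig2_ru (W X : obj) (e : mor (te X W) un) (i : mor un (te W X)) : (forall x, zig2 e i x = x) ->
 forall t, lu X (tm e (idm X) (as_ X W X (tm (idm X) i t))) = ru X t.
by move=> z2 t; rewrite -(ruK t) -zig2E z2 ruiK. Qed.

Section Extension.
Variables (A W B A' B' : obj) (io : mor A W) (p : mor W B)
 (eA : mor (te A' A) un) (iA : mor un (te A A')) (eB : mor (te B' B) un) (iB : mor un (te B B')).
Hypotheses (io_inj : injective io) (p_surj : surj p) (io_p : exact io p) (p_io : forall a, p (io a) = 0)
 (dA : dual eA iA) (dB : dual eB iB).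

Let id_surj (X : obj) : surj (idm X). by move=> x; exists x. Qed.

(* The pushout Q of A'(x)W along eA. *)
Let nmor : mor (te A' A) (probj un (te A' W)) := prpair eA (cb (-1) (tm (idm A') io) (zm _ _)).
Let nmorE v : nmor v = ((eA v, - tm (idm A') io v) : probj un (te A' W)).
by congr pair; rewrite cbE zmE addr0 scaleN1r. Qed.
Let sN := submod_image (mP nmor) (submoduleT _).
Let Q := quobj sN.
Let j1 : mor un Q := cm (qumor sN) (prpair (idm un) (zm _ _)).
Let r : mor (te A' W) Q := cm (qumor sN) (prpair (zm _ _) (idm _)).
Let hA' : hasdual A'. exact: dual_hasdual dA. Qed.
Let j1_inj : injective j1.
have K0 x : j1 x = 0 -> x = 0.
 move=> /quot_map0 [u _ /= [ux uw]]; rewrite -ux (_ : u = 0) ?(lin0 (mor_lin eA)) //.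
 apply: (tm_inj hA' io_inj); rewrite (lin0 (mor_lin (tm _ _))).
 by move: uw; rewrite addr0 scaleN1r => /eqP; rewrite oppr_eq0 => /eqP.
move=> x y e; apply/eqP; rewrite -subr_eq0; apply/eqP/K0.
by rewrite (linB (mor_lin j1)) e subrr.
Qed.

Let r_io u : r (tm (idm A') io u) = j1 (eA u).
apply/eqP; rewrite -subr_eq0 -[X in X - _]/(quot_map sN _) -[X in _ - X]/(quot_map sN _).
rewrite -(linB (hom_lin (quot_map_hom sN))); apply/eqP/quot_map0; exists (- u) => //.
rewrite nmorE (linN (mor_lin eA)) (linN (mor_lin (tm _ _))) opprK.
by congr pair; rewrite /= ?sub0r ?subr0.
Qed.

Let pi_ex : exists pi : mor Q (te A' B), (forall x, pi (j1 x) = 0) /\ (forall t, pi (r t) = tm (idm A') p t).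
have [||pi piE] := @mor_factor _ _ _ (cm (tm (idm A') p) (prsnd un (te A' W))) (qumor sN).
- exact: (@quot_onto _ _ _ _ _ sN).
- move=> z /quot_map0 [u _ <-]; rewrite cmE nmorE.
 rewrite -[prsnd _ _ _]/(- tm (idm A') io u) (linN (mor_lin (tm _ _))) tm_comp (eqtm _ (idm A') _ (zm A B)) //.
 by rewrite tm_zmr oppr0.
exists pi; split=> [x|t]; rewrite cmE piE //.
exact: (lin0 (mor_lin (tm _ _))).
Qed.

(** The dual Y is built as an extension of A' by B'. As A' is dualizable, 1 embeds into the pushout
    Q with quotient A' (x) B; pulling Q (x) B' back along A' -> (A' (x) B) (x) B' gives Y. Two maps
    Y (x) W -> Q, one through A' (x) W and one through eB, agree in A' (x) B, and their difference
    is the evaluation. The coevaluation is found on an extension E of 1 by A (x) Y, which is split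
    by the failure of the second zigzag itself. *)
Lemma extension_dual : hasdual W.
have [pi [pi_j1 pi_r]] := pi_ex.
have pi_exact x : pi x = 0 -> exists y, j1 y = x.
 have [[y t] <-] := @quot_onto _ _ _ _ _ sN x.
 have -> : quot_map sN ((y, t) : probj un (te A' W)) = j1 y + r t.
  rewrite -[j1 y]/(quot_map sN _) -[r t]/(quot_map sN _) -(linD (hom_lin (quot_map_hom sN))).
  by congr (quot_map sN _); congr pair; rewrite /= ?addr0 ?add0r.
 rewrite (linD (mor_lin pi)) pi_j1 add0r pi_r => /(tm_exact_r p_surj io_p) [u <-].
 by exists (y + eA u); rewrite (linD (mor_lin j1)) r_io.
pose kap : mor A' (te (te A' B) B') := cm (as_ A' B B') (cm (tm (idm A') iB) (rui A')).
pose Y := pullback kap (tm pi (idm B')).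
pose q : mor Y A' := pb1 _ _; pose s : mor Y (te Q B') := pb2 _ _.
have [j jE] : exists j : mor B' Y, forall b, q (j b) = 0 /\ s (j b) = tm j1 (idm B') (lui B' b).
 apply: (pb_mor (u := zm B' A') (v := cm (tm j1 (idm B')) (lui B'))) => b.
 rewrite zmE (lin0 (mor_lin kap)) cmE tm_comp (eqtm _ (zm un (te A' B)) _ (idm B')) ?tm_zml //.
have q_exact : exact j q.
 move=> y qy; have : tm pi (idm B') (s y) = 0.
  by rewrite -(pb_eq (f := kap) y) -/q qy (lin0 (mor_lin kap)).
 have pi_s : surj pi by move=> t; have [t' <-] := tm_surj (@id_surj A') p_surj t; exists (r t').
 move=> /(tm_exact_l (X := B') pi_s pi_exact) [t tE]; exists (lu B' t).
 have [e1 e2] := jE (lu B' t).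
 by apply: (pb_inj (f := kap)); [rewrite -/q e1 qy|rewrite -/s e2 luK tE].
have q_surj : surj q.
 move=> a; have pi_s : surj pi by move=> t; have [t' <-] := tm_surj (@id_surj A') p_surj t; exists (r t').
 have [t tE] := tm_surj pi_s (@id_surj B') (kap a).
 by have [y [y1 _]] := pb_ex (esym tE); exists y.
(* [al] uses only the component q of Y and [be] only s. Both induce q (x) p in A' (x) B, so be - al
   lands in the copy of 1 inside Q. *)
pose al : mor (te Y W) Q := cm r (tm q (idm W)).
pose be : mor (te Y W) Q := cm (ru Q) (cm (tm (idm Q) eB) (cm (asi Q B' B) (tm s p))).
have piru t : pi (ru Q t) = ru _ (tm pi (idm un) t) by rewrite ru_nat.
have pi_be u : pi (be u) = tm q p u.
 rewrite !cmE piru tm_comp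
  (eqtm _ (cm (idm _) pi) _ (cm eB (tm (idm B') (idm B)))) //; last by move=> x; rewrite !cmE ?idmE tm_id.
 rewrite -tm_comp -asi_nat tm_comp
  (eqtm _ (cm kap q) _ (cm (idm B) p)) //; last by move=> x; rewrite cmE [RHS]cmE (pb_eq (f := kap)).
 rewrite -tm_comp !tm_cm1 tm_zig1 tm_comp; apply: eq_tm => // x.
 by rewrite cmE; case: dB => ->.
have [eW eWE] : exists eW : mor (te Y W) un, forall u, j1 (eW u) = be u - al u.
 have [u|eW eWE] := @mor_lift _ _ _ (cb (-1) al be) j1 j1_inj.
  apply: pi_exact; rewrite cbE scaleN1r addrC (linB (mor_lin pi)) pi_be cmE pi_r tm_comp.
  by apply/eqP; rewrite subr_eq0; apply/eqP/eq_tm.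
 by exists eW => u; rewrite eWE cbE scaleN1r addrC.
have eW_j u : eW (tm j (idm W) u) = eB (tm (idm B') p u).
 apply: j1_inj; rewrite eWE.
 have -> : al (tm j (idm W) u) = 0.
  rewrite cmE tm_comp (eqtm _ (zm B' A') _ (idm W)) //.
   by rewrite tm_zml (lin0 (mor_lin r)).
  by move=> x; rewrite !cmE ?idmE; case: (jE x).
 rewrite subr0 !cmE tm_comp
  (eqtm _ (cm (cm (tm j1 (idm B')) (lui B')) (idm B')) _ (cm (idm B) p)) //; last by move=> x; rewrite !cmE ?idmE; case: (jE x).
 rewrite -tm_comp !tm_cm1 asi_nat tm_comp
  (eqtm _ (cm j1 (idm un)) _ (cm (idm un) eB)) //; last by move=> x; rewrite !cmE ?idmE tm_id.
 rewrite -tm_comp ru_nat -lu_ru lu_nat; congr (j1 (eB _)).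
 by rewrite lu_asi tmK1 //; exact: luiK.
have eW_io u : eW (tm (idm Y) io u) = - eA (tm q (idm A) u).
 apply: j1_inj; rewrite eWE (linN (mor_lin j1)) -r_io.
 have -> : be (tm (idm Y) io u) = 0.
  rewrite !cmE tm_comp (eqtm _ s _ (zm A B)) //
   tm_zmr (lin0 (mor_lin (asi _ _ _))) (lin0 (mor_lin (tm _ _))); exact: (lin0 (mor_lin (ru _))).
 by rewrite sub0r cmE !tm_comp; congr (- r _); apply: eq_tm.
(* A coevaluation of W must induce that of B in B (x) Y; E consists of the elements of 1 together
   with a lift of their image to W (x) Y. *)
pose E := pullback (cm (tm (idm B) j) iB) (tm p (idm Y)).
pose f1 : mor E un := pb1 _ _; pose f2 : mor E (te W Y) := pb2 _ _.
(* d1 is the second zigzag evaluated on a lift, d2 what it should be. They agree on B' by the zigzag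
   of B, so the defect d1 - d2 descends along q to A' (x) E. *)
pose d1 : mor (te Y E) Y := cm (lu Y) (cm (tm eW (idm Y)) (cm (as_ Y W Y) (tm (idm Y) f2))).
pose d2 : mor (te Y E) Y := cm (ru Y) (tm (idm Y) f1).
have d_j u : d1 (tm j (idm E) u) = d2 (tm j (idm E) u).
 rewrite /d1 /d2 !cmE !tm_comp
  (eqtm _ (cm j (idm B')) _ (cm (tm (idm W) (idm Y)) f2)) //; last by move=> x; rewrite !cmE ?idmE tm_id.
 rewrite -tm_comp as_nat tm_comp (eqtm _ (cm eB (tm (idm B') p)) _ (cm (idm Y) (idm Y))) //; last first.
 rewrite -tm_comp -as_nat tm_comp
  (eqtm _ (cm (idm B') (idm B')) _ (cm (tm (idm B) j) (cm iB f1))) //; last by move=> x; rewrite !cmE -(pb_eq (f := cm (tm (idm B) j) iB)).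
 rewrite -tm_comp as_nat
  (eqtm (tm (idm B') (idm B)) (idm (te B' B)) _ _ _ _ (fun=> erefl)); last by move=> x; rewrite tm_id.
 rewrite -tm_split1 tm_split2 lu_nat tm_cm2 zig2_ru; last by case: dB.
 rewrite -ru_nat tm_comp; congr (ru _ _); exact: eq_tm.
have qE_surj : surj (tm q (idm E)) by exact: tm_surj q_surj (@id_surj E).
have [d' d'E] : exists d' : mor (te A' E) Y, forall u, d' (tm q (idm E) u) = d1 u - d2 u.
 have [u|d' d'E] := @mor_factor _ _ _ (cb (-1) d2 d1) (tm q (idm E)) qE_surj.
  move=> /(tm_exact_l (X := E) q_surj q_exact) [v <-].
  by rewrite cbE scaleN1r d_j addNr.
 by exists d' => u; rewrite d'E cbE scaleN1r addrC.
have [jo joE] : exists jo : mor (te A Y) E, forall t, f1 (jo t) = 0 /\ f2 (jo t) = tm io (idm Y) t.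
 apply: (pb_mor (u := zm _ _) (v := tm io (idm Y))) => t.
 rewrite zmE (lin0 (mor_lin (cm _ _))) tm_comp.
 by rewrite (eqtm _ (zm A B) _ (idm Y)) ?tm_zml.
have d'_jo u : d' (tm (idm A') jo u) = - flat eA (idm (te A Y)) u.
 have [v <-] := tm_surj q_surj (@id_surj (te A Y)) u.
 have -> : tm (idm A') jo (tm q (idm (te A Y)) v) = tm q (idm E) (tm (idm Y) jo v) by rewrite !tm_comp; apply: eq_tm.
 rewrite d'E /d1 /d2 !cmE !tm_comp
  (eqtm _ (idm Y) (cm f1 jo) (zm _ _)) //; last by move=> x; rewrite !cmE ?idmE; case: (joE x).
 rewrite tm_zmr (lin0 (mor_lin (ru _))) subr0
  (eqtm _ (idm Y) (cm f2 jo) (tm io (idm Y))) //; last by move=> x; rewrite !cmE ?idmE; case: (joE x).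
 rewrite as_nat tm_comp
  (eqtm (cm eW (tm (idm Y) io)) (cb (-1) (cm eA (tm q (idm A))) (zm _ _)) _ (idm Y)) //; last by move=> x; rewrite cmE eW_io cbE zmE addr0 scaleN1r.
 rewrite tm_cbl tm_zml addr0 scaleN1r (linN (mor_lin (lu _))); congr (- _).
 rewrite tm_cm1 -as_nat; congr (lu _ (tm _ _ (as_ _ _ _ _))).
 by apply: eq_tm => // x; rewrite tm_id.
(* On A (x) Y the defect is minus the transpose of the identity ([d'_jo]), so transposing it back
   with a sign retracts E onto A (x) Y. *)
pose rho : mor E (te A Y) := cb (-1) (sharp iA d') (zm _ _).
have rhoE z : rho z = - sharp iA d' z by rewrite cbE zmE addr0 scaleN1r.
have [zA1 zA2] := dA.
have rho_jo t : rho (jo t) = t.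
 rewrite rhoE sharp_natl (@sharp_eq _ _ _ _ _ hB _ _ iA _ _ _ (cb (-1) (flat eA (idm (te A Y))) (zm _ _))); last by move=> u; rewrite cmE d'_jo cbE zmE addr0 scaleN1r.
 by rewrite sharpE tm_cbr tm_zmr addr0 scaleN1r opprK -sharpE flat_sharp.
(* The projector onto the kernel of [rho], a complement of A (x) Y; on it [f2] depends only on [f1],
   which gives the coevaluation. *)
pose g : mor E E := cb (-1) (cm jo rho) (idm E).
have gE z : g z = z - jo (rho z) by rewrite cbE scaleN1r addrC.
have f1_surj : surj f1.
 move=> x; have [w wE] := tm_surj p_surj (@id_surj Y) (tm (idm B) j (iB x)).
 by have [z [z1 _]] := pb_ex (f := cm (tm (idm B) j) iB) (esym wE); exists z.
have f1g z : f1 (g z) = f1 z by rewrite gE (linB (mor_lin f1)); case: (joE (rho z)) => -> _; rewrite subr0.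
have [iW iWE] : exists iW : mor un (te W Y), forall z, iW (f1 z) = f2 (g z).
 have [z|iW iWE] := @mor_factor _ _ _ (cm f2 g) f1 f1_surj; last by exists iW.
 move=> z0; have : tm p (idm Y) (f2 z) = 0.
  by rewrite -(pb_eq (f := cm (tm (idm B) j) iB) z) -/f1 z0 (lin0 (mor_lin (cm _ _))).
 move=> /(tm_exact_l (X := Y) p_surj io_p) [t tE].
 have [e1 e2] := joE t.
 have -> : z = jo t by apply: (pb_inj (f := cm (tm (idm B) j) iB)); rewrite -/f1 -/f2 ?e1 ?e2 ?z0 ?tE.
 by rewrite cmE gE rho_jo subrr (lin0 (mor_lin f2)).
have zW2 y : zig2 eW iW y = y.
 have [u uE] := tm_surj (@id_surj Y) f1_surj (rui Y y).
 rewrite zig2E -uE tm_comp (eqtm _ (cm (idm Y) (idm Y)) _ (cm f2 g)) // -tm_comp -[LHS]/(d1 (tm (idm Y) g u)).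
 have d1E v : d1 v = d' (tm q (idm E) v) + d2 v by rewrite d'E subrK.
 rewrite d1E; have -> : d2 (tm (idm Y) g u) = y.
  rewrite /d2 cmE tm_comp (eqtm _ (idm Y) _ f1) //.
  by rewrite uE ruiK.
 rewrite -[RHS]add0r; congr (_ + _).
 have -> : tm q (idm E) (tm (idm Y) g u) = tm (idm A') g (tm q (idm E) u) by rewrite !tm_comp; apply: eq_tm.
 move: (tm q (idm E) u) => u'; rewrite tm_cbr tm_cm2 tm_id // scaleN1r addrC (linB (mor_lin d')) d'_jo.
 rewrite opprK flat_natl (@flat_eq _ _ _ _ _ hB _ _ eA _ _ _ (cb (-1) (sharp iA d') (zm _ _))) //
  flatE tm_cbr tm_zmr addr0 scaleN1r (linN (mor_lin (as_ _ _ _))) (linN (mor_lin (tm _ _))).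
 by rewrite (linN (mor_lin (lu _))) -flatE sharp_flat // subrr.
have piW x : tm p (idm Y) (iW x) = tm (idm B) j (iB x)
 by have [z <-] := f1_surj x; rewrite iWE -(pb_eq (f := cm (tm (idm B) j) iB)) -/f1 f1g.
have p_zig w : p (zig1 eW iW w) = p w.
 rewrite zig1E -ru_nat tm_comp
  (eqtm _ (cm (idm B) p) _ (cm eW (tm (idm Y) (idm W)))) //; last by move=> x; rewrite !cmE ?idmE tm_id.
 rewrite -tm_comp -asi_nat tm_comp (eqtm _ (cm (tm (idm B) j) iB) _ (cm (idm W) (idm W))) // -tm_comp asi_nat tm_comp
  (eqtm _ (cm (idm B) (idm B)) _ (cm eB (tm (idm B') p))) // -tm_comp -asi_nat tm_comp
  (eqtm _ (cm iB (idm un)) _ (cm (idm B) p)) //; last by move=> x; rewrite !cmE !idmE tm_id.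
 by rewrite -tm_comp -lui_nat -zig1E; case: dB => ->.
(* The first zigzag is the identity modulo A. Its defect [de] : W -> A is invisible to eA by [e_zig]
   and the second zigzag, and the zigzag of A recovers [de] from eA. *)
exists Y, eW, iW; split=> // w; apply/esym/eqP; rewrite -subr_eq0; apply/eqP.
have [u|de deE] := @mor_lift _ _ _ (cb (-1) (zig1 eW iW) (idm W)) io io_inj.
 by apply: io_p; rewrite cbE (linD (mor_lin p)) (linZ (mor_lin p)) p_zig scaleN1r addNr.
have deE' u : io (de u) = u - zig1 eW iW u by rewrite deE cbE scaleN1r addrC.
have e_de u : eA (tm (idm A') de u) = 0.
 have [v <-] := tm_surj q_surj (@id_surj W) u.
 have -> : tm (idm A') de (tm q (idm W) v) = tm q (idm A) (tm (idm Y) de v) by rewrite !tm_comp; apply: eq_tm.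
 apply/eqP; rewrite -oppr_eq0 -eW_io tm_comp.
 rewrite (eqtm _ (idm Y) _ (cb (-1) (zig1 eW iW) (idm W))) //.
 by rewrite tm_cbr (linD (mor_lin eW)) (linZ (mor_lin eW)) -e_zig !tm_id // scaleN1r addNr.
rewrite -deE' -(zA1 (de w)) zig1E lui_nat.
have -> : tm iA (idm A) (tm (idm un) de (lui W w)) = tm (tm (idm A) (idm A')) de (tm iA (idm W) (lui W w))
 by rewrite !tm_comp; apply: eq_tm => // t; rewrite !cmE ?idmE tm_id.
rewrite asi_nat tm_comp (eqtm _ (idm A) _ (zm _ _)) //.
 by rewrite tm_zmr (lin0 (mor_lin (ru _))) (lin0 (mor_lin io)).
Qed.

End Extension.

Lemma zero_dual (Z : obj) : (forall z : Z, z = 0) -> hasdual Z.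
move=> Z0; exists Z, (zm _ _), (zm _ _); split=> z; last by rewrite (Z0 z); exact: Z0.
by rewrite (Z0 z); exact: Z0.
Qed.

Definition simple (W : vmod V) := (exists w : W, w <> 0) /\ forall U : set W, submodule U -> U = [set 0] \/ U = setT.

Lemma wcover_quotient (W : obj) (X X' : set W) (sX : submodule X) (sX' : submodule X')
 (sU : submodule (@sub_incl _ _ _ _ _ sX' @^-1` X)) : wcover X X' ->
 (forall z : @quobj (subobj sX') _ sU, z = 0) \/ simple (@quobj (subobj sX') _ sU).
move=> [XX' c]; have [Z0|/existsNP[z z0]] := pselect (forall z : @quobj (subobj sX') _ sU, z = 0); [by left|right].
split; first by exists z.
pose pr := @quot_map _ _ _ _ _ sU; pose inc := @sub_incl _ _ _ _ _ sX'.
have lp : linear pr by exact: hom_lin (quot_map_hom sU).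
move=> Z sZ; have sP := submodule_preim (quot_map_hom sU) sZ.
have XI : X `<=` inc @` (pr @^-1` Z).
 move=> x Xx; exists (sub_in sX' (XX' _ Xx)); last exact: sub_inclK.
 rewrite /= (_ : pr _ = 0); first by case: sZ.
 by apply/quot_map0; rewrite /= sub_inclK.
have IX : inc @` (pr @^-1` Z) `<=` X' by move=> _ [x _ <-]; exact: sub_inclP.
case: (c _ (submod_image (sub_incl_hom sX') sP) XI IX) => EI; [left|right]; apply/seteqP; split=> // q.
- have [w <-] := quot_onto q => Zw; apply/quot_map0; rewrite /= -EI; by exists w.
- by move=> ->; case: sZ.
have [w <-] := quot_onto q; move=> _.
have : (inc @` (pr @^-1` Z)) (inc w) by rewrite EI; exact: sub_inclP.
by move=> [w' Zw' /sub_incl_inj <-].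
Qed.

Lemma simple_duals : (forall S : obj, simple S -> hasdual S) -> forall W : obj, hasdual W.
move=> simp W; have step (X : set W) : chain [set 0] X -> forall sX : submodule X, hasdual (subobj sX).
 elim=> [sX|X' X'' _ IH sX' _ cXX sX''].
  apply: zero_dual => z; apply: sub_incl_inj; rewrite (lin0 (hom_lin (sub_incl_hom sX))).
  exact: (sub_inclP (z : sub_vmod sX)).
 have sU := submodule_preim (sub_incl_hom sX'') sX'.
 have hB' : hasdual (@quobj (subobj sX'') _ sU) by case: (wcover_quotient sX' sU cXX) => [/zero_dual|/simp].
 have [[A' [eA [iA dA]]] [B' [eB [iB dB]]]] := (IH sX', hB').
 have UX x : X' x -> X'' x by case: cXX => h _; exact: h.
 have hx (x : subobj sX') : X'' (sub_incl (x : sub_vmod sX')) by apply: UX; exact: sub_inclP.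
 pose io : mor (subobj sX') (subobj sX'') :=
  @Mor _ _ _ _ (subobj sX') (subobj sX'') _ (sub_corestrict sX'' hx (sub_incl_hom sX')).
 refine (@extension_dual (subobj sX') (subobj sX'') (@quobj (subobj sX'') _ sU) A' B' io (@qumor (subobj sX'') _ sU) eA iA eB iB _ _ _ _ dA dB).
 - by move=> x y /(congr1 (@sub_incl _ _ _ _ _ sX'')); rewrite !sub_inclK => /sub_incl_inj.
 - exact: quot_onto.
 - move=> y /quot_map0 /= Xy; exists (sub_in sX' Xy); exact: sub_incl_inj.
 - by move=> a; apply/quot_map0; exact: (sub_inclP (a : sub_vmod sX')).
have := step _ _ (submoduleT W).
have [+ _ _ _] := hDK (obP W) => /finite_lengthP h /(_ h) hs.
(* The last term of the chain is the submodule [setT], isomorphic to W but a different object; one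
   more extension, by a zero quotient, transfers the dual. *)
have [X [e [i d]]] := hs.
pose f : mor (subobj (submoduleT W)) W := submor _.
refine (@extension_dual (subobj (submoduleT W)) W (@quobj W _ (submoduleT W)) X
 (@quobj W _ (submoduleT W)) f (qumor _) e i (zm _ _) (zm _ _) _ _ _ _ d _).
- exact: sub_incl_inj.
- exact: quot_onto.
- by move=> w _; exists (@sub_in _ _ _ _ _ (submoduleT W) w I).
- by move=> a; apply/quot_map0.
- have Z0 (z : @quobj W _ (submoduleT W)) : z = 0 by have [w <-] := quot_onto z; apply/quot_map0.
 by split=> z; rewrite (Z0 z) [LHS]Z0.
Qed.

End Extensions.

(** * Eigenvectors, lowest weights and Schur's lemma *)

Section Eigenvectors.
Context R (W : lmodType R[i]) (A : W -> W) (lA : linear A).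
Let ev n (p : {poly R[i]}) w := \sum_(i < n) p`_i *: iter i A w.
Let ev_root n z (q : {poly R[i]}) w : (size q <= n)%N -> ev n.+1 (('X - z%:P) * q) w = ev n q (A w - z *: w).
move=> qn; have E i : (('X - z%:P) * q)`_i = (if i is j.+1 then q`_j else 0) - z * q`_i.
 by rewrite mulrBl coefB coefXM coefCM; case: i.
rewrite /ev big_ord_recl E (eq_bigr (fun i : 'I_n => q`_i *: iter i.+1 A w - (z * q`_i.+1) *: iter i.+1 A w)); last by move=> i _; rewrite lift0 E scalerBl.
rewrite big_split /= sumrN sub0r scaleNr.
have -> : \sum_(i < n) (z * q`_i.+1) *: iter i.+1 A w = \sum_(i < n) (z * q`_i) *: iter i A w - (z * q`_0) *: w.
 rewrite -[LHS]addr0 -[X in _ + X](addrN ((z * q`_0) *: w)) addrA; congr (_ - _); rewrite addrC.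
 have -> : \sum_(i < n) (z * q`_i) *: iter i A w = \sum_(i < n.+1) (z * q`_i) *: iter i A w
  by rewrite big_ord_recr /= (nth_default 0 qn) mulr0 scale0r addr0.
 by rewrite big_ord_recl.
rewrite opprB addrCA [RHS](eq_bigr (fun i : 'I_n => q`_i *: iter i.+1 A w - (z * q`_i) *: iter i A w)); last first.
 move=> i _; rewrite (linB (iter_linear i lA)) (linZ (iter_linear i lA)) -iterSr.
 by lmod_ring.
by rewrite addKr big_split /= sumrN.
Qed.

(** The vectors u, A u, ..., A^n u in a space spanned by n vectors are dependent, so a nonzero
    polynomial in A kills u; its linear factors are peeled off until one of them has a kernel. *)
Lemma eigen_exists (U : set W) n (b : 'I_n -> W) u : subspace U -> (forall w, U w -> U (A w)) ->
 (forall w, U w -> exists c, w = \sum_(t < n) c t *: b t) -> U u -> u <> 0 ->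
 exists h v, [/\ U v, v <> 0 & A v = h *: v].
move=> sU AU bU Uu u0.
have key (rs : seq R[i]) : forall w, U w -> w <> 0 -> ev (size rs).+1 (\prod_(z <- rs) ('X - z%:P)) w = 0 ->
  exists h v, [/\ U v, v <> 0 & A v = h *: v].
 elim: rs => [|z rs IH] w Uw w0.
  by rewrite big_nil /ev big_ord1 coefC eqxx scale1r.
 rewrite big_cons ev_root ?size_prod_XsubC // => e.
 have [zw|zw] := pselect (A w - z *: w = 0).
  by exists z, w; split=> //; apply/eqP; rewrite -subr_eq0 zw.
 by apply: (IH _ _ zw e); apply: (subB sU); [exact: AU|exact: (subZ sU)].
have Ui i : U (iter i A u) by elim: i => // i IH; rewrite iterS; exact: AU.
have [c cE] := choice (fun i : 'I_n.+1 => bU _ (Ui i)).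
pose M := \matrix_(i < n.+1, t < n) c i t.
have : kermx M != 0 by rewrite kermx_eq0 -row_leq_rank -ltnNge ltnS rank_leq_col.
move=> /rowV0Pn [v /sub_kermxP vM v0].
pose p := rVpoly v.
have p0 : p != 0 by apply: contraNneq v0 => p0; rewrite -(rVpolyK v) -/p p0 linear0.
have [rs pE] := closed_field_poly_normal p.
have lp0 : lead_coef p != 0 by rewrite lead_coef_eq0.
have sp : (size (\prod_(z <- rs) ('X - z%:P) : {poly R[i]})%R <= n.+1)%N
 by have : (size p <= n.+1)%N by [exact: size_poly]; rewrite pE size_scale.
apply: (key rs _ Uu u0); apply/eqP; have : ev n.+1 p u = 0.
 rewrite /ev (eq_bigr (fun i : 'I_n.+1 => \sum_(t < n) (v 0 i * M i t) *: b t)); last first.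
  move=> i _; rewrite coef_rVpoly_ord (cE i) scaler_sumr; apply: eq_bigr => t _.
  by rewrite mxE scalerA.
 rewrite exchange_big /= big1 // => t _; rewrite -scaler_suml.
 have : (v *m M) 0 t = 0 by rewrite vM mxE.
 by rewrite mxE => ->; exact: scale0r.
rewrite pE => /eqP; have -> : ev n.+1 (lead_coef p *: \prod_(z <- rs) ('X - z%:P)) u =
  lead_coef p *: ev (size rs).+1 (\prod_(z <- rs) ('X - z%:P)) u.
 rewrite /ev scaler_sumr (eq_bigr (fun i : 'I_n.+1 => lead_coef p *: ((\prod_(z <- rs) ('X - z%:P))`_i *: iter i A u))); last by move=> i _; rewrite coefZ scalerA.
 move: sp; rewrite size_prod_XsubC => sp.
 apply: (@sum_ord_widen _ (fun i => lead_coef p *: ((\prod_(z <- rs) ('X - z%:P))`_i *: iter i A u)) _ _ _ sp) => i ri.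
 by rewrite nth_default ?scale0r ?scaler0 // size_prod_XsubC.
by rewrite scaler_eq0 (negPf lp0).
Qed.

End Eigenvectors.

Section LowestWeights.
Context R (k : R[i]) (hk : k != 0) (V : affine_vsa k).
Local Notation vmod := (vmod V).
Definition lowest (W : vmod) (h : R[i]) := forall m : nat, forall w : W, geneig (h - m.+1%:R) w -> w = 0.

Lemma lowest_exists (W : vmod) h (w : W) : KL W -> geneig h w -> w <> 0 ->
 exists n, lowest W (h - n%:R) /\ exists2 u : W, geneig (h - n%:R) u & u <> 0.
move=> [_ _ _ lb] hw w0; have [N NP] := lb h.
pose P n := exists2 u : W, geneig (h - n%:R) u & u <> 0.
have P0 : exists n, `[< P n >] by exists 0%N; apply/asboolP; exists w; rewrite // subr0.
have PN n : `[< P n >] -> (n <= N)%N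
 by move=> /asboolP [u un u0]; rewrite leqNgt; apply/negP => Nn; apply: u0; apply: (NP n) => //; exact: ltnW.
have [n /asboolP Pn nmax] := ex_maxnP P0 PN; exists n; split=> // m u um; apply: contrapT => u0.
have : `[< P (n + m.+1)%N >] by apply/asboolP; exists u; rewrite // natrD opprD addrA.
by move=> /nmax; rewrite leqNgt addnS ltnS leq_addr.
Qed.

Lemma lowest_kill (W : vmod) h (w : W) : lowest W h -> geneig h w -> forall a (r : nat), mode W a r.+1 w = 0.
by move=> lh hw a r; apply: (lh r); have := mode_geneig hk a r.+1 hw. Qed.
Lemma mode_zero_geneig (W : vmod) a h (w : W) : geneig h w -> geneig h (mode W a 0 w).
by move=> hw; have := mode_geneig hk a 0 hw; rewrite subr0. Qed.
Lemma mode_lin (W : vmod) a r : linear (mode W a r).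
exact: act_linr. Qed.
Lemma mode0 (W : vmod) a r : mode W a r 0 = 0. exact: (lin0 (@mode_lin W a r)). Qed.

Lemma mode_swap (W : vmod) a b r s (w : W) :
 mode W a r (mode W b s w) = (-1) ^+ (odd11 a && odd11 b) *: mode W b s (mode W a r w) +
  bracket11 (fun c => mode W c (r + s) w) a b + (if r + s == 0 then r%:~R * kappa11 R a b * k else 0) *: w.
exact: (act_swap (mode_action W)). Qed.

Lemma zero_swap (W : vmod) a b (w : W) :
 mode W a 0 (mode W b 0 w) = (-1) ^+ (odd11 a && odd11 b) *: mode W b 0 (mode W a 0 w) +
  bracket11 (fun c => mode W c 0 w) a b.
by rewrite mode_swap addr0 eqxx /= !mul0r scale0r addr0. Qed.

Lemma E_central (W : vmod) a r (w : W) : mode W gE 0 (mode W a r w) = mode W a r (mode W gE 0 w).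
rewrite mode_swap (_ : (if _ then _ else _) = 0); last by case: ifP; rewrite ?mul0r.
by rewrite scale0r addr0; case: a => /=; rewrite scale1r addr0.
Qed.

Lemma E_hom (W : vmod) : ehom (mode W gE 0).
apply: mode_hom => [|w|a r w]; rewrite ?scale1r; first exact: mode_lin.
- by rewrite [RHS](act_par (mode_action W)) scale1r.
- exact: E_central.
Qed.

Lemma sq_zero (W : vmod) a r (w : W) : odd11 a -> mode W a r (mode W a r w) = 0.
move=> oa; have /eqP := mode_swap a a r r w; rewrite oa /= expr1 scaleN1r.
rewrite (_ : bracket11 _ a a = 0); last by case: a oa.
rewrite (_ : (if _ then _ else _) = 0); last by case: ifP; case: a oa; rewrite /= ?mulr0 ?mul0r.
rewrite scale0r !addr0 -subr_eq0 opprK -mulr2n -scaler_nat scaler_eq0 pnatr_eq0 /=.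
by move=> /eqP.
Qed.

(* L0 acts on such a weight space as a multiple of psi-_0 psi+_0, whose square is zero. *)
Lemma E0_lowest (W : vmod) h (w : W) : (forall w : W, mode W gE 0 w = 0) -> lowest W h -> geneig h w ->
 L 0 w = k^-1 *: mode W gPsiM 0 (mode W gPsiP 0 w) /\ L 0 (L 0 w) = 0.
move=> E0 lh.
have lm a : linear (mode W a 0) by exact: mode_lin.
have F u : geneig h u -> L 0 u = k^-1 *: mode W gPsiM 0 (mode W gPsiP 0 u).
 move=> hu; rewrite (L0_casimir hk (lowest_kill lh hu)) !E0 (lin0 (lm _)).
 rewrite (mode_swap gPsiP gPsiM) /= E0 mul0r mul0r scale0r !addr0 scaler0 addr0 expr1 scaleN1r opprK add0r.
 move: (mode W gPsiM 0 _) => x; have -> : x + x = 2%:R *: x by rewrite scaler_nat mulr2n.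
 by rewrite scalerA; congr (_ *: _); field.
move=> hw; split; first exact: F.
have hLw : geneig h (L 0 w) by rewrite F //; apply: (subZ (@geneig_sub _ _ _ _ h)); do 2!apply: mode_zero_geneig.
rewrite (F _ hLw) (F _ hw) !(linZ (lm _)) (mode_swap gPsiP gPsiM) /= E0 mul0r mul0r scale0r !addr0.
by rewrite (sq_zero (a := gPsiP)) // !(lin0 (lm _), scaler0).
Qed.

Lemma L0_sq_weight (W : vmod) h (w : W) : geneig h w -> w <> 0 -> L 0 (L 0 w) = 0 -> h = 0.
move=> hw w0 L2; apply: contrapT => /eqP h0; apply: w0.
have lL : linear (LL W 0) by exact: L_lin.
have gm v := @geigen_mod _ _ _ lL [set 0] h 0 v (subspace0 _) (fun _ e => etrans (congr1 _ e) (lin0 lL)) h0.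
apply: (gm _ hw); apply: (gm _ (geigen_shift lL 0 hw)).
by rewrite /eshift !scale0r !subr0.
Qed.

(* If E_0 = 0 all weights are natural numbers, and any quotient without weight 0 vanishes. *)
Lemma E0_weight0 (W : vmod) : KL W -> (forall w : W, mode W gE 0 w = 0) ->
 (exists w : W, w <> 0) -> exists2 u : W, geneig 0 u & u <> 0.
move=> KW E0 [w w0]; have sW := KL_span KW.
have [h h0] : exists h, gcomp (LL W 0) w h <> 0.
 apply: contrapT => /forallNP n0; apply: w0.
 have [_ [s [_ _ ->]]] := gcompP (@L_lin _ _ _ W 0) sW w; apply: big1_seq => h _.
 exact: contrapT (n0 h).
have [n [lh [u uh u0]]] := lowest_exists KW (gcomp_gen (@L_lin _ _ _ W 0) sW w h) h0.
have [_ L2] := E0_lowest E0 lh uh.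
by exists u => //; rewrite -(L0_sq_weight uh u0 L2).
Qed.

Lemma E0_weights (W : vmod) h (w : W) : KL W -> (forall w : W, mode W gE 0 w = 0) ->
 geneig h w -> w <> 0 -> exists n : nat, h = n%:R.
move=> KW E0 hw w0; have [n [lh [u uh u0]]] := lowest_exists KW hw w0.
exists n; apply/eqP; rewrite -subr_eq0; have [_ L2] := E0_lowest E0 lh uh.
by rewrite (L0_sq_weight uh u0 L2).
Qed.

(** The quotient by [U] has no weight 0 vectors, so it vanishes by [E0_weight0]. *)
Lemma E0_generated (W : vmod) (U : set W) : KL W -> (forall w : W, mode W gE 0 w = 0) ->
 submodule U -> (forall w, geneig 0 w -> U w) -> forall w, U w.
move=> KW E0 sU U0 w; have hq := quot_map_hom sU; have qs := @quot_onto _ _ _ _ _ sU.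
have KQ := KL_surjective hq qs KW; apply/quot_map0; apply: contrapT => qw0.
have EQ (q : quot_vmod sU) : mode (quot_vmod sU) gE 0 q = 0
 by have [v <-] := qs q; rewrite -[LHS]scale1r -(hom_mode gE 0 v hq) E0 (lin0 (hom_lin hq)).
have [q q0 []] := E0_weight0 KQ EQ (ex_intro (fun q : quot_vmod sU => q <> 0) _ qw0).
have [v vq] := qs q; have sW := KL_span KW; have sQ := KL_span KQ.
have lQ := @L_lin _ _ _ (quot_vmod sU) 0; have lW := @L_lin _ _ _ W 0.
have <- : quot_map sU (gcomp (LL W 0) v 0) = q.
 have [gv [s [us s0 vE]]] := gcompP lW sW v.
 have := gcomp_geigen lQ sQ 0 q0; rewrite eqxx => <-; rewrite -vq.
 have lc : linear (fun w => gcomp (LL (quot_vmod sU) 0) w 0) by exact: gcomp_linear.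
 rewrite {2}vE (lin_sum (hom_lin hq)) [RHS](lin_sum lc).
 have F h : gcomp (LL (quot_vmod sU) 0) (quot_map sU (gcomp (LL W 0) v h)) 0 =
   if 0 == h then quot_map sU (gcomp (LL W 0) v h) else 0.
  apply: (gcomp_geigen lQ sQ); apply: (geigen_map (hom_lin hq)) (gv h) => x; exact: hom_L0 hq.
 rewrite (eq_bigr _ (fun h _ => F h)) -big_mkcond /=.
 have [s0'|ns] := boolP (0 \in s).
  by rewrite -big_filter (_ : [seq h <- s | 0 == h] = [:: 0]) ?big_seq1 // -(filter_pred1_uniq us s0'); apply: eq_filter => h; exact: eq_sym.
 rewrite (s0 _ ns) (lin0 (hom_lin hq)) big1_seq // => h /andP [/eqP <- hs].
 by rewrite hs in ns.
by apply/quot_map0/U0; exact: gcomp_gen.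
Qed.

Lemma KL_eigen (W : vmod) (A : W -> W) (U : set W) h (w : W) : KL W -> linear A -> subspace U ->
 (forall w, U w -> U (A w)) -> (forall w, U w -> geneig h w) -> U w -> w <> 0 ->
 exists a u, [/\ U u, u <> 0 & A u = a *: u].
move=> [_ _ fd _] lA sU AU Uh Uw w0; have [n [b bP]] := fd h.
have [|a [u H]] := eigen_exists (b := b) lA sU AU _ Uw w0; first by move=> u /Uh /bP.
by exists a, u.
Qed.

Lemma schur (S : vmod) (f : S -> S) : KL S -> simple S -> ehom f -> exists a, forall w, f w = a *: w.
move=> KS [[w0 w00] simp] hf; have sS := KL_span KS; have lL := @L_lin _ _ _ S 0; have lf := hom_lin hf.
have [h h0] : exists h, gcomp (LL S 0) w0 h <> 0.
 apply: contrapT => /forallNP n0; apply: w00.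
 have [_ [s [_ _ ->]]] := gcompP lL sS w0; apply: big1_seq => h _.
 exact: contrapT (n0 h).
have [|a [u [_ u0 ua]]] := KL_eigen KS lf (geneig_sub S h) _ (fun _ => id) (gcomp_gen lL sS w0 h) h0.
 by move=> w; apply: (geigen_map lf) => x; exact: hom_L0 hf.
have hg := hom_add (- a) (hom_id S) hf.
exists a => w; case: (simp _ (submodule_ker hg)) => E.
 case: u0; move: E => /(congr1 (fun X : set S => X u)) /= <-.
 by rewrite ua scaleNr addNr.
have : - a *: w + f w = 0 by move: E => /(congr1 (fun X : set S => X w)) /= ->.
by rewrite scaleNr addrC => /eqP; rewrite subr_eq0 => /eqP.
Qed.

Lemma simple_E (S : vmod) : KL S -> simple S -> exists e, forall w : S, mode S gE 0 w = e *: w.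
by move=> KS sS; apply: schur (E_hom S). Qed.

(** Positive modes kill a lowest generalized weight space. There c_0 squares to zero, hence has a
    kernel; N_0 has an eigenvector in it, and a homogeneous part of that vector is nonzero. *)
Lemma extremal_exists (S : vmod) c : KL S -> simple S -> odd11 c ->
 exists h n a (t : S), [/\ t <> 0, hmg a t, geneig h t, mode S gN 0 t = n *: t &
  (forall b (r : nat), mode S b r.+1 t = 0) /\ mode S c 0 t = 0].
move=> KS [[w0 w00] _] oc; have sS := KL_span KS; have lL := @L_lin _ _ _ S 0.
have lm b r : linear (mode S b r) by exact: mode_lin.
have [h0 h00] : exists h, gcomp (LL S 0) w0 h <> 0.
 apply: contrapT => /forallNP n0; apply: w00.
 have [_ [s [_ _ ->]]] := gcompP lL sS w0; apply: big1_seq => h _.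
 exact: contrapT (n0 h).
have [n [lh [u uh u0]]] := lowest_exists KS (gcomp_gen lL sS w0 h0) h00.
move: uh u0 lh; set h := h0 - n%:R => uh u0 lh.
pose U := [set w : S | geneig h w /\ mode S c 0 w = 0].
have sU : subspace U.
 split=> [|a x y [xh x0] [yh y0]]; split=> /=; rewrite ?mode0 //; first exact: sub0 (geneig_sub S h).
  by have [_ H] := geneig_sub S h; apply: H.
 by rewrite lm x0 y0 scaler0 addr0.
have [v Uv v0] : exists2 v, U v & v <> 0.
 have [c0|c0] := pselect (mode S c 0 u = 0); first by exists u.
 exists (mode S c 0 u) => //; split; first exact: mode_zero_geneig.
 exact: sq_zero.
have NU w : U w -> U (mode S gN 0 w).
 move=> [wh w0']; split; first exact: mode_zero_geneig.
 rewrite zero_swap w0' mode0 scaler0 add0r.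
 by case: c oc w0' {U sU Uv} => //= _ ->; rewrite ?oppr0.
have Uh w : U w -> geneig h w by case.
have [m [t [[th t0] tn tm]]] := KL_eigen KS (lm gN 0) sU NU Uh Uv v0.
have [a ta0] : exists a, hproj a t <> 0.
 apply: contrapT => /forallNP H; apply: tn.
 have H' a : hproj a t = 0 by exact: contrapT (H a).
 by rewrite (hproj_sum t) !H' addr0.
have hP b r w : mode S b r (hproj a w) = hproj (a (+) odd11 b) (mode S b r w).
 have [_ mp _] := mode_action S.
 rewrite /hproj (linZ (lm _ _)) (linD (lm _ _)) (linZ (lm _ _)) mp scalerA; congr (_ *: (_ + _ *: _)).
 by rewrite -signr_addb.
have h0P b : hproj b (0 : S) = 0 by exact: lin0 (hproj_linear b).
exists h, m, a, (hproj a t); split=> //.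
- exact: hproj_hmg.
- rewrite /hproj; have sg := geneig_sub S h.
 by apply: (subZ sg); apply: (subD sg) => //; apply: (subZ sg); exact: geneig_par.
- by rewrite hP addbF tm (linZ (hproj_linear _)).
split=> [b r|]; rewrite hP ?t0 ?h0P //.
by rewrite (lowest_kill lh th) h0P.
Qed.

End LowestWeights.

Lemma gcomp_shift (K : fieldType) (W : lmodType K) (A f : W -> W) d : linear A -> gspanned A ->
 linear f -> (forall w, A (f w) = f (A w) + d *: f w) -> forall w h, gcomp A (f w) h = f (gcomp A w (h - d)).
move=> lA sA lf Af w h.
have lc h' : linear (fun w => gcomp A w h') by exact: gcomp_linear.
apply: (gspan_ind sA (U := [set w | gcomp A (f w) h = f (gcomp A w (h - d))])) w => [|h' u hu] /=.
 split=> [|a u v /= eu ev] /=; first by rewrite (lin0 lf) !(lin0 (lc _)) (lin0 lf).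
 by rewrite lf [LHS](lc h) eu ev [in RHS](lc (h - d)) lf.
have fu : geigen A (h' + d) (f u).
 have [M uM] := hu; exists M; rewrite -[RHS](lin0 lf) -uM.
 elim: M u {hu uM} => // M IH u; rewrite !iterSr -IH; congr iter.
 by rewrite /eshift Af (linB lf) (linZ lf) scalerDl opprD addrA addrAC addrK.
rewrite (gcomp_geigen lA sA h fu) (gcomp_geigen lA sA _ hu) -subr_eq.
by case: eqP => // _; rewrite (lin0 lf).
Qed.

(** * Triangular generation and simplicity of V *)

Section Triangular.
Context R (k : R[i]) (hk : k != 0) (V : affine_vsa k) (W : vmod V).
Variables (t : W) (raise : gl11 -> int -> Prop) (A : W -> W) (d : gl11 -> int -> nat).
Hypotheses (lA : linear A) (At : A t = 0)
 (Amode : forall a r w, raise a r -> A (mode W a r w) = mode W a r (A w) + (d a r)%:R *: mode W a r w)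
 (gen : forall w, mspan (mode W) [set t] raise w).

Let lm a r : linear (mode W a r). exact: mode_lin. Qed.

Lemma tri_diag : diagble A.
have sE h : subspace (@eigsub R W A h) by exact: eigsub_subspace.
have sS := spanned_subspace sE; have single h (u : W) : A u = h *: u ->
  [set w : W | exists (s : seq R[i]) (u : R[i] -> W), (forall h, @eigsub R W A h (u h)) /\ w = \sum_(h <- s) u h] u.
 move=> Au; exists [:: h], (fun h' => if h' == h then u else 0); rewrite big_seq1 eqxx; split=> // h'.
 by rewrite /eigsub /=; case: eqP => [->//|_]; rewrite (lin0 lA) scaler0.
move=> w; elim: (gen w) => [_ ->||a u v _ IHu _ IHv|a r u rar _ [s [f [fE ->]]]].
- by apply: (single 0); rewrite At scale0r.
- exact: sub0 sS.
- by have [_ H] := sS; exact: H.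
rewrite (lin_sum (lm a r)); apply: (sub_sum sS) => h _; apply: (single (h + (d a r)%:R)).
by rewrite Amode // (fE h) (linZ (lm a r)) scalerDl.
Qed.

Lemma tri_gspanned : gspanned A. exact: (diag_span tri_diag). Qed.
Let sA := tri_gspanned.
Let lc h : linear (fun w => gcomp A w h). exact: gcomp_linear. Qed.

Lemma tri_weights w h : (forall n : nat, h <> n%:R) -> gcomp A w h = 0.
move: h; elim: (gen w) => [_ -> h hn||a u v _ IHu _ IHv h hn|a r u rar _ IH h hn].
- have t0 : geigen A 0 t by exists 1%N; rewrite /= /eshift At scale0r subrr.
 rewrite (gcomp_geigen lA sA h t0); case: eqP => // h0; by case: (hn 0%N).
- by move=> h _; exact: lin0 (lc h).
- by rewrite [LHS](lc h) IHu // IHv // scaler0 addr0.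
rewrite (gcomp_shift lA sA (lm a r) (fun v => @Amode a r v rar)).
rewrite IH ?(lin0 (lm a r)) // => n /eqP; rewrite subr_eq => /eqP E.
by apply: (hn (n + d a r)%N); rewrite natrD.
Qed.

Hypothesis d_pos : forall a r, raise a r -> (0 < d a r)%N.
Let sline : subspace [set w : W | exists c, w = c *: t].
split=> [|a u v [c ->] [c' ->]]; first by exists 0; rewrite scale0r.
by exists (a * c + c'); rewrite scalerDl scalerA.
Qed.

Let raise0 a r w : raise a r -> gcomp A (mode W a r w) 0 = 0.
move=> rar; rewrite (gcomp_shift lA sA (lm a r) (fun v => @Amode a r v rar)).
rewrite tri_weights ?(lin0 (lm a r)) // => n /eqP; rewrite subr_eq -natrD eq_sym pnatr_eq0.
by rewrite addn_eq0 => /andP [_ /eqP] d0; have := d_pos rar; rewrite d0.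
Qed.

Lemma tri_line w : exists c, gcomp A w 0 = c *: t.
elim: (gen w) => [_ ->||a u v _ IHu _ IHv|a r u rar _ _].
- exists 1; have t0 : geigen A 0 t by exists 1%N; rewrite /= /eshift At scale0r subrr.
 by rewrite (gcomp_geigen lA sA 0 t0) eqxx scale1r.
- by exists 0; rewrite scale0r; exact: lin0 (lc 0).
- by rewrite [gcomp _ _ _](lc 0); have [_ H] := sline; exact: H.
by exists 0; rewrite scale0r raise0.
Qed.

(** [eps] reads off the coefficient of t: the allowed modes have positive degree, so the part of
    degree 0 is the line of t. *)
Lemma tri_functional : t <> 0 -> exists eps : W -> R[i], [/\ linear (eps : W -> R[i]^o), eps t = 1,
 forall a r w, raise a r -> eps (mode W a r w) = 0,
 forall w, A w = 0 -> w = eps w *: t & forall h w, h <> 0 -> A w = h *: w -> eps w = 0].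
move=> t0; have [eps epsE] := choice tri_line.
have inj c c' : c *: t = c' *: t -> c = c'.
 move=> /eqP; rewrite -subr_eq0 -scalerBl scaler_eq0 subr_eq0 => /orP [/eqP //|/eqP //].
have g0 h w : A w = h *: w -> geigen A h w by move=> Aw; exists 1%N; rewrite /= /eshift Aw subrr.
exists eps; split.
- by move=> a u v; apply: inj; rewrite -epsE [LHS](lc 0) !epsE scalerDl scalerA.
- by apply: inj; rewrite -epsE (gcomp_geigen lA sA 0 (g0 0 _ _)) ?eqxx ?scale1r // At scale0r.
- by move=> a r w rar; apply: inj; rewrite -epsE raise0 // scale0r.
- by move=> w Aw; rewrite -epsE (gcomp_geigen lA sA 0 (g0 0 _ _)) ?eqxx // Aw scale0r.
move=> h w h0 Aw; apply: inj; rewrite -epsE (gcomp_geigen lA sA 0 (g0 h _ Aw)) scale0r.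
by case: eqP => // e; case: h0.
Qed.

End Triangular.

Section Generation.
Context R (k : R[i]) (hk : k != 0) (V : affine_vsa k).

Lemma mspan_line (W : vmod V) (raise : gl11 -> int -> Prop) (t : W) :
 (forall a r, ~ raise a r -> exists c, mode W a r t = c *: t) ->
 forall a r u, mspan (mode W) [set t] raise u -> mspan (mode W) [set t] raise (mode W a r u).
move=> nr; apply: (mspan_stable (mode_action W)) => a r _ ->.
have [ra|/nr [c ->]] := pselect (raise a r); first by apply: mspan_act => //; exact: mspan_base.
by apply: (subZ (mspan_sub _ _ _)); exact: mspan_base.
Qed.

Lemma simple_generated (S : vmod V) (raise : gl11 -> int -> Prop) b (t : S) : simple S -> t <> 0 -> hmg b t ->
 (forall a r, ~ raise a r -> exists c, mode S a r t = c *: t) -> forall w, mspan (mode S) [set t] raise w.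
move=> [_ simp] t0 bt nr w; have sU := mspan_sub (mode S) [set t] raise.
have sub : submodule (mspan (mode S) [set t] raise).
 apply: modes_submodule => //; last by move=> a r u; apply: mspan_line.
 apply: (mspan_par (mode_action S)) => _ ->; rewrite bt; apply: (subZ sU); exact: mspan_base.
case: (simp _ sub) => E; last by rewrite E.
by case: t0; have := mspan_base (mode S) raise (erefl : [set t] t); rewrite E.
Qed.

Definition neg (a : gl11) (r : int) : Prop := (r < 0)%R.

Lemma V_generated (v : adjoint V) : mspan (mode (adjoint V)) [set (vac V : adjoint V)] neg v.
apply: (V_ind (U := mspan (mode (adjoint V)) [set (vac V : adjoint V)] neg)) v => [||a r u].
- exact: mspan_sub.
- exact: mspan_base.
apply: mspan_line => {}a {}r /negP; rewrite -leNgt; case: r => // r _.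
by exists 0; rewrite scale0r; exact: mode_vac.
Qed.

Lemma L0_mode (W : vmod V) a r (w : W) : L 0 (mode W a r w) = mode W a r (L 0 w) + (- r)%:~R *: mode W a r w.
by rewrite mode_L0 // mulrNz scaleNr addrK. Qed.

Lemma V_functional : (vac V : adjoint V) <> 0 -> exists eps : adjoint V -> R[i], [/\ linear (eps : adjoint V -> R[i]^o), eps (vac V) = 1,
 forall a r w, r < 0 -> eps (mode (adjoint V) a r w) = 0,
 forall w, L 0 w = 0 -> w = eps w *: vac V & forall h w, h <> 0 -> L 0 w = h *: w -> eps w = 0].
move=> v0; apply: (tri_functional (raise := neg) (d := fun a r => `|r|%N)) => //.
- exact: L_lin.
- exact: (L_vac V 1).
- by move=> a r w rn; rewrite L0_mode; congr (_ + _ *: _); rewrite -[RHS]/(`|r|%:Z%:~R) ltz0_abs.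
- exact: V_generated.
- by move=> a r rn; rewrite absz_gt0 lt_eqF.
Qed.

Lemma V_weights (v : adjoint V) h : (forall n : nat, h <> n%:R) -> gcomp (LL (adjoint V) 0) v h = 0.
apply: (tri_weights (t := vac V : adjoint V) (raise := neg) (d := fun a r => `|r|%N)).
- exact: L_lin.
- exact: (L_vac V 1).
- by move=> a r w rn; rewrite L0_mode; congr (_ + _ *: _); rewrite -[RHS]/(`|r|%:Z%:~R) ltz0_abs.
- exact: V_generated.
Qed.

Lemma V_diag : diagble (LL (adjoint V) 0).
apply: (tri_diag (t := vac V : adjoint V) (raise := neg) (d := fun a r => `|r|%N)).
- exact: L_lin.
- exact: (L_vac V 1).
- by move=> a r w rn; rewrite L0_mode; congr (_ + _ *: _); rewrite -[RHS]/(`|r|%:Z%:~R) ltz0_abs.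
- exact: V_generated.
Qed.

Lemma V_E (v : adjoint V) : mode (adjoint V) gE 0 v = 0.
have lE : linear (mode (adjoint V) gE 0) by exact: mode_lin.
apply: (V_ind (U := fun v => mode (adjoint V) gE 0 v = 0)) v => [||a r u Uu].
- by split=> [|a u v Uu Uv]; rewrite ?(lin0 lE) // lE Uu Uv scaler0 addr0.
- exact: mode_vac.
by rewrite [LHS](E_central (W := adjoint V)) Uu; exact: mode0.
Qed.

Lemma vac_generates (U : set (adjoint V)) : submodule U -> U (vac V) -> forall v, U v.
move=> sU Uv v; apply: (V_ind (submod_sub sU) Uv) => a r u Uu.
by have [_ _ _] := sU; apply.
Qed.

(** E_0 is zero on V, so a nonzero submodule has a nonzero vector of weight 0, and this is a
    multiple of the vacuum. *)
Lemma V_simple : KL (adjoint V) -> (vac V : adjoint V) <> 0 -> simple (adjoint V).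
move=> KV v0; split=> [|U sU]; first by exists (vac V).
have [U0|/existsNP [u /not_implyP [Uu u0]]] := pselect (forall u, U u -> u = 0).
 by left; apply/seteqP; split=> // _ ->; case: sU.
right; apply/seteqP; split=> // v _.
have hi := sub_incl_hom sU; have KU := KL_injective hi (@sub_incl_inj _ _ _ _ _ sU) KV.
have EU (w : sub_vmod sU) : mode (sub_vmod sU) gE 0 w = 0
 by apply: sub_incl_inj; rewrite (hom_mode gE 0 w hi) scale1r V_E (lin0 (hom_lin hi)).
have [|z z0 zn] := E0_weight0 hk KU EU.
 by exists (sub_in sU Uu) => e; apply: u0; rewrite -(sub_inclK sU Uu) e (lin0 (hom_lin hi)).
pose w := sub_incl z; have [eps [_ _ _ ew _]] := V_functional v0.
have wz : L 0 w = 0.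
 have g0 : geneig 0 w by apply: (geigen_map (hom_lin hi)) z0 => x; exact: hom_L0 hi.
 have := diag_gcomp w 0 (@L_lin _ _ _ (adjoint V) 0) V_diag.
 rewrite (gcomp_geigen (@L_lin _ _ _ (adjoint V) 0) (diag_span V_diag) 0 g0) eqxx.
 by rewrite /eigsub /= scale0r.
apply: (vac_generates sU _ v); have wE := ew w wz.
apply: (subZ_iff (submod_sub sU) (a := eps w)); last by rewrite -wE; exact: sub_inclP.
apply/eqP => e0; apply: zn; apply: sub_incl_inj.
by rewrite -/w wE e0 scale0r (lin0 (hom_lin hi)).
Qed.

End Generation.

(** * Twisted modules, dual actions and invariant pairings *)

Section Automorphism.
Context R (k : R[i]) (hk : k != 0) (V : affine_vsa k).

(* The automorphism N -> -N, E -> -E, psi+ -> psi-, psi- -> -psi+: a is sent to tau_sign a times tau_gen a. *)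
Definition tau_gen (a : gl11) : gl11 := match a with gPsiP => gPsiM | gPsiM => gPsiP | _ => a end.
Definition tau_sign (a : gl11) : R[i] := if a is gPsiP then 1 else -1.
Lemma tau_odd a : odd11 (tau_gen a) = odd11 a. by case: a. Qed.

Lemma tau_action (M : sspace R) (x : gl11 -> int -> M -> M) : affine_action k x ->
 affine_action k (fun a r w => tau_sign a *: x (tau_gen a) r w).
move=> xM; have [xl xp xb] := xM; split=> [a r c u v|a r w|a b r s w].
- by rewrite (xl (tau_gen a) r) scalerDr !scalerA mulrC.
- by rewrite xp tau_odd (linZ (@par_linear R M)) !scalerA mulrC.
transitivity ((tau_sign a * tau_sign b) *:
 (x (tau_gen a) r (x (tau_gen b) s w) - (-1) ^+ (odd11 a && odd11 b) *: x (tau_gen b) s (x (tau_gen a) r w))).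
 by rewrite !(linZ (xl _ _)) scalerBr !scalerA; congr (_ - _ *: _); ring.
have := xb (tau_gen a) (tau_gen b) r s w; rewrite !tau_odd => ->.
rewrite scalerDr scalerA; congr (_ + _ *: _).
 by case: a b => [] [] /=; rewrite ?(scaler0, scaleN1r, scale1r, mulN1r, mulrN1, opprK, mulr1, oppr0).
case: ifP => _; last by rewrite mulr0.
by case: a b => [] [] /=; ring.
Qed.

Lemma tau_exists : exists f : V -> V, [/\ linear f, forall v, f (par v) = par (f v), f (vac V) = vac V
 & forall a r v, f (vY (gen V a) r v) = tau_sign a *: vY (gen V (tau_gen a)) r (f v)].
have := @gen_induced R k V V _ _ (tau_action (gen_action V)) (vac_even V) => -[|f [fl fp fv fa] _].
 by move=> a r; rewrite mode_vac scaler0.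
by exists f.
Qed.

Definition tau : V -> V := sval (cid tau_exists).

Lemma tauP : [/\ linear tau, forall v, tau (par v) = par (tau v), tau (vac V) = vac V
 & forall a r v, tau (vY (gen V a) r v) = tau_sign a *: vY (gen V (tau_gen a)) r (tau v)].
exact: svalP (cid tau_exists). Qed.
Lemma tau_gen_vec a : tau (gen V a) = tau_sign a *: gen V (tau_gen a).
by have [_ _ tv ta] := tauP; rewrite -{1}gen_vac ta tv gen_vac. Qed.
Lemma tau_hmg b v : hmg b v -> hmg b (tau v).
by have [tl tp _ _] := tauP; rewrite /hmg -tp => ->; rewrite (linZ tl). Qed.

Lemma tau_vY u n v : tau (vY u n v) = vY (tau u) n (tau v).
have [tl tp tv ta] := tauP; pose AV := adjoint V.
pose U := [set u : V | forall n v, tau (vY u n v) = vY (tau u) n (tau v)].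
have sU : subspace U.
 have ll (m : int) (w : AV) : linear (fun v => vY v m w) by exact: (act_linl (W := AV) m w).
 split=> [n' v'|a x y Ux Uy n' v'] /=; first by rewrite (lin0 tl) !(lin0 (ll _ _)) (lin0 tl).
 by rewrite (ll n' v') tl Ux Uy tl (ll n' (tau v')).
suff : forall u, U u by apply.
apply: (hmg_split sU) => a w aw; move: a w aw {u n v}.
apply: (V_hmg_ind (P := fun _ u => U u)) => // [n v|a r b u bu IH n v] /=.
 have av m w : vY (vac V) m w = if m == -1 then w else 0 := act_vac (W := AV) m w.
 by rewrite tv !av; case: ifP => // _; rewrite (lin0 tl).
have lv (x : AV) (m : int) : linear (fun v => vY v m x) by exact: (act_linl (W := AV) m x).
rewrite ta (linZ (lv _ _)).
have I1 : vY (vY (gen V a) r u) n v = _ := act_iterated (W := AV) a r n v bu.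
have I2 : vY (vY (gen V (tau_gen a)) r (tau u)) n (tau v) = _ := act_iterated (W := AV) (tau_gen a) r n (tau v) (tau_hmg bu).
rewrite I1 I2.
have lm c s : linear (@act _ _ AV (gen V c) s) by exact: act_linr.
have lu (w : V) s : linear (@act _ _ AV w s) by exact: act_linr.
rewrite (fsum_lin tl); last first.
 apply: fin1Z; have [N NP] := act_fin (W := AV) u v n; have [N' NP'] := act_fin (W := AV) (gen V a) v 0.
 exists (N + N')%N => i Ni; rewrite NP ?(leq_trans (leq_addr _ _) Ni) // act0r sub0r.
 have -> : @act _ _ AV (gen V a) i%:Z v = 0 by have := NP' i (leq_trans (leq_addl _ _) Ni); rewrite add0r.
 by rewrite (lin0 (lu _ _)) scaler0 oppr0.
rewrite -[LHS]/(fsum _) -fsumZ; last first.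
 apply: fin1Z; have [N NP] := act_fin (W := AV) (tau u) (tau v) n.
 have [N' NP'] := act_fin (W := AV) (gen V (tau_gen a)) (tau v) 0.
 exists (N + N')%N => i Ni; rewrite NP ?(leq_trans (leq_addr _ _) Ni) // act0r sub0r.
 have -> : @act _ _ AV (gen V (tau_gen a)) i%:Z (tau v) = 0 by have := NP' i (leq_trans (leq_addl _ _) Ni); rewrite add0r.
 by rewrite (lin0 (lu _ _)) scaler0 oppr0.
have IH' m (w : AV) : tau (@act _ _ AV u m w) = @act _ _ AV (tau u) m (tau w) := IH m w.
have ta' c m (w : AV) : tau (@act _ _ AV (gen V c) m w) = tau_sign c *: @act _ _ AV (gen V (tau_gen c)) m (tau w) := ta c m w.
apply: eq_fsum => i; rewrite (linZ tl) (linB tl) (linZ tl) ta' !IH' ta' (linZ (lu _ _)) tau_odd.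
move: (act _ _ (act _ _ _)) (act _ _ (act _ _ _)) ((-1) ^+ i * _) ((-1) ^ r * _) => X Y c1 c2.
by rewrite [RHS]scalerCA; congr (c1 *: _); rewrite scalerBr; congr (_ - _); exact: scalerCA.
Qed.

Section Twisted.
Variable W : vmod V.
Definition tau_act (v : V) n (w : W) : W := act (tau v) n w.

Lemma tau_module : is_module tau_act.
have [tl tp tv ta] := tauP; have [yl yr yp yt yv yb] := act_module W; split.
- by move=> n w a u v; rewrite /tau_act tl yl.
- by move=> v n; exact: yr.
- by move=> v n w; rewrite /tau_act tp yp.
- by move=> v w; exact: yt.
- by move=> n w; rewrite /tau_act tv yv.
move=> a b v w1 w2 m n l va wb; rewrite -[RHS](yb _ _ _ _ _ _ _ _ (tau_hmg va) (tau_hmg wb)).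
by apply: eq_fsum => i; rewrite /tau_act tau_vY.
Qed.

(** Space, parity, the operators L_n ([tau_L]) and the submodules are those of W; only the action of
    V changes. *)
Definition tau_vmod : vmod V := Vmod tau_module.
Lemma tau_mode a r (w : W) : mode tau_vmod a r w = tau_sign a *: mode W (tau_gen a) r w.
by rewrite /mode /= /tau_act tau_gen_vec (linZ (act_linl (W := W) _ _)). Qed.
End Twisted.

Lemma tau_omega : tau (conformal_vector V) = conformal_vector V.
have [tl _ _ ta] := tauP; have td a b : tau (mode (adjoint V) a (-1) (gen V b)) =
  (tau_sign a * tau_sign b) *: mode (adjoint V) (tau_gen a) (-1) (gen V (tau_gen b)).
 rewrite [LHS]ta tau_gen_vec -[vY _ _ _]/(mode (adjoint V) _ _ _).
 by rewrite (linZ (@mode_lin _ _ _ (adjoint V) _ _)) scalerA.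
rewrite omegaE (linD tl) !(linZ tl) !(linD tl) (linN tl) !td /= !(mulN1r, mul1r, opprK, scale1r, scaleN1r).
by congr (_ *: _ + _); rewrite addrAC.
Qed.

Lemma tau_L (W : vmod V) n (w : W) : LL (tau_vmod W) n w = LL W n w.
by rewrite /L /= /tau_act tau_omega. Qed.

Lemma tau_submodule (W : vmod V) (U : set W) : @submodule _ _ _ (tau_vmod W) U <-> submodule U.
split=> [sU|[U0 Ul Up Ua]]; last by split=> // v n u Uu; exact: Ua.
have S := submod_sub sU; have [_ _ Up _] := sU.
apply: modes_submodule => // a r u Uu.
have -> : mode W a r u = (tau_sign (tau_gen a) *: mode (tau_vmod W) (tau_gen a) r u : W).
 rewrite tau_mode scalerA (_ : tau_gen (tau_gen a) = a); last by case: a.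
 rewrite (_ : _ * _ = 1) ?scale1r //.
 by case: a; rewrite /= ?mulrNN mulr1.
by apply: (subZ S); have [_ _ _] := sU; apply.
Qed.

Lemma tau_simple (W : vmod V) : simple W -> simple (tau_vmod W).
by move=> [w H]; split=> // U /tau_submodule; exact: H. Qed.

Lemma tau_KL (W : vmod V) : KL W -> KL (tau_vmod W).
have gE : (fun h (w : W) => @geneig _ _ _ (tau_vmod W) h w) = @geneig _ _ _ W.
 apply/funext => h; apply/funext => w; apply/propext.
 have E M : iter M (fun u : tau_vmod W => L 0 u - h *: u) w = iter M (fun u : W => L 0 u - h *: u) w
  by elim: M => // M IH; rewrite !iterS IH tau_L.
 by split=> -[M e]; exists M; rewrite -e E.
move=> [[n [F [F0 Fn Fs Fc]]] sp fd lb]; split.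
- exists n, F; split=> // i ni; first by apply/tau_submodule; exact: Fs.
 have [a b c] := Fc i ni; split=> // U /tau_submodule; exact: c.
- by move: sp; rewrite -gE.
- by move: fd; rewrite -gE.
by move: lb; rewrite -gE.
Qed.

End Automorphism.

Section Contragredient.
Context R (k : R[i]).

Section DualSpace.
Variable W : sspace R.
Let fpar (f : W -> R[i]^o) : W -> R[i]^o := f \o @par R W.
Fact fpar_linear : linear fpar. by move=> a f g; apply/funext. Qed.
Fact fpar_invol : involutive fpar.
by move=> f; apply/funext => w; rewrite /fpar /= par_invol. Qed.
Definition fun_sspace : sspace R := Sspace fpar_linear fpar_invol.
Definition linear_set : set fun_sspace := [set f | linear f].
Fact linear_subspace : subspace linear_set.
split=> [a u v|c f g /= lf lg a u v]; first by rewrite scaler0 addr0.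
by rewrite -[LHS]/(c *: f (a *: u + v) + g (a *: u + v)) lf lg -[(c *: f + g) u]/(c *: f u + g u) -[(c *: f + g) v]/(c *: f v + g v);
 lmod_ring.
Qed.
Fact linear_par f : linear_set f -> linear_set (par f).
by move=> lf a u v; rewrite /= /fpar /= (@par_linear R W) lf. Qed.
Definition dual_sspace : sspace R := sub_sspace linear_subspace linear_par.
Definition dual_fun (f : dual_sspace) : W -> R[i]^o := val f.
Lemma dual_fun_linear (f : dual_sspace) : linear (dual_fun f).
exact: (subspace_valU f). Qed.
Lemma dual_fun_inj : injective dual_fun. exact: val_inj. Qed.
Lemma dual_fun_lin a f g w : dual_fun (a *: f + g) w = a * dual_fun f w + dual_fun g w.
by []. Qed.
Variable x : gl11 -> int -> W -> W.
Hypothesis xW : affine_action k x.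
(** In the dual action the parity involution stands for the sign (-1)^(|a||f|), which makes sense
    for inhomogeneous f. *)
Definition apar (b : bool) (w : W) : W := if b then par w else w.
Lemma apar_linear b : linear (apar b). by case: b => //; exact: (@par_linear R W). Qed.

Fact coact_linear a r (f : dual_sspace) : linear_set (fun w => - dual_fun f (apar (odd11 a) (x a (- r) w))).
have [xl _ _] := xW; move=> c u v; rewrite xl apar_linear (dual_fun_linear f) opprD.
by rewrite scalerN.
Qed.
Definition coact a r (f : dual_sspace) : dual_sspace := subspace_in linear_subspace (coact_linear a r f).
Lemma coactE a r f w : dual_fun (coact a r f) w = - dual_fun f (apar (odd11 a) (x a (- r) w)).
by []. Qed.

Lemma apar_act b a r w : apar b (x a r w) = (-1) ^+ (b && odd11 a) *: x a r (apar b w).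
case: b => //=; last by rewrite scale1r.
by have [_ xp _] := xW; rewrite xp scalerA -expr2 sqrr_sign scale1r.
Qed.
Lemma act_apar b a r w : x a r (apar b w) = (-1) ^+ (b && odd11 a) *: apar b (x a r w).
by rewrite apar_act scalerA -expr2 sqrr_sign scale1r. Qed.
Lemma aparC b b' w : apar b (apar b' w) = apar b' (apar b w).
by case: b b' => [] []. Qed.

Lemma coact_action : affine_action k coact.
have [xl xp xb] := xW; split=> [a r c f g|a r f|a b r s f]; apply: dual_fun_inj; apply/funext => w.
- by rewrite dual_fun_lin !coactE dual_fun_lin opprD mulrN.
- rewrite coactE -[RHS]/((-1) ^+ odd11 a * - dual_fun f (apar (odd11 a) (x a (- r) (par w)))).
 rewrite -[dual_fun (par f) _]/(dual_fun f (par _)) xp (linZ (apar_linear _)) (linZ (dual_fun_linear f))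
  mulrN -[_ *: _]/(_ * _) mulrA -expr2 sqrr_sign mul1r.
 by congr (- dual_fun f _); case: (odd11 a).
have fl := dual_fun_linear f.
have E1 a' b' r' s' : dual_fun (coact a' r' (coact b' s' f)) w =
  (-1) ^+ (odd11 a' && odd11 b') * dual_fun f (apar (odd11 a') (apar (odd11 b') (x b' (- s') (x a' (- r') w))))
 by rewrite !coactE opprK act_apar (linZ (apar_linear _)) (linZ fl) aparC.
have dl : linear (fun f => dual_fun f w : R[i]^o) by move=> c f' g'; exact: dual_fun_lin.
rewrite [LHS](linB dl) (linZ dl) -[X in _ - X]/(_ * dual_fun _ w) !E1 [odd11 b && _]andbC mulrA -expr2 sqrr_sign mul1r [apar (odd11 b) (apar _ _)]aparC.
have Z u : (-1) ^+ (odd11 a && odd11 b) * dual_fun f (apar (odd11 a) (apar (odd11 b) u)) =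
 dual_fun f (apar (odd11 a) (apar (odd11 b) ((-1) ^+ (odd11 a && odd11 b) *: u)))
 by rewrite !(linZ (apar_linear _)) (linZ fl).
rewrite Z -(linB fl) -!(linB (apar_linear _)) -opprB (xb a b) !(linN (apar_linear _)) (linN fl)
 -opprD (_ : (- (r + s) == 0 :> int) = (r + s == 0)); last by rewrite oppr_eq0.
rewrite [RHS](linD dl) (linZ dl) -[X in _ = _ + X]/(_ * dual_fun f w).
case: ifP => _; last first.
 rewrite scale0r addr0 mul0r addr0.
 by case: a b {E1 Z} => [] [] /=; rewrite ?coactE /= ?par_invol ?(linN (@par_linear R W)) ?(linN fl) ?(lin0 (@par_linear R W)) ?(lin0 fl) ?opprK ?oppr0 //; rewrite -[RHS]/(- - _) opprK.
rewrite !(linD (apar_linear _)) (linD fl) [LHS]opprD; apply: (f_equal2 (fun y z : R[i] => y + z)).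
 by case: a b {E1 Z} => [] [] /=; rewrite ?coactE /= ?par_invol ?(linN (@par_linear R W)) ?(linN fl) ?(lin0 (@par_linear R W)) ?(lin0 fl) ?opprK ?oppr0 //; rewrite -[RHS]/(- - _) opprK.
rewrite !(linZ (apar_linear _)) (linZ fl) mulrNz !mulNr scaleNr opprK.
by case: a b {E1 Z} => [] [] /=; rewrite ?par_invol ?mulr0 ?mul0r ?scale0r.
Qed.

End DualSpace.

Section ProductAction.
Variables (M1 M2 : sspace R) (x1 : gl11 -> int -> M1 -> M1) (x2 : gl11 -> int -> M2 -> M2).
Hypotheses (xM1 : affine_action k x1) (xM2 : affine_action k x2).
Let M := (M1 * M2)%type.
Let ppar (w : M) : M := (par w.1, par w.2).
Fact pairing_par_linear : linear ppar.
by move=> a u v; rewrite /ppar /= (@par_linear R M1) (@par_linear R M2). Qed.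
Fact pairing_par_invol : involutive ppar.
by case=> u v; rewrite /ppar /= !par_invol. Qed.
Definition pair_sspace : sspace R := Sspace pairing_par_linear pairing_par_invol.
Definition pair_act a r (w : pair_sspace) : pair_sspace := (x1 a r w.1, x2 a r w.2).
Lemma pair_action : affine_action k pair_act.
have [l1 p1 b1] := xM1; have [l2 p2 b2] := xM2.
split=> [a r c u v|a r w|a b r s w]; apply: injective_projections; rewrite /= ?l1 ?l2 ?p1 ?p2 //.
- by rewrite b1; congr (_ + _); case: a b => [] [].
- by rewrite b2; congr (_ + _); case: a b => [] [].
Qed.
End ProductAction.
End Contragredient.

Section Functionals.
Context R (k : R[i]).

(** Only the generator contributes, since [eps] vanishes on raised vectors both before and after
    [f]. *)
Lemma functional_eigen (W : sspace R) (x : gl11 -> int -> W -> W) (t : W) (raise : gl11 -> int -> Prop)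
  (eps : W -> R[i]^o) (f : W -> W) c : linear eps -> linear f ->
 (forall w, mspan x [set t] raise w) -> (forall a r w, raise a r -> eps (x a r w) = 0) ->
 f t = c *: t -> (forall a r w, raise a r -> eps (f (x a r w)) = 0) -> forall w, eps (f w) = c * eps w.
move=> le lf gen e0 ft ef w; elim: (gen w) => [_ ->||a u v _ IHu _ IHv|a r u rar _ _].
- by rewrite ft (linZ le).
- by rewrite (lin0 lf) (lin0 le) mulr0.
- rewrite lf !le IHu IHv -[a *: (c * _)]/(a * _) -[a *: eps u]/(a * _); ring.
by rewrite ef // e0 // mulr0.
Qed.

Section Pairing.
Variables (M W : sspace R) (x1 : gl11 -> int -> M -> M) (x2 : gl11 -> int -> W -> W).
Hypotheses (xM : affine_action k x1) (xW : affine_action k x2).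
Variables (t' : M) (t : W) (raise : gl11 -> int -> Prop) (eM : M -> R[i]^o) (eW : W -> R[i]^o) (s : R[i]).
Hypotheses (lM : linear eM) (lW : linear eW)
 (genM : forall w, mspan x1 [set t'] raise w) (genW : forall w, mspan x2 [set t] (fun _ _ => True) w)
 (e1 : eW t = eM t')
 (eM0 : forall a r w, raise a r -> eM (x1 a r w) = 0) (t0 : forall a r, raise a r -> x2 a (- r) t = 0)
 (low : forall a r, ~ raise a r -> exists c, x1 a r t' = c *: t' /\
  forall w, - eW (apar (odd11 a) (x2 a (- r) w)) = c * eW w)
 (tpar : par t' = s *: t') (epar : forall w, eW (par w) = s * eW w).

Let le : linear_set (W := W) eW. exact: lW. Qed.
Let eps : dual_sspace W := subspace_in (linear_subspace W) le.
Let z : pair_sspace M (dual_sspace W) := (t', eps).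
Let xP := pair_act x1 (coact xW).
Let aP : affine_action k xP. exact: pair_action xM (coact_action xW). Qed.
Let G := mspan xP [set z] raise.
Let sG : subspace G. exact: mspan_sub. Qed.
Let G_act a r u : G u -> G (xP a r u).
apply: (mspan_stable aP) => {}a {}r _ ->; have [ra|/low [c [tc ec]]] := pselect (raise a r).
 by apply: mspan_act => //; exact: mspan_base.
have -> : xP a r z = c *: z
 by apply: injective_projections; rewrite /= ?tc //; apply: dual_fun_inj; apply/funext => w; rewrite coactE ec.
by apply: (subZ sG); exact: mspan_base.
Qed.

Let G_par u : G u -> G (par u).
apply: (mspan_par aP) => _ ->; have -> : par z = s *: z.
 by apply: injective_projections; rewrite /= ?tpar //; apply: dual_fun_inj; apply/funext => w; exact: epar.
by apply: (subZ sG); exact: mspan_base.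
Qed.

Let G_top u : G u -> dual_fun u.2 t = eM u.1.
elim=> [_ -> //||a v w _ IHv _ IHw|a r v rar _ _].
- by rewrite (lin0 lM).
- by rewrite dual_fun_lin IHv IHw lM.
- by rewrite coactE t0 // (lin0 (apar_linear _)) (lin0 (dual_fun_linear _)) oppr0 eM0.
Qed.

Let G_ex w' : exists f, G (w', f).
elim: (genM w') => [_ ->||a u v _ [f Gf] _ [g Gg]|a r u rar _ [f Gf]].
- by exists eps; exact: mspan_base.
- by exists 0; exact: mspan_zero.
- by exists (a *: f + g); exact: (mspan_lin a Gf Gg).
- by exists (coact xW a r f); exact: (mspan_act rar Gf).
Qed.

Let G_uniq f : G (0, f) -> f = 0.
move=> Gf; apply: dual_fun_inj; apply/funext => w; rewrite -[RHS]/(0 : R[i]); move: f Gf.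
elim: (genW w) => [_ -> f Gf|f _|a u v _ IHu _ IHv f Gf|a r u _ _ IH f Gf].
- by rewrite (G_top Gf) (lin0 lM).
- exact: lin0 (dual_fun_linear f).
- by rewrite (dual_fun_linear f) IHu // IHv // scaler0 addr0.
have [x1l _ _] := xM; have Gf' : G (0, if odd11 a then par f else f).
 case: odd11 => //; have := G_par Gf.
 rewrite (_ : par ((0, f) : pair_sspace M (dual_sspace W)) = (0, par f)) //.
 by apply: injective_projections => //=; exact: par0.
have := IH _ (eq_ind _ (fun p => G (p, _)) (G_act a (- r) Gf') _ (lin0 (x1l a (- r)))).
rewrite coactE opprK => /eqP; rewrite oppr_eq0 => /eqP.
by case: odd11 => //=; rewrite -[dual_fun (par f) _]/(dual_fun f (par _)) par_invol.
Qed.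

(** The submodule G of the product of M and the full dual space of W generated by (t', eps) is the
    graph of a map. It projects onto M since t' generates M; and if (0, f) lies in G, then f
    vanishes at t by [G_top], hence everywhere, as t generates W. *)
Lemma pairing_exists : exists B : M -> W -> R[i]^o, [/\ forall w, linear (B^~ w), forall w', linear (B w'),
 forall w, B t' w = eW w, forall a r w' w, B (x1 a r w') w = - B w' (apar (odd11 a) (x2 a (- r) w))
 & (forall w' w, B (par w') w = B w' (par w)) /\ forall w', B w' t = eM w'].
have [f fE] := choice G_ex.
have fu w' g : G (w', g) -> f w' = g.
 move=> Gg; apply/eqP; rewrite -subr_eq0; apply/eqP/G_uniq.
 by have := subB sG (fE w') Gg; rewrite -[_ - _]/(_, _) /= subrr.
have [x1l _ _] := xM.
exists (fun w' => dual_fun (f w')); split=> [w a u v|w'|w|a r w' w|].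
- by rewrite (fu _ (a *: f u + f v)) ?dual_fun_lin //; exact: (mspan_lin a (fE u) (fE v)).
- exact: dual_fun_linear.
- by rewrite (fu _ eps) //; exact: mspan_base.
- by rewrite (fu _ (coact xW a r (f w'))) ?coactE //; exact: (G_act a r (fE w')).
split=> [w' w|w']; last exact: (G_top (fE w')).
by rewrite (fu _ (par (f w'))) //; exact: (G_par (fE w')).
Qed.

Lemma pairing_adjoint (B : M -> W -> R[i]^o) (A1 : M -> M) (A2 : W -> W) h :
 (forall w, linear (B^~ w)) -> (forall w', linear (B w')) -> (forall w, B t' w = eW w) ->
 (forall a r w' w, B (x1 a r w') w = - B w' (apar (odd11 a) (x2 a (- r) w))) ->
 linear A1 -> linear A2 -> (forall w, A2 (par w) = par (A2 w)) ->
 (forall a r w, A1 (x1 a r w) = x1 a r (A1 w) - r%:~R *: x1 a r w) ->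
 (forall a r w, A2 (x2 a r w) = x2 a r (A2 w) - r%:~R *: x2 a r w) ->
 A1 t' = h *: t' -> (forall w, eW (A2 w) = h * eW w) -> forall w' w, B (A1 w') w = B w' (A2 w).
move=> Bl Br Bt Ba lA1 lA2 Ap A1x A2x At eA w'; have x2l : forall a r, linear (x2 a r) by case: xW.
elim: (genM w') => [_ -> w||a u v _ IHu _ IHv w|a r u rar _ IH w].
- by rewrite At (linZ (Bl w)) !Bt eA.
- by move=> w; rewrite (lin0 lA1) !(lin0 (Bl _)).
- by rewrite lA1 (Bl w) IHu IHv (Bl (A2 w)).
have Aa b v : A2 (apar b v) = apar b (A2 v) by case: b => //=; exact: Ap.
rewrite A1x (linB (Bl w)) (linZ (Bl w)) !Ba IH Aa A2x
 !(linB (apar_linear _)) (linZ (apar_linear _)) !(linB (Br _)) (linZ (Br _)) mulrNz scaleNr !opprK.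
by rewrite opprD scalerN opprK subrK.
Qed.

End Pairing.
End Functionals.

Section VacuumForm.
Context R (k : R[i]) (hk : k != 0) (V : affine_vsa k).
Local Notation AV := (adjoint V).
Hypotheses (KV : KL AV) (v0 : (vac V : AV) <> 0).

Lemma vacuum_form : exists F : AV -> AV -> R[i]^o, [/\ forall v, linear (F^~ v), forall u, linear (F u),
 F (vac V) (vac V) = 1, forall a r u v, F (mode AV a r u) v = - F u (apar (odd11 a) (mode AV a (- r) v))
 & [/\ forall u v, F (par u) v = F u (par v), forall u v, F (L 0 u) v = F u (L 0 v) &
    (forall v, (forall u, F u v = 0) -> v = 0) /\ forall u, (forall v, F u v = 0) -> u = 0]].
have [eps [le ev er eL eh]] := V_functional hk v0.
have aV := mode_action AV; have ml a r : linear (mode AV a r) by exact: mode_lin.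
have genV := @V_generated _ _ V.
have ez a w : eps (mode AV a 0 w) = 0.
 rewrite -[RHS](mul0r (eps w)); apply: (functional_eigen le (ml a 0) genV er).
  by rewrite scale0r; exact: mode_vac.
 move=> b r u rn; rewrite (mode_swap a b) !mul0r if_same scale0r addr0 add0r (linD le) (linZ le) er // scaler0 add0r.
 by case: a; case: b rn => rn /=; rewrite ?(linN le) ?er ?oppr0 ?(lin0 le).
have epar w : eps (par w) = 1 * eps w.
 apply: (functional_eigen le (@par_linear R AV) genV er); first by have := vac_even V; rewrite /hmg scale1r.
 have [_ xp _] := aV.
 move=> a r u rn; have -> : par (mode AV a r u) = (-1) ^+ odd11 a *: mode AV a r (par u).
  by rewrite xp scalerA -expr2 sqrr_sign scale1r.
 by rewrite (linZ le) er // scaler0.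
have eL0 w : eps (L 0 w) = 0 * eps w.
 apply: (functional_eigen le (@L_lin _ _ _ AV 0) genV er); first by rewrite scale0r; exact: (L_vac V 1).
 by move=> a r u rn; rewrite L0_mode // (linD le) (linZ le) !er // scaler0 addr0.
have [||||||||B [Bl Br Bv Ba [Bp Bt]]] := @pairing_exists R k AV AV (mode AV) (mode AV) aV aV (vac V) (vac V) neg eps eps 1 le le.
- exact: genV.
- by move=> w; apply: V_ind w => [||a r u]; [exact: mspan_sub|exact: mspan_base|exact: mspan_act].
- by [].
- exact: er.
- move=> a [//|r] _; rewrite NegzE opprK; exact: mode_vac.
- move=> a [r|r] nr; last by case: nr.
 exists 0; split=> [|w]; first by rewrite scale0r; exact: mode_vac.
 rewrite mul0r; apply/eqP; rewrite oppr_eq0; apply/eqP.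
 have ap b u : eps (apar b u) = eps u by case: b; rewrite /= ?epar ?mul1r.
 by rewrite ap; case: r nr => [|r] nr; [rewrite oppr0 ez|rewrite er].
- by have := vac_even V.
- exact: epar.
have Ba' a r u v : B u (mode AV a r v) = - B (mode AV a (- r) (apar (odd11 a) u)) v.
 rewrite Ba !opprK; case: (odd11 a) => //=; by rewrite Bp par_invol.
exists B; split=> //; first by rewrite Bv.
split=> //.
- apply: (@pairing_adjoint R k AV AV (mode AV) (mode AV) aV (vac V) neg eps genV B _ _ 0 Bl Br Bv Ba).
 + exact: L_lin.
 + exact: L_lin.
 + by move=> w; rewrite L_par.
 + by move=> a r w; rewrite L0_mode // mulrNz scaleNr.
 + by move=> a r w; rewrite L0_mode // mulrNz scaleNr.
 + by rewrite scale0r; exact: (L_vac V 1).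
 + exact: eL0.
have [_ simp] := V_simple hk KV v0; split=> v Fv; last first.
 have sub : submodule [set u : AV | forall v, B u v = 0].
  apply: modes_submodule => [|x Bx u|a r x Bx u].
  - split=> [u|a x y Bx By u]; first exact: (lin0 (Bl u)).
   by rewrite (Bl u) Bx By scaler0 addr0.
  - by rewrite Bp.
  - by rewrite Ba Bx oppr0.
 case: (simp _ sub) => E.
  by move: E => /(congr1 (fun X : set AV => X v)) /= E; rewrite -E.
 have : [set u : AV | forall v, B u v = 0] (vac V) by rewrite E.
 by move=> /(_ (vac V)) /eqP; rewrite Bv ev oner_eq0.
have sub : submodule [set v : AV | forall u, B u v = 0].
 apply: modes_submodule => [|x Bx u|a r x Bx u].
 - split=> [u|a x y Bx By u]; first exact: (lin0 (Br u)).
  by rewrite (Br u) Bx By scaler0 addr0.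
 - by rewrite -Bp.
 - by rewrite Ba' Bx oppr0.
case: (simp _ sub) => E.
 by move: E => /(congr1 (fun X : set AV => X v)) /= E; rewrite -E.
have : [set v : AV | forall u, B u v = 0] (vac V) by rewrite E.
by move=> /(_ (vac V)) /eqP; rewrite Bv ev oner_eq0.
Qed.

(** Distinct weights are orthogonal and weight spaces are finite-dimensional, so the functional is
    represented weight by weight, and only the weights below N matter. *)
Lemma represent (F : AV -> AV -> R[i]^o) (phi : AV -> R[i]^o) N : (forall v, linear (F^~ v)) -> (forall u, linear (F u)) ->
 (forall u v, F (L 0 u) v = F u (L 0 v)) -> (forall u, (forall v, F u v = 0) -> u = 0) ->
 linear phi -> (forall (m : nat) u, (N <= m)%N -> L 0 u = m%:R *: u -> phi u = 0) ->
 exists v, forall u, F u v = phi u.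
move=> Fl Fr FL Fn lp pN; have lL := @L_lin _ _ _ AV 0; have sV := diag_span (@V_diag _ _ hk V).
have orth m m' u v : L 0 u = m *: u -> L 0 v = m' *: v -> m != m' -> F u v = 0.
 move=> um vm mm; have := FL u v; rewrite um vm (linZ (Fl v)) (linZ (Fr u)) => /eqP.
 by rewrite -subr_eq0 -scalerBl scaler_eq0 subr_eq0 (negPf mm) => /eqP.
have comp w h : L 0 (gcomp (LL AV 0) w h) = h *: gcomp (LL AV 0) w h.
 exact: (diag_gcomp w h lL (@V_diag _ _ hk V)).
have dec w : exists s : seq R[i], w = \sum_(h <- s) gcomp (LL AV 0) w h /\ uniq s
 by have [_ [s [us _ e]]] := gcompP lL sV w; exists s.
have step (m : nat) : exists v, L 0 v = m%:R *: v /\ forall u, L 0 u = m%:R *: u -> F u v = phi u.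
 pose P : set AV := [set u | L 0 u = m%:R *: u].
 have sP : subspace P by exact: (@eigsub_subspace _ AV).
 have [_ _ fd _] := KV; have [n0 [b0 b0P]] := fd m%:R.
 have Pg u : P u -> geneig m%:R u by rewrite /P /= => Pu; exists 1%N; rewrite /= Pu subrr.
 have [n [b [bP bs]]] := span_subspace sP (fun u Pu => b0P u (Pg u Pu)).
 pose M : 'M[R[i]]_n := \matrix_(i, j) (F (b j) (b i) : R[i]).
 have ker u : P u -> (forall i, F u (b i) = 0) -> u = 0.
  move=> Pu gu; apply: Fn => v; have [s [-> us]] := dec v.
  rewrite (lin_sum (Fr u)) big1 // => h _; have [->|hm] := eqVneq h m%:R; last by apply: (orth _ _ _ _ Pu (comp v h)); rewrite eq_sym.
  have [c ->] := bs _ (comp v m%:R); rewrite (lin_sum (Fr u)) big1 // => i _.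
  by rewrite (linZ (Fr u)) gu scaler0.
 pose y : 'rV[R[i]]_n := \row_j (phi (b j) : R[i]).
 (* A vector in the cokernel of the Gram matrix gives an element orthogonal to its whole weight
    space, hence zero; so it also kills the row y. *)
 have : (y <= M)%MS.
  rewrite submxE; apply/eqP/rowP => j; rewrite [RHS]mxE.
  have u0 : \sum_i cokermx M i j *: b i = 0.
   apply: ker => [|i]; first by apply: (sub_sum sP) => i _; apply: (subZ sP); exact: bP.
   have : (M *m cokermx M) i j = 0 by rewrite mulmx_coker mxE.
   rewrite mxE => <-; rewrite (lin_sum (Fl (b i))); apply: eq_bigr => l _.
   by rewrite (linZ (Fl (b i))) [M i l]mxE mulrC.
  have : phi (\sum_i cokermx M i j *: b i) = 0 by rewrite u0 (lin0 lp).
  rewrite (lin_sum lp) => <-; rewrite mxE; apply: eq_bigr => i _.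
  by rewrite (linZ lp) [y 0 i]mxE mulrC.
 move=> /submxP [c yE]; exists (\sum_i c 0 i *: b i); split.
  by apply: (sub_sum sP) => i _; apply: (subZ sP); exact: bP.
 move=> u /bs [a ->]; rewrite (lin_sum (Fl _)) (lin_sum lp); apply: eq_bigr => j _.
 rewrite (linZ (Fl _)) (linZ lp) (lin_sum (Fr _)); congr (_ *: _).
 have := congr1 (fun X : 'rV_n => X 0 j) yE; rewrite !mxE => ->; apply: eq_bigr => i _.
 by rewrite (linZ (Fr _)) mxE.
have [w wP] := choice step; exists (\sum_(m < N) w m) => u; have [s [-> us]] := dec u.
rewrite (lin_sum (Fl _)) (lin_sum lp); apply: eq_bigr => h _.
have [[m hm]|nh] := pselect (exists m : nat, h = m%:R); last first.
 rewrite (V_weights hk) => [|m hm]; last by apply: nh; exists m.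
 by rewrite (lin0 (Fl _)) (lin0 lp).
have uh := comp u h; rewrite hm in uh *; rewrite (lin_sum (Fr _)).
have o (i : 'I_N) : (i : nat) != m -> F (gcomp (LL AV 0) u m%:R) (w i) = 0
 by move=> im; apply: (orth _ _ _ _ uh (wP i).1); rewrite eqr_nat eq_sym.
have [mN|Nm] := ltnP m N.
 rewrite (bigD1 (Ordinal mN)) //= big1 ?addr0 => [|i im]; last by apply: o; move: im; rewrite -val_eqE.
 exact: (wP m).2.
rewrite big1 ?(pN m) // => i _; apply: o; apply: contraTneq (ltn_ord i) => ->.
by rewrite -leqNgt.
Qed.

End VacuumForm.

(** * Highest weight modules and their contravariant pairing *)

Section HighestWeight.
Context R (k : R[i]) (hk : k != 0) (V : affine_vsa k).
Definition wt11 (a : gl11) : int := match a with gPsiP => 1 | gPsiM => -1 | _ => 0 end.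

Lemma N_mode (W : vmod V) a r (w : W) :
 mode W gN 0 (mode W a r w) = mode W a r (mode W gN 0 w) + (wt11 a)%:~R *: mode W a r w.
rewrite (mode_swap gN a) !mul0r if_same scale0r addr0 add0r /= scale1r; congr (_ + _).
by case: a; rewrite /= ?scale0r ?scale1r ?scaleN1r.
Qed.

(** The value of [L0_casimir] on a vector with N_0 = n, E_0 = e and psi^+_0 = 0; the summand - e
    comes from psi^+_0 psi^-_0. *)
Definition high_weight (n e : R[i]) : R[i] := (2%:R * k)^-1 * (2%:R * (e * n) - e) + (2%:R * k ^+ 2)^-1 * e ^+ 2.

Lemma L0_high (W : vmod V) (t : W) n e : (forall a (r : nat), mode W a r.+1 t = 0) ->
 mode W gPsiP 0 t = 0 -> mode W gN 0 t = n *: t -> mode W gE 0 t = e *: t -> L 0 t = high_weight n e *: t.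
move=> tp t0 tN tE; have lm a : linear (mode W a 0) by exact: mode_lin.
rewrite (L0_casimir hk tp) t0 (lin0 (lm _)) addr0 tN tE !(linZ (lm _)) tN tE
 (zero_swap gPsiP gPsiM) /= t0 (lin0 (lm _)) scaler0 add0r tE /high_weight.
by move: (2 * k)^-1 (2 * k ^+ 2)^-1 => c1 c2; lmod_ring.
Qed.

Record highest (S : vmod V) (t : S) (b : bool) (n e : R[i]) : Prop := { hw_KL : KL S; hw_simple : simple S; hw_t : t <> 0;
 hw_par : hmg b t; hw_N : mode S gN 0 t = n *: t; hw_E : forall w, mode S gE 0 w = e *: w;
 hw_pos : forall a (r : nat), mode S a r.+1 t = 0; hw_psi : mode S gPsiP 0 t = 0 }.

Lemma highest_exists (S : vmod V) : KL S -> simple S -> exists t b n e, @highest S t b n e.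
move=> KS sS; have [e eE] := simple_E KS sS.
have [h [n [b [t [t0 tb _ tN [tp tc]]]]]] := extremal_exists hk KS sS (isT : odd11 gPsiP).
by exists t, b, n, e; split.
Qed.

Section Simple.
Variables (S : vmod V) (t : S) (b : bool) (n e : R[i]).
Hypothesis H : highest t b n e.
Let h0 := high_weight n e.
Let lm a r : linear (mode S a r). exact: mode_lin. Qed.
Lemma hw_L0 : L 0 t = h0 *: t.
by have [] := H => *; apply: L0_high. Qed.
Definition down (a : gl11) (r : int) : Prop := r < 0 \/ (a = gPsiM /\ r = 0).
(** The lowering modes for the twisted module, in which psi^+ and psi^- trade places. *)
Definition down' (a : gl11) (r : int) : Prop := r < 0 \/ (a = gPsiP /\ r = 0).

Lemma hw_gen w : mspan (mode S) [set t] down w.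
have [KS sS t0 tb tN tE tp tc] := H; apply: (simple_generated sS t0 tb) => a [[|r]|r] nd.
- case: a nd => nd; [exists n|exists e|exists 0|]; rewrite ?scale0r ?tE //.
 by case: nd; right.
- by exists 0; rewrite tp scale0r.
- by case: nd; left.
Qed.

Lemma hw_gen' w : mspan (mode (tau_vmod S)) [set (t : tau_vmod S)] down' w.
have [KS sS t0 tb tN tE tp tc] := H; apply: (simple_generated (tau_simple sS) t0 tb) => a [[|r]|r] nd.
- case: a nd => nd; [exists (- n)|exists (- e)| |exists 0]; rewrite ?tau_mode /= ?tN ?tE ?tc ?scaler0 ?scale0r ?scaleN1r ?scaleNr //.
 by case: nd; right.
- by exists 0; rewrite tau_mode tp scaler0 scale0r.
- by case: nd; left.
Qed.

(** The grading by 2 L_0 - N_0, normalized at t. The factor 2 leaves a positive degree to psi^+_r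
    with r < 0, while psi^-_0 gets degree 1. *)
Let A (w : S) := 2%:R *: L 0 w - mode S gN 0 w - (2%:R * h0 - n) *: w.
Let d (a : gl11) (r : int) : nat := `|(2%:Z * r + wt11 a)%R|%N.
Let dE a r : down a r -> (d a r)%:R = - (2%:R * r%:~R) - (wt11 a)%:~R :> R[i].
move=> da; have : 2%:Z * r + wt11 a < 0.
 by case: da => [|[-> ->]] //; case: a => /=; lia.
move=> le; rewrite -[LHS]/((d a r)%:Z%:~R) /d ltz0_abs // mulrNz intrD intrM opprD //.
Qed.

Let A_lin : linear A.
move=> a u v; rewrite /A (@L_lin _ _ _ S 0) lm; lmod_ring.
Qed.

Let A_mode a r w : down a r -> A (mode S a r w) = mode S a r (A w) + (d a r)%:R *: mode S a r w.
move=> da; rewrite /A L0_mode // N_mode dE // mulrNz !(linB (lm a r)) !(linZ (lm a r)).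
by lmod_ring.
Qed.

Let A_t : A t = 0.
by rewrite /A hw_L0 (hw_N H) scalerA -scalerBl addrN. Qed.

Lemma hw_functional : exists eps : S -> R[i]^o, [/\ linear eps, eps t = 1,
 forall a r w, down a r -> eps (mode S a r w) = 0, forall w, eps (L 0 w) = h0 * eps w
 & [/\ forall w, eps (mode S gN 0 w) = n * eps w & forall w, eps (par w) = (-1) ^+ b * eps w]].
have dpos a r : down a r -> (0 < d a r)%N by rewrite /d absz_gt0; case=> [|[-> ->]] //; case: a => /=; lia.
have [eps [le et er _ _]] := tri_functional A_lin A_t A_mode hw_gen dpos (hw_t H).
exists eps; split=> // [w|]; last split=> w.
- apply: (functional_eigen le (@L_lin _ _ _ S 0) hw_gen er); first exact: hw_L0.
 by move=> a r u da; rewrite L0_mode // (linD le) (linZ le) !er // scaler0 addr0.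
- apply: (functional_eigen le (lm gN 0) hw_gen er); first exact: hw_N H.
 by move=> a r u da; rewrite N_mode (linD le) (linZ le) !er // scaler0 addr0.
apply: (functional_eigen le (@par_linear R S) hw_gen er); first exact: hw_par H.
have [_ xp _] := mode_action S.
move=> a r u da; have -> : par (mode S a r u) = (-1) ^+ odd11 a *: mode S a r (par u).
 by rewrite xp scalerA -expr2 sqrr_sign scale1r.
by rewrite (linZ le) er // scaler0.
Qed.

(** Read on S alone, through the automorphism, this is the Shapovalov form. *)
Lemma shapovalov : exists B : tau_vmod S -> S -> R[i]^o, [/\ forall w, linear (B^~ w), forall w', linear (B w'),
 B t t = 1, forall a r w' w, B (mode (tau_vmod S) a r w') w = - B w' (apar (odd11 a) (mode S a (- r) w))
 & (forall w' w, B (par w') w = B w' (par w)) /\ forall w' w, B (L 0 w') w = B w' (L 0 w)].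
have [KS sS t0 tb tN tE tp tc] := H; have [eps [le et er eL [eN ep]]] := hw_functional.
have [||||||||B [Bl Br Bv Ba [Bp Bt]]] := @pairing_exists R k (tau_vmod S) S (mode (tau_vmod S)) (mode S)
 (mode_action _) (mode_action S) t t down' eps eps ((-1) ^+ b) le le.
- exact: hw_gen'.
- move=> w; elim: (hw_gen w) => [_ ->||a u v _ IHu _ IHv|a r u _ _ IH].
 + exact: mspan_base.
 + exact: mspan_zero.
 + exact: mspan_lin.
 + exact: mspan_act.
- by [].
- move=> a r w da; rewrite tau_mode (linZ le) er ?scaler0 //.
 by case: da => [|[-> ->]]; [left|right].
- move=> a r [|[-> ->]]; last by rewrite oppr0.
 by case: r => // r _; rewrite NegzE opprK; exact: tp.
- have ap c u : eps u = 0 -> eps (apar c u) = 0 by case: c; rewrite /= ?ep // => ->; rewrite mulr0.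
 move=> a [[|r]|r] nd.
 + case: a nd => nd; rewrite tau_mode oppr0 /=.
  * by exists (- n); rewrite tN scaleN1r scaleNr; split=> // w; rewrite eN mulNr.
  * by exists (- e); rewrite tE scaleN1r scaleNr; split=> // w; rewrite tE (linZ le) mulNr.
  * by case: nd; right.
  * exists 0; rewrite tc scaler0 scale0r; split=> // w; rewrite mul0r (ap true) ?oppr0 // er //.
   by right.
 + exists 0; rewrite tau_mode tp scaler0 scale0r; split=> // w; rewrite mul0r ap ?oppr0 // er //.
  by left.
 + by case: nd; left.
- exact: tb.
- exact: ep.
exists B; split=> //; first by rewrite Bv.
split=> //; apply: (@pairing_adjoint R k (tau_vmod S) S (mode (tau_vmod S)) (mode S) (mode_action S) t down' eps hw_gen' B _ _ h0 Bl Br Bv Ba).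
- exact: L_lin.
- exact: L_lin.
- by move=> w; rewrite L_par.
- by move=> a r w; rewrite L0_mode // mulrNz scaleNr.
- by move=> a r w; rewrite L0_mode // mulrNz scaleNr.
- by rewrite tau_L hw_L0.
- exact: eL.
Qed.

Definition deg (w : S) : S := L 0 w - h0 *: w.
Let deg_lin : linear deg.
by move=> a u v; rewrite /deg (@L_lin _ _ _ S 0); lmod_ring. Qed.
Let deg_mode a r w : down a r -> deg (mode S a r w) = mode S a r (deg w) + `|r|%N%:R *: mode S a r w.
move=> da; have -> : `|r|%N%:R = (- r)%:~R :> R[i].
 rewrite -[LHS]/(`|r|%N%:Z%:~R); congr _%:~R; case: da => [|[_ ->]] //; exact: ltz0_abs.
by rewrite /deg L0_mode // (linB (lm a r)) (linZ (lm a r)); lmod_ring.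
Qed.
Let deg_t : deg t = 0. by rewrite /deg hw_L0 addrN. Qed.
Lemma deg_diag : diagble deg.
exact: tri_diag deg_lin deg_t deg_mode hw_gen. Qed.
Lemma deg_weights w h : (forall m : nat, h <> m%:R) -> gcomp deg w h = 0.
exact: tri_weights deg_lin deg_t deg_mode hw_gen w h. Qed.
End Simple.
End HighestWeight.

(** * The evaluation, as the contragredient of the right action on the vacuum module *)

Section Binomials.
Variable R : realType.
Local Notation binz := (@Defs.binz R).

Lemma binz_neg (x : int) q : binz (- x) q = (-1) ^+ q * binz (x + q%:Z - 1) q.
rewrite /Defs.binz mulrA; congr (_ / _).
rewrite (reindex_inj rev_ord_inj) /= -[X in (-1) ^+ X]card_ord -prodrN; apply: eq_bigr => i _.
rewrite subnS -subn1 !natrB ?subn_gt0 //; last exact: ltnW.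
by rewrite mulrNz !intrD mulrNz; ring.
Qed.

(** Reflecting the binomials with negative argument turns this into Vandermonde's identity. It
    recombines the expansion of [L1div_mode] in [left_sum]. *)
Lemma binz_alternating (m n : int) s :
 \sum_(i < s.+1) (-1) ^+ i * binz m i * binz (- (n + i%:Z)) (s - i)%N = binz (- (m + n)) s.
rewrite binz_neg -[m + n + _]addrA -[m + (_) - 1]addrA vandermonde mulr_sumr; apply: eq_bigr => i _.
have is_ : (i <= s)%N by rewrite -ltnS.
rewrite binz_neg (_ : n + i%:Z + (s - i)%N%:Z - 1 = n + s%:Z - 1); last by rewrite -subzn //; lia.
have -> : (-1) ^+ s = (-1) ^+ i * (-1) ^+ (s - i) :> R[i] by rewrite -exprD subnKC.
by ring.
Qed.

Lemma binz_step (s : int) q : binz (- s) q.+1 * q.+1%:R = - (binz (- s) q * (s + q%:Z)%:~R).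
by rewrite binzS mulrVK ?unitfE ?pnatr_eq0 // mulrNz intrD; ring. Qed.
End Binomials.

Section Conjugation.
Context R (k : R[i]) (hk : k != 0) (V : affine_vsa k) (W : vmod V).
Local Notation binz := (@Defs.binz R).
Local Notation L1 := (LL W 1).
Definition L1div j (w : W) : W := j`!%:R^-1 *: iter j L1 w.
Let lL : linear L1. exact: L_lin. Qed.
Lemma L1div_linear j : linear (L1div j).
by move=> a u v; rewrite /L1div (iter_linear j lL) scalerDr !scalerA mulrC. Qed.

Lemma L1divS j w : j.+1%:R *: L1div j.+1 w = L 1 (L1div j w).
by rewrite /L1div (linZ lL) scalerA factS natrM invfM mulrA divff ?mul1r ?pnatr_eq0.
Qed.

(** In generating form, e^(x L_1) a_s e^(-x L_1) is the mode of the function (t / (1 + x t))^s. *)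
Lemma L1div_mode j a s w : L1div j (mode W a s w) =
 \sum_(q < j.+1) binz (- s) q *: mode W a (s + q%:Z) (L1div (j - q) w).
have la r : linear (mode W a r) by exact: mode_lin.
have K r u : L 1 (mode W a r u) = mode W a r (L 1 u) - r%:~R *: mode W a (r + 1) u by rewrite (mode_L hk) addrK.
elim: j => [|j IH].
 by rewrite big_ord1 /L1div /= invr1 !scale1r binz0 scale1r addr0.
have j0 : j.+1%:R != 0 :> R[i] by rewrite pnatr_eq0.
apply: (scalerI j0); rewrite L1divS IH (lin_sum lL) scaler_sumr.
pose X q := binz (- s) q *: mode W a (s + q%:Z) (L1div (j.+1 - q) w).
pose Y q := (binz (- s) q * (s + q%:Z)%:~R) *: mode W a (s + q.+1%:Z) (L1div (j - q) w).
rewrite (eq_bigr (fun q : 'I_j.+1 => (j.+1 - q)%N%:R *: X q - Y q)); last first.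
 move=> q _; rewrite (linZ lL) K -[L 1 (L1div _ _)]L1divS -subSn; last by rewrite -ltnS.
 rewrite (linZ (la _)) scalerBr !scalerA -addrA -[q%:Z + 1]/(q%:Z + 1%N%:Z) -PoszD addn1.
 by rewrite [X in X *: _ - _]mulrC.
rewrite big_split /= sumrN [RHS](eq_bigr (fun q : 'I_j.+2 => (j.+1 - q)%N%:R *: X q + q%:R *: X q)); last by move=> q _; rewrite -scalerDl -natrD subnK // -ltnS.
rewrite big_split /= [in RHS]big_ord_recr /= subnn scale0r addr0; congr (_ + _).
rewrite [RHS]big_ord_recl /= scale0r add0r -sumrN; apply: eq_bigr => q _.
by rewrite /bump /= add1n /X /Y subSS scalerA [q.+1%:R * _]mulrC binz_step scaleNr.
Qed.

End Conjugation.

Section Evaluation.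
Context R (k : R[i]) (hk : k != 0) (V : affine_vsa k).
Variables (T : tensor_data V) (hT : hlz_structure (@KL R k V) T).
Local Notation C := R[i].
Local Notation AV := (adjoint V).
Local Notation binz := (@Defs.binz R).
Let hB := hlz_braided hT.
Let KV : KL AV := bt_unit hB.
Variables (S : vmod V) (t : S) (b0 : bool) (n0 e0 : C).
Hypothesis H : highest t b0 n0 e0.
Let M : vmod V := tau_vmod S.
Let KM : KL M := tau_KL (hw_KL H).
Let h0 := high_weight k n0 e0.
Let dg : S -> S := @deg _ _ _ S n0 e0.
Let dgE (w : S) : dg w = L 0 w - h0 *: w. by []. Qed.
Let dg_lin : linear dg.
by move=> a u v; rewrite !dgE (@L_lin _ _ _ S 0); lmod_ring. Qed.
Let dL (z : C) (w : S) : dg w = z *: w -> L 0 w = (h0 + z) *: w.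
by move=> wz; rewrite scalerDl -wz dgE addrC subrK. Qed.
Let dg_diag := deg_diag hk H.

Lemma deg_nat z (w : S) : dg w = z *: w -> (forall m : nat, z <> m%:R) -> w = 0.
move=> wz zn; rewrite -(deg_weights hk H w zn).
have g : geigen dg z w by exists 1%N; rewrite /= /eshift wz subrr.
by rewrite (gcomp_geigen dg_lin (diag_span dg_diag) z g) eqxx.
Qed.

Lemma deg_ind (U : set S) : subspace U -> (forall (d : nat) w, dg w = d%:R *: w -> U w) -> forall w, U w.
move=> sU hU w; have sA := diag_span dg_diag; have [_ [s [_ _ ->]]] := gcompP dg_lin sA w.
apply: (sub_sum sU) => h _; have e := diag_gcomp w h dg_lin dg_diag.
have [[m hm]|nm] := pselect (exists m : nat, h = m%:R); first by apply: (hU m); rewrite -hm.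
by rewrite (deg_nat e) => [|m hm]; [exact: sub0|apply: nm; exists m].
Qed.

(* The series of Y(w',x)u with values in M. *)
Let Ys (w' : M) (m : int) (u : AV) : M := run (tY T w' (0 + m%:~R) 0%N u).
Let HY : intertwining false (fun (w' : M) h j (u : AV) => run (tY T w' h j u) : M).
have [hr _ _] := bt_run hB KM; exact: (int_comp (hlz_intertwining hT KM KV) hr).
Qed.

Let Ysl m u : linear (fun w' => Ys w' m u). exact: int_linl HY _ _ _. Qed.
Let Ysr w' m : linear (Ys w' m). exact: int_linr HY _ _ _. Qed.
Let Ys_fin w' l u : fin1 (fun i => Ys w' (l + i%:Z) u).
have [N NP] := int_trunc HY w' u (0 + l%:~R); exists N => i Ni.
by rewrite /Ys intrD addrA; exact: NP.
Qed.
Let Ys_par w' m u : par (Ys w' m u) = Ys (par w') m (par u).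
by have := int_par HY w' (0 + m%:~R) 0%N u; rewrite scale1r. Qed.
Let Ys_jac a b w' : hmg b w' -> jacobi Ys (@act _ _ M (gen V a)) (@act _ _ AV (gen V a)) (@act _ _ M (gen V a))
 1 ((-1) ^+ (odd11 a && b)) w'.
move=> wb; have := (jacobi_borcherds _ _ _ _ _).2 (int_borcherds HY 0 0%N) _ _ _ _ (gen_par V a) wb.
by [].
Qed.

Let Ys_vac a w' : hmg a w' -> Ys w' (-1) (vac V) = w'.
move=> wa; rewrite /Ys (hlz_run hT KM _ _ wa (vac_even V)) andbF scale1r /skew_modes.
have Yv h j : Ymod (vac V : AV) h j w' = if (h == -1) && (j == 0%N) then w' else 0.
 have [->|h1] := eqVneq h (-1).
  have fl : Num.floor (complex.Re (-1 : C)) = -1 by rewrite -[RHS](@intrKfloor R) mulrN1z.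
  by rewrite /Ymod fl mulrN1z eqxx; case: eqP => // _; exact: (act_vac (W := M)).
 rewrite /Ymod; case: ifP => // /andP [/eqP hz _]; rewrite [LHS](act_vac (W := M)); case: eqP => // z1.
 by move: h1; rewrite hz z1 mulrN1z eqxx.
have iL i : linear (iter i (LL M (-1))) by apply: iter_linear; exact: L_lin.
rewrite -[LHS]/(fsum _) (fsumE (N := 1)) => [|i i0].
 rewrite big_ord1 fact0 invr1 scale1r /= addr0 add0r mulrN1z opprK subrr mulr0 expC0 scale1r
  -[LHS]/(fsum _) (fsumE (N := 1)) => [|j j0].
  by rewrite big_ord1 Yv eqxx bin0 expr0 mulr1 scale1r.
 by rewrite Yv eqxx; case: j j0 => // j _; rewrite scaler0.
rewrite (_ : \sum_(t0 \in [set: nat]) _ = 0) ?scaler0 ?(lin0 (iL _)) ?scaler0 //.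
apply: (@fsum_eq0 _ M) => j; rewrite Yv add0r mulrN1z.
have -> : (-1 + i%:R == -1 :> C) = false by rewrite -subr_eq0 opprK addrAC addNr add0r pnatr_eq0; case: i i0.
by rewrite scaler0.
Qed.

Let Ys_weight x y w' m u : dg w' = x *: w' -> L 0 u = y *: u -> dg (Ys w' m u) = (x + y - m%:~R - 1) *: Ys w' m u.
move=> wx uy; have gw : @geneig _ _ _ M (h0 + x) w' by exists 1%N; rewrite -[LHS]/(LL M 0 w' - (h0 + x) *: (w' : M)) tau_L // (dL wx) subrr.
have gu : @geneig _ _ _ AV y u by exists 1%N; rewrite -[LHS]/(LL AV 0 u - y *: u) uy subrr.
have := int_geneig hk HY (0 + m%:~R) 0 gw gu; rewrite -/(Ys w' m u).
set z := h0 + x + y - _ - 1 => gz.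
have gd : geigen dg (z - h0) (Ys w' m u).
 have [N e] := gz; exists N.
 suff E N' v : iter N' (eshift dg (z - h0)) v = iter N' (fun u : M => L 0 u - z *: u) v by rewrite E; exact: e.
 elim: N' v => // N' IH v; rewrite !iterSr -IH; congr iter.
 by rewrite /eshift dgE tau_L //; lmod_ring.
have := diag_gcomp (Ys w' m u) (z - h0) dg_lin dg_diag.
rewrite (gcomp_geigen dg_lin (diag_span dg_diag) _ gd) eqxx /eigsub /= => ->.
by congr (_ *: _); rewrite /z; ring.
Qed.

Let la a r : linear (mode S a r). exact: mode_lin. Qed.
Let lM a r : linear (mode M a r). exact: mode_lin. Qed.
Let dg_mode a r z (w : S) : dg w = z *: w -> dg (mode M a r w) = (z - r%:~R) *: (mode M a r w : S).
move=> wz; rewrite tau_mode (linZ dg_lin) scalerCA; congr (_ *: _).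
by rewrite dgE L0_mode // (dL wz) (linZ (la _ _)) mulrNz; lmod_ring.
Qed.

Let D j (w : S) : S := @L1div _ _ _ M j w.
Let D_lin j : linear (D j).
exact: (@L1div_linear _ _ _ M j). Qed.
Let LM n (w : S) : LL M n w = LL S n w.
exact: tau_L. Qed.
Let D_deg j z (w : S) : dg w = z *: w -> dg (D j w) = (z - j%:R) *: D j w.
move=> wz; rewrite /D /L1div (linZ dg_lin) scalerCA; congr (_ *: _).
elim: j => [|j IH]; first by rewrite subr0.
rewrite iterS; set x := iter j _ w in IH *; have Lx := dL IH.
have e' : L 0 (L 1 x) = L 1 (L 0 x) - 1%:~R *: L 1 x :> S by have := L0_L hk 1 x.
rewrite LM dgE e' Lx (linZ (@L_lin _ _ _ S 1)) -natr1; lmod_ring.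
Qed.

Let neg_zero (z : int) (w : S) : dg w = z%:~R *: w -> z < 0 -> w = 0.
move=> wz z0; apply: (deg_nat wz) => m /eqP; rewrite -[m%:R]/(m%:Z%:~R) eqr_int => /eqP E.
by move: z0; rewrite E.
Qed.

Let D_zero j (d : int) (w : S) : dg w = d%:~R *: w -> d < j%:Z -> D j w = 0.
move=> wd dj; apply: (@neg_zero (d - j%:Z)); last by rewrite subr_lt0.
by rewrite (D_deg j wd) intrB.
Qed.

(** Summed over j and with the sign in [Ohom], this is the coefficient of x^(-l-1) in Y(e^(x L_1)
    (-x^(-2))^d w', 1/x) u, the contragredient of [Ys] at w' of degree d. The mode index m solves j
    - 2 d + m + 1 = - l - 1. The part h0 of the weight is left out and returns in [Ec]. *)
Let Oterm (l : int) d j (w' : S) (u : AV) : S := Ys (D j w') (2%:Z * d - l - j%:Z - 2%:Z) u.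
Let Ohom l (d : int) (w' : S) u : S := (-1) ^ d *: (\fs_j Oterm l d j w' u).
Let O l (w' : S) u : S := fsum (fun d : nat => Ohom l d (gcomp dg w' d%:R) u).
Let comp_d (w' : S) h : dg (gcomp dg w' h) = h *: gcomp dg w' h.
exact: (diag_gcomp w' h dg_lin dg_diag). Qed.
Let Oterm_fin l (d : int) (w' : S) u : dg w' = d%:~R *: w' -> fin1 (fun j => Oterm l d j w' u).
move=> wd; exists (`|d|.+1)%N => j dj; rewrite /Oterm (D_zero (j := j) wd) ?(lin0 (Ysl _ _)) //.
by lia.
Qed.

Let Ohom_0 l d u : Ohom l d 0 u = 0.
rewrite /Ohom fsum_eq0 ?scaler0 // => j.
by rewrite /Oterm (lin0 (D_lin j)) (lin0 (Ysl _ _)).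
Qed.

Let O_hom l (d : int) (w' : S) u : dg w' = d%:~R *: w' -> O l w' u = Ohom l d w' u.
move=> wd; have gA := diag_span dg_diag.
have gw : geigen dg d%:~R w' by exists 1%N; rewrite /= /eshift wd subrr.
case: d wd gw => d wd gw.
 rewrite /O (fsumE (N := d.+1)) => [|i di]; last first.
  rewrite (gcomp_geigen dg_lin gA _ gw) (_ : i%:R == _ = false) ?Ohom_0 //.
  by rewrite -[(Posz d)%:~R]/(d%:R) eqr_nat; lia.
 rewrite big_ord_recr /= big1 ?add0r => [|i _]; last first.
  rewrite (gcomp_geigen dg_lin gA _ gw) (_ : i%:R == _ = false) ?Ohom_0 //.
  by rewrite -[(Posz d)%:~R]/(d%:R) eqr_nat; have := ltn_ord i; lia.
 by rewrite (gcomp_geigen dg_lin gA _ gw) eqxx.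
have w0 : w' = 0 by apply: (neg_zero wd).
rewrite w0 Ohom_0; apply: fsum_eq0 => i.
by rewrite (lin0 (@gcomp_linear _ _ _ dg_lin gA i%:R)) Ohom_0.
Qed.

Let comp_fin (w' : S) : fin1 (fun d : nat => gcomp dg w' d%:R).
have gA := diag_span dg_diag; have lc h : linear (fun w => gcomp dg w h) by exact: gcomp_linear.
apply: (deg_ind (U := [set w' | fin1 (fun d : nat => gcomp dg w' d%:R)])) w' => [|d w wd] /=.
 split=> [|a u v [N NP] [N' NP']]; first by exists 0%N => i _; exact: (lin0 (lc _)).
 exists (N + N')%N => i Ni; rewrite (lc i%:R) NP ?(leq_trans (leq_addr _ _) Ni) //.
 by rewrite NP' ?(leq_trans (leq_addl _ _) Ni) // scaler0 addr0.
have gw : geigen dg d%:R w by exists 1%N; rewrite /= /eshift wd subrr.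
by exists d.+1 => i di; rewrite (gcomp_geigen dg_lin gA _ gw) eqr_nat; case: eqP => //; lia.
Qed.

Let Ohom_lin l (d : int) (w w' : S) a u : dg w = d%:~R *: w -> dg w' = d%:~R *: w' ->
 Ohom l d (a *: w + w') u = a *: Ohom l d w u + Ohom l d w' u.
move=> wd wd'; rewrite /Ohom (eq_fsum (g := fun j => a *: Oterm l d j w u + Oterm l d j w' u)); last by move=> j; rewrite /Oterm (D_lin j) (Ysl _ u).
rewrite fsumD ?fsumZ //; do ?[by apply: fin1Z; exact: Oterm_fin|exact: Oterm_fin].
by rewrite scalerDr scalerCA.
Qed.

Let Ohom_fin l w' u : fin1 (fun d : nat => Ohom l d (gcomp dg w' d%:R) u).
by have [N NP] := comp_fin w'; exists N => d Nd; rewrite NP ?Ohom_0. Qed.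
Let O_linl l u : linear (fun w' => O l w' u).
have gA := diag_span dg_diag; move=> a w w'; rewrite /O.
rewrite (eq_fsum (g := fun d : nat => a *: Ohom l d (gcomp dg w d%:R) u + Ohom l d (gcomp dg w' d%:R) u)).
 by rewrite fsumD ?fsumZ //; do ?[exact: Ohom_fin|by apply: fin1Z; exact: Ohom_fin].
by move=> d; rewrite -Ohom_lin ?(@gcomp_linear _ _ _ dg_lin gA d%:R) //; exact: comp_d.
Qed.

Let O_linr l w' : linear (O l w').
move=> a u v; rewrite /O.
rewrite (eq_fsum (g := fun d : nat => a *: Ohom l d (gcomp dg w' d%:R) u + Ohom l d (gcomp dg w' d%:R) v)).
 by rewrite fsumD ?fsumZ //; do ?[exact: Ohom_fin|by apply: fin1Z; exact: Ohom_fin].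
move=> d; have wd := comp_d w' d%:R; rewrite /Ohom (eq_fsum (g := fun j => a *: Oterm l d j (gcomp dg w' d%:R) u + Oterm l d j (gcomp dg w' d%:R) v)).
 rewrite fsumD ?fsumZ //; do ?[by apply: fin1Z; exact: Oterm_fin|exact: Oterm_fin].
 by rewrite scalerDr scalerCA.
by move=> j; exact: Ysr.
Qed.

Let dg_par (w : S) : dg (par w) = par (dg w).
by rewrite !dgE -L_par // (linB (@par_linear R S)) (linZ (@par_linear R S)). Qed.
Let D_par j (w : S) : par (D j w) = D j (par w).
rewrite /D /L1div (linZ (@par_linear R S)); congr (_ *: _).
by elim: j => // j IH; rewrite !iterS -IH [LHS](L_par (W := M)).
Qed.

Let O_par l w' u : par (O l w' u) = O l (par w') (par u).
apply: (deg_ind (U := [set w' | par (O l w' u) = O l (par w') (par u)])) w' => [|d w wd] /=.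
 split=> [|a x y ex ey] /=.
  by rewrite (lin0 (O_linl l u)) par0 (lin0 (O_linl l (par u))).
 by rewrite O_linl (@par_linear R S) ex ey (@par_linear R S) O_linl.
have pd : dg (par w) = (d%:Z)%:~R *: par w by rewrite dg_par wd (linZ (@par_linear R S)).
rewrite (O_hom l u (d := d) wd) (O_hom l _ pd) /Ohom (linZ (@par_linear R S)) (fsum_lin (@par_linear R S)); last exact: Oterm_fin.
by congr (_ *: _); apply: eq_fsum => j; rewrite /Oterm [LHS]Ys_par D_par.
Qed.

(* The pairing with a general vector w' of S, whose parity enters through a sign on u. *)
Let Oc l (w' : S) u : S := O l (hproj false w') u + O l (hproj true w') (par u).
Let Oc_hmg b l (w' : S) u : hmg b w' -> Oc l w' u = O l w' (apar b u).
case: b => wb; rewrite /Oc.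
 by rewrite (hproj_other (a := false)) // (hproj_id wb) (lin0 (O_linl l u)) add0r.
by rewrite (hproj_other (a := true)) // (hproj_id wb) (lin0 (O_linl l _)) addr0.
Qed.

Let Oc_linl l u : linear (fun w' => Oc l w' u).
move=> a x y; rewrite /Oc !(hproj_linear _ a) (O_linl l u) (O_linl l (par u)).
by rewrite scalerDr addrACA.
Qed.

Let Oc_linr l w' : linear (Oc l w').
by move=> a u v; rewrite /Oc (@par_linear R AV) !(O_linr l _) scalerDr addrACA. Qed.
Let Oc_par l w' u : par (Oc l w' u) = Oc l (par w') (par u).
have hp b : par (hproj b w') = hproj b (par w')
 by rewrite /hproj (linZ (@par_linear R S)) (linD (@par_linear R S)) (linZ (@par_linear R S)).
by rewrite /Oc (linD (@par_linear R S)) !O_par !hp.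
Qed.

Variables (F : AV -> AV -> C^o) (B : M -> S -> C^o).
Hypotheses (Fl : forall v, linear (F^~ v)) (Fr : forall u, linear (F u))
 (Fa : forall a r u v, F (mode AV a r u) v = - F u (apar (odd11 a) (mode AV a (- r) v)))
 (Fp : forall u v, F (par u) v = F u (par v)) (FL : forall u v, F (L 0 u) v = F u (L 0 v))
 (Fnr : forall v, (forall u, F u v = 0) -> v = 0) (Fnl : forall u, (forall v, F u v = 0) -> u = 0).
Hypotheses (Bl : forall w, linear (B^~ w)) (Br : forall w', linear (B w')) (Bt : B t t = 1)
 (Ba : forall a r w' w, B (mode M a r w') w = - B w' (apar (odd11 a) (mode S a (- r) w)))
 (Bp : forall w' w, B (par w') w = B w' (par w)) (BL : forall w' w, B (LL M 0 w') w = B w' (L 0 w)).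

Let B_weight z z' (w' w : S) : dg w' = z *: w' -> dg w = z' *: w -> z != z' -> B w' w = 0.
move=> wz wz' zz; have := BL w' w; rewrite LM (dL wz) (dL wz') (linZ (Bl w)) (linZ (Br w')) => /eqP.
rewrite -subr_eq0 -scalerBl scaler_eq0 opprD addrACA subrr add0r subr_eq0 (negPf zz) => /eqP //.
Qed.

Let O_weight l (d d2 : int) (w' w : S) z u : dg w' = d%:~R *: w' -> dg w = d2%:~R *: w -> L 0 u = z *: u ->
 z != (d + d2 - l - 1)%:~R -> B (O l w' u) w = 0.
move=> wd wd2 uz zn; rewrite (O_hom l u wd) /Ohom (linZ (Bl w)) (fsum_lin (Bl w)); last exact: Oterm_fin.
rewrite -[X in _ *: X]/(fsum _) fsum_eq0 ?scaler0 // => j; apply: (B_weight _ wd2 _).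
 exact: (Ys_weight _ (D_deg j wd) uz).
apply: contraNneq zn => e; rewrite -subr_eq0; apply/eqP.
have -> : z = d2%:~R - d%:~R + j%:R + (2%:Z * d - l - j%:Z - 2%:Z)%:~R + 1 by rewrite -e; ring.
by rewrite !intrD !mulrNz intrM; ring.
Qed.

Let Oc_weight l (d d2 : int) (w' w : S) z u : dg w' = d%:~R *: w' -> dg w = d2%:~R *: w -> L 0 u = z *: u ->
 z != (d + d2 - l - 1)%:~R -> B (Oc l w' u) w = 0.
move=> wd wd2 uz zn; have hd b : dg (hproj b w') = d%:~R *: hproj b w'.
 rewrite /hproj (linZ dg_lin) (linD dg_lin) (linZ dg_lin) dg_par wd (linZ (@par_linear R S)).
 by rewrite [RHS]scalerCA; congr (_ *: _); rewrite [RHS]scalerDr; congr (_ + _); exact: scalerCA.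
have pz : L 0 (par u) = z *: par u by rewrite -L_par // uz (linZ (@par_linear R AV)).
by rewrite /Oc (linD (Bl w)) (O_weight (hd _) wd2 uz zn) (O_weight (hd _) wd2 pz zn) addr0.
Qed.

(** For homogeneous w' and w the functional lives on a single weight of u ([Oc_weight]), so
    [represent] applies; [c] is the resulting operator with values in V. *)
Let c_exists (l : int) (w' w : S) : exists v, forall u, F u v = B (Oc l w' u) w.
suff [N NP] : exists N : nat, forall (m : nat) u, (N <= m)%N -> L 0 u = m%:R *: u -> B (Oc l w' u) w = 0.
 apply: (represent hk KV Fl Fr FL Fnl _ NP) => a u v; by rewrite (Oc_linr l w') (Bl w).
have sub1 w2 : subspace [set w' | exists N : nat, forall (m : nat) u, (N <= m)%N -> L 0 u = m%:R *: u -> B (Oc l w' u) w2 = 0].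
 split=> [|a x y [N NP] [N' NP']].
  by exists 0%N => m u _ _; rewrite (lin0 (Oc_linl l u)) (lin0 (Bl w2)).
 exists (N + N')%N => m u Nm um; rewrite (Oc_linl l u) (Bl w2).
 by rewrite (NP m u _ um) ?(leq_trans (leq_addr _ _) Nm) // (NP' m u _ um) ?(leq_trans (leq_addl _ _) Nm) // scaler0 addr0.
have sub2 w1 : subspace [set w | exists N : nat, forall (m : nat) u, (N <= m)%N -> L 0 u = m%:R *: u -> B (Oc l w1 u) w = 0].
 split=> [|a x y [N NP] [N' NP']].
  by exists 0%N => m u _ _; rewrite (lin0 (Br _)).
 exists (N + N')%N => m u Nm um; rewrite (Br _).
 by rewrite (NP m u _ um) ?(leq_trans (leq_addr _ _) Nm) // (NP' m u _ um) ?(leq_trans (leq_addl _ _) Nm) // scaler0 addr0.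
apply: (deg_ind (sub1 w)) w' => d w' wd; apply: (deg_ind (sub2 w')) w => d2 w wd2 /=.
exists (`|(d%:Z + d2%:Z - l - 1)%R|.+1)%N => m u Nm um.
apply: (Oc_weight (d := d%:Z) (d2 := d2%:Z) wd wd2 um).
by rewrite -[m%:R]/(m%:Z%:~R) eqr_int; lia.
Qed.

Let c (w' : M) (l : int) (w : S) : AV := sval (cid (c_exists l w' w)).
Let cP w' l w u : F u (c w' l w) = B (Oc l w' u) w.
exact: (svalP (cid (c_exists l w' w))). Qed.
Let F_inj v v' : (forall u, F u v = F u v') -> v = v'.
move=> e; apply/eqP; rewrite -subr_eq0; apply/eqP/Fnr => u.
by rewrite (linB (Fr u)) e subrr.
Qed.

Let c_linl l w : linear (fun w' => c w' l w).
by move=> a x y; apply: F_inj => u; rewrite (Fr u) !cP (Oc_linl l u) (Bl w). Qed.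
Let c_linr w' l : linear (c w' l).
by move=> a x y; apply: F_inj => u; rewrite (Fr u) !cP (Br _). Qed.
Let c_par w' l w : par (c w' l w) = c (par w') l (par w).
by apply: F_inj => u; rewrite -Fp !cP -Bp Oc_par par_invol. Qed.
Let c_weight l (d d2 : int) (w' w : S) : dg w' = d%:~R *: w' -> dg w = d2%:~R *: w ->
 L 0 (c w' l w) = (d + d2 - l - 1)%:~R *: c w' l w.
move=> wd wd2; have lL := @L_lin _ _ _ AV 0; have dV := @V_diag _ _ hk V; have sV := diag_span dV.
set z := (d + d2 - l - 1)%:~R; apply: F_inj => u; rewrite -FL (linZ (Fr u)).
have [_ [s [_ _ ->]]] := gcompP lL sV u.
rewrite (lin_sum lL) !(lin_sum (Fl _)) scaler_sumr; apply: eq_bigr => h _.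
have uh : L 0 (gcomp (LL AV 0) u h) = h *: gcomp (LL AV 0) u h := diag_gcomp u h lL dV.
rewrite uh (linZ (Fl _)); have [->//|hz] := eqVneq h z.
by rewrite cP (Oc_weight wd wd2 uh hz) !scaler0.
Qed.

Let c_neg l (d d2 : int) (w' w : S) : dg w' = d%:~R *: w' -> dg w = d2%:~R *: w -> d + d2 - l - 1 < 0 -> c w' l w = 0.
move=> wd wd2 neg; have := c_weight l wd wd2; set z := d + d2 - l - 1 in neg *; set v := c w' l w => e.
have lL := @L_lin _ _ _ AV 0; have dV := @V_diag _ _ hk V; have sV := diag_span dV.
have g : geigen (LL AV 0) z%:~R v by exists 1%N; rewrite -[LHS]/(L 0 v - z%:~R *: v) e subrr.
rewrite -(V_weights hk v (h := z%:~R)) ?(gcomp_geigen lL sV _ g) ?eqxx // => m /eqP.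
by rewrite -[m%:R]/(m%:Z%:~R) eqr_int => /eqP E; move: neg; rewrite E.
Qed.

Let c_fin w' w l : fin1 (fun i => c w' (l + i%:Z) w).
have sub1 w2 : subspace [set w' | fin1 (fun i => c w' (l + i%:Z) w2)].
 split=> [|a x y [N NP] [N' NP']]; first by exists 0%N => i _; exact: (lin0 (c_linl _ _)).
 exists (N + N')%N => i Ni; rewrite (c_linl _ _).
 by rewrite NP ?(leq_trans (leq_addr _ _) Ni) // NP' ?(leq_trans (leq_addl _ _) Ni) // scaler0 addr0.
have sub2 w1 : subspace [set w | fin1 (fun i => c w1 (l + i%:Z) w)].
 split=> [|a x y [N NP] [N' NP']]; first by exists 0%N => i _; exact: (lin0 (c_linr _ _)).
 exists (N + N')%N => i Ni; rewrite (c_linr _ _).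
 by rewrite NP ?(leq_trans (leq_addr _ _) Ni) // NP' ?(leq_trans (leq_addl _ _) Ni) // scaler0 addr0.
apply: (deg_ind (sub1 w)) w' => d w' wd; apply: (deg_ind (sub2 w')) w => d2 w wd2 /=.
exists (`|(d%:Z + d2%:Z - l - 1)%R|.+1)%N => i Ni.
by apply: (c_neg (d := d%:Z) (d2 := d2%:Z) wd wd2); lia.
Qed.

Let signzD (x y : int) : (-1) ^ (x + y) = (-1) ^ x * (-1) ^ y :> C.
by rewrite expfzDr // oppr_eq0 oner_eq0. Qed.
Let signz_sq (x : int) : (-1) ^ x * (-1) ^ x = 1 :> C.
by rewrite -expfzMl mulrNN mulr1 exp1rz. Qed.
Let signzN (x : int) : (-1) ^ (- x) = (-1) ^ x :> C.
have x0 : (-1) ^ x != 0 :> C by rewrite expfz_neq0 // oppr_eq0 oner_eq0.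
by apply: (mulIf x0); rewrite -signzD addNr signz_sq.
Qed.

Let apar2 p b (W : sspace R) (u : W) : apar (p (+) b) u = apar b (apar p u).
by case: p b => [] [] //=; rewrite par_invol. Qed.
Let Ba' a r (w' : M) w : B w' (mode S a r w) = - B (mode M a (- r) (apar (odd11 a) w')) w.
by rewrite Ba !opprK; case: (odd11 a) => //=; rewrite Bp par_invol. Qed.
Let Fa' a r u v : F u (mode AV a r v) = - F (mode AV a (- r) (apar (odd11 a) u)) v.
by rewrite Fa !opprK; case: (odd11 a) => //=; rewrite Fp par_invol. Qed.
Let O_apar p b l (w' : S) u : hmg b w' -> apar p (O l w' u) = (-1) ^+ (p && b) *: O l w' (apar p u).
move=> wb; case: p => /=; last by rewrite scale1r.
by rewrite O_par wb (linZ (O_linl l _)).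
Qed.

Section Jacobi.
Variables (a : gl11) (b : bool) (d : int) (w' : S).
Hypotheses (wb : hmg b w') (wd : dg w' = d%:~R *: w').
Let p := odd11 a.
Let sgn : C := (-1) ^+ (p && b).
Let N1 (n : int) : nat := (`|(d - n)%R|.+1)%N.
Let N2 : nat := `|d|.+1.
Let E_hmg j : hmg b (D j w'). by rewrite /hmg D_par wb (linZ (D_lin j)). Qed.
Let E_zero j : (N2 <= j)%N -> D j w' = 0.
by move=> dj; apply: (D_zero wd); rewrite /N2 in dj; lia. Qed.
Fact aE_zero n s j : (N1 n <= s)%N -> mode M a (n + s%:Z) (D j w') = 0.
move=> ns; apply: (@neg_zero (d - j%:Z - (n + s%:Z))); last by rewrite /N1 in ns; lia.
by rewrite (dg_mode a _ (D_deg j wd)) !intrB.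
Qed.
Let O_sum l u : O l w' u = (-1) ^ d *: \sum_(j < N2) Ys (D j w') (2%:Z * d - l - j%:Z - 2%:Z) u.
rewrite (O_hom l u wd) /Ohom (fsumE (N := N2)) // => j nj.
by rewrite /Oterm E_zero // (lin0 (Ysl _ _)).
Qed.

Variables (m n l : int) (w : S) (u : AV).
Let u2 := apar b (apar p u).
Let K j : int := 2%:Z * d - l - j%:Z - 2%:Z - n.
Let X i j : M := mode M a (- (m + n) + n - i%:Z) (Ys (D j w') (K j + i%:Z) u2).
Let Z i j : M := Ys (D j w') (n + K j - i%:Z) (mode AV a (- (m + n) + i%:Z) u2).
Let G i q j : S := (binz m i * (-1) ^ (d - n - i%:Z) * binz (- (n + i%:Z)) q) *:
 Ys (mode M a (n + (i + q)%N%:Z) (D j w')) (- (m + n) + K j - (i + q)%N%:Z) u2.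

Let G0 i q j : (N1 n <= i + q)%N || (N2 <= j)%N -> G i q j = 0.
move=> /orP [h|h]; rewrite /G; first by rewrite aE_zero // (lin0 (Ysl _ _)) scaler0.
by rewrite E_zero // (lin0 (lM _ _)) (lin0 (Ysl _ _)) scaler0.
Qed.

(** [L1div_mode] moves the powers of L_1 past the current; the result is regrouped along
    antidiagonals. *)
Fact left_term i : F u (binz m i *: c (mode M a (n + i%:Z) w') (m + l - i%:Z) w) =
 B (\fs_q \fs_j G i q j) w.
have xb : hmg (p (+) b) (mode M a (n + i%:Z) w') by exact: (act_hmg (W := M) _ (gen_par V a) wb).
have xd : dg (mode M a (n + i%:Z) w') = (d - n - i%:Z)%:~R *: (mode M a (n + i%:Z) w' : S)
 by rewrite (dg_mode a _ wd) -intrB; congr (_%:~R *: _); ring.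
rewrite (linZ (Fr u)) cP (Oc_hmg _ _ xb) apar2 -/u2 -(linZ (Bl w)); congr (B _ w).
rewrite (O_hom _ _ xd) /Ohom scalerA -fsumZ; last exact: (Oterm_fin _ _ xd).
rewrite fsum_diag; last first.
 exists (N1 n + N2)%N => q j qj; apply: G0; lia.
apply: eq_fsum => j; rewrite /Oterm /D (L1div_mode (W := M) hk).
have ly h : linear (fun x => Ys x h u2) by exact: Ysl.
rewrite (lin_sum (ly _)) scaler_sumr; apply: eq_bigr => q _.
have qj : (q <= j)%N by rewrite -ltnS.
rewrite (linZ (ly _)) scalerA /G; congr (_ *: Ys (mode M a _ _) _ _); first by rewrite PoszD addrA.
by rewrite /K PoszD -subzn //; ring.
Qed.

Let XZ_fin j : fin1 (fun i => ((-1) ^+ i * binz n i) *: (X i j - ((-1) ^ n * sgn) *: Z i j)).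
have [N NP] := Ys_fin (D j w') (K j) u2; have [N' NP'] := act_fin (W := AV) (gen V a) u2 (- (m + n)).
apply: fin1Z; exists (N + N')%N => i Ni; rewrite /X NP ?(leq_trans (leq_addr _ _) Ni) //.
rewrite /Z [mode AV a _ _]NP' ?(leq_trans (leq_addl _ _) Ni) // (lin0 (lM _ _)) (lin0 (Ysr _ _)).
by rewrite scaler0 subr0.
Qed.

Fact sum_fin : fin1 (fun i => \sum_(j < N2) ((-1) ^+ i * binz n i) *: (X i j - ((-1) ^ n * sgn) *: Z i j)).
have [N NP] := choice XZ_fin; exists (\max_(j < N2) N j)%N => i Ni.
by apply: big1 => j _; apply: NP; apply: leq_trans Ni; exact: leq_bigmax.
Qed.

(** Under t -> 1/t the function t^m (t - y)^n becomes t^(-m-n) (t - y)^n up to sign and a power of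
    y; hence the Jacobi identity of [Ys] is taken at -(m + n) in place of m. *)
Fact left_sum : (\fs_i \fs_q \fs_j G i q j) =
 (-1) ^ (d - n) *: fsum (fun i => \sum_(j < N2) ((-1) ^+ i * binz n i) *: (X i j - ((-1) ^ n * sgn) *: Z i j)).
rewrite (fsum_big (F := fun i (j : 'I_N2) => ((-1) ^+ i * binz n i) *: (X i j - ((-1) ^ n * sgn) *: Z i j))); last by move=> j; exact: XZ_fin.
have f1 i (j : 'I_N2) : fin1 (fun q => G i q j) by exists (N1 n) => q nq; apply: G0; lia.
rewrite (eq_fsum (g := fun i => \sum_(j < N2) (\fs_q G i q j))); last first.
 move=> i; rewrite -fsum_big //; apply: eq_fsum => q; rewrite (fsumE (N := N2)) // => j nj.
 by apply: G0; rewrite nj orbT.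
rewrite fsum_big; last by move=> j; exists (N1 n) => i ni; apply: fsum_eq0 => q; apply: G0; lia.
rewrite scaler_sumr; apply: eq_bigr => j _.
rewrite (fsum_diag (F := fun i q => G i q j)); last by exists (N1 n) => i q iq; apply: G0; rewrite iq.
have := Ys_jac a (E_hmg j) (- (m + n)) n (K j) u2.
rewrite -/(mode AV a) -/(mode M a) => J.
rewrite (_ : (\fs_i ((-1) ^+ i * binz n i) *: (X i j - ((-1) ^ n * sgn) *: Z i j)) =
 \fs_i binz (- (m + n)) i *: Ys (mode M a (n + i%:Z) (D j w')) (- (m + n) + K j - i%:Z) u2); last by rewrite [RHS]J; apply: eq_fsum => i; rewrite scale1r.
rewrite -fsumZ; last by apply: fin1Z; exists (N1 n) => s ns; rewrite aE_zero // (lin0 (Ysl _ _)).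
apply: eq_fsum => s; rewrite scalerA -binz_alternating mulr_sumr scaler_suml; apply: eq_bigr => i _.
have is_ : (i <= s)%N by rewrite -ltnS.
rewrite /G subnKC //; congr (_ *: _).
have -> : (-1) ^ (d - n - i%:Z) = (-1) ^ (d - n) * (-1) ^+ i :> C by rewrite signzD signzN.
by ring.
Qed.

Fact right_term i : F u (((-1) ^+ i * binz n i) *: (1 *: mode AV a (m + n - i%:Z) (c w' (l + i%:Z) w)
 - ((-1) ^ n * sgn) *: c w' (n + l - i%:Z) (mode S a (m + i%:Z) w))) =
 B ((-1) ^ (d - n) *: \sum_(j < N2) ((-1) ^+ i * binz n i) *: (X i j - ((-1) ^ n * sgn) *: Z i j)) w.
have sgn2 : sgn * sgn = 1 by rewrite -expr2 sqrr_sign.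
rewrite scale1r (linZ (Fr u)) (linB (Fr u)) (linZ (Fr u)) Fa' !cP !(Oc_hmg _ _ wb)
 (apar_act (mode_action AV)) -/p andbC -/sgn -/u2 (linZ (O_linr _ _)) (linZ (Bl w))
 Ba' -/p (O_apar p _ _ wb) -/sgn (linZ (lM _ _)) (linZ (Bl w)).
have -> : apar p (apar b u) = u2 by rewrite /u2; case: p b => [] [].
rewrite !O_sum (linZ (lM _ _)) (lin_sum (lM _ _)).
have EX (j : 'I_N2) : mode M a (- (m + i%:Z)) (Ys (D j w') (2%:Z * d - (n + l - i%:Z) - j%:Z - 2%:Z) u2) = X i j
 by rewrite /X; congr (mode M a _ (Ys _ _ _)); rewrite /K; ring.
have EZ (j : 'I_N2) : Ys (D j w') (2%:Z * d - (l + i%:Z) - j%:Z - 2%:Z) (mode AV a (- (m + n - i%:Z)) u2) = Z i j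
 by rewrite /Z; congr (Ys _ _ (mode AV a _ _)); rewrite /K; ring.
rewrite (eq_bigr _ (fun j _ => EX j)) (eq_bigr _ (fun j _ => EZ j)).
rewrite -scaler_sumr sumrB -scaler_sumr !(linZ (Bl w)) (linB (Bl w)) (linZ (Bl w)) signzD signzN.
move: (B (\sum_(j < N2) X i j) w) (B (\sum_(j < N2) Z i j) w) => x z.
rewrite -![_ *: (_ : C^o)]/(_ * _).
have nn : (-1) ^ n * (-1) ^ n = 1 :> C by exact: signz_sq.
move: nn sgn2; move: ((-1) ^ n) ((-1) ^ d) sgn ((-1) ^+ i * binz n i) => y1 y2 y3 y4 nn sgn2.
by ring: nn sgn2.
Qed.

End Jacobi.
Let near_fin a n w' m l w : fin1 (fun i => binz m i *: c (mode M a (n + i%:Z) w') (m + l - i%:Z) w).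
have [N NP] := act_fin (W := M) (gen V a) w' n.
by apply: fin1Z; exists N => i /NP e; rewrite [mode M a _ _]e (lin0 (c_linl _ _)).
Qed.

Let far_fin a (x : C) w' m n l w : fin1 (fun i => ((-1) ^+ i * binz n i) *:
 (1 *: mode AV a (m + n - i%:Z) (c w' (l + i%:Z) w) - x *: c w' (n + l - i%:Z) (mode S a (m + i%:Z) w))).
have [N NP] := c_fin w' w l; have [N' NP'] := act_fin (W := S) (gen V a) w m.
apply: fin1Z; exists (N + N')%N => i Ni; rewrite NP ?(leq_trans (leq_addr _ _) Ni) //.
rewrite [mode S a _ _]NP' ?(leq_trans (leq_addl _ _) Ni) // (lin0 (c_linr _ _)).
by rewrite (lin0 (@mode_lin _ _ _ AV _ _)) !scaler0 subr0.
Qed.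

Let jac a b m n l w w' := (\fs_i binz m i *: c (mode M a (n + i%:Z) w') (m + l - i%:Z) w) =
 \fs_i ((-1) ^+ i * binz n i) *: (1 *: mode AV a (m + n - i%:Z) (c w' (l + i%:Z) w)
 - ((-1) ^ n * (-1) ^+ (odd11 a && b)) *: c w' (n + l - i%:Z) (mode S a (m + i%:Z) w)).

Let c_jac_hom a b (d : int) w' : hmg b w' -> dg w' = d%:~R *: w' -> forall m n l w, jac a b m n l w w'.
move=> wb wd m n l w; apply: F_inj => u.
rewrite [RHS](fsum_lin (Fr u)); last exact: far_fin.
rewrite [LHS](fsum_lin (Fr u)); last exact: near_fin.
apply: etrans (eq_fsum (fun i => left_term a wb wd m n l w u i)) _.
rewrite -[LHS](fsum_lin (Bl w)); last first.
 exists (`|(d - n)%R|.+1)%N => i ni; apply: fsum_eq0 => q; apply: fsum_eq0 => j.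
 by rewrite (aE_zero a wd) ?(lin0 (Ysl _ _)) ?scaler0 //; lia.
rewrite (left_sum a wb wd) -fsumZ; last exact: sum_fin.
rewrite (fsum_lin (Bl w)); last by apply: fin1Z; exact: sum_fin.
by apply: eq_fsum => i; rewrite (right_term a wb wd).
Qed.

Let c_jac a b w' : hmg b w' -> forall m n l w, jac a b m n l w w'.
move=> wb m n l w; have sA := diag_span dg_diag.
have lV r : linear (mode AV a r) by exact: mode_lin.
pose U : set S := jac a b m n l w.
have sU : subspace U.
 split=> [|x w1 w2]; rewrite /U /jac; last move=> e1 e2.
  rewrite !fsum_eq0 // => i; last by rewrite (lin0 (lM _ _)) (lin0 (c_linl _ _)) scaler0.
  by rewrite !(lin0 (c_linl _ _)) (lin0 (lV _)) !scaler0 subr0 scaler0.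
 rewrite (eq_fsum (g := fun i => x *: (binz m i *: c (mode M a (n + i%:Z) w1) (m + l - i%:Z) w) +
  binz m i *: c (mode M a (n + i%:Z) w2) (m + l - i%:Z) w)); last by move=> i; rewrite lM (c_linl _ _) scalerDr scalerCA.
 rewrite fsumD; [|by apply: fin1Z; exact: near_fin|exact: near_fin].
 rewrite fsumZ; last exact: near_fin.
 rewrite e1 e2 -fsumZ; last exact: far_fin.
 rewrite -fsumD; [|by apply: fin1Z; exact: far_fin|exact: far_fin].
 apply: eq_fsum => i; rewrite !(c_linl _ _) lV; move: ((-1) ^+ i * _) ((-1) ^ n * _) => c1 c2; lmod_ring.
suff : U w' by [].
have [_ [s [_ _ ->]]] := gcompP dg_lin sA w'.
apply: (sub_sum sU) => h _; have e := diag_gcomp w' h dg_lin dg_diag.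
have [[d hd]|nm] := pselect (exists d : nat, h = d%:R); last by rewrite (deg_nat e) => [|d hd]; [exact: sub0|apply: nm; exists d].
have gb : hmg b (gcomp dg w' h).
 rewrite /hmg -{1}[h]subr0 -(gcomp_shift dg_lin sA (@par_linear R S)); last by move=> y; rewrite dg_par scale0r addr0.
 by rewrite wb (linZ (@gcomp_linear _ _ _ dg_lin sA h)).
by apply: (c_jac_hom (d := d) a gb); rewrite hd in e *.
Qed.

Let c_borcherds : borcherds (@act _ _ M) (@act _ _ S) (@act _ _ AV) false c.
apply: borcherds_generators => [m' w|m' w|w' w l|a b w' wb m n l w].
- exact: c_linl.
- exact: c_linr.
- exact: c_fin.
- exact: (c_jac a wb).
Qed.

(** Restores the power x^(-2 h0) omitted from [c]. L_0 is diagonalizable on S and on V, so there are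
    no logarithms. *)
Let Ec (w' : M) (h : C) (j : nat) (w : S) : AV := if pselect (exists m : int, h = h0 + h0 + m%:~R) is left ex then
  (if j == 0%N then c w' (sval (cid ex)) w else 0) else 0.

Let Ec_in w' (m : int) w : Ec w' (h0 + h0 + m%:~R) 0 w = c w' m w.
rewrite /Ec; case: pselect => [ex|[]]; last by exists m.
by case: cid => m' /= /addrI /intr_inj ->.
Qed.
Let Ec_out w' h j w : ~ (exists m : int, h = h0 + h0 + m%:~R) -> Ec w' h j w = 0.
by move=> nh; rewrite /Ec; case: pselect. Qed.
Let Ec_log w' h j w : Ec w' h j.+1 w = 0.
by rewrite /Ec; case: pselect. Qed.
Let Ec_cases (P : C -> nat -> Prop) : (forall m : int, P (h0 + h0 + m%:~R) 0%N) ->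
 (forall h j, (forall w' (n : int) w, Ec w' (h + n%:~R) j w = 0) -> P h j) -> forall h j, P h j.
move=> P0 Pz h [|j]; last by apply: Pz => w' n w; exact: Ec_log.
have [[m ->//]|nh] := pselect (exists m : int, h = h0 + h0 + m%:~R); apply: Pz => w' n w.
apply: Ec_out => -[m e]; apply: nh; exists (m - n).
by rewrite intrB addrA -e addrK.
Qed.

Let c_L1 w' l w : c (L (-1) (w' : M)) (l + 1) w = (- (h0 + h0 + l%:~R) - 1) *: c w' l w.
have comm w1 w2 : c (LL M (-1) w1) (l + 1) w2 = L 0 (c w1 l w2) - c w1 l (L 0 w2) - c (LL M 0 w1) l w2.
 apply: (hmg_split (U := [set w1 : M | c (LL M (-1) w1) (l + 1) w2 =
  L 0 (c w1 l w2) - c w1 l (L 0 w2) - c (LL M 0 w1) l w2])) w1 => [|b w1 wb]; rewrite /mkset.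
  have lm := @L_lin _ _ _ M (-1); have l0 := @L_lin _ _ _ M 0; have lv := @L_lin _ _ _ AV 0.
  split=> [|x y z ey ez].
   by rewrite (lin0 lm) (lin0 l0) !(lin0 (c_linl _ _)) (lin0 lv) !subr0.
  rewrite lm !(c_linl _ _) ey ez l0 lv (c_linl _ _); lmod_ring.
 have := borcherds_comm c_borcherds w2 1 l (omega_even V) wb.
 rewrite andbF scale1r scale1r -[LHS]/(fsum _) (fsumE (N := 2)) => [|i i2]; last first.
  rewrite (_ : Defs.binz R 1 i = 0) ?scale0r // -[1]/(1%N%:Z) binz_nat bin_small //.
 have b1 : Defs.binz R 1 1 = 1 by rewrite binzS binz0 mul1r subr0 divr1.
 have -> : \sum_(i < 2) Defs.binz R 1 i *: c (act (conformal_vector V) i%:Z w1) (1 + l - i%:Z) w2 =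
   c (LL M (-1) w1) (1 + l) w2 + c (LL M 0 w1) l w2.
  rewrite big_ord_recl big_ord1 binz0 [Defs.binz R 1 (lift _ _)]b1 !scale1r
   (_ : 1 + l - (nat_of_ord ord0)%:Z = 1 + l); last by rewrite subr0.
  by rewrite (_ : 1 + l - (nat_of_ord (lift ord0 ord0))%:Z = l); last by rewrite [LHS]addrAC [X in X + _]subrr add0r.
 by move=> e; rewrite [l + 1]addrC; apply/eqP; rewrite eq_sym subr_eq eq_sym; apply/eqP; exact: e.
have sub1 w2 : subspace [set w' : S | c (LL M (-1) w') (l + 1) w2 = (- (h0 + h0 + l%:~R) - 1) *: c w' l w2].
 have lm := @L_lin _ _ _ M (-1); split=> [|x y z ey ez]; rewrite /mkset.
  by rewrite (lin0 lm) !(lin0 (c_linl _ _)) scaler0.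
 by rewrite lm !(c_linl _ _) ey ez scalerDr scalerCA.
have sub2 w1 : subspace [set w : S | c (LL M (-1) w1) (l + 1) w = (- (h0 + h0 + l%:~R) - 1) *: c w1 l w].
 split=> [|x y z ey ez] /=; first by rewrite !(lin0 (c_linr _ _)) scaler0.
 by rewrite !(c_linr _ _) ey ez scalerDr scalerCA.
apply: (deg_ind (sub1 w)) w' => d w' wd; apply: (deg_ind (sub2 w')) w => d2 w wd2; rewrite /mkset.
rewrite comm LM (c_weight l (d := d) (d2 := d2) wd wd2) (dL wd) (dL wd2) (linZ (c_linr _ _)) (linZ (c_linl _ _))
 -!scalerBl; congr (_ *: _); rewrite !intrD !mulrNz; ring.
Qed.

Let Ec_int : intertwining false Ec.
split.
- apply: Ec_cases => [m w a x y|h j z w a x y]; first by rewrite !Ec_in; exact: c_linl.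
 by have z' w' := z w' 0 w; rewrite addr0 in z'; rewrite !z' scaler0 addr0.
- move=> w'; apply: Ec_cases => [m a x y|h j z a x y]; first by rewrite !Ec_in; exact: c_linr.
 by have z' w := z w' 0 w; rewrite addr0 in z'; rewrite !z' scaler0 addr0.
- move=> w' h j w; rewrite scale1r; move: h j w; apply: Ec_cases => [m w|h j z w]; first by rewrite !Ec_in c_par.
 by have z' w' w2 := z w' 0 w2; rewrite addr0 in z'; rewrite !z' par0.
- move=> w' w h; have [N NP] : exists N : nat, forall n : nat, (N <= n)%N -> Ec w' (h + n%:R) 0 w = 0.
  move: h 0%N; apply: Ec_cases => [m|h j z]; last by exists 0%N => n _; exact: (z w' n).
  have [N NP] := c_fin w' w m; exists N => n /NP e.
  by rewrite -addrA -[n%:R]/(n%:Z%:~R) -intrD Ec_in.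
 by exists N => n [|j] Nn; [exact: NP|exact: Ec_log].
- by move=> w' w h; exists 1%N => -[//|j] _; exact: Ec_log.
- apply: Ec_cases => [m|h j z] a b v w' w m' n l va wb; last first.
  have zz w1 (x : int) w2 : Ec w1 (h + x%:~R) j w2 = 0 by exact: z.
  rewrite -[LHS]/(fsum _) -[RHS]/(fsum _) !fsum_eq0 // => i; rewrite !zz ?scaler0 //.
  by rewrite (lin0 (@act_linr _ _ _ AV _ _)) !scaler0 subr0 scaler0.
 have e w1 (x : int) w2 : Ec w1 (h0 + h0 + m%:~R + x%:~R) 0 w2 = c w1 (m + x) w2 by rewrite -addrA -intrD Ec_in.
 have := c_borcherds w m' n (m + l) va wb => J.
 rewrite -[LHS]/(fsum _) -[RHS]/(fsum _).
 apply: etrans (etrans J _); apply: eq_fsum => i; rewrite !e.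
  by congr (_ *: c _ _ _); ring.
 have -> : m + l + i%:Z = m + (l + i%:Z) by ring.
 by have -> : n + (m + l) - i%:Z = m + (n + l - i%:Z) by ring.
move=> w'; apply: Ec_cases => [m w|h j z w].
 rewrite Ec_log scaler0 addr0 -addrA -[m%:~R + 1]/(m%:~R + 1%:~R) -intrD !Ec_in.
 exact: c_L1.
have z1 := z w' 0 w; rewrite addr0 in z1.
have z2 : Ec (L (-1) (w' : M)) (h + 1) j w = 0 := z _ 1 w.
by rewrite z2 z1 Ec_log !scaler0 addr0.
Qed.

Lemma evaluation_of_forms : exists e : ten T M S -> AV, ehom e /\ exists u, e u <> 0.
have [e [he eE] _] := hlz_universal hT KM (hw_KL H) KV Ec_int.
(* The leading coefficient: its pairing with the vacuum is B t t = 1, because Y(t, x) vac starts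
   with t. *)
exists e; split=> //; exists (tY T (t : M) (h0 + h0 + (-1)%:~R) 0%N t); rewrite eE Ec_in => c0.
have := cP t (-1) t (vac V); rewrite c0 (lin0 (Fr _)) => /esym/eqP.
have td : dg t = 0%:Z%:~R *: t by rewrite dgE (hw_L0 hk H) subrr scale0r.
rewrite (Oc_hmg _ _ (hw_par H)).
have -> : apar b0 (vac V : AV) = vac V by case: b0 => //=; have := vac_even V; rewrite /hmg scale1r.
rewrite (O_hom _ _ td) /Ohom scale1r (fsumE (N := 1)) => [|j j0]; last by rewrite /Oterm (D_zero (j := j) td) ?(lin0 (Ysl _ _)).
rewrite big_ord1 /Oterm (_ : 2%:Z * 0%:Z - (-1) - 0%N%:Z - 2%:Z = -1) //.
have -> : D 0 t = t by rewrite /D /L1div fact0 invr1 scale1r.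
by rewrite (Ys_vac (hw_par H)) Bt oner_eq0.
Qed.

End Evaluation.

Lemma evaluation_exists (R : realType) (k : R[i]) (hk : k != 0) (V : affine_vsa k)
  (T : tensor_data V) (hT : hlz_structure (@KL R k V) T) (v0 : (vac V : adjoint V) <> 0)
  (S : vmod V) (t : S) b n e : highest t b n e ->
 exists ev : ten T (tau_vmod S) S -> adjoint V, ehom ev /\ exists u, ev u <> 0.
move=> H; have KV := bt_unit (hlz_braided hT).
have [F [Fl Fr Fv Fa [Fp FL [Fnr Fnl]]]] := vacuum_form hk KV v0.
have [B [Bl Br Bt Ba [Bp BL]]] := shapovalov hk H.
exact: (evaluation_of_forms hk hT H Fl Fr Fa Fp FL Fnr Fnl Bl Br Bt Ba Bp BL).
Qed.

(** * The kernel of the exponential; generation of tensor products by few coefficients *)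

Section Kernel.
Variable R : realType.

Lemma expC_kernel (x : R[i]) : expC (2%:R * piI R * x) = 1 -> exists m : int, x = m%:~R.
case: x => a b e0; pose m := Num.floor a; exists m; pose f := a - m%:~R.
have mE : m%:~R = (m%:~R : R)%:C :> R[i] by rewrite rmorph_int.
(* The angle is kept as pi f + pi f, so that cosine 1 gives sin (pi f) = 0 by the addition formula;
   then 0 <= f < 1 forces f = 0. *)
have re : 2%:R * (0 +i* pi) * (a +i* b) - 2%:R * (0 +i* pi) * m%:~R
  = (- (2%:R * pi * b)) +i* (pi * f + pi * f) :> R[i]
 by rewrite mE; apply/eqP; rewrite eq_complex /= /f; apply/andP; split; apply/eqP; ring.
have e : expC ((- (2%:R * pi * b)) +i* (pi * f + pi * f)) = 1 :> R[i]
 by rewrite -re -mulrN -rmorphN expCD e0 mul1r expC_2piIz.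
move: e; rewrite /expC /=; set x := - _; set y := _ + _ => e.
have [e1 e2] : expR x * cos y = 1 /\ expR x * sin y = 0
 by move/eqP: e; rewrite eq_complex /= => /andP [/eqP h1 /eqP h2]; split; [rewrite -h1|rewrite -h2]; ring.
have ep := expR_gt0 x.
have s0 : sin y = 0 by move/eqP: e2; rewrite mulf_eq0 gt_eqF ?expR_gt0 //= => /eqP.
have c1 : cos y = 1.
 have := cos2Dsin2 y; rewrite s0 expr0n addr0 => /eqP; rewrite sqrf_eq1 => /orP [/eqP //|/eqP c]; exfalso.
 have ex : expR x = -1 by have := e1; rewrite c mulrN1 => <-; rewrite opprK.
 by move: ep; rewrite ex oppr_gt0 ltNge ler01.
have b0 : b = 0.
 have x0 : x = 0 by apply: expR_inj; rewrite expR0 -e1 c1 mulr1.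
 by move/eqP: x0; rewrite oppr_eq0 !mulf_eq0 pnatr_eq0 /= gt_eqF ?pi_gt0 //= => /eqP.
have f0 : f = 0.
 have sf : sin (pi * f) = 0.
  have := c1; rewrite cosD => h; have := cos2Dsin2 (pi * f); rewrite -h => /eqP.
  rewrite -subr_eq0 (_ : _ - _ = 2%:R * sin (pi * f) ^+ 2); last by ring.
  by rewrite mulf_eq0 pnatr_eq0 /= sqrf_eq0 => /eqP.
 apply/eqP; apply: contraPT (sf) => fn.
 have /andP [f1 f2] : 0 <= f < 1 by rewrite /f subr_ge0 floor_le_tmp ltrBlDl -intrD1 floorD1_gt.
 apply/eqP; rewrite gt_eqF // sin_gt0_pi // mulr_gt0 ?pi_gt0 ?lt_def ?fn //=.
 by rewrite -lt_def -[ltRHS]mulr1 ltr_pM2l ?pi_gt0.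
by apply/eqP; rewrite mE eq_complex /= b0 eqxx andbT -subr_eq0 -/f f0.
Qed.

End Kernel.
Lemma fsum_head (K : pzRingType) (W : lmodType K) (f : nat -> W) : (forall i, f i.+1 = 0) -> fsum f = f 0%N.
by move=> f0; rewrite (@fsumE _ _ 1) ?big_ord1 // => -[|i] // _; exact: f0. Qed.

Section Vanishing.
Context R (k : R[i]) (hk : k != 0) (V : affine_vsa k).
Definition generates (W : vmod V) (t : W) : Prop := forall U : set W, submodule U -> U t -> forall w, U w.
Lemma simple_generates (W : vmod V) (t : W) : simple W -> t <> 0 -> generates t.
by case=> _ s t0 U sU Ut w; case: (s U sU) => e; move: Ut; rewrite e. Qed.

Section Intertwiner.
Variables (W1 W2 W3 : vmod V) (q : bool) (Y : log_modes W1 W2 W3) (t1 : W1) (t2 : W2) (b : bool).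
Hypotheses (HY : intertwining q Y) (g1 : generates t1) (g2 : generates t2) (h2 : hmg b t2)
 (Y0 : forall h j, Y t1 h j t2 = 0).

Let par_stable (U : set W1) : subspace U -> (forall u, U u -> U (par u)) ->
 (forall a r c u, hmg c u -> U u -> U (mode W1 a r u)) -> submodule U.
move=> sU pU mU; apply: modes_submodule => // a r u Uu.
have hU c : U (hproj c u) by apply: (subZ sU); apply: (subD sU) => //; apply: (subZ sU); apply: pU.
rewrite (hproj_sum u) (linD (@mode_lin _ _ _ _ _ _)); apply: (subD sU).
 by apply: (mU _ _ _ _ (hproj_hmg _ _)).
by apply: (mU _ _ _ _ (hproj_hmg _ _)).
Qed.

(* For m large the Jacobi identity only involves Y(a_(n+i) w1, x) t2, and a_n w1 = 0 for n large. *)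
Let Yt w1 h j : Y w1 h j t2 = 0.
have [ll lr] := (int_linl HY, int_linr HY).
suff sU : submodule [set w1 | forall h j, Y w1 h j t2 = 0].
 by apply: (g1 sU) => h' j'; exact: Y0.
apply: par_stable.
- split=> [h' j'|a u v U1 U2 h' j']; first exact: (lin0 (ll _ _ _)).
 by rewrite (ll _ _ _) U1 U2 scaler0 addr0.
- move=> u Uu h' j'; have e := int_par HY u h' j' t2.
 have : Y (par u) h' j' (par t2) = 0 by apply: (can_inj (@signZ _ q _)); rewrite -e Uu par0 scaler0.
 rewrite h2 (linZ (lr _ _ _)) => e'; apply: (can_inj (@signZ _ b _)); rewrite e' scaler0 //.
- move=> a r c u hu Uu.
 have [N2 z2] := mod_trunc (act_module W2) (gen V a) t2.
 have [N1 z1] := mod_trunc (act_module W1) (gen V a) u.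
 suff H p : forall n : int, (N1%:Z - n <= p%:Z) -> forall h' j', Y (mode W1 a n u) h' j' t2 = 0.
  by apply: (H `|N1%:Z - r|%N); lia.
 elim: p => [|p IH] n np h' j'.
  have -> : n = `|n|%N by lia.
  by rewrite /mode z1 ?(lin0 (ll _ _ _)) //; lia.
 have := int_borcherds HY (h' - N2%:R) j' t2 N2%:Z n 0 (gen_par V a) hu.
 rewrite [RHS]fsum_eq0; last first.
  move=> i; rewrite Uu act0r scaler0 -PoszD z2 ?leq_addr //.
  by rewrite (lin0 (lr _ _ _)) scaler0 subr0 scaler0.
 rewrite -/(fsum _) fsum_head => [|i]; last by rewrite -/(mode _ _ _ _) (IH (n + i.+1%:Z)) ?scaler0 //; lia.
 by rewrite binz0 scale1r !addr0 -pmulrn subrK.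
Qed.

Lemma int_vanish w1 h j w2 : Y w1 h j w2 = 0.
have [ll lr] := (int_linl HY, int_linr HY).
suff sU : submodule [set w2 | forall w1 h j, Y w1 h j w2 = 0].
 by apply: (g2 sU) => w h' j'; exact: Yt.
apply: modes_submodule.
- split=> [w h' j'|a u v U1 U2 w h' j']; first exact: (lin0 (lr _ _ _)).
 by rewrite (lr _ _ _) U1 U2 scaler0 addr0.
- move=> u Uu w h' j'; have e := int_par HY (par w) h' j' u.
 by apply: (can_inj (@signZ _ q _)); rewrite -[in LHS](par_invol w) -e Uu par0 scaler0.
- move=> a r u Uu w h' j'; rewrite (hproj_sum w) (linD (ll _ _ _)).
 suff H c w' : hmg c w' -> Y w' h' j' (mode W2 a r u) = 0 by rewrite !(H _ _ (hproj_hmg _ _)) addr0.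
 move=> hw; have := borcherds_comm (int_borcherds HY h' j') u r 0 (gen_par V a) hw.
 rewrite [LHS]fsum_eq0 => [|i]; last by rewrite Uu scaler0.
 rewrite Uu act0r scaler0 sub0r addr0 => /esym/eqP.
 rewrite oppr_eq0 => /eqP e; apply: (can_inj (@signZ _ (odd11 a && c) _)).
 by rewrite e scaler0.
Qed.

End Intertwiner.

(* If P is obtained from X by modes a_r with r < 0, the lowest weight space of a quotient comes from X. *)
Lemma lowest_span (P Q : vmod V) (X : set P) (f : P -> Q) (U : set Q) h : ehom f ->
 onto f -> gspanned (LL Q 0) -> lowest Q h ->
 (forall p, mspan (mode P) X neg p) -> (forall x, X x -> exists h', geneig h' x) -> subspace U ->
 (forall x, X x -> geneig h x -> U (f x)) -> forall q, geneig h q -> U q.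
move=> hf fs sQ low gX wX sU XU q hq; have lA := @L_lin _ _ V Q 0.
have lc : linear (fun w => gcomp (LL Q 0) w h) by exact: gcomp_linear.
have [p e] := fs q; have -> : q = gcomp (LL Q 0) (f p) h.
 by rewrite e (gcomp_geigen lA sQ h hq) eqxx.
elim: {e} (gX p) => [x Xx||a u v _ IHu _ IHv|a r u ra _ _].
- have [h' hx] := wX _ Xx.
 have fx : geneig h' (f x) by apply: (geigen_map (hom_lin hf)) hx => w; exact: (hom_L0 _ hf).
 rewrite (gcomp_geigen lA sQ h fx); case: eqP => [e|_]; last exact: (sub0 sU).
 by apply: XU; rewrite ?e.
- by rewrite (lin0 (hom_lin hf)) (lin0 lc); exact: (sub0 sU).
- by rewrite (hom_lin hf) lc; apply: (proj2 sU).
- rewrite (hom_mode _ _ _ hf) expr0 scale1r.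
 rewrite (gcomp_shift (d := (- r)%:~R) lA sQ (mode_lin _ _)); last by move=> w; exact: L0_mode.
 have [m rE] : exists m : nat, r = - m.+1%:Z by exists `|r|%N.-1; move: ra; rewrite /neg; lia.
 have -> : gcomp (LL Q 0) (f u) (h - (- r)%:~R) = 0
  by apply: (low m); rewrite rE opprK -pmulrn; exact: gcomp_gen.
 by rewrite mode0; exact: (sub0 sU).
Qed.

Lemma hom_of_vector (W : vmod V) (z : W) : hmg false z -> (forall a (r : nat), mode W a r z = 0) ->
 exists2 f : adjoint V -> W, ehom f & f (vac V) = z.
move=> hz z0; have [f [lf pf fv fm] _] := gen_induced V (mode_action W) hz z0.
exists f; last by [].
apply: mode_hom; first exact: lf.
 by move=> w; rewrite pf scale1r.
by move=> a r w; rewrite scale1r; exact: fm.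
Qed.

Section Tensor.
Variables (T : tensor_data V) (hT : hlz_structure (@KL R k V) T).
Local Notation "A ** B" := (ten T A B) (at level 40, left associativity).
Let hB := hlz_braided hT.
Variables (W1 W2 : vmod V) (K1 : KL W1) (K2 : KL W2).
Let HY := hlz_intertwining hT K1 K2.

Lemma ten_generated (t1 : W1) (t2 : W2) b (U : set (W1 ** W2)) : generates t1 -> generates t2 -> hmg b t2 ->
 submodule U -> (forall h j, U (tY T t1 h j t2)) -> forall u, U u.
move=> g1 g2 h2 sU Ut; apply: (ten_ind hT K1 K2 (submod_sub sU)) => w1 h j w2.
apply/(@quot_map0 _ _ _ _ _ sU).
apply: (int_vanish (Y := fun w1 h j w2 => quot_map sU (tY T w1 h j w2)) (int_comp HY (quot_map_hom sU)) g1 g2 h2) => h' j'.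
exact/quot_map0.
Qed.

Lemma ten_mspan (t1 : W1) (t2 : W2) b (X : set (W1 ** W2)) : generates t1 -> generates t2 -> hmg b t2 ->
 (forall h j, X (tY T t1 h j t2)) -> (forall x, X x -> X (par x)) ->
 (forall a (r : nat) x, X x -> mspan (mode _) X neg (mode _ a r x)) -> forall u, mspan (mode _) X neg u.
move=> g1 g2 h2 Xt Xp Xm; apply: (ten_generated g1 g2 h2); last by move=> h j; exact: mspan_base.
have xM := mode_action (W1 ** W2); apply: modes_submodule.
- exact: mspan_sub.
- by apply: (mspan_par xM) => u Xu; apply: mspan_base; exact: Xp.
- apply: (mspan_stable xM) => a [r|r] u Xu; first exact: Xm.
 by apply: mspan_act; [|exact: mspan_base].
Qed.

Lemma tY_mode0 a b (w1 : W1) h j (w2 : W2) : hmg b w1 -> mode _ a 0 (tY T w1 h j w2) =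
 (-1) ^+ (odd11 a && b) *: tY T w1 h j (mode W2 a 0 w2) + tY T (mode W1 a 0 w1) h j w2.
move=> hb; rewrite /mode (tY_act hT K1 K2 _ _ _ _ (gen_par V a) hb); congr (_ + _).
rewrite fsum_head => [|i]; last by rewrite binz_0 scale0r.
by rewrite binz0 scale1r subr0 addr0.
Qed.

Lemma tY_even0 a (w1 : W1) h j (w2 : W2) : odd11 a = false -> mode _ a 0 (tY T w1 h j w2) =
 tY T w1 h j (mode W2 a 0 w2) + tY T (mode W1 a 0 w1) h j w2.
move=> ea; have [ll lr] := (int_linl HY, int_linr HY).
rewrite {1 2 3}(hproj_sum w1) !(linD (ll _ _ _)) !(linD (mode_lin _ _)).
by rewrite !(tY_mode0 _ _ _ _ (hproj_hmg _ _)) ea !expr0 !scale1r (linD (ll _ _ _)) addrACA.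
Qed.

Lemma ten_E0 e1 e2 : (forall w, mode W1 gE 0 w = e1 *: w) -> (forall w, mode W2 gE 0 w = e2 *: w) ->
 forall u, mode (W1 ** W2) gE 0 u = (e1 + e2) *: u.
move=> E1 E2; apply: (ten_ext hT K1 K2); first exact: mode_lin.
 by move=> a u v; rewrite scalerDr scalerCA.
move=> w1 h j w2; rewrite tY_even0 // E1 E2 (linZ (int_linl HY _ _ _)) (linZ (int_linr HY _ _ _)).
by rewrite -scalerDl addrC.
Qed.

Lemma tY_geneig h1 h2 (w1 : W1) (w2 : W2) h j : L 0 w1 = h1 *: w1 -> L 0 w2 = h2 *: w2 ->
 geneig (h1 + h2 - h - 1) (tY T w1 h j w2).
by move=> e1 e2; apply: (int_geneig hk HY); exists 1%N; rewrite /= ?e1 ?e2 subrr. Qed.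

(* X = B1 (x) B2 for subspaces B1, B2 killed by the positive modes. *)
Section Bottom.
Variables (B1 : set W1) (B2 : set W2).
Hypotheses (p1 : forall w, B1 w -> B1 (par w)) (p2 : forall w, B2 w -> B2 (par w)) (s1 : subspace B1)
 (m1 : forall a w, B1 w -> B1 (mode W1 a 0 w)) (m2 : forall a w, B2 w -> B2 (mode W2 a 0 w))
 (n1 : forall a (r : nat) w, B1 w -> mode W1 a r.+1 w = 0) (n2 : forall a (r : nat) w, B2 w -> mode W2 a r.+1 w = 0).
(** A space of products stable under the zero modes and, up to such products, under the positive
    ones, so that negative modes generate the rest. *)
Definition bottomY : set (W1 ** W2) := [set u | exists w1 w2 h j, [/\ B1 w1, B2 w2 & u = tY T w1 h j w2]].

Lemma bottomY_mspan t1 t2 b : B1 t1 -> B2 t2 -> generates t1 -> generates t2 -> hmg b t2 ->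
 forall u, mspan (mode _) bottomY neg u.
move=> Bt1 Bt2 g1 g2 h2; apply: (ten_mspan g1 g2 h2).
- by move=> h j; exists t1, t2, h, j.
- move=> _ [w1 [w2 [h [j [b1 b2 ->]]]]]; exists (par w1), (par w2), h, j; split; [exact: p1|exact: p2|].
 by rewrite (int_par HY) expr0 scale1r.
- move=> a r _ [w1 [w2 [h [j [b1 b2 ->]]]]].
 have sM := mspan_sub (mode (W1 ** W2)) bottomY neg.
 have [ll lr] := (int_linl HY, int_linr HY).
 have H c w : hmg c w -> B1 w -> mspan (mode _) bottomY neg (mode _ a r (tY T w h j w2)).
  move=> hc bw; rewrite /mode (tY_act hT K1 K2 _ _ _ _ (gen_par V a) hc); apply: (subD sM).
   apply: (subZ sM); case: r => [|r]; last by rewrite -/(mode _ _ _ _) n2 // (lin0 (lr _ _ _)); exact: (sub0 sM).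
   by apply: mspan_base; exists w, (mode W2 a 0 w2), h, j; split=> //; exact: m2.
  rewrite fsum_head => [|i]; last by rewrite -/(mode _ _ _ _) n1 // (lin0 (ll _ _ _)) scaler0.
  apply: (subZ sM); apply: mspan_base; eexists (mode W1 a 0 w), w2, _, j; split=> //.
  exact: m1.
 rewrite (hproj_sum w1) (linD (ll _ _ _)) (linD (mode_lin _ _)).
 have hp c : B1 (hproj c w1) by apply: (subZ s1); apply: (subD s1) => //; apply: (subZ s1); apply: p1.
 by apply: (subD sM); apply: H (hproj_hmg _ _) (hp _).
Qed.

End Bottom.
End Tensor.
End Vanishing.

(** * Highest weight vectors for spectrally flowed triangular decompositions *)

Section Flow.
Context R (k : R[i]) (hk : k != 0) (V : affine_vsa k).

(* s is a highest weight vector for the l-fold spectral flow of the standard triangular decomposition. *)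
Record flow (S : vmod V) (l : int) (s : S) : Prop := { fl_neq0 : s <> 0; fl_hmg : exists b, hmg b s;
 fl_L0 : exists h, L 0 s = h *: s; fl_N : exists n, mode S gN 0 s = n *: s;
 fl_Npos : forall r : nat, mode S gN r.+1 s = 0; fl_Epos : forall r : nat, mode S gE r.+1 s = 0;
 fl_plus : forall r : nat, mode S gPsiP (r%:Z - l) s = 0; fl_minus : forall r : nat, mode S gPsiM (r%:Z + l) s = 0 }.

Section Nonnegative.
Variables (S : vmod V) (e : R[i]).
Hypotheses (KS : KL S) (sS : simple S) (E0 : forall w, mode S gE 0 w = e *: w).

(** One condition short of [flow m]: nothing is said about psi^+_(-m), which decides whether the
    flow can continue. *)
Record preflow (m : nat) (s : S) : Prop := { pf_neq0 : s <> 0; pf_hmg : exists b, hmg b s;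
 pf_L0 : exists h, L 0 s = h *: s; pf_N : exists n, mode S gN 0 s = n *: s;
 pf_Npos : forall r : nat, mode S gN r.+1 s = 0; pf_Epos : forall r : nat, mode S gE r.+1 s = 0;
 pf_plus : forall r : nat, mode S gPsiP (r.+1%:Z - m%:Z) s = 0;
 pf_minus : forall r : nat, mode S gPsiM (r%:Z + m%:Z) s = 0 }.

Let psi_swap r (s : int) w : mode S gPsiM r (mode S gPsiP s w) =
 - mode S gPsiP s (mode S gPsiM r w) + mode S gE (r + s) w - (if r + s == 0 then r%:~R * k else 0) *: w.
rewrite mode_swap /= scaleN1r; congr (_ + _); case: ifP => _; last by rewrite scale0r oppr0.
by rewrite -scaleNr; congr (_ *: _); ring.
Qed.

Let raise_ (m : nat) (s : S) :
 (exists b, hmg b s) -> (exists h, L 0 s = h *: s) -> (exists n, mode S gN 0 s = n *: s) ->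
 let u := mode S gPsiP (- m%:Z) s in
 [/\ exists b, hmg b u, exists h, L 0 u = h *: u & exists n, mode S gN 0 u = n *: u].
move=> [b hb] [h hh] [n hn] u; split.
- by exists (true (+) b); apply: act_hmg hb; exact: (gen_par V gPsiP).
- by exists (h + (- - m%:Z)%:~R); rewrite /u (L0_mode hk) hh (linZ (mode_lin _ _)) -scalerDl.
- by eexists; rewrite /u N_mode hn (linZ (mode_lin _ _)) -scalerDl.
Qed.

Let plus_step m s : preflow m s -> (forall r : nat, mode S gN r.+1 (mode S gPsiP (- m%:Z) s) = 0) /\
 (forall r : nat, mode S gPsiP (r%:Z - m%:Z) (mode S gPsiP (- m%:Z) s) = 0).
move=> F; have lm a r : linear (mode S a r) by exact: mode_lin.
split=> r.
- rewrite mode_swap /= (pf_Npos F) mode0 scaler0 add0r (pf_plus F r) add0r mulr0 mul0r.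
 by rewrite if_same scale0r.
- rewrite mode_swap /= mulr0 mul0r if_same scale0r !addr0; case: r => [|r]; last by rewrite (pf_plus F) mode0 scaler0.
 by rewrite sub0r sq_zero // scaler0.
Qed.

(** psi^-_m psi^+_(-m) s = (e - m k) s, so as long as e differs from m k the vector psi^+_(-m) s is
    nonzero and lies one flow further. *)
Lemma preflow_exists m : (forall j : nat, (j < m)%N -> e != j%:R * k) -> exists s, preflow m s.
have lm a r : linear (mode S a r) by exact: mode_lin.
elim: m => [_|m IH em].
 have [h [n [a [t [t0 ha gt nt [pos ps]]]]]] := extremal_exists hk (c := gPsiM) KS sS erefl.
 exists t; split=> //; [by exists a| |by exists n|by move=> r; rewrite subr0|by case=> [|r]; rewrite addr0].
 eexists; rewrite (L0_casimir hk pos) ps mode0 subr0 !E0 (linZ (lm _ _)) !nt.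
 rewrite (_ : mode S gPsiM 0 (mode S gPsiP 0 t) = e *: t); last by rewrite psi_swap ps mode0 oppr0 add0r E0 addr0 eqxx mul0r scale0r subr0.
 by rewrite -!scalerDl ?scalerA -!scalerDl ?scalerA -?scalerDl.
have [j jm|s F] := IH _; first by apply: em; exact: ltnW.
have [h1 h2 h3] := raise_ m (pf_hmg F) (pf_L0 F) (pf_N F); have [n1 n2] := plus_step F.
exists (mode S gPsiP (- m%:Z) s); split=> //.
- move=> u0; have := psi_swap m%:Z (- m%:Z) s; rewrite u0 mode0 subrr eqxx E0.
 have := pf_minus F 0; rewrite add0r => ->; rewrite mode0 oppr0 add0r -scalerBl => /esym/eqP.
 rewrite scaler_eq0 subr_eq0 (negPf (em m _)) //= => /eqP; exact: (pf_neq0 F).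
- by move=> r; rewrite mode_swap /= (pf_Epos F) mode0 scaler0 !add0r mulr0 mul0r if_same scale0r.
- by move=> r; rewrite (_ : _ - _ = r%:Z - m%:Z) //; lia.
- move=> r; rewrite psi_swap; have := pf_minus F r.+1; rewrite (_ : r.+1%:Z + m%:Z = r%:Z + m.+1%:Z); last by lia.
 move=> ->; rewrite mode0 oppr0 add0r (_ : _ - m%:Z = r.+1%:Z); last by lia.
 by rewrite (pf_Epos F) scale0r subr0.
Qed.

(** At e = l k the vector u = psi^+_(-l) s is singular. If it were nonzero it would generate S by
    modes of positive degree; s has the same degree as u, hence would be a multiple of it, but the
    N_0-eigenvalues differ. *)
Lemma flow_nonneg (l : nat) : e = l%:R * k -> exists s : S, flow l%:Z s.
move=> el; have lm a r : linear (mode S a r) by exact: mode_lin.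
have [j jl|s F] := preflow_exists (m := l) _.
 by rewrite el -subr_eq0 -mulrBl mulf_eq0 negb_or hk andbT subr_eq0 eqr_nat gtn_eqF.
exists s; split; try exact F.
- exact: (pf_neq0 F).
- exact: (pf_hmg F).
- exact: (pf_L0 F).
- exact: (pf_N F).
- exact: (pf_Npos F).
- exact: (pf_Epos F).
- case=> [|r]; last exact: (pf_plus F).
 rewrite sub0r; apply: contrapT => u0; set u := mode _ _ _ _ in u0.
 have [[b hb] [h hh] [n hn]] := raise_ l (pf_hmg F) (pf_L0 F) (pf_N F); have [n1 n2] := plus_step F.
 pose raise a (r : int) := 0 < - r - l%:Z * wt11 a.
 have gen : forall w, mspan (mode S) [set u] raise w.
  apply: (simple_generated sS u0 hb) => a r nr.
  have rE : r = (`|(r + l%:Z * wt11 a)%R|%N)%:Z - l%:Z * wt11 a by move: nr; rewrite /raise; lia.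
  move: (`|_|%N) rE => p ->; case: a {nr} => /=; rewrite ?mulr0 ?subr0 ?mulr1 ?mulrN1 ?opprK.
  + case: p => [|p]; first by exists n.
   by exists 0; rewrite scale0r n1.
  + case: p => [|p]; first by exists e.
   by exists 0; rewrite mode_swap /= (pf_Epos F) mode0 scaler0 !add0r mulr0 mul0r if_same !scale0r.
  + by exists 0; rewrite scale0r n2.
  + exists 0; rewrite scale0r psi_swap (pf_minus F) mode0 oppr0 add0r addrK; case: p => [|p].
    by rewrite E0 eqxx -scalerBl -pmulrn -el subrr scale0r.
   by rewrite (pf_Epos F) scale0r subr0.
 (* In the grading by L_0 - l N_0 the mode psi^+_(-l) has degree 0. *)
 pose A w := L 0 w - l%:R *: mode S gN 0 w - (h - l%:R * n) *: w.
 have lA : linear A.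
  move=> c x y; rewrite /A (L_lin _ _) (lm _ _); lmod_ring.
 have Au : A u = 0 by rewrite /A hh hn; lmod_ring.
 pose d a (r : int) := `|(- r - l%:Z * wt11 a)%R|%N.
 have Am a r w : raise a r -> A (mode S a r w) = mode S a r (A w) + (d a r)%:R *: mode S a r w.
  move=> ra; rewrite /A (L0_mode hk) N_mode !(linB (lm _ _)) !(linZ (lm _ _)).
  have -> : (d a r)%:R = (- r)%:~R - l%:R * (wt11 a)%:~R :> R[i].
   rewrite pmulrn /d gez0_abs; last exact: ltW.
   by rewrite intrB intrM.
  lmod_ring.
 have dp a r : raise a r -> (0 < d a r)%N by rewrite /raise /d; lia.
 have [eps [_ _ _ line _]] := tri_functional lA Au Am gen dp u0.
 have [h' hs] := pf_L0 F; have [n' ns] := pf_N F.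
 have nn : n = n' + 1.
  have := hn; rewrite N_mode ns (linZ (lm _ _)) -scalerDl => /eqP.
  by rewrite -subr_eq0 -scalerBl scaler_eq0 => /orP [/eqP e0|/eqP //]; apply/esym/eqP; rewrite -subr_eq0 -e0.
 have hh' : h = h' + l%:R.
  have := hh; rewrite (L0_mode hk) hs opprK (linZ (lm _ _)) -scalerDl => /eqP.
  by rewrite -subr_eq0 -scalerBl scaler_eq0 => /orP [/eqP e0|/eqP //]; apply/esym/eqP; rewrite -subr_eq0 -e0.
 have As : A s = 0 by rewrite /A hs ns nn hh'; lmod_ring.
 have := line _ As; move=> es; have := ns; rewrite es (linZ (lm _ _)) hn -es scalerA mulrC -scalerA -es.
 rewrite nn => /eqP; rewrite -subr_eq0 -scalerBl scaler_eq0 addrAC subrr add0r oner_eq0 /= => /eqP.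
 exact: (pf_neq0 F).
- exact: (pf_minus F).
Qed.

End Nonnegative.

Lemma flow_exists (S : vmod V) e (l : int) : KL S -> simple S -> (forall w, mode S gE 0 w = e *: w) -> e = l%:~R * k ->
 exists s : S, flow l s.
move=> KS sS E0 el; case: (lerP 0 l) => l0.
 have [|s F] := flow_nonneg (l := `|l|%N) KS sS E0; first by rewrite el -[l in LHS]gez0_abs.
 by exists s; move: F; rewrite gez0_abs.
(* For negative l the twist changes the sign of e and exchanges psi^+ with psi^-. *)
have E0' w : mode (tau_vmod S) gE 0 w = (- e) *: w by rewrite tau_mode E0 /= scaleN1r scaleNr.
have [|s F] := flow_nonneg (l := `|l|%N) (tau_KL KS) (tau_simple sS) E0'.
 by rewrite pmulrn ltz0_abs // el; rewrite mulrNz mulNr.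
have lE : `|l|%N%:Z = - l by lia.
exists s; split; first exact: (fl_neq0 F).
- exact: (fl_hmg F).
- have [h hs] := fl_L0 F; exists h; rewrite -hs tau_L //.
- have [n ns] := fl_N F; exists (- n); have := ns; rewrite tau_mode /= scaleN1r scaleNr => <-; rewrite opprK //.
- move=> r; have := fl_Npos F r; rewrite tau_mode /= scaleN1r => /eqP; rewrite oppr_eq0 => /eqP //.
- move=> r; have := fl_Epos F r; rewrite tau_mode /= scaleN1r => /eqP; rewrite oppr_eq0 => /eqP //.
- move=> r; have := fl_minus F r; rewrite tau_mode lE /= scaleN1r => /eqP; rewrite oppr_eq0 => /eqP //.
- move=> r; have := fl_plus F r; rewrite tau_mode lE opprK /= scale1r //.
Qed.

End Flow.

(** * Duals of simple modules, atypical and typical *)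

Section SimpleDuals.
Context R (k : R[i]) (hk : k != 0) (V : affine_vsa k).
Variables (T : tensor_data V) (hT : hlz_structure (@KL R k V) T) (v0 : (vac V : adjoint V) <> 0).
Local Notation KLV := (@KL R k V).
Local Notation "A ** B" := (ten T A B) (at level 40, left associativity).
Let hB := hlz_braided hT.
Local Notation te := (te hB).
Local Notation un := (un hB).
Local Notation tm := (tm hB).
Local Notation idm := (@idm _ _ _ KLV).
Local Notation as_ := (as_ hB).
Local Notation eqtm f f' g g' := (@eq_tm _ _ _ _ _ hB _ _ _ _ f f' g g').
Local Notation asi := (asi hB).
Local Notation br := (br hB).
Let KV : KLV (adjoint V) := bt_unit hB.

Lemma geneig_uniq (W : vmod V) h h' (w : W) : geneig h w -> geneig h' w -> h != h' -> w = 0.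
move=> g [n e] ne; have lA := @L_lin _ _ V W 0; apply: (geigen_iter_mod lA (n := n) (@subspace0 _ _) _ ne g); last exact: e.
by move=> u ->; exact: (lin0 lA).
Qed.

Variables (S : vmod V) (t : S) (b : bool) (n e : R[i]).
Hypothesis H : highest t b n e.
Let KS : KLV S := hw_KL H.
Let sS : simple S := hw_simple H.
Let M := tau_vmod S.
Let KM : KLV M := tau_KL KS.
Let sM : simple M := tau_simple sS.
Let oS : obj KLV := Obj KS.
Let oM : obj KLV := Obj KM.
Let h0 := high_weight k n e.
Let P := S ** M.
Let KP : KLV P := bt_ten hB KS KM.
Let lm (W : vmod V) a r : linear (mode W a r). exact: mode_lin. Qed.

Section Evaluation.
Variable ev : mor (te oM oS) un.
Hypothesis ev0 : exists u, ev u <> 0.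
Definition tail : mor (te (te oS oM) oS) (te oS un) := cm (tm (idm oS) ev) (asi oS oM oS).

(* By Schur both zigzags are scalars; the second is 1 once the first is, since ev <> 0. *)
Lemma dual_of_nonzero (i : mor un (te oS oM)) : (exists u, tail (tm i (idm oS) u) <> 0) ->
 exists i', dual (hB := hB) ev i'.
case=> u0 u0P; have [a aE] := schur KS sS (mP (zig1 (hB := hB) ev i)).
have a0 : a != 0.
 apply/eqP => a0; case: u0P.
 have := aE (lu hB oS u0); rewrite a0 scale0r -[mf _ _]/(zig1 ev i _) zig1E luK => e0.
 by rewrite /tail cmE -[LHS](@ruK _ _ _ _ _ hB oS) e0 (lin0 (mor_lin _)).
pose i' : mor un (te oS oM) := cb a^-1 i (zm _ _).
have z1 w : zig1 (hB := hB) ev i' w = w.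
 rewrite zig1E tm_cbl tm_zml addr0 !(linZ (mor_lin _)) -zig1E; have := aE w; rewrite -[mf _ _]/(zig1 ev i _) => ->.
 by rewrite scalerA mulVf // scale1r.
exists i'; split=> // x; have [c cE] := schur KM sM (mP (zig2 (hB := hB) ev i')).
suff c1 : c = 1 by have := cE x; rewrite c1 scale1r.
have [u uP] := ev0; have := e_zig (hB := hB) ev i' u; rewrite [in RHS]tm_id //.
rewrite (eqtm _ (cb c (idm oM) (zm _ _)) (idm oS) (idm oS)) //; last by move=> y; rewrite cbE zmE addr0; exact: cE.
rewrite tm_cbl tm_zml addr0 tm_id // (linZ (mor_lin _)) => /eqP; rewrite -subr_eq0 -{2}[mf ev u]scale1r -scalerBl.
by rewrite scaler_eq0 subr_eq0 => /orP [/eqP //|/eqP].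
Qed.

Lemma ev_surj : surj ev.
move=> y; case: (proj2 (V_simple hk KV v0) _ (submod_image (mP ev) (submoduleT _))) => eq.
 by have [u uP] := ev0; have : (mf ev @` setT) (ev u) by [exists u]; rewrite eq => /uP.
have : (mf ev @` setT) y by rewrite eq.
by case=> u _ <-; exists u.
Qed.

Lemma tail_surj : surj tail.
move=> y; have [x xe] := tm_surj (f := idm oS) (g := ev) hT (fun _ => id) (fun w => ex_intro _ w erefl) ev_surj y.
by exists (as_ oS oM oS x); rewrite /tail cmE asK.
Qed.

Lemma dual_of_surj (i : mor un (te oS oM)) : surj i -> exists i', dual (hB := hB) ev i'.
move=> si; apply: (@dual_of_nonzero i).
have [y ye] := tail_surj (rui hB oS (t : oS)).
have [u ue] := tm_surj (f := i) (g := idm oS) hT (fun _ => id) si (fun w => ex_intro _ w erefl) y.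
exists u; rewrite ue ye => z; apply: (hw_t H).
by rewrite -[t](@ruiK _ _ _ _ _ hB oS) z (lin0 (mor_lin _)).
Qed.

End Evaluation.
Let mM a r (w : S) : mode M a r w = tau_sign _ a *: mode S (tau_gen a) r w.
exact: tau_mode. Qed.

Lemma pair_E0 (u : P) : mode P gE 0 u = 0.
rewrite (ten_E0 hT KS KM (e1 := e) (e2 := - e)) ?subrr ?scale0r //; first exact: (hw_E H).
by move=> w; rewrite mM /= (hw_E H) scaleN1r scaleNr.
Qed.

Lemma pair_lowest : lowest P 0.
move=> m w hw; apply: contrapT => w0.
have [j] := E0_weights hk KP pair_E0 hw w0; rewrite sub0r => /eqP; rewrite eq_sym -subr_eq0 opprK -natrD.
by rewrite pnatr_eq0 addnS.
Qed.

Let HY := hlz_intertwining hT KS KM.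

(* L_0 maps the coefficient of (log x)^j in weight 0 to j+1 times the next one. *)
Let y_log (hs : R[i]) (s s' : S) j : L 0 s = hs *: s -> L 0 s' = hs *: s' ->
 L 0 (tY T s (hs + hs - 1) j (s' : M)) = j.+1%:R *: tY T s (hs + hs - 1) j.+1 (s' : M).
move=> e1 e2; have e2' : L 0 (s' : M) = hs *: (s' : M) by rewrite tau_L.
rewrite (int_L0_comm HY) e1 e2' (linZ (int_linl HY _ _ _)) (linZ (int_linr HY _ _ _)).
by rewrite -[RHS]add0r -!scalerDl; congr (_ + _); rewrite (_ : _ + _ = 0) ?scale0r //; ring.
Qed.

Let y_geneig (hs : R[i]) (s s' : S) h j : L 0 s = hs *: s -> L 0 s' = hs *: s' ->
 geneig (hs + hs - h - 1) (tY T s h j (s' : M)).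
by move=> e1 e2; apply: (tY_geneig hk hT KS KM) => //; rewrite tau_L. Qed.
Let y_zero (hs : R[i]) (s s' : S) h j : L 0 s = hs *: s -> L 0 s' = hs *: s' ->
 geneig 0 (tY T s h j (s' : M)) -> h = hs + hs - 1 \/ tY T s h j (s' : M) = 0.
move=> e1 e2 g0; case: (eqVneq (hs + hs - h - 1) 0) => [e0|ne]; last by right; apply: (geneig_uniq (y_geneig _ _ e1 e2) g0).
by left; rewrite -[h]add0r -e0; ring.
Qed.

Section Atypical.
Variables (l : int) (s : S).
Hypothesis F : flow l s.
(** In the Jacobi identity with exponents r - n0 and n0 all terms with a acting on a factor vanish;
    what is left expresses a_r through modes of smaller index on other coefficients. *)
Let flow_step a (n0 : int) (r : nat) h j (U : set P) : subspace U ->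
 (forall i : nat, mode S a (n0 + i%:Z) s = 0) -> (forall i : nat, mode M a (i%:Z - n0) s = 0) ->
 (forall i : nat, U (mode P a (r%:Z - i.+1%:Z) (tY T s (h + i.+1%:R) j (s : M)))) ->
 U (mode P a r (tY T s h j (s : M))).
move=> sU k1 k2 Ui; have [c hc] := fl_hmg F; have [ll lr] := (int_linl HY, int_linr HY).
have := int_borcherds HY h j (s : M) (r%:Z - n0) n0 0 (gen_par V a) hc.
rewrite [LHS]fsum_eq0 => [|i]; last by rewrite -/(mode _ _ _ _) k1 (lin0 (ll _ _ _)) scaler0.
set f := fun i : nat => _; set f' := fun i : nat => mode P a (r%:Z - i%:Z) (tY T s (h + i%:R) j (s : M)).
have fE i : f i = ((-1) ^+ i * Defs.binz R n0 i) *: f' i.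
 rewrite /f -[act (gen V a) (r%:Z - n0 + i%:Z) _]/(mode M a (r%:Z - n0 + i%:Z) s) (_ : r%:Z - n0 + i%:Z = (r + i)%N%:Z - n0); last by rewrite PoszD; ring.
 by rewrite k2 (lin0 (lr _ _ _)) scaler0 subr0 scale1r subrK add0r -pmulrn.
have ff' : fin1 f'.
 have [N hN] := int_fin HY s (s : M) h j; exists N => i Ni; rewrite /f' hN // mode0 //.
have ff : fin1 f by have [N hN] := ff'; exists N => i Ni; rewrite fE hN // scaler0.
pose g i := if i is 0%N then 0 else - f i.
have fg : fin1 g by have [N hN] := ff; exists N => -[|i] Ni //=; rewrite hN // oppr0.
move=> sf; have -> : mode P a r (tY T s h j (s : M)) = fsum g.
 rewrite -[RHS]add0r [X in X + _]sf -[\sum_(_ \in _) _]/(fsum f) -fsumD // fsum_head => [|i]; last exact: subrr.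
 by rewrite fE /g /f' binz0 expr0 mulr1 scale1r !addr0 ?subr0.
apply: (sub_fsum sU) => -[|i] /=; first exact: (sub0 sU).
by apply: (subN sU); rewrite fE; apply: (subZ sU); exact: Ui.
Qed.

Let X : set P := [set u | exists h j, u = tY T s h j (s : M)].
Let plusP (i : nat) : mode S gPsiP (- l + i%:Z) s = 0. by rewrite addrC; exact: (fl_plus F). Qed.
Let plusM (i : nat) : mode M gPsiP (i%:Z - - l) s = 0.
by rewrite mM opprK /= (fl_minus F) scaler0. Qed.
Let minusP (i : nat) : mode S gPsiM (l + i%:Z) s = 0. by rewrite addrC; exact: (fl_minus F). Qed.
Let minusM (i : nat) : mode M gPsiM (i%:Z - l) s = 0.
by rewrite mM /= (fl_plus F) scaler0. Qed.
Let par_y h j : par (tY T s h j (s : M)) = tY T s h j (s : M).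
have [c hc] := fl_hmg F; rewrite (int_par HY) expr0 scale1r.
by rewrite hc (linZ (int_linl HY _ _ _)) (linZ (int_linr HY _ _ _)) signZ.
Qed.

Let gens (p : P) : mspan (mode P) X neg p.
have [c hc] := fl_hmg F; have [ll lr] := (int_linl HY, int_linr HY).
have sX := mspan_sub (mode P) X neg.
have Xy h j : X (tY T s h j (s : M)) by exists h, j.
refine (ten_mspan hk hT KS KM (t1 := s) (t2 := s : M) (b := c) (simple_generates sS (fl_neq0 F)) (@simple_generates _ _ _ M s sM (fl_neq0 F)) hc Xy _ _ p).
 by move=> _ [h [j ->]]; rewrite par_y.
move=> a r _ [h [j ->]].
have odd a' n0 : (forall i : nat, mode S a' (n0 + i%:Z) s = 0) -> (forall i : nat, mode M a' (i%:Z - n0) s = 0) ->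
  mspan (mode P) X neg (mode P a' r (tY T s h j (s : M))).
 move=> k1 k2; elim/ltn_ind: r h => r IH h; apply: (flow_step sX k1 k2) => i.
 case: (ltnP i r) => ir; last by apply: mspan_act; [rewrite /neg; lia|exact: mspan_base].
 by rewrite (_ : r%:Z - i.+1%:Z = (r - i.+1)%N%:Z); [apply: IH; lia|lia].
have even a' x : odd11 a' = false -> tau_gen a' = a' -> mode S a' 0 s = x *: s ->
  (forall r : nat, mode S a' r.+1 s = 0) -> mspan (mode P) X neg (mode P a' r (tY T s h j (s : M))).
 move=> oa ta e0 ep; rewrite /mode (tY_act hT KS KM _ _ _ _ (gen_par V a') hc) fsum_head => [|i]; last by rewrite -/(mode _ _ _ _) ep (lin0 (ll _ _ _)) scaler0.
 rewrite -/(mode S a' 0 s) e0 (linZ (ll _ _ _)); apply: (subD sX); apply: (subZ sX); last by apply: (subZ sX); exact: mspan_base.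
 rewrite -/(mode M a' r s) mM ta (linZ (lr _ _ _)); apply: (subZ sX).
 case: (r) => [|r']; first by rewrite e0 (linZ (lr _ _ _)); apply: (subZ sX); exact: mspan_base.
 by rewrite ep (lin0 (lr _ _ _)); exact: (sub0 sX).
case: a.
- by have [x xs] := fl_N F; exact: (even _ _ _ _ xs (fl_Npos F)).
- by apply: (even _ _ _ _ (hw_E H s) (fl_Epos F)).
- exact: odd plusP plusM.
- exact: odd minusP minusM.
Qed.

(** The weight 0 coefficient z is killed by all nonnegative modes and so defines a map from V. As
    L_0 z = 0, the coefficients with logarithms vanish; hence weight 0 lies in the image, and it
    generates S (x) S'. *)
Lemma atypical_surj : exists i : mor un (te oS oM), surj i.
have [hs sE] := fl_L0 F; pose z : P := tY T s (hs + hs - 1) 0 (s : M).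
have [ll lr] := (int_linl HY, int_linr HY).
have zg : geneig 0 z by have := y_geneig (hs + hs - 1) 0 sE sE; rewrite (_ : _ - 1 = 0) //; ring.
have y0 a (i r : nat) : mode P a (r%:Z - i.+1%:Z) (tY T s (hs + hs - 1 + i.+1%:R) 0 (s : M)) = 0.
 rewrite (_ : tY T _ _ _ _ = 0) ?mode0 //; apply: (pair_lowest (m := i)).
 by have := y_geneig (hs + hs - 1 + i.+1%:R) 0 sE sE; rewrite (_ : _ - 1 = 0 - i.+1%:R) //; ring.
have zk a (r : nat) : mode P a r z = 0.
 case: r => [|r]; last exact: (lowest_kill hk pair_lowest zg).
 case: a.
 - have [x xs] := fl_N F; rewrite (tY_even0 hT KS KM) // mM /= xs scaleN1r (linN (lr _ _ _)) (linZ (lr _ _ _)) (linZ (ll _ _ _)).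
  by rewrite addNr.
 - exact: pair_E0.
 - by apply: (flow_step (@subspace0 _ _) plusP plusM) => i; exact: y0.
 - by apply: (flow_step (@subspace0 _ _) minusP minusM) => i; exact: y0.
have zh : hmg false z by rewrite /hmg par_y scale1r.
have [f hf fz] := hom_of_vector zh zk.
exists (@Mor _ _ _ _ un (te oS oM) f hf) => p /=.
pose U := f @` setT; have sU : submodule U := submod_image hf (submoduleT _).
have zU : U z by exists (vac V : adjoint V).
have L0z : L 0 z = 0 by have [-> _] := E0_lowest hk pair_E0 pair_lowest zg; rewrite zk mode0 scaler0.
have yj j : U (tY T s (hs + hs - 1) j (s : M)).
 have sU' := submod_sub sU.
 case: j => [//|j]; have -> : tY T s (hs + hs - 1) j.+1 (s : M) = 0; last exact: (sub0 sU').
 elim: j => [|j IH]; have := y_log _ sE sE; [move=> /(_ 0%N)|move=> /(_ j.+1)]; rewrite ?L0z ?IH ?(lin0 (@L_lin _ _ V P 0)).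
  by rewrite scale1r => <-.
 by move=> /esym/eqP; rewrite scaler_eq0 pnatr_eq0 /= => /eqP.
have : U p.
 apply: (E0_generated hk KP pair_E0 sU) => w.
 apply: (lowest_span hk (X := X) (hom_id P) _ (KL_span KP) pair_lowest gens _ (submod_sub sU)).
 - by move=> q; exists q.
 - by move=> _ [h [j ->]]; eexists; exact: (y_geneig _ _ sE sE).
 - move=> _ [h [j ->]] g0; case: (y_zero sE sE g0) => [->|->]; first exact: yj.
  exact: (sub0 (submod_sub sU)).
by case=> v _ <-; exists v.
Qed.

End Atypical.
Let t' : S := mode S gPsiM 0 t.
(** The gl(1|1)-submodule generated by t. Products of its elements generate tensor products with S
    by negative modes ([bottomY_mspan]). *)
Definition bot : set S := [set w | exists x y, w = x *: t + y *: t'].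
Let bot_t : bot t. by exists 1, 0; rewrite scale1r scale0r addr0. Qed.
Let bot_t' : bot t'. by exists 0, 1; rewrite scale1r scale0r add0r. Qed.
Let bot_subspace : subspace bot.
split=> [|c u v [x [y ->]] [x' [y' ->]]]; first by exists 0, 0; rewrite !scale0r addr0.
by exists (c * x + x'), (c * y + y'); lmod_ring.
Qed.

Let bot_sub (U : set S) w : subspace U -> U t -> U t' -> bot w -> U w.
by move=> sU Ut Ut' [x [y ->]]; apply: (subD sU); exact: (subZ sU). Qed.
Let bot_bil (W : lmodType R[i]) (B : S -> S -> W) (U : set W) w w' : subspace U -> (forall w, linear (B^~ w)) ->
 (forall w, linear (B w)) -> U (B t t) -> U (B t t') -> U (B t' t) -> U (B t' t') -> bot w -> bot w' -> U (B w w').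
move=> sU l1 l2 u1 u2 u3 u4 bw bw'; apply: (bot_sub (U := [set w | U (B w w')]) _ _ _ bw); rewrite /mkset.
- by split=> [|a x y Ux Uy]; rewrite /mkset ?(lin0 (l1 _)) ?(l1 w'); [exact: (sub0 sU)|exact: (proj2 sU)].
- apply: (bot_sub (U := [set w' | U (B t w')]) _ u1 u2 bw').
 by split=> [|a x y Ux Uy]; rewrite /mkset ?(lin0 (l2 _)) ?(l2 t); [exact: (sub0 sU)|exact: (proj2 sU)].
- apply: (bot_sub (U := [set w' | U (B t' w')]) _ u3 u4 bw').
 by split=> [|a x y Ux Uy]; rewrite /mkset ?(lin0 (l2 _)) ?(l2 t'); [exact: (sub0 sU)|exact: (proj2 sU)].
Qed.

Let t'_N : mode S gN 0 t' = (n - 1) *: t'.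
by rewrite N_mode (hw_N H) (linZ (lm _ _)) -scalerDl mulrN1z. Qed.
Let t'_P : mode S gPsiP 0 t' = e *: t.
by rewrite zero_swap (hw_psi H) mode0 scaler0 add0r /= (hw_E H). Qed.
Let t'_M : mode S gPsiM 0 t' = 0. exact: sq_zero. Qed.
Let t'_hmg : hmg (true (+) b) t'. by apply: act_hmg (hw_par H); exact: (gen_par V gPsiM). Qed.
Let mode_sub a r (U : set S) : subspace U -> subspace [set w | U (mode S a r w)].
move=> sU; split=> [|x u v Uu Uv]; rewrite /mkset ?mode0 ?(lm a r); first exact: (sub0 sU).
exact: (proj2 sU).
Qed.

Let bot_mode a w : bot w -> bot (mode S a 0 w).
have Z x u : bot u -> bot (x *: u) by exact: (subZ bot_subspace).
have z : bot 0 by exact: (sub0 bot_subspace).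
apply: (bot_sub (mode_sub a 0 bot_subspace)); rewrite /mkset.
- case: a; rewrite ?(hw_N H) ?(hw_E H) ?(hw_psi H) //; exact: Z.
- case: a; rewrite ?t'_N ?t'_P ?t'_M ?(hw_E H) //; exact: Z.
Qed.

Let bot_kill a (r : nat) w : bot w -> mode S a r.+1 w = 0.
apply: (bot_sub (mode_sub a r.+1 (@subspace0 _ _))); first exact: (hw_pos H).
rewrite /mkset /t' mode_swap (hw_pos H) mode0 scaler0 add0r !addr0 scale0r addr0.
by case: a => /=; rewrite ?(hw_pos H) ?oppr0.
Qed.

Let bot_L0 w : bot w -> L 0 w = h0 *: w.
have lL := @L_lin _ _ V S 0.
have sU : subspace [set w : S | L 0 w = h0 *: w].
 split=> [|a u v Uu Uv]; rewrite /mkset ?(lin0 lL) ?scaler0 //.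
 by rewrite lL Uu Uv scalerDr scalerCA.
apply: (bot_sub sU); first exact: (hw_L0 hk H).
by rewrite /mkset /t' (L0_mode hk) (hw_L0 hk H) (linZ (lm _ _)) oppr0 scale0r addr0.
Qed.

Let bot_par w : bot w -> bot (par w).
have sU : subspace [set w | bot (par w)].
 split=> [|a u v Uu Uv]; rewrite /mkset ?par0 ?par_linear; first exact: (sub0 bot_subspace).
 exact: (proj2 bot_subspace).
by apply: (bot_sub sU); rewrite /mkset ?(hw_par H) ?t'_hmg; exact: (subZ bot_subspace).
Qed.

Let bot_modeM a w : bot w -> bot (mode M a 0 w).
by move=> bw; rewrite mM; apply: (subZ bot_subspace); exact: bot_mode. Qed.
Let bot_killM a (r : nat) w : bot w -> mode M a r.+1 w = 0.
by move=> bw; rewrite mM bot_kill // scaler0. Qed.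
Let genS := simple_generates sS (hw_t H).
Let genM : generates (t : M) := @simple_generates _ _ _ M t sM (hw_t H).

Section Typical.
Hypothesis typ : forall m : int, e <> m%:~R * k.
Let X : set P := bottomY (T := T) (W1 := S) (W2 := M) bot bot.
Let gensX (p : P) : mspan (mode P) X neg p.
exact: (bottomY_mspan hk hT KS KM (B1 := bot) (B2 := bot) bot_par bot_par bot_subspace bot_mode bot_modeM
 bot_kill bot_killM bot_t bot_t genS genM (hw_par H) p).
Qed.

(* z spans the image of L_0 on the weight zero space of S (x) M, and theta - 1 is a multiple of L_0 there. *)
Lemma theta_image : exists i : mor un (te oS oM), forall p : P, exists v, i v = theta p - p.
have [ll lr] := (int_linl HY, int_linr HY).
pose y j (w w' : S) : P := tY T w (h0 + h0 - 1) j (w' : M).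
have lyl j w' : linear (y j ^~ w') by exact: ll.
have lyr j w : linear (y j w) by exact: lr.
have yg j w w' : bot w -> bot w' -> geneig 0 (y j w w').
 move=> bw bw'; have := y_geneig (h0 + h0 - 1) j (bot_L0 bw) (bot_L0 bw'); rewrite (_ : _ - 1 = 0) //; ring.
have ty := hw_par H.
(* The product of t and t' has N_0 = 1 and is killed by psi^+_0, so applying psi^-_0 gives a vector
   that all zero modes kill. *)
pose z : P := mode P gPsiM 0 (y 0%N t t').
have zg : geneig 0 z by apply: (mode_zero_geneig hk); exact: yg.
have P1 : mode P gPsiP 0 (y 0%N t t') = 0
 by rewrite (tY_mode0 hT KS KM _ _ _ _ ty) mM /= t'_M scaler0 (lin0 (lr _ _ _)) scaler0 add0r (hw_psi H) (lin0 (ll _ _ _)).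
have N1 : mode P gN 0 (y 0%N t t') = y 0%N t t'.
 rewrite (tY_even0 hT KS KM) // mM /= t'_N (hw_N H) !(linZ (lr _ _ _)) (linZ (ll _ _ _)) scalerA -scalerDl.
 by rewrite (_ : _ + n = 1) ?scale1r //; ring.
have zk a (r : nat) : mode P a r z = 0.
 case: r => [|r]; last exact: (lowest_kill hk pair_lowest zg).
 case: a.
 - by rewrite /z N_mode N1 mulrN1z scaleN1r subrr.
 - exact: pair_E0.
 - by rewrite /z zero_swap P1 mode0 scaler0 add0r /= pair_E0.
 - exact: sq_zero.
have zh : hmg false z.
 apply: (act_hmg (a := true) (b := true)); first exact: (gen_par V gPsiM).
 rewrite /hmg (int_par HY) expr0 scale1r ty.
 have -> : par (t' : M) = (-1) ^+ (true (+) b) *: t' by exact: t'_hmg.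
 rewrite (linZ (ll _ _ _)) (linZ (lr _ _ _)) scalerA -signr_addb; congr (_ ^+ _ *: _); by case: (b).
have [f hf fz] := hom_of_vector zh zk.
exists (@Mor _ _ _ _ un (te oS oM) f hf) => p.
pose U := f @` setT; have sU : submodule U := submod_image hf (submoduleT _).
have sU' := submod_sub sU.
have zU x : U (x *: z) by apply: (subZ sU'); exists (vac V : adjoint V).
pose q (p : P) := mode P gPsiM 0 (mode P gPsiP 0 p).
have lq : linear q by move=> a u v; rewrite /q !(lm _ _).
have sq : subspace [set p | U (q p)]
 by split=> [|a u v Uu Uv]; rewrite /mkset ?(lin0 lq) ?lq; [exact: (sub0 sU')|exact: (proj2 sU')].
have q0 w w' : bot w -> bot w' -> U (q (y 0%N w w')).
 apply: (bot_bil (B := y 0%N) sq) => //; rewrite /mkset /q.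
 - rewrite (tY_mode0 hT KS KM _ _ _ _ ty) mM /= scale1r (hw_psi H) (lin0 (ll _ _ _)) addr0 (linZ (lm _ _)); exact: zU.
 - by rewrite P1 mode0; exact: (sub0 sU').
 - rewrite zero_swap /= pair_E0 addr0 (tY_mode0 hT KS KM _ _ _ _ t'_hmg) mM /= t'_M (lin0 (ll _ _ _)) addr0.
  rewrite (hw_psi H) scaler0 (lin0 (lr _ _ _)) scaler0 mode0 scaler0; exact: (sub0 sU').
 - rewrite (tY_mode0 hT KS KM _ _ _ _ t'_hmg) mM /= t'_M scaler0 (lin0 (lr _ _ _)) scaler0 add0r t'_P.
  by rewrite (linZ (ll _ _ _)) (linZ (lm _ _)); exact: zU.
have qL x : geneig 0 x -> L 0 x = k^-1 *: q x /\ L 0 (L 0 x) = 0.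
 exact: (E0_lowest hk pair_E0 pair_lowest).
have qy j w w' : bot w -> bot w' -> U (q (y j w w')).
 (* A coefficient with a logarithm is a multiple of L_0 applied to the previous one, and L_0^2 = 0
    on weight 0, so q kills it. *)
 case: j => [|j] bw bw'; first exact: q0.
 have e1 := y_log j (bot_L0 bw) (bot_L0 bw'); have [_ e2] := qL _ (yg j w w' bw bw').
 have [e3 _] := qL _ (yg j.+1 w w' bw bw'); move: e2; rewrite e1 (linZ (@L_lin _ _ V P 0)) -[tY _ _ _ _ _]/(y j.+1 w w') e3.
 move=> /eqP; rewrite !scaler_eq0 pnatr_eq0 invr_eq0 (negPf hk) /= => /eqP ->; exact: (sub0 sU').
have sT : submodule [set p : P | U (-1 *: p + theta p)].
 exact: (submodule_preim (hom_add (-1) (hom_id P) (theta_hom hk (KL_span KP))) sU).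
have [v _ ve] : U (-1 *: p + theta p).
 apply: (E0_generated hk KP pair_E0 sT) => x xg; have [e1 e2] := qL _ xg; rewrite /mkset.
 (* L_0^2 = 0 on weight 0, hence theta - 1 = 2 pi i L_0 there. *)
 rewrite (theta_gen (KL_span KP) xg) (texpE (M := 2)); last by rewrite /= /eshift !scale0r !subr0.
 rewrite mulr0 expC0 scale1r !big_ord_recl big_ord0 /= /eshift scale0r subr0 expr0 expr1 !divr1 scale1r scaleN1r addr0 addKr
  e1 scalerA; apply: (subZ sU').
 apply: (lowest_span hk (X := X) (U := [set p | U (q p)]) (hom_id P) _ (KL_span KP) pair_lowest gensX _ sq _ xg).
 - by move=> p'; exists p'.
 - by move=> _ [w [w' [h [j [bw bw' ->]]]]]; eexists; exact: (y_geneig _ _ (bot_L0 bw) (bot_L0 bw')).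
 - move=> _ [w [w' [h [j [bw bw' ->]]]]] g0; rewrite /mkset.
  case: (y_zero (bot_L0 bw) (bot_L0 bw') g0) => [->|->]; first exact: qy.
  by rewrite (lin0 lq); exact: (sub0 sU').
by exists v; rewrite /= ve scaleN1r addrC.
Qed.

Let SS := S ** S.
Let KSS : KLV SS := bt_ten hB KS KS.
Let HSS := hlz_intertwining hT KS KS.
Let c : R[i] := expC (2%:R * piI R * h0).

(* The highest weight vectors of the cokernel have N_0 = 2n or 2n-1, hence conformal weight 4 h0 + e/k or
 4 h0 - e/k. *)
Lemma theta_shift_surj (y : SS) : exists x : SS, theta x - c ^+ 4 *: x = y.
have [ll lr] := (int_linl HSS, int_linr HSS).
have gSS := KL_span KSS.
pose f (x : SS) := - c ^+ 4 *: x + theta x; have hf : ehom f := hom_add _ (hom_id SS) (theta_hom hk gSS).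
pose U := f @` setT; have sU : submodule U := submod_image hf (submoduleT _).
have [[x _ <-]|nU] := pselect (U y); first by exists x; rewrite /f scaleNr addrC.
exfalso; pose Q := quot_vmod sU; pose q := quot_map sU : SS -> Q.
have hq : ehom q := quot_map_hom sU; have sq := @quot_onto _ _ _ _ _ sU.
have KQ : KLV Q := KL_surjective hq sq KSS.
have gQ := KL_span KQ.
have [h1 [u1 [g1 u10]]] : exists h1 (u1 : Q), geneig h1 u1 /\ u1 <> 0.
 apply: contrapT => nn; case: nU; apply/(quot_map0 sU).
 apply: (gspan_ind gQ (@subspace0 _ Q)) => h1 u1 g1; apply: contrapT => u10; apply: nn; by exists h1, u1.
have [j [low [u0 ug un0]]] := lowest_exists KQ g1 u10; set h := h1 - j%:R in low ug.
have EQ (x : Q) : mode Q gE 0 x = (e + e) *: x.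
 have [x' <-] := sq x; rewrite -(linZ (hom_lin hq)) -(ten_E0 hT KS KS (hw_E H) (hw_E H)).
 by rewrite (hom_mode _ _ _ hq) scale1r.
pose N3 a (x : Q) := mode Q gN 0 x - a *: x.
(* On products of two bottom vectors N_0 takes the values 2n, 2n - 1 and 2n - 2, so this cubic kills
   the lowest weight space of the cokernel. *)
pose cub (x : Q) := N3 (n + n) (N3 (n + (n - 1)) (N3 (n - 1 + (n - 1)) x)).
have lN a : linear (N3 a) by move=> c' u v; rewrite /N3 (lm _ _); lmod_ring.
have lcomp (f1 f2 : Q -> Q) : linear f1 -> linear f2 -> linear (fun x => f1 (f2 x))
 by move=> l1 l2 c' u v; rewrite l2 l1.
have lcub : linear cub := lcomp _ _ (lN _) (lcomp _ _ (lN _) (lN _)).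
have sker (f1 : Q -> Q) : linear f1 -> subspace [set x | f1 x = 0]
 by move=> l1; split=> [|c' u v Uu Uv]; rewrite /mkset ?(lin0 l1) // l1 Uu Uv scaler0 addr0.
have scub : subspace [set x | cub x = 0] := sker _ lcub.
have N3e a x (u : Q) : mode Q gN 0 u = x *: u -> N3 a u = (x - a) *: u by move=> e1; rewrite /N3 e1 scalerBl.
have cube x (u : Q) : mode Q gN 0 u = x *: u -> cub u = ((x - (n + n)) * (x - (n + (n - 1))) * (x - (n - 1 + (n - 1)))) *: u
 by move=> e1; rewrite /cub !(N3e _ _ _ e1) !(linZ (lN _)) !(N3e _ _ _ e1) !(linZ (lN _)) !(N3e _ _ _ e1) !scalerA; congr (_ *: _); ring.
have genY (p : SS) : mspan (mode SS) (bottomY (T := T) (W1 := S) (W2 := S) bot bot) neg p.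
 exact: (bottomY_mspan hk hT KS KS (B1 := bot) (B2 := bot) bot_par bot_par bot_subspace bot_mode bot_mode
  bot_kill bot_kill bot_t bot_t genS genS (hw_par H) p).
have cub0 (x : Q) : geneig h x -> cub x = 0.
 apply: (lowest_span hk hq sq gQ low genY _ scub).
  move=> _ [w [w' [h' [j' [bw bw' ->]]]]]; eexists.
  exact: (tY_geneig hk hT KS KS _ _ (bot_L0 bw) (bot_L0 bw')).
 move=> _ [w [w' [h' [j' [bw bw' ->]]]]] _; rewrite /mkset.
 have ly1 (u : S) : linear (fun v => q (tY T v h' j' u)) by move=> c' u' v'; rewrite (ll _ _ _) (hom_lin hq).
 have ly2 (u : S) : linear (fun v => q (tY T u h' j' v)) by move=> c' u' v'; rewrite (lr _ _ _) (hom_lin hq).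
 have NQ a1 a2 (v v' : S) : mode S gN 0 v = a1 *: v -> mode S gN 0 v' = a2 *: v' ->
   mode Q gN 0 (q (tY T v h' j' v')) = (a1 + a2) *: q (tY T v h' j' v').
  move=> w1 w2; have := hom_mode gN 0 (tY T v h' j' v') hq; rewrite scale1r => <-.
  by rewrite (tY_even0 hT KS KS) // w1 w2 (linZ (ll _ _ _)) (linZ (lr _ _ _)) -scalerDl (linZ (hom_lin hq)) addrC.
 apply: (bot_bil (B := fun v v' => q (tY T v h' j' v')) scub ly1 ly2 _ _ _ _ bw bw'); rewrite /mkset.
 - by rewrite (cube _ _ (NQ _ _ _ _ (hw_N H) (hw_N H))) subrr !mul0r scale0r.
 - by rewrite (cube _ _ (NQ _ _ _ _ (hw_N H) t'_N)) subrr mulr0 mul0r scale0r.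
 - by rewrite (cube _ _ (NQ _ _ _ _ t'_N (hw_N H))) [n - 1 + n]addrC subrr mulr0 mul0r scale0r.
 - by rewrite (cube _ _ (NQ _ _ _ _ t'_N t'_N)) subrr mulr0 scale0r.
have e0 : e != 0 by apply/eqP => e0; apply: (typ (m := 0)); rewrite e0 mul0r.
have [x0 [xg x00 xp]] : exists x0 : Q, [/\ geneig h x0, x0 <> 0 & mode Q gPsiP 0 x0 = 0].
 have [p0|pn] := pselect (mode Q gPsiP 0 u0 = 0); first by exists u0.
 by exists (mode Q gPsiP 0 u0); split=> //; [exact: mode_zero_geneig|exact: sq_zero].
pose K := [set x : Q | geneig h x /\ mode Q gPsiP 0 x = 0].
have [nu [x [[xg' xp'] xn0 xN]]] : exists nu x, [/\ K x, x <> 0 & mode Q gN 0 x = nu *: x].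
 apply: (KL_eigen (h := h) KQ (lm _ _) _ _ _ (conj xg xp) x00).
 - split; first by split; [exact: (sub0 (geneig_sub Q h))|exact: mode0].
  move=> c' u v [Uu Pu] [Uv Pv]; split; first exact: (proj2 (geneig_sub Q h)).
  by rewrite (lm _ _) Pu Pv scaler0 addr0.
 - move=> u [ug' up']; split; first exact: mode_zero_geneig.
  by rewrite zero_swap up' mode0 scaler0 add0r /= up' oppr0.
 - by move=> u [].
have xL : L 0 x = high_weight k nu (e + e) *: x by apply: (L0_high hk) => // a r; exact: (lowest_kill hk low).
have e4 (x' : R[i]) : expC (2%:R * piI R * (x' + x' + x' + x')) = expC (2%:R * piI R * x') ^+ 4
 by rewrite !mulrDr !expCD; ring.
(* On the cokernel theta is c^4, and on x it is the exponential of the weight of x; so this weight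
   differs from 4 h0 by an integer. *)
have thx : expC (2%:R * piI R * high_weight k nu (e + e)) = expC (2%:R * piI R * (h0 + h0 + h0 + h0)).
 have e1 := theta_eigen gQ xL; have [x' x'e] := sq x.
 have e2 : theta x = c ^+ 4 *: x.
  rewrite -x'e (theta_nat gSS gQ hq); apply/eqP; rewrite -subr_eq0 -(linZ (hom_lin hq)) -(linB (hom_lin hq)).
  by apply/eqP/(quot_map0 sU); exists x' => //; rewrite /f scaleNr addrC.
 have -> : expC (2%:R * piI R * (h0 + h0 + h0 + h0)) = c ^+ 4 by rewrite -(e4 h0).
 apply/eqP; rewrite -subr_eq0; have := e1; rewrite e2 => /eqP; rewrite eq_sym -subr_eq0 -scalerBl scaler_eq0 => /orP [//|/eqP //].
have [m mE] : exists m : int, high_weight k nu (e + e) - (h0 + h0 + h0 + h0) = m%:~R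
 by apply: expC_kernel; rewrite mulrBr -mulrN mulrN expCD thx -expCD subrr expC0.
have hwE : high_weight k nu (e + e) - (h0 + h0 + h0 + h0) = e / k * (2%:R * nu - 4%:R * n + 1)
 by rewrite /h0 /high_weight; field; rewrite hk.
have := cub0 _ xg'; rewrite (cube _ _ xN) => /eqP; rewrite scaler_eq0 !mulf_eq0 !subr_eq0 => /orP [|/eqP //].
have ek (s : int) : e / k * s%:~R = m%:~R -> s * s = 1 -> False.
 move=> e1 s1; apply: (typ (m := m * s)); by rewrite intrM -e1 -(mulrA (e / k)) -intrM s1 mulr1 divfK.
case/orP=> [/orP [/eqP nE|/eqP nE]|/eqP nE].
- by apply: (ek 1) => //; rewrite -mE hwE nE; congr (_ * _); ring.
- by apply: (ek (-1)) => //; rewrite -mE hwE nE; congr (_ * _); rewrite mulrN1z; ring.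
(* If N_0 = 2n - 2 on x, then psi^-_0 x has N_0 = 2n - 3, where the cubic takes the value -6, so it
   is zero. But then psi^+_0 psi^-_0 x = 2 e x is zero as well. *)
- have y0 : mode Q gPsiM 0 x = 0.
  have yN : mode Q gN 0 (mode Q gPsiM 0 x) = (nu - 1) *: mode Q gPsiM 0 x
   by rewrite N_mode xN (linZ (lm _ _)) -scalerDl mulrN1z.
  have := cub0 _ (mode_zero_geneig hk gPsiM xg'); rewrite (cube _ _ yN) nE (_ : _ * _ = - 6%:R); last by ring.
  by move/eqP; rewrite scaler_eq0 oppr_eq0 pnatr_eq0 /= => /eqP.
 have := zero_swap gPsiP gPsiM x; rewrite y0 xp' !mode0 scaler0 add0r /= EQ => /esym/eqP.
 by rewrite scaler_eq0 -mulr2n mulrn_eq0 (negPf e0) /= => /eqP.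
Qed.

Section TypicalTail.
Variable ev : mor (te oM oS) un.
Hypothesis ev0 : exists u, ev u <> 0.
Let Tl := tail ev.
Let thm (A : obj KLV) : mor A A := Mor (theta_hom hk (KL_span (obP A))).
Let theta_scalar (A : obj KLV) (u : A) x : simple A -> u <> 0 -> L 0 u = x *: u ->
 forall w : A, theta w = expC (2%:R * piI R * x) *: w.
move=> sA u0 uL; have [a aE] := schur (obP A) sA (mP (thm A)) => w.
suff -> : expC (2%:R * piI R * x) = a by exact: aE.
apply/eqP; rewrite -subr_eq0; have := aE u; rewrite /= (theta_eigen (KL_span (obP A)) uL) => /eqP.
by rewrite -subr_eq0 -scalerBl scaler_eq0 => /orP [//|/eqP //].
Qed.

Let thS (w : oS) : theta w = c *: w.
exact: (@theta_scalar oS t h0 sS (hw_t H) (hw_L0 hk H)). Qed.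
Let thM (w : oM) : theta w = c *: w.
by apply: (@theta_scalar oM t h0 sM (hw_t H)); rewrite tau_L; exact: (hw_L0 hk H). Qed.
Let balance (A B : obj KLV) (u : te A B) : (forall w : A, theta w = c *: w) -> (forall w : B, theta w = c *: w) ->
 theta u = (c * c) *: br B A (br A B u).
move=> tA tB; rewrite (theta_balanced hk hT (obP A) (obP B)) -[@tenm _ _ _ _ _ _ _ _ _ _ _]/(mf (tm (thm A) (thm B)) u).
rewrite (eqtm _ (cb c (idm A) (zm _ _)) _ (cb c (idm B) (zm _ _))).
- rewrite tm_cbl tm_zml addr0 tm_cbr tm_zmr addr0 tm_id // scalerA.
 by rewrite -[brd _ in LHS]/(mf (br B A) (mf (br A B) ((c * c) *: u))) !(linZ (mor_lin _)).
- by move=> w; rewrite cbE zmE addr0; exact: tA.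
- by move=> w; rewrite cbE zmE addr0; exact: tB.
Qed.

(** By naturality ev carries the double braiding to one with the unit, which is trivial. *)
Let monodromy (y : te oS (te oM oS)) : tm (idm oS) ev (br (te oM oS) oS (br oS (te oM oS) y)) = tm (idm oS) ev y.
rewrite -br_nat -br_nat; apply: (can_inj (@ruK _ _ _ _ _ hB oS)).
by rewrite (ru_br hk hT (fun _ => id)) (lu_br hk hT (fun _ => id)).
Qed.

Let Psi (y : te oM (te oS oS)) := Tl (tm (br oM oS) (idm oS) (as_ oM oS oS y)).
(** The double braiding of S with S' (x) S, invisible after ev, is inserted and decomposed by the
    two hexagons. *)
Let tail_hexagon u : Tl u = Psi (tm (idm oM) (cm (br oS oS) (br oS oS)) (asi oM oS oS (tm (br oS oM) (idm oS) u))).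
rewrite {1}/Tl /tail cmE -monodromy -[br oS _ _](@asiK _ _ _ _ _ hB oM oS oS) hexagon'
 -[br (te oM oS) oS _](@asK _ _ _ _ _ hB oS oM oS) hexagon /Psi /Tl /tail cmE.
by rewrite [in RHS]tm_cm2.
Qed.

Lemma typical_nonzero : exists (i : mor un (te oS oM)) u, Tl (tm i (idm oS) u) <> 0.
have [i iE] := theta_image; exists i; apply: contrapT => nn.
have T0 u : Tl (tm i (idm oS) u) = 0 by apply: contrapT => z; apply: nn; exists u.
have c0 : c != 0 := expC_neq0 _.
(* theta - 1 factors through i, so a tail that kills i also kills theta - 1; balance rewrites
   theta. *)
have s1 u : Tl u = (c * c) *: Tl (tm (br oM oS) (idm oS) (tm (br oS oM) (idm oS) u)).
 pose d := cb (-1) (idm (te oS oM)) (thm (te oS oM)).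
 have d0 w : Tl (tm d (idm oS) w) = 0.
  apply: (ten_ext hT KP KS (f := cm Tl (tm d (idm oS))) (g := fun=> 0)) => [||p h j s]; first exact: (hom_lin (mP (cm Tl (tm d (idm oS))))).
   by move=> a x y; rewrite scaler0 addr0.
  have [v ve] := iE p; rewrite cmE -[RHS](T0 (tY T v h j s)); congr (mf Tl _).
  rewrite [LHS](tenmE hT _ _ _ _ KP KS KP KS (mP d) (hom_id _)) [RHS](tenmE hT _ _ _ _ KV KS KP KS (mP i) (hom_id _)).
  by rewrite /= ve scaleN1r addrC.
 have := d0 u; rewrite /d tm_cbl tm_id // scaleN1r (linD (mor_lin _)) (linN (mor_lin _)) => /eqP.
 rewrite addrC subr_eq0 => /eqP <-; rewrite tm_comp.
 rewrite (eqtm _ (cb (c * c) (cm (br oM oS) (br oS oM)) (zm _ _)) _ (idm oS)) //; last by move=> w; rewrite cbE zmE addr0; apply: balance; [exact: thS|exact: thM].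
 rewrite tm_cbl tm_zml addr0 (linZ (mor_lin _)); congr (_ *: mf Tl _); exact: eq_tm.
have lPsi : linear Psi by move=> a x y; rewrite /Psi !(mor_lin _).
have s2 y : Psi (tm (idm oM) (cm (br oS oS) (br oS oS)) y) = (c * c) *: Psi y.
 pose u := tm (bri hB oS oM) (idm oS) (as_ oM oS oS y).
 have ue : tm (br oS oM) (idm oS) u = as_ oM oS oS y by apply: tmK1; exact: briK.
 by have := tail_hexagon u; rewrite ue asK => <-; rewrite s1 ue.
pose d := cb (- c ^+ 4) (idm (te oS oS)) (thm (te oS oS)).
have s3 y : Psi (tm (idm oM) d y) = 0.
 rewrite /d tm_cbr tm_id // lPsi
  (eqtm _ (idm oM) _ (cb (c * c) (cm (br oS oS) (br oS oS)) (zm _ _))) //; last by move=> w; rewrite cbE zmE addr0; apply: balance; exact: thS.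
 rewrite tm_cbr tm_zmr addr0 (linZ lPsi) s2 scalerA -scalerDl (_ : _ + _ = 0) ?scale0r //; ring.
have ds : surj d by move=> y; have [x xe] := theta_shift_surj y; exists x; rewrite /= -xe scaleNr addrC.
have P0 y : Psi y = 0.
 have [x <-] := tm_surj (f := idm oM) (g := d) hT (fun _ => id) (fun w => ex_intro _ w erefl) ds y.
 exact: s3.
have Tz x : Tl x = 0.
 have := P0 (asi oM oS oS (tm (bri hB oM oS) (idm oS) x)); rewrite /Psi asiK tmK1 //; exact: briK.
have [x xe] := tail_surj ev0 (rui hB oS (t : oS)); apply: (hw_t H).
by rewrite -[t](@ruiK _ _ _ _ _ hB oS) -xe [tail _ _]Tz (lin0 (mor_lin _)).
Qed.

End TypicalTail.
End Typical.

(** The split is on whether e is an integral multiple of k: then a flow vector exists, otherwise the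
    cokernel argument for theta - c^4 is available. *)
Lemma highest_dual : exists (e : mor (te oM oS) un) i, dual (hB := hB) e i.
have [f [hf f0]] := evaluation_exists hk hT v0 H.
pose ev : mor (te oM oS) un := @Mor _ _ _ _ (te oM oS) un f hf.
exists ev; have [[l el]|ne] := pselect (exists l : int, e = l%:~R * k).
 have [s F] := flow_exists hk KS sS (hw_E H) el.
 have [i si] := atypical_surj F; exact: (dual_of_surj (ev := ev) f0 si).
have [i ii] : exists (i : mor un (te oS oM)) u, tail ev (tm i (idm oS) u) <> 0
 by apply: typical_nonzero => // m em; apply: ne; exists m.
exact: (dual_of_nonzero (ev := ev) f0 ii).
Qed.

End SimpleDuals.

(** * The twist of a dual module *)

Section SlTwoForms.
Variables (K : numFieldType) (W1 W2 : lmodType K) (A1 B1 : W1 -> W1) (A2 B2 : W2 -> W2) (F : K -> W1 -> W2 -> K^o).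
Hypotheses (lA1 : linear A1) (lB1 : linear B1) (lA2 : linear A2) (lB2 : linear B2)
 (Fl : forall h v, linear (F h ^~ v)) (Fr : forall h u, linear (F h u))
 (AB1 : forall u, B1 (A1 u) = A1 (B1 u) + B1 u) (AB2 : forall v, B2 (A2 v) = A2 (B2 v) + B2 v)
 (Frel : forall h u v, F (h + 1) (A1 u) v - F (h + 1) u (A2 v) = - F h (B1 u) v - F h u (B2 v)).

Lemma iter_weight (W : lmodType K) (A B : W -> W) a u : linear B -> (forall u, B (A u) = A (B u) + B u) ->
 iter a B (A u) = A (iter a B u) + a%:R *: iter a B u.
move=> lB AB; elim: a => [|a IH] /=; first by rewrite scale0r addr0.
by rewrite IH (linD lB) (linZ lB) AB -addrA -[a.+1]add1n natrD scalerDl scale1r.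
Qed.

Definition conj_coef a b : K := (-1) ^+ b * (a`!%:R^-1 * b`!%:R^-1).

(* The form F(x^(L0) e^(-x L1) u, x^(-L0) e^(x L1) v) up to normalization. *)
Definition conj_form N h u v : K^o := \sum_(a < N) \sum_(b < N)
 conj_coef a b *: F (h - (a + b)%:R) (iter a B1 u) (iter b B2 v).

Let sum_shift N (G : nat -> K^o) : G 0%N = 0 -> G N = 0 -> \sum_(a < N) G a.+1 = \sum_(a < N) G a.
move=> G0 GN; have e : \sum_(a < N.+1) G a = G 0%N + \sum_(a < N) G a.+1 by rewrite big_ord_recl.
by apply: (addrI (G 0%N)); rewrite -e big_ord_recr /= GN addr0 G0 add0r.
Qed.

(** [Frel] turns the defect of adjointness into terms with one more B on either side, and summation
    by parts against the factorials cancels them; nilpotency of order N removes the boundary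
    terms. *)
Lemma conj_form_adjoint N h u v : iter N B1 u = 0 -> iter N B2 v = 0 ->
 conj_form N h (A1 u) v = conj_form N h u (A2 v).
move=> u0 v0; pose G a b : K^o := F (h - (a + b)%:R) (iter a B1 u) (iter b B2 v).
have GN b : G N b = 0 by rewrite /G u0 (lin0 (Fl _ _)).
have GN' a : G a N = 0 by rewrite /G v0 (lin0 (Fr _ _)).
have fz m : (m.+1%:R : K) * m.+1`!%:R^-1 = m`!%:R^-1 by rewrite factS natrM invfM mulrA divff ?mul1r ?pnatr_eq0.
apply/eqP; rewrite -subr_eq0 /conj_form -sumrB; apply/eqP.
have tE a b : conj_coef a b *: F (h - (a + b)%:R) (iter a B1 (A1 u)) (iter b B2 v) -
  conj_coef a b *: F (h - (a + b)%:R) (iter a B1 u) (iter b B2 (A2 v)) =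
  - (conj_coef a b *: G a.+1 b) - conj_coef a b *: G a b.+1 + (conj_coef a b * (a%:R - b%:R)) *: G a b.
 rewrite (iter_weight _ _ lB1 AB1) (iter_weight _ _ lB2 AB2) (linD (Fl _ _)) (linD (Fr _ _)) (linZ (Fl _ _)) (linZ (Fr _ _)).
 have := Frel (h - (a + b).+1%:R) (iter a B1 u) (iter b B2 v).
 rewrite -[(a + b).+1]addn1 natrD opprD addrA subrK => e.
 have -> : G a.+1 b = F (h - (a + b)%:R - 1) (B1 (iter a B1 u)) (iter b B2 v)
  by rewrite /G addSn -[(a + b).+1]addn1 natrD opprD addrA.
 have -> : G a b.+1 = F (h - (a + b)%:R - 1) (iter a B1 u) (B2 (iter b B2 v))
  by rewrite /G addnS -[(a + b).+1]addn1 natrD opprD addrA.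
 by rewrite -/(G a b); move/eqP: e; rewrite subr_eq => /eqP ->; lmod_ring.
rewrite (eq_bigr (fun a : 'I_N => \sum_(b < N) (- (conj_coef a b *: G a.+1 b) - conj_coef a b *: G a b.+1 +
 (conj_coef a b * (a%:R - b%:R)) *: G a b))); last by move=> a _; rewrite -sumrB; apply: eq_bigr => b _; exact: tE.
have s1 : \sum_(a < N) \sum_(b < N) conj_coef a b *: G a.+1 b = \sum_(a < N) \sum_(b < N) (conj_coef a b * a%:R) *: G a b.
 rewrite [LHS]exchange_big [RHS]exchange_big; apply: eq_bigr => b _ /=.
 rewrite -(sum_shift (G := fun a => (conj_coef a b * a%:R) *: G a b)) ?GN ?scaler0 ?mulr0 ?scale0r //.
 apply: eq_bigr => a _; congr (_ *: _); rewrite /conj_coef -(fz a); ring.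
have s2 : \sum_(a < N) \sum_(b < N) conj_coef a b *: G a b.+1 = - \sum_(a < N) \sum_(b < N) (conj_coef a b * b%:R) *: G a b.
 rewrite -sumrN; apply: eq_bigr => a _ /=.
 rewrite -(sum_shift (G := fun b => (conj_coef a b * b%:R) *: G a b)) ?GN' ?scaler0 ?mulr0 ?scale0r // -sumrN.
 apply: eq_bigr => b _; rewrite -scaleNr; congr (_ *: _); rewrite /conj_coef -(fz b) exprS; ring.
under eq_bigr do rewrite big_split sumrB sumrN /=.
rewrite big_split sumrB sumrN /= s1 s2 opprK.
under [X in _ + X]eq_bigr do (under eq_bigr do rewrite mulrBr scalerBl; rewrite sumrB).
by rewrite sumrB addrACA addNr subrr addr0.
Qed.

Lemma conj_form_linl N h v : linear (conj_form N h ^~ v).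
move=> c u u'; rewrite /conj_form scaler_sumr -big_split; apply: eq_bigr => a _ /=.
rewrite scaler_sumr -big_split; apply: eq_bigr => b _ /=.
by rewrite (iter_linear a lB1) (Fl _ _) scalerDr scalerCA.
Qed.

Lemma conj_form_linr N h u : linear (conj_form N h u).
move=> c v v'; rewrite /conj_form scaler_sumr -big_split; apply: eq_bigr => a _ /=.
rewrite scaler_sumr -big_split; apply: eq_bigr => b _ /=.
by rewrite (iter_linear b lB2) (Fr _ _) scalerDr scalerCA.
Qed.

End SlTwoForms.

Section AdjointForm.
Context R (k : R[i]) (hk : k != 0) (V : affine_vsa k).
Variables (W1 W2 : vmod V) (K1 : KL W1) (K2 : KL W2).
Local Notation N1 := (eshift (LL W1 0)).
Local Notation N2 := (eshift (LL W2 0)).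
Let lL (W : vmod V) m : linear (LL W m) := @L_lin _ _ V W m.

Section OneForm.
Variables (z : W1 -> W2 -> R[i]^o) (U1 : set W1) (U2 : set W2).
Hypotheses (zl : forall v, linear (z ^~ v)) (zr : forall u, linear (z u)) (sU1 : subspace U1) (sU2 : subspace U2)
 (LU1 : forall u, U1 u -> U1 (L 0 u)) (LU2 : forall v, U2 v -> U2 (L 0 v))
 (adj : forall u v, U1 u -> U2 v -> z (L 0 u) v = z u (L 0 v)).

Let NU1 h u : U1 u -> U1 (N1 h u). by move=> Uu; apply: (subB sU1); [exact: LU1|exact: subZ]. Qed.
Let NU2 h u : U2 u -> U2 (N2 h u). by move=> Uu; apply: (subB sU2); [exact: LU2|exact: subZ]. Qed.
Let form_orth h1 h2 i j u v : h1 != h2 -> U1 u -> U2 v -> iter i (N1 h1) u = 0 -> iter j (N2 h2) v = 0 -> z u v = 0.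
move=> ne; move: {2}(i + j)%N (leqnn (i + j)) => s; elim: s => [|s IH] in i j u v *; case: i => [|i]; case: j => [|j] //=.
all: try by move=> _ _ _ -> _; rewrite (lin0 (zl _)).
all: try by move=> _ _ _ _ ->; rewrite (lin0 (zr _)).
move=> ij Uu Uv iu jv; rewrite -!iterS !iterSr in iu jv.
have e1 : z (N1 h1 u) v = 0 by apply: (IH i j.+1) => //; solve [exact: NU1|lia|by rewrite iterSr].
have e2 : z u (N2 h2 v) = 0 by apply: (IH i.+1 j) => //; solve [exact: NU2|lia|by rewrite iterSr].
move: e1 e2; rewrite /eshift (linB (zl _)) (linB (zr _)) (linZ (zl _)) (linZ (zr _)) adj // => /eqP; rewrite subr_eq0 => /eqP ->.
by rewrite -scalerBl => /eqP; rewrite scaler_eq0 subr_eq0 (negPf ne) /= => /eqP.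
Qed.

Let iter_adj h m u v : U1 u -> U2 v -> z (iter m (N1 h) u) v = z u (iter m (N2 h) v).
elim: m u v => [|m IH] u v Uu Uv //; rewrite iterSr IH //; last exact: NU1.
rewrite iterS; have Um : U2 (iter m (N2 h) v) by elim: (m) => //= m' Um'; exact: NU2.
by rewrite /eshift (linB (zl _)) (linB (zr _)) (linZ (zl _)) (linZ (zr _)) adj.
Qed.

(** Different eigenvalues are orthogonal, and for equal ones the nilpotent parts are adjoint term by
    term. The subspaces are there because adjointness will be available only where L_1^N
    vanishes. *)
Lemma theta_adj h1 h2 u v : U1 u -> U2 v -> geneig h1 u -> geneig h2 v -> z (theta u) v = z u (theta v).
move=> Uu Uv gu gv; have [g1 g2] := (KL_span K1, KL_span K2).
have [m1 e1] := gu; have [m2 e2] := gv.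
have e1' : iter (m1 + m2) (N1 h1) u = 0 by rewrite addnC iterD [iter m1 _ _]e1 (lin0 (eshift_lin (@lL _ _) _ _)).
have e2' : iter (m1 + m2) (N2 h2) v = 0 by rewrite iterD [iter m2 _ _]e2 (lin0 (eshift_lin (@lL _ _) _ _)).
rewrite (theta_gen g1 gu) (theta_gen g2 gv) (texpE e1') (texpE e2') (linZ (zl _)) (linZ (zr _)) (lin_sum (zl _)) (lin_sum (zr _)).
have [<-|ne] := eqVneq h1 h2.
 by congr (_ *: _); apply: eq_bigr => m _; rewrite (linZ (zl _)) (linZ (zr _)) iter_adj.
rewrite !big1 ?scaler0 // => m _.
- rewrite (linZ (zr _)) (form_orth ne Uu _ e1' (j := m1 + m2)) ?scaler0 //.
  by elim: (nat_of_ord m) => //= m' Um'; exact: NU2.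
 by rewrite -iterD addnC iterD e2' (lin0 (eshift_lin (@lL _ _) _ _)).
- rewrite (linZ (zl _)) (form_orth ne _ Uv (i := m1 + m2) _ e2') ?scaler0 //.
  by elim: (nat_of_ord m) => //= m' Um'; exact: NU1.
 by rewrite -iterD addnC iterD e1' (lin0 (eshift_lin (@lL _ _) _ _)).
Qed.

End OneForm.

Lemma L1_geneig (W : vmod V) h (w : W) : geneig h w -> geneig (h - 1) (L 1 w).
move=> g; have := @geigen_map _ _ _ (L 0) (fun u => L 0 u + u) (L 1) (@lL W 1) _ h w g; case.
 by move=> u; rewrite (L0_L hk) scale1r subrK.
move=> m e; exists m; rewrite -[RHS]e; congr (iter m _ _); apply/funext => u.
by rewrite /eshift scalerBl scale1r opprB addrA addrAC.
Qed.

Lemma L1_nilpotent (W : vmod V) h (w : W) : KL W -> geneig h w -> exists N, iter N (L 1) w = 0.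
move=> [_ _ _ bnd] g; have [N0 N0P] := bnd h; exists N0; apply: (N0P N0 (leqnn _)).
elim: (N0) => [|m IH]; first by rewrite subr0.
by rewrite -[m.+1]addn1 natrD opprD addrA addn1; exact: L1_geneig.
Qed.

Variable F : R[i] -> W1 -> W2 -> R[i]^o.
Hypotheses (Fl : forall h v, linear (F h ^~ v)) (Fr : forall h u, linear (F h u))
 (Frel : forall h u v, F (h + 1) (L 0 u) v - F (h + 1) u (L 0 v) = - F h (L 1 u) v - F h u (L 1 v)).

Let iter_kill (W : vmod V) i m (w : W) : iter i (L 1) w = 0 -> (i <= m)%N -> iter m (L 1) w = 0.
by move=> e im; rewrite -(subnK im) iterD e (lin0 (iter_linear _ (@lL _ _))). Qed.
Let theta_iter (W : vmod V) a (w : W) : KL W -> iter a (L 1) (theta w) = theta (iter a (L 1) w).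
move=> KW; elim: a => //= a ->; rewrite (hom_L _ _ (theta_hom hk (KL_span KW))) //.
Qed.

Let AB (W : vmod V) (w : W) : L 1 (L 0 w) = L 0 (L 1 w) + L 1 w.
by rewrite (L0_L hk) scale1r subrK. Qed.

(** In [conj_form] the term a = b = 0 is F itself, and all others involve L_1; induction on the two
    orders of nilpotency isolates it. *)
Lemma theta_form s i j h h1 h2 u v : (i + j <= s)%N -> iter i (L 1) u = 0 -> iter j (L 1) v = 0 ->
 geneig h1 u -> geneig h2 v -> F h (theta u) v = F h u (theta v).
have [g1 g2] := (KL_span K1, KL_span K2).
have [lt1 lt2] := (theta_lin g1, theta_lin g2).
elim: s i j h h1 h2 u v => [|s IH] i j h h1 h2 u v; case: i => [|i]; case: j => [|j] //.
all: try by move=> _ /= -> _ _ _; rewrite (lin0 lt1) !(lin0 (Fl _ _)).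
all: try by move=> _ _ /= -> _ _; rewrite (lin0 lt2) !(lin0 (Fr _ _)).
move=> ij iu jv gu gv; set N := (i + j)%N.+1.
have iN : iter N (L 1) u = 0 by apply: (iter_kill iu); rewrite /N; lia.
have jN : iter N (L 1) v = 0 by apply: (iter_kill jv); rewrite /N; lia.
have kerS (W : vmod V) : subspace [set w : W | iter N (L 1) w = 0].
 have l := iter_linear N (@lL W 1); split=> [|c x y Ux Uy]; rewrite /mkset ?(lin0 l) // l Ux Uy scaler0 addr0 //.
have kerL (W : vmod V) (w : W) : iter N (L 1) w = 0 -> iter N (L 1) (L 0 w) = 0
 by move=> e; rewrite (iter_weight _ _ (@lL W 1) (@AB W)) e (lin0 (@lL _ _)) scaler0 addr0.
pose z := conj_form (LL W1 1) (LL W2 1) F N h.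
have zl v' : linear (z ^~ v') by apply: conj_form_linl => //; exact: lL.
have zr u' : linear (z u') by apply: conj_form_linr => //; exact: lL.
have za u' v' : iter N (L 1) u' = 0 -> iter N (L 1) v' = 0 -> z (L 0 u') v' = z u' (L 0 v')
 by move=> u0 v0; apply: conj_form_adjoint => //; solve [exact: lL|exact: AB].
have Z := theta_adj zl zr (kerS W1) (kerS W2) (@kerL W1) (@kerL W2) za iN jN gu gv.
have ge (W : vmod V) a hh (w : W) : geneig hh w -> geneig (hh - a%:R) (iter a (L 1) w).
 move=> g; elim: a => [|a IHa]; first by rewrite subr0.
 by rewrite -[a.+1]addn1 natrD opprD addrA addn1; exact: L1_geneig.
have T a b : (0 < a + b)%N -> F (h - (a + b)%:R) (iter a (L 1) (theta u)) (iter b (L 1) v) =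
  F (h - (a + b)%:R) (iter a (L 1) u) (iter b (L 1) (theta v)).
 move=> ab; rewrite !theta_iter //; apply: (IH (i.+1 - a)%N (j.+1 - b)%N _ _ _ _ _ _ _ _ (ge _ a _ _ gu) (ge _ b _ _ gv)).
 - by lia.
 - by rewrite -iterD; apply: (iter_kill iu); lia.
 - by rewrite -iterD; apply: (iter_kill jv); lia.
move: Z; rewrite /z /conj_form /N !big_ord_recl /= !subr0 /conj_coef !fact0 !invr1 !mulr1 !scale1r.
rewrite [X in _ + X](_ : _ = \sum_(i0 < i + j) \sum_(b < (i + j).+1) conj_coef R[i] (bump 0 i0) b *:
 F (h - (bump 0 i0 + b)%:R) (iter (bump 0 i0) (L 1) u) (iter b (L 1) (theta v))); last by apply: eq_bigr => a _; apply: eq_bigr => b _; rewrite T.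
move/addIr; rewrite [X in _ + X](_ : _ = \sum_(b < i + j) ((-1) ^+ (bump 0 b) * (1 * (bump 0 b)`!%:R^-1)) *:
 F (h - (0 + bump 0 b)%:R) u (iter (bump 0 b) (L 1) (theta v))); last by apply: eq_bigr => b _; rewrite -(T 0%N).
by move/addIr.
Qed.

End AdjointForm.

Section DualTwist.
Context R (k : R[i]) (hk : k != 0) (V : affine_vsa k).
Variables (T : tensor_data V) (hT : hlz_structure (@KL R k V) T).
Local Notation KLV := (@KL R k V).
Local Notation AV := (adjoint V).
Local Notation "f *** g" := (@tenm _ _ _ T _ _ _ _ f g) (at level 40, left associativity).
Let hB := hlz_braided hT.
Local Notation eqtm f f' g g' := (@eq_tm _ _ _ _ _ hB _ _ _ _ f f' g g').
Let KV : KLV AV := bt_unit hB.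
(** V is given only by its universal property. Should its vacuum vanish, every module is zero and
    all claims hold trivially; this case is split off wherever a nonzero vacuum is used. *)
Lemma modules_zero (W : vmod V) (w : W) : (vac V : AV) = 0 -> w = 0.
by move=> v0; have := act_vac (-1) w; rewrite eqxx => <-; rewrite v0; exact: act0l. Qed.

(** Invariance of the vacuum functional under L_(-1), L_0 and L_1. For r < 0 the commutator of a_r
    with one of these has index at most 0, where the functional vanishes. *)
Lemma vacuum_functional_L (eps : AV -> R[i]^o) m (v : AV) : linear eps ->
 (forall a r w, r < 0 -> eps (mode AV a r w) = 0) -> (m <= 2)%N -> eps (L (m%:Z - 1) v) = 0.
move=> le e0 m2; have lm a r : linear (mode AV a r) by exact: mode_lin.
have z0 b w : eps (mode AV b 0 w) = 0.
 rewrite (@functional_eigen _ AV (mode AV) (vac V) neg eps (mode AV b 0) 0 le (lm _ _) (@V_generated _ _ V) e0) ?mul0r //.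
  by rewrite scale0r; exact: (mode_vac (gen V b) 0).
 move=> a r w' ra; rewrite mode_swap add0r (lt_eqF ra) scale0r addr0 (linD le) (linZ le) e0 // scaler0 add0r.
 by case: b; case: (a) => /=; rewrite ?(linN le) ?(e0 _ _ _ ra) ?oppr0 ?(lin0 le).
have lL := @L_lin _ _ V AV (m%:Z - 1).
rewrite (@functional_eigen _ AV (mode AV) (vac V) neg eps (L (m%:Z - 1)) 0 le lL (@V_generated _ _ V) e0) ?mul0r //.
 by rewrite scale0r; exact: L_vac.
move=> a r w ra; have e1 := mode_L hk a r (m%:Z - 1) w.
have -> : L (m%:Z - 1) (mode AV a r w) = mode AV a r (L (m%:Z - 1) w) - r%:~R *: mode AV a (r + (m%:Z - 1)) w
 by rewrite e1 addrK.
rewrite (linB le) (linZ le) e0 // sub0r; case: (ltrgtP (r + (m%:Z - 1)) 0) => [ra'|ra'|->].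
- by rewrite e0 // scaler0 oppr0.
- by exfalso; move: ra ra'; rewrite /neg; lia.
- by rewrite z0 scaler0 oppr0.
Qed.

(** The vacuum functional makes f a family of forms to which [theta_form] applies. The difference of
    the two sides is a module map to V whose values the functional kills; as V is simple, such a map
    is zero. *)
Lemma theta_form_dual (W1 W2 : vmod V) (K1 : KLV W1) (K2 : KLV W2) (f : ten T W1 W2 -> AV) : (vac V : AV) <> 0 ->
 ehom f -> forall u, f ((@theta _ _ _ W1 *** @id W2) u) = f ((@id W1 *** @theta _ _ _ W2) u).
move=> v0 hf; have [eps [le ev e0 _ _]] := V_functional hk v0.
have [g1 g2] := (KL_span K1, KL_span K2); have [th1 th2] := (theta_hom hk g1, theta_hom hk g2).
have HY := hlz_intertwining hT K1 K2; have [ll lr] := (int_linl HY, int_linr HY).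
have H1 := bt_hom hB K1 K2 K1 K2 th1 (hom_id W2); have H2 := bt_hom hB K1 K2 K1 K2 (hom_id W1) th2.
have lf := hom_lin hf.
have lc (g : ten T W1 W2 -> ten T W1 W2) : linear g -> linear (fun u => eps (f (g u)) : R[i]^o)
 by move=> lg a u v; rewrite lg lf le.
have epsE u : eps (f ((@theta _ _ _ W1 *** @id W2) u)) = eps (f ((@id W1 *** @theta _ _ _ W2) u)).
 apply: (ten_ext hT K1 K2 (lc _ (hom_lin H1)) (lc _ (hom_lin H2))) => w1 h j w2.
 rewrite (tenmE hT _ _ _ _ K1 K2 K1 K2 th1 (hom_id _)) (tenmE hT _ _ _ _ K1 K2 K1 K2 (hom_id _) th2) /=.
 pose F h (u : W1) (v : W2) : R[i]^o := eps (f (tY T u h j v)).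
 have Fl h' v : linear (F h' ^~ v) by move=> a x y; rewrite /F (ll _ _ _) lf le.
 have Fr h' x : linear (F h' x) by move=> a y z; rewrite /F (lr _ _ _) lf le.
 (* Invariance under L_1 at h' and under L_0 at h' + 1; combining the two eliminates the
    L_(-1)-derivative together with its logarithmic term. *)
 have Frel h' x y : F (h' + 1) (L 0 x) y - F (h' + 1) x (L 0 y) = - F h' (L 1 x) y - F h' x (L 1 y).
  have a1 : eps (f (L 1 (tY T x h' j y))) = 0 by rewrite (hom_L _ _ hf); exact: (vacuum_functional_L (m := 2) _ le e0).
  have a2 : eps (f (L 0 (tY T x (h' + 1) j y))) = 0 by rewrite (hom_L _ _ hf); exact: (vacuum_functional_L (m := 1) _ le e0).
  move: a1 a2; rewrite (int_Lm_comm HY) (int_L0_comm HY).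
  rewrite (_ : h' + 2%:R = h' + 1 + 1); last by ring.
  rewrite (int_deriv HY) !(linD lf) !(linD le) !(linZ lf) !(linZ le) /F.
  move: (eps (f (tY T x (h' + 1) j.+1 y))) => q; rewrite /GRing.scale /= => a1 a2; apply/eqP; rewrite -subr_eq0; apply/eqP.
  by rewrite -[RHS](subrr 0) -{1}a1 -{1}a2; ring.
 apply: (gspan_ind g1 (U := [set w1 | F h (theta w1) w2 = F h w1 (theta w2)])) => [|h1 x gx].
  split=> [|a x y Ux Uy]; rewrite /mkset ?(lin0 (theta_lin g1)) ?(lin0 (Fl _ _)) //.
  by rewrite (theta_lin g1) !(Fl _ _) Ux Uy.
 apply: (gspan_ind g2 (U := [set w2 | F h (theta x) w2 = F h x (theta w2)])) => [|h2 y gy].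
  split=> [|a y z Uy Uz]; rewrite /mkset ?(lin0 (theta_lin g2)) ?(lin0 (Fr _ _)) //.
  by rewrite (theta_lin g2) !(Fr _ _) Uy Uz.
 have [i iP] := L1_nilpotent hk K1 gx; have [j' jP] := L1_nilpotent hk K2 gy.
 exact: (theta_form hk K1 K2 Fl Fr Frel h (leqnn (i + j')) iP jP gx gy).
pose d := fun u => -1 *: f ((@id W1 *** @theta _ _ _ W2) u) + f ((@theta _ _ _ W1 *** @id W2) u).
have hd : ehom d := hom_add (-1) (hom_comp hf H2) (hom_comp hf H1).
move=> u; case: (proj2 (V_simple hk KV v0) _ (submod_image hd (submoduleT _))) => eq.
 have : (d @` setT) (d u) by exists u.
 by rewrite eq /= /d scaleN1r addrC => /eqP; rewrite subr_eq0 => /eqP.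
have : (d @` setT) (vac V) by rewrite eq.
case=> w _ we; have := ev; rewrite -we /d le epsE scaleN1r addNr => /eqP.
by rewrite eq_sym oner_eq0.
Qed.

(** theta is moved from W to X across the evaluation by [theta_form_dual], and naturality then
    carries it through the zigzag. *)
Lemma theta_dual_map (W X : vmod V) (KW : KLV W) (KX : KLV X) (e : ten T X W -> AV) i :
 dual_pair e i -> forall x, theta x = dual_map e i (@theta _ _ _ W) x.
have [v0|v0] := pselect ((vac V : AV) = 0); first by move=> _ x; rewrite [LHS]modules_zero // [RHS]modules_zero.
move=> [he hi _ z2] x; pose oW : obj KLV := Obj KW; pose oX : obj KLV := Obj KX.
pose em : mor (te hB oX oW) (un hB) := @Mor _ _ _ _ (te hB oX oW) (un hB) e he.
pose im : mor (un hB) (te hB oW oX) := @Mor _ _ _ _ (un hB) (te hB oW oX) i hi.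
pose tX : mor oX oX := @Mor _ _ _ _ oX oX _ (theta_hom hk (KL_span KX)).
pose tW : mor oW oW := @Mor _ _ _ _ oW oW _ (theta_hom hk (KL_span KW)).
pose id_ (A : obj KLV) := idm A.
rewrite -[RHS]/(mf (lu hB oX) (tm hB em (id_ oX) (tm hB (tm hB (id_ oX) tW) (id_ oX)
 (as_ hB oX oW oX (tm hB (id_ oX) im (rui hB oX x)))))) -[tm hB em _ (tm hB _ _ _)]tm_cm1
 (eqtm _ (cm em (tm hB tX (id_ oW))) _ (id_ oX)) //; last by move=> u; rewrite !cmE; symmetry; exact: (theta_form_dual KX KW v0 he).
rewrite tm_cm1 -as_nat (eqtm _ tX _ (id_ (te hB oW oX))) //; last by move=> u; rewrite tm_id.
rewrite -tm_split1 [tm hB tX im _]tm_split2 -rui_nat -[RHS]/(mf (lu hB oX) (tm hB em (id_ oX) (as_ hB oX oW oX (tm hB (id_ oX) im (rui hB oX (theta x)))))).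
symmetry; exact: z2.
Qed.

Lemma theta_twist (D : vmod V -> Prop) : (forall W, D W -> KLV W) -> twist D T (@theta R k V).
move=> hDK; split.
- by move=> W /hDK/KL_span g; split; [exact: theta_hom|exact: theta_bijective].
- by move=> W1 W2 p f /hDK/KL_span g1 /hDK/KL_span g2 hf w; exact: (theta_nat g1 g2 hf).
- by move=> v; apply: (theta_adjoint hk); exact: KL_span KV.
- by move=> W1 W2 /hDK d1 /hDK d2 u; exact: (theta_balanced hk hT d1 d2).
- by move=> W X e i /hDK d1 /hDK d2; exact: theta_dual_map.
Qed.

(** * Rigidity of KL and O^fin *)

Section Rigid.
Variables (D : vmod V -> Prop) (hDK : forall W, D W -> KLV W) (hD : braided_tensor D T).
Hypotheses (Dinj : forall (W W' : vmod V) (f : W' -> W), ehom f -> injective f -> D W -> D W')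
 (Dsur : forall (W W' : vmod V) (f : W -> W'), ehom f -> onto f -> D W -> D W')
 (Dprod : forall W1 W2 : vmod V, D W1 -> D W2 -> D (prod_vmod W1 W2))
 (Dsimple : forall S : vmod V, KLV S -> simple S -> D S).

Lemma hasdual_all (W : obj D) : hasdual hD W.
have [v0|v0] := pselect ((vac V : AV) = 0).
 by apply: zero_dual => z; exact: modules_zero.
apply: (simple_duals hk hT hDK Dinj Dsur Dprod) => S sS; have KS := hDK (obP S).
have [t [b [n [e H]]]] := highest_exists hk KS sS; have [ev [i [d1 d2]]] := highest_dual hk hT v0 H.
(* The dual was found in KL; being simple again it lies in D, and the same evaluation and
   coevaluation serve there. *)
have DM : D (tau_vmod S) by apply: Dsimple; [exact: tau_KL|exact: tau_simple].
pose oM : obj D := Obj DM.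
exists oM, (@Mor _ _ _ _ (te hD oM S) (un hD) _ (mP ev)), (@Mor _ _ _ _ (un hD) (te hD S oM) _ (mP i)).
by split; [exact: d1|exact: d2].
Qed.

Lemma rigid_all : rigid D T.
move=> W dW; have [X [e [i de]]] := hasdual_all (Obj dW); have [dX dp] := (obP X, dual_dual_pair de).
split; first by exists X, e, i.
have de' := dual_braided (lu_br hk hT hDK (hB := hD)) (ru_br hk hT hDK (hB := hD)) de.
by exists X, (cm e (br hD _ X)), (cm (bri hD X _) i); split=> //; exact: dual_dual_pair de'.
Qed.

End Rigid.

Section Diagonalizable.
Let eig_in (W : sspace R) (op : W -> W) h (u : W) : op u = h *: u -> op 0 = 0 ->
 [set w : W | exists (s : seq R[i]) (f : R[i] -> W), (forall h, eigsub op h (f h)) /\ w = \sum_(h <- s) f h] u.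
move=> e e0; exists [:: h], (fun h' => if h' == h then u else 0); rewrite big_seq1 eqxx; split=> // h'.
by case: eqP => [->|_] //; rewrite /eigsub /mkset e0 scaler0.
Qed.

(** E_0 is scalar by Schur; the sums of N_0-eigenvectors form a submodule, nonzero by
    [extremal_exists]. *)
Lemma simple_Ofin (S : vmod V) : KLV S -> simple S -> Ofin S.
move=> KS sS; have lm a r : linear (mode S a r) by exact: mode_lin.
split=> //; last first.
 have [e eE] := simple_E KS sS => w; exact: (eig_in (eE w) (lin0 (lm gE 0))).
have sP := spanned_subspace (fun h => eigsub_subspace h (lm gN 0)).
set U := [set w | _] in sP; suff [U0|UT] : U = [set 0] \/ U = setT.
- have [h [n [a [t [t0 _ _ nt _]]]]] := extremal_exists hk (c := gPsiM) KS sS erefl.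
 by have := eig_in nt (lin0 (lm gN 0)); rewrite -/U U0 => /t0.
- by move=> w; have : U w by rewrite UT.
apply: (proj2 sS); apply: modes_submodule => // [_ [s [u [uh ->]]]|a r _ [s [u [uh ->]]]].
- rewrite (lin_sum (@par_linear _ _)); apply: (sub_sum sP) => h _.
 apply: (eig_in (h := h)); last exact: mode0.
 have := act_par (mode_action S) gN 0 (u h); rewrite /= scale1r => <-.
 by rewrite (uh h) (linZ (@par_linear _ _)).
- rewrite (lin_sum (lm _ _)); apply: (sub_sum sP) => h _; apply: (eig_in (h := h + (wt11 a)%:~R)); last exact: mode0.
 by have e := uh h; rewrite N_mode [mode S gN 0 _]e (linZ (lm _ _)) -scalerDl.
Qed.

Lemma ten_diagonalizable (W1 W2 : vmod V) a : KLV W1 -> KLV W2 -> odd11 a = false ->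
 diagble (mode W1 a 0) -> diagble (mode W2 a 0) -> diagble (mode (ten T W1 W2) a 0).
move=> K1 K2 oa d1 d2; have lm (W : vmod V) : linear (mode W a 0) by exact: mode_lin.
have HY := hlz_intertwining hT K1 K2; have [ll lr] := (int_linl HY, int_linr HY).
have sP := spanned_subspace (fun h => eigsub_subspace h (lm (ten T W1 W2))).
apply: (ten_ind hT K1 K2 sP) => w1 h j w2.
have [s1 [u1 [e1 ->]]] := d1 w1; have [s2 [u2 [e2 ->]]] := d2 w2.
rewrite (lin_sum (ll _ _ _)); apply: (sub_sum sP) => h1 _; rewrite (lin_sum (lr _ _ _)); apply: (sub_sum sP) => h2 _.
apply: (eig_in (h := h2 + h1)); last exact: (lin0 (lm _)).
by rewrite (tY_even0 hT K1 K2) // e1 e2 (linZ (ll _ _ _)) (linZ (lr _ _ _)) -scalerDl.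
Qed.

Lemma Ofin_unit : Ofin AV.
have [v0|v0] := pselect ((vac V : AV) = 0); last exact: (simple_Ofin KV (V_simple hk KV v0)).
have d a : diagble (mode AV a 0)
 by move=> w; exists [::], (fun=> 0); split=> [h|]; rewrite ?big_nil [LHS]modules_zero // [RHS]modules_zero.
by split; [exact: KV|exact: d|exact: d].
Qed.

Lemma Ofin_ten (W1 W2 : vmod V) : Ofin W1 -> Ofin W2 -> Ofin (ten T W1 W2).
move=> [K1 n1 e1] [K2 n2 e2]; split; first exact: (bt_ten hB).
- exact: (ten_diagonalizable (a := gN)).
- exact: (ten_diagonalizable (a := gE)).
Qed.

Lemma Ofin_braided : braided_tensor (@Ofin R k V) T.
have hO (W : vmod V) : Ofin W -> KLV W by case.
constructor.
- exact: Ofin_unit.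
- exact: Ofin_ten.
- by intros; eapply (bt_hom hB); eauto.
- by intros; eapply (bt_linl hB); eauto.
- by intros; eapply (bt_linr hB); eauto.
- by intros; eapply (bt_id hB); eauto.
- by intros; eapply (bt_comp hB); eauto.
- by intros; eapply (bt_lun hB); eauto.
- by intros; eapply (bt_run hB); eauto.
- by intros; eapply (bt_asc hB); eauto.
- by intros; eapply (bt_brd hB); eauto.
- by intros; eapply (bt_lun_nat hB); eauto.
- by intros; eapply (bt_run_nat hB); eauto.
- by intros; eapply (bt_asc_nat hB); eauto.
- by intros; eapply (bt_brd_nat hB); eauto.
- by intros; eapply (bt_triangle hB); eauto.
- by intros; eapply (bt_pentagon hB); eauto.
- by intros; eapply (bt_hexagon hB); eauto.
- by intros; eapply (bt_hexagon' hB); eauto.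
Qed.

End Diagonalizable.
End DualTwist.

Theorem theorem4p2p3 (R : realType) (k : R[i]) (hk : k != 0)
    (V : affine_vsa k) (T : tensor_data V) (hT : hlz_structure (@KL R k V) T) :
  (rigid (@KL R k V) T /\ rigid (@Ofin R k V) T) /\
  exists th : forall W : vmod V, W -> W,
    [/\ forall W : vmod V, KL W -> is_exp2piL0 (th W),
        braided_ribbon (@KL R k V) T th
      & braided_ribbon (@Ofin R k V) T th].
Proof.
have hO (W : vmod V) : Ofin W -> KL W by case.
have r1 : rigid (@KL R k V) T.
 exact: (rigid_all hk hT (fun _ => id) (hlz_braided hT) (@KL_injective R k V) (@KL_surjective R k V) (@KL_prod R k V)).
have r2 : rigid (@Ofin R k V) T.
 apply: (rigid_all hk hT hO (Ofin_braided hk hT) _ _ _ (@simple_Ofin R k hk V)).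
 - exact: Ofin_injective.
 - exact: Ofin_surjective.
 - exact: Ofin_prod.
split=> //; exists (@theta R k V); split.
- by move=> W /KL_span; exact: theta_exp.
- by split=> //; [exact: (hlz_braided hT)|exact: theta_twist].
- by split=> //; [exact: Ofin_braided|exact: theta_twist].
Qed.
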